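(* Let $N_3(X)$ denote the number of elliptic curves $E\in\mathcal{E}$ with $\operatorname{ht}(E)\le X$ that possess a $3$-isogeny defined over $\mathbb{Q}$. Then there exist constants $c_1,c_2\in\mathbb{R}$ such that, as $X\to\infty$, $$N_3(X)=\frac{2}{3\sqrt3\,\zeta(6)}X^{1/2}+c_1X^{1/3}\log X+c_2X^{1/3}+O(X^{7/24}).$$ Moreover, $$c_1=\frac{c_0}{8\pi^2\zeta(4)}=0.107437\ldots,\qquad c_0=\int_{-\infty}^{\infty}h(\beta)^2\,d\beta,$$ and the constant $c_2$ is effectively computable.
   Context: $\mathcal{E}$ is the set of elliptic curves over $\mathbb{Q}$ given by equations $E_{A,B}\colon y^2=x^3+Ax+B$ with $A,B\in\mathbb{Z}$, $4A^3+27B^2\ne0$, and such that there is no prime $\ell$ with both $\ell^4\mid A$ and $\ell^6\mid B$; every elliptic curve over $\mathbb{Q}$ is isomorphic over $\mathbb{Q}$ to exactly one member of $\mathcal{E}$. The height is $\operatorname{ht}(E_{A,B})=\max(|4A^3|,|27B^2|)$. A $3$-isogeny is an isogeny of degree $3$. $\zeta$ is the Riemann zeta function. The function $h$ is $h(\beta)=\min\{f(\beta),g(\beta)\}$ for $\beta\in\mathbb{R}$, where $$f(\beta)=\frac{1}{2^{1/3}|\beta|^{1/2}},\qquad g(\beta)=\frac{4^{1/3}}{3^{1/2}\left|1+2\beta-\tfrac13\beta^2\right|^{1/3}},$$ with the convention that $f$ or $g$ equals $+\infty$ where its denominator vanishes. *)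

(* Defs.v *)
From HB Require Import structures.
From mathcomp Require Import all_boot all_order all_algebra.
From mathcomp Require Import finmap.
From mathcomp Require Import all_classical all_reals all_analysis.

Set Implicit Arguments.
Unset Strict Implicit.
Unset Printing Implicit Defensive.

Import Order.TTheory GRing.Theory Num.Theory numFieldNormedType.Exports.

Local Open Scope classical_set_scope.
Local Open Scope ring_scope.

Section FunctionField.
Variables a b : rat.

Definition curve_poly : {poly {fraction {poly rat}}} :=
  'X^2 - (tofrac ('X^3 + a *: 'X + b%:P : {poly rat}))%:P.

(* The function field Q(E) of E : y^2 = x^3 + a x + b, as Q(x)[y]/(y^2 - f(x)).
   It is a field: f has odd degree, so y^2 - f(x) is irreducible over Q(x). *)
Notation function_field := {poly %/ curve_poly}.

Definition ff_const (c : rat) : function_field :=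
  qpolyC curve_poly (tofrac (c%:P : {poly rat})).
Definition ff_x : function_field :=
  qpolyC curve_poly (tofrac ('X : {poly rat})).
Definition ff_y : function_field := 'qX.

(* P(X, Y), the outer variable of P being sent to X and the inner one to Y. *)
Definition ff_eval (P : {poly {poly rat}}) (X Y : function_field)
  : function_field :=
  (map_poly (map_poly ff_const) P).[X%:P].[Y].

(* Membership in the local ring of E at the point at infinity O = [0 : 1 : 0].
   In the affine chart with coordinates t = x/y and w = 1/y, O is the origin. *)
Definition regular_at_O (z : function_field) : Prop :=
  exists g h : {poly {poly rat}}, h.[0].[0] != 0 /\
    z * ff_eval h (ff_x / ff_y) (ff_y^-1) = ff_eval g (ff_x / ff_y) (ff_y^-1).

(* The subfield Q(X, Y) of Q(E).  For phi = [X : Y : 1] : E -> E' it is the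
   pullback phi^* Q(E'). *)
Definition pullback_field (X Y : function_field) : set function_field :=
  [set z | exists g h : {poly {poly rat}},
     ff_eval h X Y != 0 /\ z * ff_eval h X Y = ff_eval g X Y].

(* [Q(E) : K] = n, for a subfield K of Q(E). *)
Definition ff_degree (K : set function_field) (n : nat) : Prop :=
  exists e : 'I_n -> function_field, forall z : function_field,
    exists! c : {ffun 'I_n -> function_field},
      (forall i, K (c i)) /\ z = \sum_i c i * e i.

(* [X : Y : 1] is an isogeny over Q from E to E' : y^2 = x^3 + a' x + b'.
   A rational map over Q from E to E', other than the constant map O, is a
   Q(E)-point (X, Y) of the affine curve E', and it is a morphism because E is
   smooth.  It maps O to O exactly when X has a pole at O: if X is regular at O
   then so is Y, which is integral over Q[X], and the image of O is affine.
   A constant X is regular at O, so these maps are nonconstant. *)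
Definition is_isogeny (a' b' : rat) (X Y : function_field) : Prop :=
  Y ^+ 2 = X ^+ 3 + ff_const a' * X + ff_const b' /\ ~ regular_at_O X.

(* Every elliptic curve over Q has a short Weierstrass model, so the targets
   below are all the elliptic curves over Q, up to isomorphism. *)
Definition has_isogeny_of_degree (n : nat) : Prop :=
  exists a' b' : rat, 4 * a' ^+ 3 + 27 * b' ^+ 2 != 0 /\
    exists X Y : function_field,
      is_isogeny a' b' X Y /\ ff_degree (pullback_field X Y) n.

End FunctionField.

(* The pair (A, B) stands for the curve E_{A,B} : y^2 = x^3 + A x + B. *)
Definition calE : set (int * int) :=
  [set AB | 4 * AB.1 ^+ 3 + 27 * AB.2 ^+ 2 != 0 /\
     ~ exists l : nat, [/\ prime l, (l%:Z ^+ 4 %| AB.1)%Z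
                                  & (l%:Z ^+ 6 %| AB.2)%Z]].

Definition ht (AB : int * int) : int :=
  Num.max `|4 * AB.1 ^+ 3| `|27 * AB.2 ^+ 2|.

Definition N3 (R : realType) (X : R) : nat :=
  #|` fset_set [set AB : int * int |
        [/\ calE AB, (ht AB)%:~R <= X
          & has_isogeny_of_degree AB.1%:~R AB.2%:~R 3]] |%fset.

(* The Dirichlet series of the Riemann zeta function, convergent for s > 1. *)
Definition zeta (R : realType) (s : R) : R :=
  limn (fun n => \sum_(0 <= k < n) (k.+1%:R `^ s)^-1).

Section IntegrandOfC0.
Variable R : realType.

Definition quot_oo (x d : R) : \bar R := if d == 0 then +oo%E else (x / d)%:E.

Definition f_beta (beta : R) : \bar R :=
  quot_oo 1 (2 `^ (1 / 3) * `|beta| `^ (1 / 2)).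

Definition g_beta (beta : R) : \bar R :=
  quot_oo (4 `^ (1 / 3))
    (3 `^ (1 / 2) * `|1 + 2 * beta - 1 / 3 * beta ^+ 2| `^ (1 / 3)).

Definition h_beta (beta : R) : \bar R := Order.min (f_beta beta) (g_beta beta).

End IntegrandOfC0.

(* The total recursive functions: the least class containing the initial
   functions and closed under composition, primitive recursion, and
   minimization of functions having a zero for all values of the parameters. *)
Inductive recursive : forall k : nat, (k.-tuple nat -> nat) -> Prop :=
| rec_zero : @recursive 0 (fun _ => 0%N)
| rec_succ : @recursive 1 (fun x => (thead x).+1)
| rec_proj (k : nat) (i : 'I_k) : @recursive k (fun x => tnth x i)
| rec_comp (k m : nat) (f : m.-tuple nat -> nat)
    (g : 'I_m -> k.-tuple nat -> nat) :
    recursive f -> (forall i, recursive (g i)) ->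
    @recursive k (fun x => f [tuple g i x | i < m])
| rec_prim (k : nat) (f : k.-tuple nat -> nat) (g : k.+2.-tuple nat -> nat) :
    recursive f -> recursive g ->
    @recursive k.+1 (fun x =>
      nat_rec (fun _ => nat) (f [tuple of behead x])
        (fun n r => g [tuple of n :: r :: behead x]) (thead x))
| rec_mu (k : nat) (f : k.+1.-tuple nat -> nat)
    (f_zero : forall x : k.-tuple nat,
       exists n : nat, f [tuple of n :: x] == 0%N) :
    recursive f ->
    @recursive k (fun x => ex_minn (f_zero x)).

(* Effective computability of a real number, in Turing's sense: an algorithm
   outputs, for each n, a rational number within 2^-n of c. *)
Definition computable_real (R : realType) (c : R) : Prop :=
  exists p q d : 1.-tuple nat -> nat,
    [/\ recursive p, recursive q, recursive d &
      forall n : nat, let t := [tuple n] in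
        `|c - ((p t)%:R - (q t)%:R) / (d t).+1%:R| <= 2^-1 ^+ n].

(* Main.v *)
(* E_{A,B} has a rational 3-isogeny if and only if its 3-division polynomial
   3 e^4 + 6 A e^2 + 12 B e - A^2 has a rational root.  Velu's formulas give the
   isogeny.  Conversely, an isogeny of degree 3 sends x to P(x)/Q(x) with P, Q of
   degrees 3 and 2, and the equation of the target forces Q to be a multiple of
   (x - e)^2 with e a root of the 3-division polynomial.

   When A, B are integers the roots are integers.  The root 0 means A = 0, and
   these curves give the term in X^(1/2).  For a root a <> 0 one has
   A = 3 a^2 + 6 D and a B = 3 D^2 - a^4 for an integer D with a | 3 D^2, and with
   T = X^(1/6) the condition ht(E) <= X becomes |a| <= T h(beta), beta = A / a^2.
   For fixed a the admissible D form a lattice and a bounded number of intervals,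
   and one is left with the sum of a s(3 a) over a <= T h(beta), where s(n)^2 is the
   largest square dividing n.  The hyperbola method gives T^2 log T and T^2 with an
   error O(T^(7/4)), and integration over beta preserves this.  Curves with two
   roots are negligible, and minimal models are extracted by Moebius inversion
   over the twists (e^4 A, e^6 B).

   Since N_3(X) is a recursive function of an integer X, c_2 is computable from
   its values at X = 2^(24 k), 2^(24 (k + 1)), 2^(24 (k + 2)).

   For the decimals of c_1, the integral c_0 is cut at the points where f = g; on
   each piece h^2 has an antiderivative which is elementary or a hypergeometric
   series, truncated with an error of known sign. *)

Require Import Defs.
From HB Require Import structures.
From mathcomp Require Import all_boot all_order all_algebra all_field.
From mathcomp Require Import ring lra zify.

Set Implicit Arguments.
Unset Strict Implicit.
Unset Printing Implicit Defensive.

Import Order.TTheory GRing.Theory Num.Theory.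
Local Open Scope ring_scope.

(** * Isogenies of degree 3 and the 3-division polynomial *)

(** By definition an isogeny is an arbitrary Q(E)-point of its target. That it has the shape
    [(r(x), s(x) y)] is obtained by adding to it its conjugate under [y -> -y]: the sum is a point
    over Q(x), hence constant, and it can only be O. After that the algebra consists of divisibility
    and degree counts for polynomials. On the analytic side the error [x ^ (7/4)] is demanded for
    all [x > 0], not just for large [x]. The asymptotics get composed with [T * hfun b] and with
    [x / g ^ 2], which come arbitrarily close to 0; a bound valid there lets the integral over [b]
    and the sums over [g] be taken in full, and one class of functions is preserved from the
    hyperbola method to the final count. Lattice points are counted on a difference of two
    intervals, because [1 + 2 beta - beta ^ 2 / 3] is concave in [beta]. The algorithm for [c_2]
    rests on the asymptotic alone: after two eliminations the error is [128 ^ k] against a main term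
    [256 ^ k], up to a factor linear in [k]. For the decimals of [c_1] the points where f = g are
    replaced by rationals, and a small relative slack pays for the difference. *)

Section CubicForm.
Variables (F : numFieldType) (a b : F).
Hypothesis disc_neq0 : 4 * a ^+ 3 + 27 * b ^+ 2 != 0.
Implicit Types P Q U V D h : {poly F}.

(** For [X = P / Q] this is [Q ^ 3 (X ^ 3 + a X + b)], and [wronskian P Q] is [Q ^ 2 X']; the two
    express the differential [dX / Y] through polynomials. *)
Definition cubic_form P Q := P ^+ 3 + a *: (P * Q ^+ 2) + b *: Q ^+ 3.
Definition wronskian P Q := P^`() * Q - P * Q^`().

(** Once the gcd is divided out, the cofactor of [Q] divides a square to which it is coprime, so it
    is a unit. *)
Lemma dvdp_exp32 Q V : Q ^+ 3 %| V ^+ 2 -> Q %| V.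
Proof.
have [->|Q0] := eqVneq Q 0.
  by rewrite expr0n /= dvd0p expf_eq0 /= => /eqP ->.
move=> QV; set G := gcdp Q V.
have G0 : G != 0 by rewrite gcdp_eq0 negb_and Q0.
have /dvdpP [Q1 Q1E] : G %| Q by apply: dvdp_gcdl.
have /dvdpP [V1 V1E] : G %| V by apply: dvdp_gcdr.
have cop : coprimep Q1 V1.
  rewrite /coprimep -/(_ == 1%N) size_poly_eq1.
  have : gcdp (Q1 * G) (V1 * G) %= gcdp Q1 V1 * G by rewrite eqp_sym; apply: mulp_gcdl.
  rewrite -Q1E -V1E -/G -[X in X %= _]mul1r eqp_mul2r // eqp_sym; done.
have : Q1 %| V1 ^+ 2.
  move: QV; rewrite V1E Q1E !exprMn (exprSr G 2) [G ^+ 2 * G]mulrC mulrA.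
  rewrite dvdp_mul2r ?expf_neq0 // => H; apply: dvdp_trans H.
  by rewrite exprS -mulrA dvdp_mulr.
move=> H; have : Q1 %| 1.
  by rewrite -(Gauss_dvdpl _ (_ : coprimep Q1 (V1 ^+ 2))) ?mul1r // coprimep_expr.
rewrite dvdp1 => s1.
rewrite V1E Q1E dvdp_mul2r //; apply: dvdp_trans (dvd1p _); rewrite dvdp1 //.
Qed.

Lemma coprimep_cubic_form P Q : coprimep P Q -> coprimep (cubic_form P Q) Q.
Proof.
move=> cop; rewrite coprimep_sym.
have -> : cubic_form P Q = P ^+ 3 + (a *: (P * Q) + b *: Q ^+ 2) * Q :> {poly F}.
  by rewrite /cubic_form -!mul_polyC; ring.
by rewrite addrC coprimep_addl_mul coprimep_expr // coprimep_sym.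
Qed.

(** The chain rule for [X ^ 3 + a X + b], cleared of denominators, is
    [FP * wronskian = Q F' - 3 F Q'] with [F] the cubic form. A factor whose square divides [F]
    divides the right side, and it is coprime to [FP] because the discriminant is not 0. *)
Lemma dvdp_wronskian P Q U h c : coprimep P Q -> c != 0 ->
  h * U ^+ 2 = c *: cubic_form P Q -> U %| wronskian P Q.
Proof.
move=> cop c0 E.
have UF : U %| cubic_form P Q.
  by rewrite -(dvdpZr _ _ c0) -E expr2 mulrA dvdp_mull.
have cUQ : coprimep U Q by apply: coprimep_dvdr UF (coprimep_cubic_form cop).
pose FP := 3 *: P ^+ 2 + a *: Q ^+ 2.
have cUF : coprimep U FP.
  apply/coprimepP => d dU dF.
  (* Bezout identity for the cubic and its derivative, homogenized in [P] and [Q]. *)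
  have dQ : d %| - (4 * a ^+ 3 + 27 * b ^+ 2) *: Q ^+ 4.
    have -> : - (4 * a ^+ 3 + 27 * b ^+ 2) *: Q ^+ 4 =
       ((18 * a) *: P - (27 * b) *: Q) * cubic_form P Q +
       (- (6 * a) *: P ^+ 2 + (9 * b) *: (P * Q) - (4 * a ^+ 2) *: Q ^+ 2) * FP.
      rewrite /cubic_form /FP -!mul_polyC !(polyCD, polyCN, polyCM, polyC_exp); ring.
    by rewrite dvdp_add // dvdp_mull // (dvdp_trans dU).
  rewrite dvdpZr ?oppr_eq0 // in dQ.
  have : coprimep d (Q ^+ 4) by rewrite coprimep_expr // (coprimep_dvdr dU).
  by move/coprimepP => /(_ d (dvdpp _) dQ).
have : U %| FP * wronskian P Q.
  have -> : FP * wronskian P Q = Q * (cubic_form P Q)^`() - 3 *: (cubic_form P Q * Q^`()).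
    rewrite /cubic_form /FP /wronskian !(derivD, derivZ, derivM, derivX, derivXn, exprS, expr0, mulr1) -!mul_polyC; ring.
  rewrite dvdp_sub //; last by rewrite dvdpZr ?pnatr_eq0 // dvdp_mulr.
  rewrite dvdp_mull // -(dvdpZr _ _ c0) -derivZ -E.
  have -> : (h * U ^+ 2)^`() = U * (h^`() * U + h * U^`() *+ 2).
    by rewrite derivM expr2 derivM; ring.
  exact: dvdp_mulr.
by rewrite Gauss_dvdpr.
Qed.


(** Comparison of denominators in [h (U / V) ^ 2 = X ^ 3 + a X + b] for [X = P / Q]. With [h = 1] it
    makes [Q] a square up to a constant; with [h] the cubic of the source curve, [Q] may also share
    factors with [h]. *)
Lemma square_part P Q U V h : coprimep P Q -> coprimep U V -> Q != 0 ->
  h * U ^+ 2 * Q ^+ 3 = V ^+ 2 * cubic_form P Q ->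
  exists V1, [/\ V = V1 * Q, Q %| V1 ^+ 2, V1 ^+ 2 %| h * Q
     & h * Q * U ^+ 2 = V1 ^+ 2 * cubic_form P Q].
Proof.
move=> cPQ cUV Q0 E; have cFQ := coprimep_cubic_form cPQ.
have QV : Q %| V.
  apply: dvdp_exp32; rewrite -(Gauss_dvdpl _ (_ : coprimep _ (cubic_form P Q))).
    by rewrite -E dvdp_mull.
  by rewrite coprimep_sym coprimep_expr.
have /dvdpP [V1 V1E] := QV; exists V1.
have E1 : h * Q * U ^+ 2 = V1 ^+ 2 * cubic_form P Q.
  apply: (mulIf (expf_neq0 2 Q0)); rewrite V1E in E.
  transitivity (h * U ^+ 2 * Q ^+ 3); first by ring.
  by rewrite E; ring.
split=> //.
  have cQF : coprimep Q (cubic_form P Q) by rewrite coprimep_sym.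
  by rewrite -(Gauss_dvdpl _ cQF) -E1 dvdp_mulr // dvdp_mull.
have cV1U : coprimep (V1 ^+ 2) (U ^+ 2).
  rewrite coprimep_expl // coprimep_expr // coprimep_sym.
  by apply: coprimep_dvdl cUV; rewrite V1E dvdp_mulr.
by rewrite -(Gauss_dvdpl _ cV1U) E1 dvdp_mulr.
Qed.

Lemma size_wronskian_lt P Q : wronskian P Q != 0 ->
  (size (wronskian P Q) < size P + size Q - 1)%N.
Proof.
move=> W0.
have P0 : P != 0 by apply: contraNneq W0 => ->; rewrite /wronskian deriv0 !mul0r subrr.
have Q0 : Q != 0 by apply: contraNneq W0 => ->; rewrite /wronskian deriv0 !mulr0 subrr.
have := lt_size_deriv P0; have := lt_size_deriv Q0.
have := size_polyMleq (P^`()) Q; have := size_polyMleq P (Q^`()).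
have := size_polyD (P^`() * Q) (- (P * Q^`())); rewrite size_polyN -/(wronskian P Q).
have : (0 < size P)%N by rewrite size_poly_gt0.
have : (0 < size Q)%N by rewrite size_poly_gt0.
have : (0 < size (wronskian P Q))%N by rewrite size_poly_gt0.
move: (size P) (size Q) (size (wronskian P Q)) (size P^`()) (size Q^`()).
move: (size (P^`() * Q)) (size (P * Q^`())); clear; lia.
Qed.

Lemma deriv_eq0 P : P^`() = 0 -> (size P <= 1)%N.
Proof.
move=> P'0; apply/leq_sizeP => -[|i] // _.
have /(congr1 (fun p : {poly F} => p`_i)) := P'0.
by rewrite coef_deriv coef0 => /eqP; rewrite mulrn_eq0 => /eqP.
Qed.

Lemma wronskian_eq0 P Q : coprimep P Q -> wronskian P Q = 0 -> (size P <= 1)%N.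
Proof.
move=> cop /eqP; rewrite subr_eq0 => /eqP E.
have : P %| P^`() by rewrite -(Gauss_dvdpl _ cop) E dvdp_mulr.
have [-> _|P0] := eqVneq P 0; first by rewrite size_poly0.
have [P'E _|P'0 /(dvdp_leq P'0)] := eqVneq (P^`()) 0; first exact: deriv_eq0.
by rewrite leqNgt lt_size_deriv.
Qed.


(** Taylor expansion of the cubic at [e], for the case where [X = P / Q] takes the finite value [e]
    at infinity. *)
Lemma cubic_form_shift P Q e :
  cubic_form (e *: Q + P) Q = (e ^+ 3 + a * e + b) *: Q ^+ 3
    + P * ((3 * e ^+ 2 + a) *: Q ^+ 2 + (3 * e) *: (P * Q) + P ^+ 2).
Proof. by rewrite /cubic_form -!mul_polyC !(polyCD, polyCM, polyC_exp); ring. Qed.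

Lemma size_exp_poly P n : P != 0 -> size (P ^+ n) = ((size P).-1 * n).+1.
Proof.
move=> P0; rewrite -size_exp prednK //.
by rewrite size_poly_gt0 expf_neq0.
Qed.

Lemma wronskian_shift P Q e : wronskian (e *: Q + P) Q = wronskian P Q.
Proof. by rewrite /wronskian derivD derivZ -!mul_polyC; ring. Qed.

Lemma wronskian_sqr P D k : wronskian P (k *: D ^+ 2) = D *
   (k *: (P^`() * D - 2 * P * D^`())).
Proof. by rewrite /wronskian derivZ expr2 derivM -!mul_polyC; ring. Qed.

(* The invariant differential of the curve pulls back to a differential
   without poles on the projective line, that is, to zero. *)
Lemma rational_point_const P Q U V : coprimep P Q -> coprimep U V -> Q != 0 ->
  U ^+ 2 * Q ^+ 3 = V ^+ 2 * cubic_form P Q -> (size P <= 1)%N /\ (size Q <= 1)%N.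
Proof.
move=> cPQ cUV Q0 E; have cFQ := coprimep_cubic_form cPQ.
have [|D [VE QD DQ E1]] := @square_part P Q U V 1 cPQ cUV Q0; first by rewrite mul1r.
rewrite mul1r in DQ E1.
suff W0 : wronskian P Q = 0.
  split; first exact: wronskian_eq0 W0.
  apply: (@wronskian_eq0 Q P); first by rewrite coprimep_sym.
  have -> : wronskian Q P = - wronskian P Q by rewrite /wronskian; ring.
  by rewrite W0 oppr0.
apply/eqP; apply: contraT => W0.
have D0 : D != 0.
  by apply: contraNneq Q0 => D0; move: DQ; rewrite D0 expr0n /= dvd0p.
have /eqpP [[k1 k2] /= /andP[k10 k20] kE] : Q %= D ^+ 2 by rewrite /eqp QD DQ.
pose k := k1^-1 * k2; have k0 : k != 0 by rewrite mulf_neq0 ?invr_neq0.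
have QE : Q = k *: D ^+ 2 by rewrite /k -scalerA -kE scalerA mulVf ?scale1r.
have E2 : k%:P * U ^+ 2 = 1 *: cubic_form P Q.
  apply: (mulIf (expf_neq0 2 D0)); rewrite scale1r [RHS]mulrC -E1 QE -mul_polyC; ring.
have UW := dvdp_wronskian cPQ (oner_neq0 _) E2.
have U0 : U != 0 by apply: contraNneq W0 => U0; rewrite U0 dvd0p in UW.
have cUD : coprimep U D.
  rewrite -(@coprimep_pexpr _ 2) //; apply: coprimep_dvdl DQ _.
  apply: coprimep_dvdr cFQ; rewrite -[cubic_form _ _]scale1r -E2 expr2 mulrA dvdp_mull //.
have [W1 WE] : exists W1, wronskian P Q = D * (k *: W1).
  by exists (P^`() * D - 2 * P * D^`()); rewrite QE wronskian_sqr.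
rewrite WE (Gauss_dvdpr _ cUD) dvdpZr // in UW.
have W10 : W1 != 0 by apply: contraNneq W0 => W10; rewrite WE W10 scaler0 mulr0.
have sU : (size U <= size W1)%N by apply: dvdp_leq.
have sF : size (cubic_form P Q) = size (U ^+ 2).
  by rewrite -[cubic_form _ _]scale1r -E2 mul_polyC size_scale.
(* Subtracting [e *: Q] from [P] keeps the Wronskian, so the smaller polynomial [P1] bounds the
   degree of [W1]. *)
have sW P1 e : P = e *: Q + P1 -> (size W1 + 1 < size P1 + size D)%N.
  move=> PE; have W10' : wronskian P1 Q != 0 by rewrite -(wronskian_shift _ _ e) -PE.
  have := size_wronskian_lt W10'; rewrite -(wronskian_shift _ _ e) -PE.
  rewrite WE QE size_mul ?scaler_eq0 ?negb_or ?k0 // !size_scale // size_exp_poly //.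
  have : (0 < size D)%N by rewrite size_poly_gt0.
  move: (size D) (size P1) (size W1); clear; lia.
have sD : (0 < size D)%N by rewrite size_poly_gt0.
have sQ : size Q = ((size D).-1 * 2).+1 by rewrite QE size_scale // size_exp_poly.
have sU2 : size (cubic_form P Q) = ((size U).-1 * 2).+1 by rewrite sF size_exp_poly.
have sU0 : (0 < size U)%N by rewrite size_poly_gt0.
have sMX n (A B : {poly F}) c : A != 0 -> B != 0 ->
    (size (c *: (A ^+ n * B ^+ (3 - n))) <= (size A).-1 * n + (size B).-1 * (3 - n) + 1)%N.
  move=> A0 B0; apply: leq_trans (size_scale_leq _ _) _.
  by rewrite size_mul ?expf_neq0 // !size_exp_poly // addSn addnS addn1.
have Qp' : (0 < size Q)%N by rewrite size_poly_gt0.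
(* Pole of [X] at infinity: the cubic form has the degree of [P ^+ 3], and [U] comes out larger than
   [W1]. *)
case: (ltnP (size Q) (size P)) => sPQ.
  have P0 : P != 0 by rewrite -size_poly_gt0; apply: leq_trans sPQ.
  have := sW P 0; rewrite scale0r add0r => /(_ erefl) sW1.
  have : size (cubic_form P Q) = ((size P).-1 * 3).+1.
    rewrite /cubic_form -addrA size_polyDl size_exp_poly //.
    apply: leq_ltn_trans (size_polyD _ _) _; rewrite gtn_max; apply/andP; split.
      apply: leq_ltn_trans (sMX 1%N P Q a P0 Q0) _.
      by move: sPQ Qp'; move: (size P) (size Q) => p q; clear; lia.
    rewrite -[Q ^+ 3]mul1r; apply: leq_ltn_trans (sMX 0%N P Q b P0 Q0) _.
    by move: sPQ Qp'; move: (size P) (size Q) => p q; clear; lia.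
  rewrite sU2; move: sU sW1 sPQ sU0 sD; rewrite sQ.
  by move: (size U) (size W1) (size P) (size D) => u w p d; clear; lia.
(* No pole at infinity: [e] is the value of [X] there, and the degree of the cubic form depends on
   whether [e] is a root of the cubic, necessarily a simple one. *)
pose e := P`_(size Q).-1 / lead_coef Q; pose P1 := P - e *: Q.
have PE : P = e *: Q + P1 by rewrite /P1 addrC subrK.
have sP1 : (size P1 < size Q)%N.
  have Qp : (0 < size Q)%N by rewrite size_poly_gt0.
  rewrite -(prednK Qp) ltnS; apply/leq_sizeP => j hj.
  rewrite coefB coefZ; case: (ltngtP j (size Q).-1) hj => // [hj _|-> _].
    have hj2 : (size Q <= j)%N by rewrite -(prednK Qp).
    by rewrite !nth_default ?mulr0 ?subr0 // (leq_trans sPQ).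
  by rewrite /e divfK ?subrr // lead_coef_eq0.
have := sW P1 e PE => sW1; clearbody P1 e k.
have P10 : P1 != 0.
  apply: contraNneq W0 => P10.
  by rewrite PE wronskian_shift P10 /wronskian deriv0 !mul0r subrr.
have /= FE := cubic_form_shift P1 Q e; rewrite -PE in FE.
have s1 := sMX 1%N P1 Q (3 * e ^+ 2 + a) P10 Q0.
have s2 := sMX 2%N P1 Q (3 * e) P10 Q0.
have s3 := sMX 3%N P1 Q 1 P10 Q0.
have Qp : (0 < size P1)%N by rewrite size_poly_gt0.
have s1E : P1 * ((3 * e ^+ 2 + a) *: Q ^+ 2) = (3 * e ^+ 2 + a) *: (P1 ^+ 1 * Q ^+ (3 - 1)).
  by rewrite -scalerAr.
have s2E : P1 * ((3 * e) *: (P1 * Q)) = (3 * e) *: (P1 ^+ 2 * Q ^+ (3 - 2)).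
  by rewrite -scalerAr mulrA.
have s3E : P1 * P1 ^+ 2 = 1 *: (P1 ^+ 3 * Q ^+ (3 - 3)).
  by rewrite scale1r mulr1 -exprS.
case: (eqVneq (e ^+ 3 + a * e + b) 0) => [ge|ge].
  have ge' : 3 * e ^+ 2 + a != 0.
    apply: contraNneq disc_neq0 => ge'.
    have -> : 4 * a ^+ 3 + 27 * b ^+ 2 = - ((18 * a * e - 27 * b) * (e ^+ 3 + a * e + b)
       + (- (6 * a) * e ^+ 2 + (9 * b) * e - (4 * a ^+ 2)) * (3 * e ^+ 2 + a)) by ring.
    by rewrite ge ge' !mulr0 addr0 oppr0.
  have : size (cubic_form P Q) = (size P1 + (size Q).-1 * 2)%N.
    rewrite FE ge scale0r add0r !mulrDr -addrA.
    have ST : size (P1 * ((3 * e ^+ 2 + a) *: Q ^+ 2)) = (size P1 + (size Q).-1 * 2)%N.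
      by rewrite size_mul ?scaler_eq0 ?negb_or ?ge' ?expf_neq0 // size_scale // size_exp_poly // addnS.
    rewrite size_polyDl ST //.
    rewrite s2E s3E.
    apply: leq_ltn_trans (size_polyD _ _) _; rewrite gtn_max; apply/andP; split.
      apply: leq_ltn_trans s2 _.
      by move: sP1 Qp; move: (size P1) (size Q) => p q; clear; lia.
    apply: leq_ltn_trans s3 _.
    by move: sP1 Qp; move: (size P1) (size Q) => p q; clear; lia.
  rewrite sU2; move: sU sW1 sP1 sU0 sD; rewrite sQ.
  by move: (size U) (size W1) (size P1) (size D) => u w p d; clear; lia.
have : size (cubic_form P Q) = ((size Q).-1 * 3).+1.
  rewrite FE size_polyDl size_scale ?size_exp_poly // !mulrDr.
  rewrite s1E s2E s3E.
  apply: leq_ltn_trans (size_polyD _ _) _; rewrite gtn_max; apply/andP; split; last first.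
    apply: leq_ltn_trans s3 _.
    by move: sP1 Qp; move: (size P1) (size Q) => p q; clear; lia.
  apply: leq_ltn_trans (size_polyD _ _) _; rewrite gtn_max; apply/andP; split.
    apply: leq_ltn_trans s1 _.
    by move: sP1 Qp; move: (size P1) (size Q) => p q; clear; lia.
  apply: leq_ltn_trans s2 _.
  by move: sP1 Qp; move: (size P1) (size Q) => p q; clear; lia.
rewrite sU2; move: sU sW1 sP1 sU0 sD; rewrite sQ.
by move: (size U) (size W1) (size P1) (size D) => u w p d; clear; lia.
Qed.

End CubicForm.

Lemma Poly_cons (F : nzRingType) (x : F) s : Poly (x :: s) = Poly s * 'X + x%:P.
Proof. exact: cons_poly_def. Qed.

Lemma Poly_eq0 (F : nzRingType) (s : seq F) i : Poly s = 0 -> s`_i = 0.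
Proof. by move=> /(congr1 (fun p : {poly F} => p`_i)); rewrite coef_Poly coef0. Qed.

Lemma size4_Poly (F : nzRingType) (P : {poly F}) : (size P <= 4)%N ->
  P = Poly [:: P`_0; P`_1; P`_2; P`_3].
Proof.
move=> sP; apply/polyP => i; rewrite coef_Poly.
case: (ltnP i 4) => hi; last by rewrite [LHS]nth_default ?(leq_trans sP hi) // [RHS]nth_default.
by move: i hi; do 4!case=> //; move=> i; rewrite !ltnS ltn0.
Qed.

(** * Poles of the x-coordinate of a map of degree 3 *)

Section DegreeThree.
Variable F : numFieldType.
Implicit Types (A B a b c e q : F) (P Q U V : {poly F}).

Definition cubic A B : {poly F} := 'X^3 + A *: 'X + B%:P.

(** After [e] is moved to 0, comparing coefficients determines [c P] near the pole in terms of
    [f0 = f(e)] and [f1 = f'(e)], and two of the relations are compatible only if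
    [12 e f0 - f1 ^ 2 = 0]. This expression is the 3-division polynomial at [e]. *)
Lemma psi3_of_double_pole A B a b c e q P : (size P = 4)%N -> P.[e] != 0 -> c != 0 ->
  cubic A B * (P^`() * ('X - e%:P) - 2 *: P) ^+ 2
    = c *: cubic_form a b P (q *: ('X - e%:P) ^+ 2) ->
  3 * e ^+ 4 + 6 * A * e ^+ 2 + 12 * B * e - A ^+ 2 = 0.
Proof.
move=> sP Pe c0 E; pose S := P \Po ('X + e%:P).
have sS : (size S = 4)%N.
  by rewrite size_comp_poly2 ?size_XaddC.
have SE : S = Poly [:: S`_0; S`_1; S`_2; S`_3] by apply: size4_Poly; rewrite sS.
have p0E : S`_0 = P.[e].
  by rewrite -horner_coef0 /S horner_comp !hornerE.
have p30 : S`_3 != 0.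
  have : lead_coef S != 0 by rewrite lead_coef_eq0 -size_poly_eq0 sS.
  by rewrite /lead_coef sS.
have S'E : S^`() = P^`() \Po ('X + e%:P).
  by rewrite /S deriv_comp derivD derivX derivC addr0 mulr1.
have Xe : 'X \Po ('X + e%:P) = 'X + e%:P :> {poly F} by rewrite comp_polyX.
move: E => /(congr1 (fun p : {poly F} => p \Po ('X + e%:P))) E.
rewrite /cubic /cubic_form -!mul_polyC !(exprS, expr0, mulr1) in E.
rewrite !(comp_polyM, comp_polyB, comp_polyD, comp_polyC, Xe) -/S -S'E in E.
move: (S`_0) (S`_1) (S`_2) (S`_3) SE p0E p30 => p0 p1 p2 p3 SE p0E p30.
have p00 : p0 != 0 by rewrite p0E.
have S'P : S^`() = Poly [:: p1; 2 * p2; 3 * p3].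
  by rewrite SE !Poly_cons !(derivD, derivM, derivX, derivC) /=; ring.
pose f0 := e ^+ 3 + A * e + B; pose f1 := 3 * e ^+ 2 + A; pose f2 := 3 * e.
pose h := [:: f0 * (4 * p0 ^+ 2) - c * p0 ^+ 3;
  f0 * (4 * p0 * p1) + f1 * (4 * p0 ^+ 2) - c * (3 * p0 ^+ 2 * p1);
  f0 * p1 ^+ 2 + f1 * (4 * p0 * p1) + f2 * (4 * p0 ^+ 2)
    - c * (3 * p0 ^+ 2 * p2 + 3 * p0 * p1 ^+ 2);
  f0 * (- 4 * p0 * p3) + f1 * p1 ^+ 2 + f2 * (4 * p0 * p1) + 4 * p0 ^+ 2
    - c * (3 * p0 ^+ 2 * p3 + 6 * p0 * p1 * p2 + p1 ^+ 3);
  f0 * (- 2 * p1 * p3) + f1 * (- 4 * p0 * p3) + f2 * p1 ^+ 2 + 4 * p0 * p1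
    - c * (6 * p0 * p1 * p3 + 3 * p0 * p2 ^+ 2 + 3 * p1 ^+ 2 * p2 + a * q ^+ 2 * p0);
  f1 * (- 2 * p1 * p3) + f2 * (- 4 * p0 * p3) + p1 ^+ 2
    - c * (6 * p0 * p2 * p3 + 3 * p1 ^+ 2 * p3 + 3 * p1 * p2 ^+ 2 + a * q ^+ 2 * p1);
  f0 * p3 ^+ 2 + f2 * (- 2 * p1 * p3) - 4 * p0 * p3
    - c * (3 * p0 * p3 ^+ 2 + 6 * p1 * p2 * p3 + p2 ^+ 3 + a * q ^+ 2 * p2 + b * q ^+ 3);
  f1 * p3 ^+ 2 - 2 * p1 * p3 - c * (3 * p1 * p3 ^+ 2 + 3 * p2 ^+ 2 * p3 + a * q ^+ 2 * p3);
  f2 * p3 ^+ 2 - c * (3 * p2 * p3 ^+ 2);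
  p3 ^+ 2 - c * p3 ^+ 3].
have hE : Poly h = 0.
  move/eqP: E; rewrite -subr_eq0 => /eqP <-.
  rewrite S'P SE /h !Poly_cons /= /f0 /f1 /f2; ring.
(* The coefficients of degree 0, 1, 2, 8 and 9 suffice. *)
have h0 := Poly_eq0 0 hE; have h1 := Poly_eq0 1 hE; have h2 := Poly_eq0 2 hE.
have h8 := Poly_eq0 8 hE; have h9 := Poly_eq0 9 hE.
rewrite /h /= in h0 h1 h2 h8 h9; clear hE h E.
have c3 : c * p3 = 1.
  apply: (mulfI (expf_neq0 2 p30)).
  by rewrite mulr1 -[RHS]subr0 -h9; ring.
have c2 : c * p2 = e.
  apply: (mulfI (expf_neq0 2 p30)); apply: (mulfI (_ : 3 != 0)); first by rewrite pnatr_eq0.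
  by rewrite -[RHS]subr0 -h8 /f2; ring.
have c1 : c * p0 = 4 * f0.
  by apply: (mulfI (expf_neq0 2 p00)); rewrite -[RHS]subr0 -h0; ring.
have g1 : f1 * p0 = 2 * f0 * p1.
  have /eqP := h1; rewrite (_ : _ - _ = 4 * p0 * (f0 * p1 + f1 * p0) - 3 * (c * p0) * p0 * p1); last by ring.
  rewrite c1 (_ : _ - _ = 4 * p0 * (f1 * p0 - 2 * f0 * p1)); last by ring.
  by rewrite !mulf_eq0 pnatr_eq0 (negPf p00) /= subr_eq0 => /eqP.
have g2 : 3 * e * p0 ^+ 2 = f0 * p1 ^+ 2.
  have : f0 * p1 ^+ 2 + 4 * (f1 * p0) * p1 + f2 * (4 * p0 ^+ 2)
    - (3 * (c * p2) * p0 ^+ 2 + 3 * (c * p0) * p1 ^+ 2) = 0 by rewrite -h2; ring.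
  rewrite c1 c2 g1 /f2 => H; apply: (mulfI (_ : 3 != 0)); first by rewrite pnatr_eq0.
  by rewrite -[RHS]addr0 -H; ring.
have f00 : f0 != 0.
  by have : c * p0 != 0; [rewrite mulf_neq0 | rewrite c1 mulf_eq0 negb_or => /andP[]].
apply: (mulIf (expf_neq0 2 p00)); rewrite mul0r.
transitivity (4 * f0 * (3 * e * p0 ^+ 2) - (f1 * p0) ^+ 2).
  by rewrite /f0 /f1; ring.
by rewrite g2 g1; ring.
Qed.

(** The equation and its derivative at [e1] and [e2] give the values there of [c P] and of [c P'].
    Such Hermite data determine a cubic, and its leading coefficient comes out as 0. *)
Lemma no_two_simple_poles a b c e1 e2 e3 P : (size P = 4)%N -> e1 != e2 ->
  P.[e1] != 0 -> P.[e2] != 0 -> c != 0 -> 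
  let Q := ('X - e1%:P) * ('X - e2%:P) in
  ('X - e3%:P) * wronskian P Q ^+ 2 = c *: cubic_form a b P Q -> False.
Proof.
move=> sP e12 P1 P2 c0 Q E.
have p30 : P`_3 != 0.
  have : lead_coef P != 0 by rewrite lead_coef_eq0 -size_poly_eq0 sP.
  by rewrite /lead_coef sP.
have PE := @size4_Poly _ P; rewrite sP in PE; have {}PE := PE isT.
move: (P`_0) (P`_1) (P`_2) (P`_3) PE p30 => p0 p1 p2 p3 PE p30.
have d0 : e1 - e2 != 0 by rewrite subr_eq0.
have P'E x : P^`().[x] = p1 + 2 * p2 * x + 3 * p3 * x ^+ 2.
  by rewrite PE !Poly_cons /= !(derivD, derivM, derivX, derivC) !(hornerD, hornerM, hornerX, hornerC); ring.
have PxE x : P.[x] = p0 + p1 * x + p2 * x ^+ 2 + p3 * x ^+ 3.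
  by rewrite PE !Poly_cons /= !(hornerD, hornerN, hornerM, hornerX, hornerC); ring.
have Qe1 : Q.[e1] = 0 by rewrite /Q !hornerE subrr mul0r.
have Qe2 : Q.[e2] = 0 by rewrite /Q !hornerE subrr mulr0.
have Q'e x : Q^`().[x] = (x - e1) + (x - e2).
  by rewrite /Q !(derivM, derivB, derivX, derivC) !(hornerD, hornerN, hornerM, hornerX, hornerC); ring.
have Q''e x : Q^`()^`().[x] = 2.
  by rewrite /Q !(derivM, derivB, derivX, derivC, derivD, deriv0, mul0r, mulr0, subr0, add0r, addr0, mulr1, mul1r) !(hornerD, hornerN, hornerM, hornerX, hornerC); ring.
clearbody Q.
have ev x : Q.[x] = 0 -> (x - e3) * P.[x] ^+ 2 * Q^`().[x] ^+ 2 = c * P.[x] ^+ 3.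
  move=> Qx; have /(congr1 (fun p => p.[x])) := E.
  rewrite /cubic_form /wronskian !(hornerD, hornerN, hornerM, hornerX, hornerC, hornerZ, horner_exp) Qx => H.
  by transitivity ((x - e3) * (P^`().[x] * 0 - P.[x] * Q^`().[x]) ^+ 2); [ring | rewrite H; ring].
have ev' x : Q.[x] = 0 -> P.[x] ^+ 2 * Q^`().[x] ^+ 2
     + 4 * (x - e3) * P.[x] ^+ 2 * Q^`().[x] = 3 * c * P.[x] ^+ 2 * P^`().[x].
  move=> Qx; have /(congr1 (fun p => p^`().[x])) := E.
  rewrite /cubic_form /wronskian -!mul_polyC ![_ ^+ 3]exprS !expr2.
  rewrite !(derivM, derivB, derivD, derivX, derivC, subr0, mul0r, add0r, mul1r) !(hornerD, hornerN, hornerM, hornerX, hornerC, horner0) Qx Q''e => H.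
  by move/eqP: H; rewrite -subr_eq0 => /eqP H; rewrite -[RHS]addr0 -[X in _ = _ + X]H; ring.
have {}E1 := ev _ Qe1; have {}E2 := ev _ Qe2; have E1' := ev' _ Qe1; have E2' := ev' _ Qe2.
rewrite !Q'e !subrr ?add0r ?addr0 in E1 E2 E1' E2'.
have {}E1 : (e1 - e3) * (e1 - e2) ^+ 2 = c * P.[e1].
  by apply: (mulfI (expf_neq0 2 P1)); rewrite mulrCA mulrA E1; ring.
have {}E2 : (e2 - e3) * (e1 - e2) ^+ 2 = c * P.[e2].
  by apply: (mulfI (expf_neq0 2 P2)); transitivity (c * P.[e2] ^+ 3); [rewrite -E2|]; ring.
have {}E1' : (e1 - e2) ^+ 2 + 4 * (e1 - e3) * (e1 - e2) = 3 * c * P^`().[e1].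
  by apply: (mulfI (expf_neq0 2 P1)); transitivity (3 * c * P.[e1] ^+ 2 * P^`().[e1]); [rewrite -E1'|]; ring.
have {}E2' : (e1 - e2) ^+ 2 - 4 * (e2 - e3) * (e1 - e2) = 3 * c * P^`().[e2].
  by apply: (mulfI (expf_neq0 2 P2)); transitivity (3 * c * P.[e2] ^+ 2 * P^`().[e2]); [rewrite -E2'|]; ring.
have : 3 * c * p3 * (e1 - e2) ^+ 3 = 0.
  transitivity ((e1 - e2) * (3 * c * P^`().[e1] + 3 * c * P^`().[e2])
     - 6 * (c * P.[e1] - c * P.[e2])).
    by rewrite !P'E !PxE; ring.
  by rewrite -E1' -E2' -E1 -E2; ring.
by apply/eqP; rewrite !mulf_neq0 ?expf_neq0 ?pnatr_eq0.
Qed.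

End DegreeThree.

Section PsiRoot.
Variable F : numFieldType.
Implicit Types (A B a b c e q : F) (P Q U V : {poly F}).

Lemma size_cubic A B : size (cubic A B) = 4%N.
Proof.
rewrite /cubic -addrA size_polyDl size_polyXn //.
apply: leq_ltn_trans (size_polyD _ _) _; rewrite gtn_max.
apply/andP; split; last by apply: leq_ltn_trans (size_polyC_leq1 _) _.
by apply: leq_ltn_trans (size_scale_leq _ _) _; rewrite size_polyX.
Qed.

Lemma coprimep_cubic_deriv A B : 4 * A ^+ 3 + 27 * B ^+ 2 != 0 ->
  coprimep (cubic A B) (cubic A B)^`().
Proof.
move=> disc; apply/coprimepP => d df df'.
have : d %| (- (4 * A ^+ 3 + 27 * B ^+ 2))%:P.
  have -> : (- (4 * A ^+ 3 + 27 * B ^+ 2))%:P =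
    ((18 * A) *: 'X - (27 * B)%:P) * cubic A B +
    (- (6 * A) *: 'X ^+ 2 + (9 * B) *: 'X - (4 * A ^+ 2)%:P) * (cubic A B)^`().
    rewrite /cubic !derivD derivZ derivX derivC -!mul_polyC derivXn; ring.
  by rewrite dvdp_add // dvdp_mull.
rewrite -[X in _ %| X]alg_polyC dvdpZr ?oppr_eq0 // dvdp1 => sd.
by rewrite -size_poly_eq1.
Qed.

Lemma sqr_dvdp_separable P f : coprimep f f^`() -> P ^+ 2 %| f -> size P = 1%N.
Proof.
move=> cop /dvdpP [g fE]; apply/eqP; rewrite size_poly_eq1.
have /coprimepP -> // := cop; first by rewrite fE expr2 mulrA dvdp_mull.
have -> : f^`() = P * (g^`() * P + g * P^`() *+ 2) by rewrite fE expr2 !derivM; ring.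
exact: dvdp_mulr.
Qed.

Lemma separable_dvdp_sqr Q V : coprimep Q Q^`() -> Q %| V ^+ 2 -> Q %| V.
Proof.
move=> cop QV; have [Q0|Q0] := eqVneq Q 0.
  by move: QV; rewrite Q0 !dvd0p expf_eq0.
set G := gcdp Q V; have G0 : G != 0 by rewrite gcdp_eq0 negb_and Q0.
have /dvdpP [H HE] : G %| Q by apply: dvdp_gcdl.
have /dvdpP [K KE] : G %| V by apply: dvdp_gcdr.
have cHK : coprimep H K.
  have : gcdp (H * G) (K * G) %= gcdp H K * G by rewrite eqp_sym; apply: mulp_gcdl.
  by rewrite -HE -KE -/G -[X in X %= _]mul1r eqp_mul2r // eqp_sym /coprimep size_poly_eq1.
have HG : H %| G.
  have : H * G %| (G * K ^+ 2) * G by rewrite -HE (_ : _ * G = V ^+ 2) // KE; ring.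
  by rewrite dvdp_mul2r // Gauss_dvdpl // coprimep_expr.
have : H ^+ 2 %| Q by rewrite HE expr2 dvdp_mul2l // -size_poly_eq0; apply: contraTneq isT => /eqP; rewrite size_poly_eq0 => /eqP H0; move: Q0; rewrite HE H0 mul0r eqxx.
move=> /(sqr_dvdp_separable cop) /eqP; rewrite size_poly_eq1 => H1.
rewrite HE KE dvdp_mul2r //; apply: dvdp_trans (dvd1p _).
by rewrite (eqp_dvdl _ H1).
Qed.

Lemma cubic_formZ a b P Q q : cubic_form a b P (q *: Q) = cubic_form (a * q ^+ 2) (b * q ^+ 3) P Q.
Proof. by rewrite /cubic_form -!mul_polyC; ring. Qed.

Lemma size_cubic_form a b P Q : Q != 0 -> (size Q < size P)%N ->
  size (cubic_form a b P Q) = ((size P).-1 * 3).+1.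
Proof.
move=> Q0 sQ; have P0 : P != 0 by rewrite -size_poly_gt0; apply: leq_trans sQ.
have Qp : (0 < size Q)%N by rewrite size_poly_gt0.
rewrite /cubic_form -addrA size_polyDl size_exp_poly //.
apply: leq_ltn_trans (size_polyD _ _) _; rewrite gtn_max.
apply/andP; split; apply: leq_ltn_trans (size_scale_leq _ _) _.
  rewrite size_mul ?expf_neq0 // size_exp_poly //.
  by move: sQ Qp; move: (size P) (size Q) => p r; clear; lia.
rewrite size_exp_poly //.
by move: sQ Qp; move: (size P) (size Q) => p r; clear; lia.
Qed.

Lemma size2_root P : size P = 2%N -> exists e, P %= 'X - e%:P.
Proof.
move=> sP; pose e := - (P`_0 / P`_1); exists e.
have l0 : P`_1 != 0.
  have : lead_coef P != 0 by rewrite lead_coef_eq0 -size_poly_eq0 sP.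
  by rewrite /lead_coef sP.
rewrite eqp_sym -dvdp_size_eqp ?size_XsubC ?sP // dvdp_XsubCl /root.
by rewrite (horner_coef_wide _ (leqnn _)) sP !big_ord_recl big_ord0 /= /e; apply/eqP; field.
Qed.

Lemma eqp_scale P Q : P %= Q -> exists2 c, c != 0 & P = c *: Q.
Proof.
move=> /eqpP [[c1 c2] /= /andP[c10 c20] E]; exists (c1^-1 * c2).
  by rewrite mulf_neq0 ?invr_neq0.
by rewrite -scalerA -E scalerA mulVf ?scale1r.
Qed.

End PsiRoot.

(** [Q] need not split over the rationals, so the equation is mapped to [algC], where [Q] has two
    roots. They are distinct by separability, and not roots of [P] by coprimality. *)
Lemma separable_quadratic_split (P Q m : {poly rat}) (a b c : rat) :
  size P = 4%N -> size Q = 3%N -> size m = 2%N -> c != 0 -> coprimep P Q -> coprimep Q Q^`() ->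
  m * wronskian P Q ^+ 2 = c *: cubic_form a b P Q -> False.
Proof.
move=> sP sQ sm c0 cPQ cQ E.
pose g : {poly rat} -> {poly algC} := map_poly ratr.
have [r Qr] := closed_field_poly_normal (g Q).
have sr : size r = 2%N.
  have := size_map_poly (ratr : {rmorphism rat -> algC}) Q; rewrite -/(g Q) Qr sQ.
  by rewrite size_scale ?size_prod_XsubC ?lead_coef_eq0 -?size_poly_eq0 ?size_map_poly ?sQ // => -[].
case: r sr Qr => [|e1 [|e2 [|]]] // _; rewrite !big_cons big_nil mulr1 => Qr.
have [e3 /eqp_scale [l l0 mE]] := size2_root sm.
set k := lead_coef _ in Qr.
have k0 : k != 0 by rewrite lead_coef_eq0 -size_poly_eq0 size_map_poly sQ.
have rr0 (x : rat) : x != 0 -> ratr x != 0 :> algC by rewrite fmorph_eq0.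
have root_neq x : root (g Q) x -> (g P).[x] != 0.
  move=> Qx; apply: (@coprimep_root _ (g Q)) => //.
  by rewrite coprimep_map coprimep_sym.
have re1 : root (g Q) e1 by rewrite Qr rootZ // rootM root_XsubC eqxx.
have re2 : root (g Q) e2 by rewrite Qr rootZ // rootM !root_XsubC eqxx orbT.
apply: (@no_two_simple_poles _ (ratr a * k ^+ 2) (ratr b * k ^+ 3) (ratr c / (ratr l * k ^+ 2)) e1 e2 (ratr e3) (g P)).
- by rewrite size_map_poly.
- apply: contraNneq (coprimep_root (_ : coprimep (g Q) (g Q)^`()) re1) => [e12|].
    by rewrite Qr -e12 derivZ derivM hornerZ hornerD !hornerM !hornerXsubC subrr mulr0 mul0r addr0 mulr0.
  by rewrite deriv_map coprimep_map.
- exact: root_neq.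
- exact: root_neq.
- apply: mulf_neq0; first exact: rr0.
  by rewrite invr_neq0 // mulf_neq0 ?expf_neq0 //; apply: rr0.
rewrite -cubic_formZ -Qr.
have {}E : ratr l *: (('X - (ratr e3)%:P) * wronskian (g P) (g Q) ^+ 2) = ratr c *: cubic_form (ratr a) (ratr b) (g P) (g Q).
  have gM u v : g (u * v) = g u * g v by rewrite /g rmorphM.
  have gD u v : g (u + v) = g u + g v by rewrite /g rmorphD.
  have gB u v : g (u - v) = g u - g v by rewrite /g rmorphB.
  have gZ u v : g (u *: v) = ratr u *: g v by rewrite /g map_polyZ.
  have gX u n : g (u ^+ n) = g u ^+ n by rewrite /g rmorphXn.
  have /(congr1 g) := E; rewrite mE /wronskian /cubic_form.
  have gder u : (g u)^`() = g u^`() by rewrite /g deriv_map.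
  rewrite !(gZ, gM, gX, gB, gD) !gder.
  have -> : g 'X = 'X by rewrite /g map_polyX.
  have -> : g e3%:P = (ratr e3)%:P by rewrite /g map_polyC.
  by rewrite -scalerAl.
apply: (scalerI (_ : ratr l * k ^+ 2 != 0)); first by apply: mulf_neq0; [apply: rr0 | rewrite expf_neq0].
rewrite [RHS]scalerA [X in _ = X *: _]mulrC divfK; last by apply: mulf_neq0; [apply: rr0 | rewrite expf_neq0].
rewrite -E.
rewrite Qr /wronskian derivZ -!mul_polyC rmorphM rmorphXn /=; ring.
Qed.

(** [U] divides the Wronskian, which has small degree, whereas the equation fixes the degree of [U]
    in terms of [Q] and [V1]. Of the possible denominators only a double pole survives. *)
Theorem psi3_root_of_degree3 (A B a b : rat) (P Q U V : {poly rat}) :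
  4 * A ^+ 3 + 27 * B ^+ 2 != 0 -> 4 * a ^+ 3 + 27 * b ^+ 2 != 0 ->
  coprimep P Q -> coprimep U V -> size P = 4%N -> (size Q <= 3)%N -> Q != 0 ->
  cubic A B * U ^+ 2 * Q ^+ 3 = V ^+ 2 * cubic_form a b P Q ->
  exists e, 3 * e ^+ 4 + 6 * A * e ^+ 2 + 12 * B * e - A ^+ 2 = 0.
Proof.
move=> discf discg cPQ cUV sP sQ Q0 E.
have [V1 [VE QV V1f E1]] := square_part cPQ cUV Q0 E.
set f := cubic A B in E V1f E1; have sf : size f = 4%N by apply: size_cubic.
have f0 : f != 0 by rewrite -size_poly_eq0 sf.
have cf : coprimep f f^`() by apply: coprimep_cubic_deriv.
have P0 : P != 0 by rewrite -size_poly_eq0 sP.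
have V10 : V1 != 0.
  apply: contraTneq cUV => V10; rewrite VE V10 mul0r.
  move/eqP: E1; rewrite V10 expr0n mul0r !mulf_eq0 (negPf f0) (negPf Q0) /= orbb => /eqP ->.
  by rewrite coprimep0 -size_poly_eq1 size_poly0.
have sF : size (cubic_form a b P Q) = 10%N by rewrite size_cubic_form ?sP.
have F0 : cubic_form a b P Q != 0 by rewrite -size_poly_eq0 sF.
have U0 : U != 0.
  apply: contraNneq F0 => U0; move/eqP: E1.
  by rewrite U0 expr0n mulr0 eq_sym mulf_eq0 expf_eq0 (negPf V10).
have cFQ := coprimep_cubic_form a b cPQ.
have sV : (0 < size V1)%N by rewrite size_poly_gt0.
have sU : (0 < size U)%N by rewrite size_poly_gt0.
have sQ0 : (0 < size Q)%N by rewrite size_poly_gt0.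
have sE : (2 + size Q + 2 * (size U).-1 = 2 * (size V1).-1 + 9)%N.
  have /(congr1 (fun p : {poly rat} => size p)) := E1.
  rewrite (size_mul (mulf_neq0 f0 Q0) (expf_neq0 2 U0)) (size_mul f0 Q0) (size_mul (expf_neq0 2 V10) F0).
  rewrite !size_exp_poly // sf sF.
  by move: sQ0; move: (size Q) (size U) (size V1) => x y z; clear; lia.
have W0 : wronskian P Q != 0.
  by apply/eqP => /(wronskian_eq0 cPQ); rewrite sP.
have sW := size_wronskian_lt W0; rewrite sP in sW.
have UWof h c : c != 0 -> h * U ^+ 2 = c *: cubic_form a b P Q -> U %| wronskian P Q.
  exact: dvdp_wronskian.
have sV1 : ((size V1).-1 * 2 < 3 + size Q)%N.
  have := dvdp_leq _ V1f; rewrite mulf_neq0 // => /(_ isT).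
  by rewrite size_exp_poly // size_mul // sf; move: (size V1) (size Q) => x y; clear; lia.
case sQE : (size Q) sQ sQ0 => [|[|[|[|//]]]] // _ _; rewrite sQE in sE sW sV1.
(* [X] is a polynomial: [V1] is constant because [f] is squarefree, and then [U] is too large to
   divide the Wronskian. *)
- have /size_poly1P [q q0 QE] : size Q == 1%N by rewrite sQE.
  have : V1 ^+ 2 %| f by rewrite QE mulrC mul_polyC dvdpZr // in V1f.
  move=> /(sqr_dvdp_separable cf) sV11; rewrite sV11 in sE.
  have : (size U <= size (wronskian P Q))%N.
    have /size_poly1P [v v0 V1E] : size V1 == 1%N by rewrite sV11.
    apply: dvdp_leq => //; apply: (UWof (f * Q) (v ^+ 2)); first by rewrite expf_neq0.
    by rewrite E1 V1E -polyC_exp mul_polyC.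
  by move: sE sW; move: (size U) (size _) => x y; clear; lia.
(* A linear denominator contradicts [sE] modulo 2. *)
- by exfalso; move: sE; move: (size U) (size V1) => x y; clear; lia.
have : (size Q <= ((size V1).-1 * 2).+1)%N.
  by rewrite -size_exp_poly //; apply: dvdp_leq => //; rewrite expf_neq0.
rewrite sQE => sV1'.
have [sV2|sV2] : size V1 = 2%N \/ size V1 = 3%N.
- by move: sV1 sV1'; move: (size V1) => x; clear; lia.
(* One double pole at [e]: the degrees force [U] to be the Wronskian divided by [x - e], up to a
   constant. *)
- have [e /eqp_scale [l l0 V1E]] := size2_root sV2.
  have /eqp_scale [q q0 QE] : Q %= ('X - e%:P) ^+ 2.
    rewrite -dvdp_size_eqp.
      by rewrite sQE size_exp_poly ?polyXsubC_eq0 // size_XsubC.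
    by move: QV; rewrite V1E exprZn dvdpZr ?expf_neq0.
  have D0 : ('X - e%:P : {poly rat}) != 0 by rewrite polyXsubC_eq0.
  have E2 : (q *: f) * U ^+ 2 = l ^+ 2 *: cubic_form a b P Q.
    apply: (mulIf (expf_neq0 2 D0)).
    transitivity (f * Q * U ^+ 2); first by rewrite QE -!mul_polyC; ring.
    by rewrite E1 V1E -!mul_polyC rmorphXn /=; ring.
  have UW := UWof _ _ (expf_neq0 2 l0) E2.
  have Pe : P.[e] != 0.
    apply: (@coprimep_root _ Q); first by rewrite coprimep_sym.
    by rewrite QE rootZ // root_exp_XsubC.
  have cUD : coprimep U ('X - e%:P).
    rewrite -(@coprimep_pexpr _ 2) //.
    apply: (@coprimep_dvdl _ Q); first by rewrite QE dvdpZr.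
    apply: coprimep_dvdr cFQ.
    by rewrite -(dvdpZr _ _ (expf_neq0 2 l0)) -E2 expr2 mulrA dvdp_mull.
  pose W1 := P^`() * ('X - e%:P) - 2 *: P.
  have WE : wronskian P Q = ('X - e%:P) * (q *: W1).
    by rewrite QE wronskian_sqr /W1 derivB derivX derivC subr0 mulr1 -!mul_polyC; ring.
  rewrite WE Gauss_dvdpr // dvdpZr // in UW.
  have W10 : W1 != 0 by apply: contraNneq W0 => W10; rewrite WE W10 scaler0 mulr0.
  have /eqp_scale [w w0 UE] : U %= W1.
    rewrite -dvdp_size_eqp // eqn_leq dvdp_leq //=.
    have : size (wronskian P Q) = (size W1).+1.
      by rewrite WE size_mul ?scaler_eq0 ?negb_or ?q0 // size_scale // size_XsubC.
    by move: sE sW; rewrite sV2; move: (size U) (size W1) (size _) => x y z; clear; lia.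
  exists e; apply: (@psi3_of_double_pole _ A B a b (l ^+ 2 / (q * w ^+ 2)) e q P) => //.
    by rewrite !mulf_neq0 ?invr_neq0 ?mulf_neq0 ?expf_neq0.
  rewrite -QE -/W1 -/f; apply: (scalerI (_ : q * w ^+ 2 != 0)); first by rewrite mulf_neq0 ?expf_neq0.
  rewrite [RHS]scalerA [X in _ = X *: _]mulrC divfK ?mulf_neq0 ?expf_neq0 // -E2 UE -!mul_polyC rmorphM rmorphXn /=; ring.
(* Two simple poles: [Q] and [V1] agree up to constants with a quadratic factor of the separable
   cubic [f], and [U] with the whole Wronskian. *)
exfalso.
have /dvdpP [m mE] := V1f; have /dvdpP [Q2 Q2E] := QV.
have fE : f = m * Q2 by apply: (mulIf Q0); rewrite mE Q2E; ring.
have Q20 : Q2 != 0 by apply: contraNneq f0 => Q20; rewrite fE Q20 mulr0.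
have m0 : m != 0 by apply: contraNneq f0 => m0; rewrite fE m0 mul0r.
have sQ2 : size Q2 = 3%N.
  have /(congr1 (fun p : {poly rat} => size p)) := Q2E.
  by rewrite size_exp_poly // size_mul // sV2 sQE; move: (size Q2) => x; clear; lia.
have sm : size m = 2%N.
  have /(congr1 (fun p : {poly rat} => size p)) := fE.
  by rewrite size_mul // sf sQ2; move: (size m) => x; clear; lia.
have cQ2 : coprimep Q2 Q2^`().
  apply/coprimepP => d dQ dQ'; move/coprimepP: cf; apply.
    by rewrite fE dvdp_mull.
  by rewrite fE derivM dvdp_add // dvdp_mull.
have /eqp_scale [k k0 Q2V] : Q2 %= V1.
  rewrite -dvdp_size_eqp ?sQ2 ?sV2 //; apply: separable_dvdp_sqr => //.
  by rewrite Q2E dvdp_mulr.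
have V1E : V1 = k *: Q.
  apply: (mulIf V10); rewrite -expr2 Q2E Q2V -!mul_polyC; ring.
have fQ : f = m * (k ^+ 2 *: Q) by rewrite fE Q2V V1E scalerA -expr2.
have E2 : m * U ^+ 2 = 1 *: cubic_form a b P Q.
  apply: (mulIf (expf_neq0 2 V10)); rewrite scale1r [RHS]mulrC -E1 fQ V1E -!mul_polyC rmorphXn /=; ring.
have UW := UWof _ _ (oner_neq0 _) E2.
have /eqp_scale [w w0 UE] : U %= wronskian P Q.
  rewrite -dvdp_size_eqp // eqn_leq dvdp_leq //=.
  by move: sE sW; rewrite sV2; move: (size U) (size (wronskian P Q)) => x y; clear; lia.
apply: (@separable_quadratic_split P Q m a b (w ^- 2)) => //.
- by rewrite invr_neq0 ?expf_neq0.
- apply/coprimepP => d dQ dQ'; move/coprimepP: cf; apply.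
    by rewrite fQ dvdp_mull // dvdpZr // expf_neq0.
  by rewrite fQ derivM derivZ dvdp_add // dvdp_mull // dvdpZr // expf_neq0.
apply: (scalerI (expf_neq0 2 w0)); rewrite scalerA divff ?expf_neq0 // -E2 UE.
by rewrite -!mul_polyC rmorphXn /=; ring.
Qed.

(** * Reduced fractions, linear dependence over a subfield, and the target of Velu's isogeny *)

Notation ratfun := {fraction {poly rat}}.


Lemma ratfun_fraction (r : ratfun) : exists P Q : {poly rat},
  [/\ coprimep P Q, Q != 0 & r = tofrac P / tofrac Q].
Proof.
have [P [Q [Q0 ->]]] : exists P Q : {poly rat}, Q != 0 /\ r = tofrac P / tofrac Q.
  elim/quotW: r => -[[P Q] /= Q0]; exists P, Q; split=> //.
  apply: (@mulIf _ (tofrac Q)); first by rewrite tofrac_eq0.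
  rewrite divfK ?tofrac_eq0 //.
  transitivity (\pi_ratfun (FracField.mulf (@mkRatio _ (P, Q) Q0) (Ratio Q 1)))%qT.
    by rewrite FracField.pi_mul; congr (FracField.mul _ _); rewrite piE.
  rewrite [RHS]piE; apply/eqmodP; rewrite /= FracField.equivfE /FracField.mulf.
  by rewrite !numden_Ratio ?mulf_neq0 ?oner_eq0 //= !mulr1 mulrC.
pose G := gcdp P Q; have G0 : G != 0 by rewrite gcdp_eq0 negb_and Q0 orbT.
have /dvdpP [P1 PE] : G %| P by apply: dvdp_gcdl.
have /dvdpP [Q1 QE] : G %| Q by apply: dvdp_gcdr.
exists P1, Q1; split=> /=.
- have : gcdp (P1 * G) (Q1 * G) %= gcdp P1 Q1 * G by rewrite eqp_sym; apply: mulp_gcdl.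
  by rewrite -QE -PE -/G -[X in X %= _]mul1r eqp_mul2r // eqp_sym /coprimep size_poly_eq1.
- by apply: contraNneq Q0 => Q10; rewrite QE Q10 mul0r.
by rewrite PE QE !tofracM invfM mulrACA divff ?mulr1 // tofrac_eq0.
Qed.

(** Gaussian elimination of the first coordinate, by induction on [n]. The subfield is a predicate
    closed under the field operations, since the pullback field is only given as a set. *)
Lemma subfield_dependence (K : fieldType) (L : K -> Prop) :
  L 0 -> L 1 -> (forall z w, L z -> L w -> L (z + w)) -> (forall z w, L z -> L w -> L (z * w)) ->
  (forall z, L z -> L (- z)) -> (forall z, L z -> L z^-1) ->
  forall n m (c : 'I_m -> 'I_n -> K), (n < m)%N -> (forall k i, L (c k i)) ->
  exists d : 'I_m -> K, [/\ forall k, L (d k), exists k, d k != 0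
     & forall i, \sum_k d k * c k i = 0].
Proof.
move=> L0 L1 LD LM LN LV; elim=> [|n IH] [//|m] c lt Lc.
  exists (fun=> 1); split=> //; last by case.
  by exists ord0; rewrite oner_eq0.
have Lsum p (F : 'I_p -> K) : (forall i, L (F i)) -> L (\sum_i F i).
  by move=> LF; apply: big_ind.
have [/existsP [k0 ck0]|/existsPn c0] := boolP [exists k, c k ord0 != 0].
  pose c' (k : 'I_m) (i : 'I_n) := c (lift k0 k) (lift ord0 i)
    - c (lift k0 k) ord0 / c k0 ord0 * c k0 (lift ord0 i).
  have [|k i|d [Ld [k dk] E]] := IH m c'; first by [].
    by apply: (LD) => //; apply: (LN); apply: (LM) => //; apply: (LM) => //; apply: (LV).
  pose d0 := - \sum_k d k * (c (lift k0 k) ord0 / c k0 ord0).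
  exists (fun k => if unlift k0 k is Some k' then d k' else d0); split.
  - move=> k'; case: unliftP => [k1 _|_] //; apply: (LN); apply: (Lsum) => k1.
    by apply: (LM) => //; apply: (LM) => //; apply: (LV).
  - by exists (lift k0 k); rewrite liftK.
  move=> i; rewrite (bigD1_ord k0) //= unlift_none.
  under eq_bigr => k1 _ do rewrite liftK.
  case: (unliftP ord0 i) => [i'|] ->.
    rewrite /d0 mulNr mulr_suml -sumrN -big_split /= -[RHS](E i').
    by apply: eq_bigr => k1 _; rewrite /c'; ring.
  rewrite /d0 mulNr mulr_suml -sumrN -big_split /=.
  by rewrite big1 // => k1 _; field.
have [|k i|d [Ld [k dk] E]] := IH m.+1 (fun k i => c k (lift ord0 i)); first by apply: ltnW.
  by [].
exists d; split=> //; first by exists k.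
move=> i; case: (unliftP ord0 i) => [i'|] ->; first exact: E.
by rewrite big1 // => k1 _; have := c0 k1; rewrite negbK => /eqP ->; rewrite mulr0.
Qed.

Lemma natr_mul_neq0 (F : numDomainType) n (x : F) : x != 0 -> n.+1%:R * x != 0.
Proof. by move=> x0; rewrite mulf_neq0 // pnatr_eq0. Qed.

(** The 3-division polynomial is [12 e f(e) - f'(e) ^ 2], so [f(e) = 0] would make [e] a double root
    of [f]. *)
Lemma velu_nonsingular_pole (F : numFieldType) (A B e : F) : 4 * A ^+ 3 + 27 * B ^+ 2 != 0 ->
  3 * e ^+ 4 + 6 * A * e ^+ 2 + 12 * B * e - A ^+ 2 = 0 -> e ^+ 3 + A * e + B != 0.
Proof.
set f0 := e ^+ 3 + _ + _; pose f1 := 3 * e ^+ 2 + A => discf psi.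
apply: contraNneq discf => f00.
have f10 : f1 = 0.
  apply/eqP; rewrite -sqrf_eq0; apply/eqP.
  transitivity (12 * e * f0 - (3 * e ^+ 4 + 6 * A * e ^+ 2 + 12 * B * e - A ^+ 2)).
    by rewrite /f0 /f1; ring.
  by rewrite f00 psi mulr0 subr0.
have -> : A = f1 - 3 * e ^+ 2 by rewrite /f1; ring.
have -> : B = f0 - e ^+ 3 - (f1 - 3 * e ^+ 2) * e by rewrite /f0 /f1; ring.
by rewrite f00 f10; apply/eqP; ring.
Qed.

(** For [e != 0] the equation of [e] gives [B]. The two discriminants are then, up to a common
    denominator and a constant, products of [A + 3 e ^ 2] and [3 A + e ^ 2] with exponents 3, 1 for
    the source and 1, 3 for the target. *)
Lemma velu_nonsingular (F : numFieldType) (A B e : F) (al := 2 * (3 * e ^+ 2 + A))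
  (a := A - 5 * al) (b := B - 7 * (4 * (e ^+ 3 + A * e + B) + e * al)) :
  4 * A ^+ 3 + 27 * B ^+ 2 != 0 ->
  3 * e ^+ 4 + 6 * A * e ^+ 2 + 12 * B * e - A ^+ 2 = 0 -> 4 * a ^+ 3 + 27 * b ^+ 2 != 0.
Proof.
move=> discf psi; have [e0|e0] := eqVneq e 0.
  have A0 : A = 0.
    apply/eqP; rewrite -sqrf_eq0; apply/eqP; move: psi; rewrite e0 => psi.
    by apply/eqP; rewrite -oppr_eq0; apply/eqP; rewrite -psi; ring.
  have B0 : B != 0 by apply: contraNneq discf => B0; rewrite A0 B0 !expr0n !mulr0 addr0.
  have -> : 4 * a ^+ 3 + 27 * b ^+ 2 = 27 * (27 * B) ^+ 2.
    by rewrite /b /a /al e0 A0; ring.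
  by apply: natr_mul_neq0; rewrite expf_neq0 //; apply: natr_mul_neq0.
have e12 : 12 * e != 0 by apply: natr_mul_neq0.
have e16 : 16 * e ^+ 2 != 0 by apply: natr_mul_neq0; rewrite expf_neq0.
have BE : B = (A ^+ 2 - 6 * A * e ^+ 2 - 3 * e ^+ 4) / (12 * e).
  apply: (mulIf e12); rewrite divfK //.
  by apply/eqP; rewrite -subr_eq0 -psi; apply/eqP; ring.
have dE : 4 * A ^+ 3 + 27 * B ^+ 2 = (A + 3 * e ^+ 2) ^+ 3 * (3 * A + e ^+ 2) / (16 * e ^+ 2).
  by rewrite BE; field.
have -> : 4 * a ^+ 3 + 27 * b ^+ 2 = 81 * ((A + 3 * e ^+ 2) * (3 * A + e ^+ 2) ^+ 3) / (16 * e ^+ 2).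
  by rewrite /b /a /al BE; field.
rewrite dE in discf; clear BE dE; clearbody a b.
have h1 : A + 3 * e ^+ 2 != 0 by apply: contraNneq discf => ->; rewrite expr0n !mul0r.
have h2 : 3 * A + e ^+ 2 != 0 by apply: contraNneq discf => ->; rewrite mulr0 mul0r.
rewrite mulf_neq0 ?invr_neq0 //; apply: natr_mul_neq0.
by rewrite mulf_neq0 ?expf_neq0.
Qed.

(** * Degrees of rational functions, over an abstract copy of Q(x) *)

Section RationalFunctions.
Variables (Fr : fieldType) (j : {rmorphism {poly rat} -> Fr}).
Hypothesis j_eq0 : forall P, (j P == 0) = (P == 0).
Hypothesis j_frac : forall r, exists P Q, [/\ coprimep P Q, Q != 0 & r = j P / j Q].
Implicit Types (r s : Fr) (P Q : {poly rat}) (n : int).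

Lemma j_neq0 Q : Q != 0 -> j Q != 0.
Proof. by rewrite j_eq0. Qed.

Lemma rdeg_exists : {d : Fr -> int |
  forall P Q, P != 0 -> Q != 0 -> d (j P / j Q) = (size P)%:Z - (size Q)%:Z}.
Proof.
have ex r : exists PQ : {poly rat} * {poly rat}, (PQ.2 != 0) && (r == j PQ.1 / j PQ.2).
  by have [P [Q [_ Q0 ->]]] := j_frac r; exists (P, Q); rewrite /= Q0 eqxx.
exists (fun r => let PQ := xchoose (ex r) in (size PQ.1)%:Z - (size PQ.2)%:Z) => P Q P0 Q0 /=.
have /andP [] := xchooseP (ex (j P / j Q)).
case: (xchoose _) => P1 Q1 /= Q10 /eqP E.
have P10 : P1 != 0.
  apply/eqP => P10; move/eqP: E; rewrite P10 rmorph0 mul0r.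
  by apply/negP; rewrite mulf_neq0 ?invr_neq0 ?j_neq0.
have E2 : P * Q1 = P1 * Q.
  apply/eqP; rewrite -subr_eq0 -j_eq0 rmorphB !rmorphM subr_eq0; apply/eqP.
  move/(congr1 (fun z => z * (j Q * j Q1))): E.
  rewrite mulrA divfK ?j_neq0 // => ->.
  by rewrite mulrCA [j P1 / _ * _]divfK ?j_neq0 // mulrC.
have : (size P + size Q1 = size P1 + size Q)%N.
  have := congr1 (fun p : {poly rat} => size p) E2.
  rewrite !size_mul //.
  have : (0 < size P)%N by rewrite size_poly_gt0.
  have : (0 < size P1)%N by rewrite size_poly_gt0.
  by move: (size P) (size P1) (size Q) (size Q1) => x y z t; clear; lia.
by move: (size P) (size P1) (size Q) (size Q1) => x y z t; clear; lia.
Qed.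

Definition rdeg := sval rdeg_exists.

Lemma rdeg_div P Q : P != 0 -> Q != 0 -> rdeg (j P / j Q) = (size P)%:Z - (size Q)%:Z.
Proof. exact: (svalP rdeg_exists). Qed.

Lemma ratfun_neq0 r : r != 0 -> exists P Q, [/\ P != 0, Q != 0, coprimep P Q & r = j P / j Q].
Proof.
move=> r0; have [P [Q [cPQ Q0 rE]]] := j_frac r.
exists P, Q; split=> //; apply: contraNneq r0 => P0.
by rewrite rE P0 rmorph0 mul0r.
Qed.

Lemma rdegM r s : r != 0 -> s != 0 -> rdeg (r * s) = rdeg r + rdeg s.
Proof.
move=> /ratfun_neq0 [P [Q [P0 Q0 _ ->]]] /ratfun_neq0 [P1 [Q1 [P10 Q10 _ ->]]].
rewrite mulrACA -invfM -!rmorphM !rdeg_div ?mulf_neq0 // !size_mul //.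
have : (0 < size P)%N by rewrite size_poly_gt0.
have : (0 < size P1)%N by rewrite size_poly_gt0.
have : (0 < size Q)%N by rewrite size_poly_gt0.
have : (0 < size Q1)%N by rewrite size_poly_gt0.
by move: (size P) (size P1) (size Q) (size Q1) => x y z t; clear; lia.
Qed.

Lemma rdeg_poly P : P != 0 -> rdeg (j P) = (size P)%:Z - 1.
Proof. by move=> P0; rewrite -[j P]divr1 -(rmorph1 j) rdeg_div ?oner_eq0 // size_poly1. Qed.

(** The zero function counts as having degree minus infinity. *)
Definition rdeg_le r n := (r == 0) || (rdeg r <= n).

Lemma rdeg_leW r m n : m <= n -> rdeg_le r m -> rdeg_le r n.
Proof. by rewrite /rdeg_le; case: (r == 0) => //= mn h; apply: le_trans mn. Qed.

Lemma rdegN r : rdeg (- r) = rdeg r.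
Proof.
have [->|r0] := eqVneq r 0; first by rewrite oppr0.
rewrite -mulN1r rdegM ?oppr_eq0 ?oner_eq0 //.
have -> : -1 = j (- 1) by rewrite rmorphN rmorph1.
by rewrite rdeg_poly ?oppr_eq0 ?oner_eq0 // size_polyN size_poly1 subrr add0r.
Qed.

Lemma rdeg_leN r n : rdeg_le (- r) n = rdeg_le r n.
Proof. by rewrite /rdeg_le oppr_eq0 rdegN. Qed.

Lemma rdeg_leD r s n : rdeg_le r n -> rdeg_le s n -> rdeg_le (r + s) n.
Proof.
have [->|r0] := eqVneq r 0; first by rewrite add0r.
have [->|s0] := eqVneq s 0; first by rewrite addr0.
have [rs0|rs0] := eqVneq (r + s) 0; first by rewrite rs0 /rdeg_le eqxx.
rewrite /rdeg_le (negPf r0) (negPf s0) (negPf rs0) /=; move: rs0 r0 s0.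
move=> rs0 /ratfun_neq0 [P [Q [P0 Q0 _ E]]] /ratfun_neq0 [P1 [Q1 [P10 Q10 _ E1]]].
have sE : r + s = j (P * Q1 + P1 * Q) / j (Q * Q1).
  rewrite E E1 rmorphD !rmorphM; field; by rewrite !j_neq0.
have S0 : P * Q1 + P1 * Q != 0 by apply: contraNneq rs0 => S0; rewrite sE S0 rmorph0 mul0r.
rewrite sE E E1 !rdeg_div ?mulf_neq0 // size_mul //.
have := size_polyD (P * Q1) (P1 * Q); rewrite !size_mul //.
have : (0 < size P)%N by rewrite size_poly_gt0.
have : (0 < size P1)%N by rewrite size_poly_gt0.
have : (0 < size Q)%N by rewrite size_poly_gt0.
have : (0 < size Q1)%N by rewrite size_poly_gt0.
have : (0 < size (P * Q1 + P1 * Q)%R)%N by rewrite size_poly_gt0.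
by move: (size P) (size P1) (size Q) (size Q1) (size (P * Q1 + P1 * Q)%R) => x y z t u; clear; lia.
Qed.

Lemma rdegD_neq r s : r != 0 -> s != 0 -> rdeg r != rdeg s ->
  r + s != 0 /\ rdeg (r + s) = Num.max (rdeg r) (rdeg s).
Proof.
wlog lt : r s / rdeg r < rdeg s.
  move=> H r0 s0 ne; case: (ltgtP (rdeg r) (rdeg s)) => lt.
  - by have := H r s lt r0 s0 ne; rewrite max_r // ltW.
  - by have := H s r lt s0 r0; rewrite eq_sym addrC max_r ?ltW // => /(_ ne) [].
  - by rewrite lt eqxx in ne.
move=> r0 s0 _; have rs0 : r + s != 0.
  apply: contraTneq lt => /eqP; rewrite addr_eq0 => /eqP rE.
  have : rdeg_le (- s) (rdeg s) by rewrite rdeg_leN /rdeg_le lexx orbT.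
  have : rdeg_le (- r) (rdeg r) by rewrite rdeg_leN /rdeg_le lexx orbT.
  by rewrite rE opprK /rdeg_le oppr_eq0 (negPf s0) /= -leNgt.
split=> //; rewrite max_r ?ltW //; apply/eqP; rewrite eq_le; apply/andP; split.
  have : rdeg_le (r + s) (rdeg s).
    by apply: rdeg_leD; rewrite /rdeg_le ?lexx ?(ltW lt) orbT.
  by rewrite /rdeg_le (negPf rs0).
rewrite leNgt; apply/negP => lt2.
have : rdeg_le (r + s + - r) (rdeg s - 1).
  apply: rdeg_leD; first by rewrite /rdeg_le (negPf rs0) /=; move: lt2; lia.
  by rewrite rdeg_leN /rdeg_le (negPf r0) /=; move: lt; lia.
by rewrite addrAC subrr add0r /rdeg_le (negPf s0) /=; lia.
Qed.


Lemma rdeg_le0 n : rdeg_le 0 n. Proof. by rewrite /rdeg_le eqxx. Qed.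

Lemma rdeg_le_refl r : rdeg_le r (rdeg r).
Proof. by rewrite /rdeg_le lexx orbT. Qed.

Lemma natr_neq0 (n : nat) : n.+1%:R != 0 :> Fr.
Proof.
rewrite -(rmorph_nat j) j_eq0 -(rmorph_nat (polyC : {rmorphism rat -> {poly rat}})).
by rewrite polyC_eq0 pnatr_eq0.
Qed.

Lemma cubicE (A B : rat) : cubic A B = 'X ^+ 3 + A%:P * 'X + B%:P.
Proof. by rewrite mul_polyC. Qed.

Local Opaque cubic.

(** * The function field of the curve: conjugation, norm and poles at O *)

Section FunctionField.
Variables (K : fieldType) (iota : {rmorphism Fr -> K}) (y : K) (A B : rat).
Variables (c0 c1 : K -> Fr).
Local Notation f := (cubic A B).
Hypothesis y2 : y ^+ 2 = iota (j f).
Hypothesis KE : forall z, z = iota (c0 z) + iota (c1 z) * y.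
Hypothesis K0 : forall r s, iota r + iota s * y = 0 -> r = 0 /\ s = 0.
Implicit Types (z w : K).

Lemma coordE r s : c0 (iota r + iota s * y) = r /\ c1 (iota r + iota s * y) = s.
Proof.
set z := iota r + _; have E := KE z.
have /K0 [/eqP + /eqP] : iota (r - c0 z) + iota (s - c1 z) * y = 0.
  rewrite !rmorphB mulrBl addrACA -opprD -E subrr //.
by rewrite !subr_eq0 => /eqP <- /eqP <-.
Qed.

Lemma c0E r s : c0 (iota r + iota s * y) = r. Proof. by have [] := coordE r s. Qed.
Lemma c1E r s : c1 (iota r + iota s * y) = s. Proof. by have [] := coordE r s. Qed.

Lemma coordD z w : c0 (z + w) = c0 z + c0 w /\ c1 (z + w) = c1 z + c1 w.
Proof.
have -> : z + w = iota (c0 z + c0 w) + iota (c1 z + c1 w) * y.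
  by rewrite [in LHS](KE z) [in LHS](KE w) !rmorphD; ring.
exact: coordE.
Qed.

Lemma coordM z w : c0 (z * w) = c0 z * c0 w + j f * c1 z * c1 w
  /\ c1 (z * w) = c0 z * c1 w + c1 z * c0 w.
Proof.
have -> : z * w = iota (c0 z * c0 w + j f * c1 z * c1 w) + iota (c0 z * c1 w + c1 z * c0 w) * y.
  rewrite [in LHS](KE z) [in LHS](KE w).
  transitivity (iota (c0 z) * iota (c0 w) + y ^+ 2 * iota (c1 z) * iota (c1 w)
    + (iota (c0 z) * iota (c1 w) + iota (c1 z) * iota (c0 w)) * y); first by ring.
  by rewrite y2; ring.
exact: coordE.
Qed.

(** The automorphism [y -> -y] over Q(x), that is, pullback by negation on E. *)
Definition conjugate z := iota (c0 z) - iota (c1 z) * y.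

Lemma coord_conj z : c0 (conjugate z) = c0 z /\ c1 (conjugate z) = - c1 z.
Proof. by rewrite /conjugate -mulNr -rmorphN; apply: coordE. Qed.

Lemma conjD z w : conjugate (z + w) = conjugate z + conjugate w.
Proof. by rewrite /conjugate; have [-> ->] := coordD z w; rewrite !rmorphD; ring. Qed.

Lemma conjM z w : conjugate (z * w) = conjugate z * conjugate w.
Proof.
rewrite /conjugate; have [-> ->] := coordM z w; apply/esym.
transitivity (iota (c0 z) * iota (c0 w) + y ^+ 2 * iota (c1 z) * iota (c1 w)
    - (iota (c0 z) * iota (c1 w) + iota (c1 z) * iota (c0 w)) * y); first by ring.
by rewrite y2; ring.
Qed.

Lemma conj_iota r : conjugate (iota r) = iota r.
Proof.
have -> : iota r = iota r + iota 0 * y by rewrite rmorph0 mul0r addr0.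
by rewrite /conjugate c0E c1E rmorph0 mul0r subr0 addr0.
Qed.

Lemma conjN z : conjugate (- z) = - conjugate z.
Proof. by rewrite -mulN1r conjM -[-1](rmorphN1 iota) conj_iota rmorphN1 mulN1r. Qed.

Lemma conj_y : conjugate y = - y.
Proof.
have -> : y = iota 0 + iota 1 * y by rewrite rmorph0 rmorph1 mul1r add0r.
by rewrite /conjugate c0E c1E; ring.
Qed.

Lemma conjK z : conjugate (conjugate z) = z.
Proof. by rewrite {1}/conjugate; have [-> ->] := coord_conj z; rewrite rmorphN mulNr opprK -KE. Qed.

Lemma conj_id z : conjugate z = z -> z = iota (c0 z).
Proof.
move=> E; have [_ E1] := coord_conj z; rewrite E in E1.
have : c1 z = 0.
  have /eqP : c1 z + c1 z = 0 by rewrite {1}E1 addNr.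
  by rewrite -mulr2n -mulr_natl mulf_eq0 (negPf (natr_neq0 1)) => /eqP.
by move=> c10; rewrite {1}(KE z) c10 rmorph0 mul0r addr0.
Qed.

Lemma conj_eq0 z : (conjugate z == 0) = (z == 0).
Proof.
have c00 : conjugate 0 = 0 by have := conj_iota 0; rewrite rmorph0.
by apply/eqP/eqP => [E|->//]; rewrite -(conjK z) E.
Qed.

Definition fnorm z := c0 z ^+ 2 - j f * c1 z ^+ 2.

Lemma fnormE z : iota (fnorm z) = z * conjugate z.
Proof.
rewrite {2}(KE z) /conjugate /fnorm; apply/esym.
transitivity (iota (c0 z) ^+ 2 - y ^+ 2 * iota (c1 z) ^+ 2); first by ring.
by rewrite y2; ring.
Qed.

Lemma fnormM z w : fnorm (z * w) = fnorm z * fnorm w.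
Proof. by apply: (fmorph_inj iota); rewrite rmorphM !fnormE conjM; ring. Qed.

Lemma fnorm_eq0 z : (fnorm z == 0) = (z == 0).
Proof. by rewrite -(fmorph_eq0 iota) fnormE mulf_eq0 conj_eq0 orbb. Qed.

Lemma fnorm_conj z : fnorm (conjugate z) = fnorm z.
Proof. by apply: (fmorph_inj iota); rewrite !fnormE conjK mulrC. Qed.

(* The order of the pole at O; the degree of [y] over [x] is [3/2]. *)
Definition pole z := rdeg (fnorm z).
(** Stated on the two components separately, so that it covers 0 and is visibly stable under sums;
    [pole_leP] identifies it with a bound on [pole]. *)
Definition pole_le z n := rdeg_le (c0 z ^+ 2) n && rdeg_le (j f * c1 z ^+ 2) n.

Lemma poleM z w : z != 0 -> w != 0 -> pole (z * w) = pole z + pole w.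
Proof. by move=> z0 w0; rewrite /pole fnormM rdegM // fnorm_eq0. Qed.

Lemma pole_conj z : pole (conjugate z) = pole z.
Proof. by rewrite /pole fnorm_conj. Qed.

Lemma rdegX2 r : r != 0 -> rdeg (r ^+ 2) = 2 * rdeg r.
Proof. by move=> r0; rewrite expr2 rdegM //; lia. Qed.

Lemma jf_neq0 : j f != 0.
Proof. by rewrite j_neq0 // -size_poly_eq0 size_cubic. Qed.

Lemma rdeg_jf r : r != 0 -> rdeg (j f * r ^+ 2) = 3 + 2 * rdeg r.
Proof.
move=> r0; rewrite rdegM ?jf_neq0 ?expf_neq0 // rdegX2 // rdeg_poly ?size_cubic //.
by rewrite -size_poly_eq0 size_cubic.
Qed.

(** In the norm [c0 z ^ 2 - f c1 z ^ 2] one term has even degree and the other odd degree, so they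
    cannot cancel. *)
Lemma pole_leP z n : z != 0 -> pole_le z n = (pole z <= n).
Proof.
move=> z0; rewrite /pole_le /pole /fnorm.
have [e0|e0] := eqVneq (c0 z) 0; have [e1|e1] := eqVneq (c1 z) 0.
- by move: z0; rewrite (KE z) e0 e1 rmorph0 mul0r addr0 eqxx.
- by rewrite e0 expr0n /= sub0r rdeg_le0 /= rdegN /rdeg_le mulf_eq0 expf_eq0 (negPf e1) (negPf jf_neq0).
- by rewrite e1 expr0n /= mulr0 subr0 rdeg_le0 andbT /rdeg_le expf_eq0 (negPf e0).
have h0 : c0 z ^+ 2 != 0 by rewrite expf_neq0.
have h1 : - (j f * c1 z ^+ 2) != 0 by rewrite oppr_eq0 mulf_neq0 ?expf_neq0 ?jf_neq0.
have [|_ ->] := rdegD_neq h0 h1.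
  by rewrite rdegN rdegX2 // rdeg_jf //; apply/eqP; lia.
rewrite rdegN ge_max /rdeg_le (negPf h0) /=; congr (_ && _).
by rewrite -oppr_eq0 (negPf h1).
Qed.

Lemma pole_leD z w n : pole_le z n -> pole_le w n -> pole_le (z + w) n.
Proof.
have sq r s m : rdeg_le (r ^+ 2) m -> rdeg_le (s ^+ 2) m -> rdeg_le ((r + s) ^+ 2) m.
  have [->|r0] := eqVneq r 0; first by rewrite add0r.
  have [->|s0] := eqVneq s 0; first by rewrite addr0.
  have [->|rs0] := eqVneq (r + s) 0; first by rewrite expr0n rdeg_le0.
  rewrite /rdeg_le !expf_eq0 (negPf r0) (negPf s0) (negPf rs0) /= !rdegX2 // => h1 h2.
  have : rdeg_le (r + s) (Num.max (rdeg r) (rdeg s)).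
    by apply: rdeg_leD; apply: rdeg_leW (rdeg_le_refl _); rewrite le_max lexx ?orbT.
  rewrite /rdeg_le (negPf rs0) /=; move: h1 h2; lia.
have sq1 r s m : rdeg_le (j f * r ^+ 2) m -> rdeg_le (j f * s ^+ 2) m -> rdeg_le (j f * (r + s) ^+ 2) m.
  have jV k t : rdeg_le (j f * t) k = rdeg_le t (k - 3).
    have [->|t0] := eqVneq t 0; first by rewrite mulr0 !rdeg_le0.
    rewrite /rdeg_le mulf_eq0 (negPf jf_neq0) (negPf t0) /= rdegM ?jf_neq0 //.
    by rewrite rdeg_poly ?size_cubic -?size_poly_eq0 ?size_cubic //; apply/idP/idP; lia.
  by rewrite !jV; apply: sq.
move=> /andP[h1 h2] /andP[h3 h4]; apply/andP; have [-> ->] := coordD z w.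
by split; [apply: sq | apply: sq1].
Qed.

Lemma pole_leN z n : pole_le (- z) n = pole_le z n.
Proof.
rewrite /pole_le; have -> : - z = iota (- c0 z) + iota (- c1 z) * y.
  by rewrite {1}(KE z) !rmorphN; ring.
by rewrite c0E c1E !sqrrN.
Qed.

Lemma pole_le0 n : pole_le 0 n.
Proof.
have -> : 0 = iota 0 + iota 0 * y by rewrite rmorph0 mul0r addr0.
by rewrite /pole_le c0E c1E !expr0n mulr0 rdeg_le0.
Qed.

Lemma pole_leW z m n : m <= n -> pole_le z m -> pole_le z n.
Proof. by move=> mn /andP[h1 h2]; rewrite /pole_le !(rdeg_leW mn). Qed.

Lemma pole_leM z w m n : pole_le z m -> pole_le w n -> pole_le (z * w) (m + n).
Proof.
have [->|z0] := eqVneq z 0; first by rewrite mul0r !pole_le0.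
have [->|w0] := eqVneq w 0; first by rewrite mulr0 !pole_le0.
by rewrite !pole_leP ?mulf_neq0 // poleM // => h1 h2; apply: lerD.
Qed.

Lemma pole_iota r : r != 0 -> pole (iota r) = 2 * rdeg r.
Proof.
move=> r0; rewrite /pole /fnorm.
have -> : iota r = iota r + iota 0 * y by rewrite rmorph0 mul0r addr0.
by rewrite c0E c1E expr0n mulr0 subr0 rdegX2.
Qed.

Lemma pole_y : pole y = 3.
Proof.
rewrite /pole /fnorm.
have -> : y = iota 0 + iota 1 * y by rewrite rmorph0 rmorph1 mul1r add0r.
rewrite c0E c1E expr0n sub0r expr1n mulr1 -rmorphN rdeg_poly ?size_polyN ?size_cubic //.
by rewrite oppr_eq0 -size_poly_eq0 size_cubic.
Qed.

Lemma y_neq0 : y != 0.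
Proof.
apply/eqP => y0; have := jf_neq0.
by rewrite -(fmorph_eq0 iota) -y2 y0 expr0n eqxx.
Qed.

Lemma poleV z : z != 0 -> pole z^-1 = - pole z.
Proof.
move=> z0; have := poleM z0 (invr_neq0 z0); rewrite divff //.
have -> : pole 1 = 0.
  by rewrite -(rmorph1 iota) pole_iota ?oner_eq0 // -(rmorph1 j) rdeg_poly ?oner_eq0 // size_poly1.
by move=> h; lia.
Qed.

Lemma poleX z (n : nat) : z != 0 -> pole (z ^+ n) = n%:Z * pole z.
Proof.
move=> z0; elim: n => [|n IH]; last by rewrite exprS poleM ?expf_neq0 // IH; lia.
have := poleM (oner_neq0 K) (oner_neq0 K); rewrite mulr1 expr0 mul0r => h.
by move: (pole 1) h => p h; lia.
Qed.

Definition const (c : rat) : K := iota (j c%:P).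

Lemma const_is_zmod_morphism : zmod_morphism const.
Proof. by move=> c d; rewrite /const polyCB !rmorphB. Qed.

Lemma const_is_monoid_morphism : monoid_morphism const.
Proof. by split; [rewrite /const polyC1 !rmorph1 | move=> c d; rewrite /const polyCM !rmorphM]. Qed.

HB.instance Definition _ := GRing.isZmodMorphism.Build rat K const const_is_zmod_morphism.
HB.instance Definition _ := GRing.isMonoidMorphism.Build rat K const const_is_monoid_morphism.

Lemma pole_const c : c != 0 -> pole (const c) = 0.
Proof. by move=> c0'; rewrite /const pole_iota ?j_neq0 ?polyC_eq0 // rdeg_poly ?polyC_eq0 // size_polyC c0'. Qed.

Lemma pole_le_const c : pole_le (const c) 0.
Proof.
have [->|c0'] := eqVneq c 0; first by rewrite /const !rmorph0 pole_le0.
rewrite pole_leP ?pole_const // /const fmorph_eq0 j_eq0 polyC_eq0 //.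
Qed.


(** * The local ring at O *)

Definition coordx : K := iota (j 'X).
Local Notation x := coordx.

Lemma y2E : y ^+ 2 = x ^+ 3 + const A * x + const B.
Proof.
by rewrite y2 cubicE /coordx /const !(rmorphD, rmorphM, rmorphXn).
Qed.

Lemma pole_x : pole x = 2.
Proof. by rewrite /coordx pole_iota ?j_neq0 ?polyX_eq0 // rdeg_poly ?polyX_eq0 // size_polyX. Qed.

Lemma x_neq0 : x != 0.
Proof. by rewrite fmorph_eq0 j_eq0 polyX_eq0. Qed.

Definition geval (P : {poly {poly rat}}) (X Y : K) : K :=
  (map_poly (map_poly const) P).[X%:P].[Y].

Lemma gevalD X Y (P Q : {poly {poly rat}}) : geval (P + Q) X Y = geval P X Y + geval Q X Y.
Proof. by rewrite /geval rmorphD !hornerD. Qed.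
Lemma gevalM X Y (P Q : {poly {poly rat}}) : geval (P * Q) X Y = geval P X Y * geval Q X Y.
Proof. by rewrite /geval rmorphM !hornerM. Qed.
Lemma gevalC X Y (p : {poly rat}) : geval p%:P X Y = (map_poly const p).[Y].
Proof. by rewrite /geval map_polyC hornerC. Qed.
Lemma gevalCC X Y c : geval c%:P%:P X Y = const c.
Proof. by rewrite gevalC map_polyC hornerC. Qed.
Lemma gevalX X Y : geval 'X X Y = X.
Proof. by rewrite /geval map_polyX hornerX hornerC. Qed.
Lemma gevalY X Y : geval ('X)%:P X Y = Y.
Proof. by rewrite gevalC map_polyX hornerX. Qed.

Lemma geval1 X Y : geval 1 X Y = 1.
Proof. by have := gevalCC X Y 1; rewrite !polyC1 rmorph1. Qed.

Local Notation t := (x / y).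
Local Notation w := (y^-1).

Lemma pole_t : pole t = -1.
Proof. by rewrite poleM ?invr_neq0 ?x_neq0 ?y_neq0 // poleV ?y_neq0 // pole_x pole_y. Qed.

Lemma pole_geval_inner (p : {poly rat}) : pole_le ((map_poly const p).[w] - const p.[0]) (-1).
Proof.
elim/poly_ind: p => [|p c IH]; first by rewrite rmorph0 !horner0 rmorph0 subrr pole_le0.
rewrite rmorphD rmorphM /= map_polyX map_polyC !(hornerD, hornerM, hornerX, hornerC) mulr0 add0r.
rewrite addrK; apply: (@pole_leW _ (0 + (-3))) => //; apply: pole_leM.
  rewrite -[(map_poly _ _).[_]](subrK (const p.[0])).
  by apply: pole_leD; [apply: pole_leW IH | apply: pole_le_const].
by rewrite pole_leP ?invr_neq0 ?y_neq0 // poleV ?y_neq0 // pole_y.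
Qed.

(** Both [t] and [w] vanish at O, so a polynomial in them differs from its constant term by a
    function vanishing at O. *)
Lemma pole_geval (P : {poly {poly rat}}) : pole_le (geval P t w - const P.[0].[0]) (-1).
Proof.
elim/poly_ind: P => [|P c IH]; first by rewrite /geval rmorph0 !horner0 rmorph0 subrr pole_le0.
rewrite gevalD gevalM gevalX gevalC !(hornerD, hornerM, hornerX, hornerC) mulr0 add0r -addrA.
apply: pole_leD; last exact: pole_geval_inner.
apply: (@pole_leW _ (0 + (-1))) => //; apply: pole_leM; last first.
  by rewrite pole_leP ?pole_t // mulf_neq0 ?invr_neq0 ?x_neq0 ?y_neq0.
rewrite -[geval P _ _](subrK (const P.[0].[0])).
by apply: pole_leD; [apply: pole_leW IH | apply: pole_le_const].
Qed.

Definition regular z := exists g h : {poly {poly rat}}, h.[0].[0] != 0 /\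
  z * geval h t w = geval g t w.

(** Regularity at O together with the value [c] at O; values are needed to know which quotients stay
    regular. *)
Definition regular_value z c := exists g h : {poly {poly rat}}, [/\ h.[0].[0] != 0,
  z * geval h t w = geval g t w & g.[0].[0] = c * h.[0].[0]].

Lemma regular_value_regular z c : regular_value z c -> regular z.
Proof. by move=> [g [h [h0 E _]]]; exists g, h. Qed.

Lemma geval_neq0 (h : {poly {poly rat}}) : h.[0].[0] != 0 -> geval h t w != 0 /\ pole (geval h t w) = 0.
Proof.
move=> h0; have H := pole_geval h; set c := h.[0].[0] in h0 H; set z := geval _ _ _ in H *.
have c0' : const c != 0 by rewrite fmorph_eq0.
have notle : ~~ pole_le (const c) (-1) by rewrite pole_leP // pole_const.
have z0 : z != 0 by apply: contraNneq notle => z0; rewrite z0 sub0r pole_leN in H.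
split=> //; apply/eqP; rewrite eq_le; apply/andP; split.
  rewrite -pole_leP // -[z](subrK (const c)).
  by apply: pole_leD; [apply: pole_leW H | apply: pole_le_const].
rewrite leNgt; apply/negP => lt; move/negP: notle; apply.
rewrite -[const c](subKr z); apply: pole_leD; last by rewrite pole_leN.
by rewrite pole_leP //; move: lt; lia.
Qed.

Lemma regular_pole z : regular z -> pole_le z 0.
Proof.
move=> [g [h [h0 E]]]; have [z0|z0] := eqVneq z 0; first by rewrite z0 pole_le0.
have [e0 pe] := geval_neq0 h0.
rewrite pole_leP // -[pole z]addr0 -pe -poleM // E -pole_leP -?E ?mulf_neq0 // E.
rewrite pe -[geval g _ _](subrK (const g.[0].[0])).
by apply: pole_leD; [apply: pole_leW (pole_geval g) | apply: pole_le_const].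
Qed.

Lemma regular_valueD z1 z2 d1 d2 : regular_value z1 d1 -> regular_value z2 d2 -> regular_value (z1 + z2) (d1 + d2).
Proof.
move=> [g1 [h1 [h10 E1 V1]]] [g2 [h2 [h20 E2 V2]]].
exists (g1 * h2 + g2 * h1), (h1 * h2); split.
- by rewrite !hornerM mulf_neq0.
- by rewrite gevalD !gevalM -E1 -E2; ring.
by rewrite !(hornerD, hornerM) V1 V2; ring.
Qed.

Lemma regular_valueM z1 z2 d1 d2 : regular_value z1 d1 -> regular_value z2 d2 -> regular_value (z1 * z2) (d1 * d2).
Proof.
move=> [g1 [h1 [h10 E1 V1]]] [g2 [h2 [h20 E2 V2]]].
exists (g1 * g2), (h1 * h2); split.
- by rewrite !hornerM mulf_neq0.
- by rewrite !gevalM -E1 -E2; ring.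
by rewrite !hornerM V1 V2; ring.
Qed.

Lemma regular_value_const c : regular_value (const c) c.
Proof.
exists c%:P%:P, 1; split; first by rewrite !hornerC oner_eq0.
  have -> : geval 1 t w = 1 by apply: geval1.
  by rewrite mulr1 gevalCC.
by rewrite !hornerC mulr1.
Qed.

Lemma regular_valueV z d : d != 0 -> regular_value z d -> regular_value z^-1 d^-1.
Proof.
move=> d0 [g [h [h0 E V]]]; have g0 : g.[0].[0] != 0 by rewrite V mulf_neq0.
have [eg0 _] := geval_neq0 g0; have [eh0 _] := geval_neq0 h0.
exists h, g; split=> //; last by rewrite V mulKf.
by rewrite -E mulKf //; apply: contraNneq eg0 => z0; rewrite -E z0 mul0r.
Qed.

Lemma regular_value_div z u p d : regular_value u 1 -> regular_value p d -> z * u = p -> regular_value z d.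
Proof.
move=> Ru Rp E; have [|u0] := eqVneq u 0.
  move=> u0; move: Ru; rewrite u0 => -[g [h [h0 E0 V]]].
  have : g.[0].[0] != 0 by rewrite V mul1r.
  by move/geval_neq0 => [+ _]; rewrite -E0 mul0r eqxx.
have -> : z = p * u^-1 by rewrite -E mulfK.
by rewrite -[d]mulr1 -invr1; apply: regular_valueM => //; apply: regular_valueV Ru; rewrite oner_eq0.
Qed.

Lemma regular_value_t : regular_value t 0.
Proof.
exists 'X, 1; split; rewrite ?hornerC ?oner_eq0 //.
  by rewrite gevalX (_ : geval 1 t w = 1) ?mulr1 //; apply: geval1.
by rewrite hornerX hornerC mul0r.
Qed.

Lemma regular_value_w : regular_value w 0.
Proof.
exists 'X%:P, 1; split; rewrite ?hornerC ?oner_eq0 //.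
  by rewrite gevalY (_ : geval 1 t w = 1) ?mulr1 //; apply: geval1.
by rewrite hornerX mul0r.
Qed.

(** The equation of the curve divided by [y ^+ 2] says [u = x ^ 3 / y ^ 2]. As [u] has value 1 at O,
    the functions [1 / x = t ^ 2 / u] and [y / x ^ 2 = t / u] are regular. *)
Let u : K := const 1 + const (- A) * (t * w) + const (- B) * (w * w).

Lemma regular_value_u : regular_value u 1.
Proof.
have -> : (1 : rat) = 1 + (- A) * (0 * 0) + (- B) * (0 * 0) by ring.
rewrite /u; apply: regular_valueD; first apply: regular_valueD; first exact: regular_value_const.
  apply: regular_valueM; first exact: regular_value_const.
  by apply: regular_valueM; [exact: regular_value_t | exact: regular_value_w].
apply: regular_valueM; first exact: regular_value_const.
by apply: regular_valueM; exact: regular_value_w.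
Qed.

Lemma uE : u * y ^+ 2 = x ^+ 3.
Proof.
rewrite /u !rmorphN rmorph1.
transitivity (y ^+ 2 - const A * x - const B); last by rewrite y2E; ring.
by field; exact: y_neq0.
Qed.

Lemma regular_value_invx : regular_value x^-1 0.
Proof.
apply: (@regular_value_div _ u (t * t)); first exact: regular_value_u.
  have -> : (0 : rat) = 0 * 0 by rewrite mul0r.
  by apply: regular_valueM; exact: regular_value_t.
apply: (mulfI x_neq0); apply: (mulIf (expf_neq0 2 y_neq0)).
rewrite (mulVKf x_neq0) uE; field; exact: y_neq0.
Qed.

Lemma regular_value_yinvx2 : regular_value (y * x^-1 ^+ 2) 0.
Proof.
apply: (@regular_value_div _ u t); [exact: regular_value_u | exact: regular_value_t |].
apply: (mulIf (expf_neq0 2 y_neq0)); rewrite -[LHS]mulrA uE; field.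
by rewrite x_neq0 y_neq0.
Qed.

Lemma regular_value_poly (p : {poly rat}) (n : nat) : (size p <= n.+1)%N ->
  regular_value (iota (j p) * x^-1 ^+ n) p`_n.
Proof.
elim/poly_ind: p n => [|p c IH] n sp.
  by rewrite !rmorph0 mul0r coef0; have := regular_value_const 0; rewrite rmorph0.
case: n sp => [|n] sp.
  have -> : p = 0.
    apply/eqP; rewrite -size_poly_leq0; move: sp; rewrite size_MXaddC.
    by case: eqP => [->|_] /=; rewrite ?size_poly0.
  by rewrite mul0r add0r expr0 mulr1 coefC; apply: regular_value_const.
have sp' : (size p <= n.+1)%N.
  by move: sp; rewrite size_MXaddC; case: eqP => [->|_] //=; rewrite size_poly0.
rewrite coefD coefMX coefC /= addr0 -[p`_n]addr0 !rmorphD !rmorphM mulrDl.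
apply: regular_valueD.
  by rewrite exprS mulrA mulfK ?x_neq0 //; apply: IH.
by rewrite -[0](mulr0 c) exprS; apply: regular_valueM; [apply: regular_value_const|];
  rewrite -[0](mul0r (0 ^+ n)); apply: regular_valueM; [exact: regular_value_invx|];
  elim: (n) => [|m IHm]; [rewrite !expr0 -(rmorph1 const); apply: regular_value_const
  | rewrite !exprS; apply: regular_valueM => //; exact: regular_value_invx].
Qed.

Lemma regular_iota r : rdeg_le r 0 -> exists c, regular_value (iota r) c.
Proof.
have [->|r0] := eqVneq r 0.
  by move=> _; exists 0; have := regular_value_const 0; rewrite /const !rmorph0.
have [P [Q [P0 Q0 _ E]]] := ratfun_neq0 r0.
rewrite /rdeg_le (negPf r0) /= E rdeg_div // => sPQ.
pose n := (size Q).-1.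
have sQ : (size Q <= n.+1)%N by rewrite /n; case: (size Q).
have sP : (size P <= n.+1)%N by rewrite (leq_trans _ sQ) //; move: sPQ; lia.
have RP := regular_value_poly sP; have RQ := regular_value_poly sQ.
exists (P`_n * (Q`_n)^-1).
have -> : iota (j P / j Q) = (iota (j P) * x^-1 ^+ n) * (iota (j Q) * x^-1 ^+ n)^-1.
  by rewrite fmorph_div invfM mulrACA divff ?mulr1 // expf_neq0 // invr_neq0 ?x_neq0.
by apply: regular_valueM => //; apply: regular_valueV => //; rewrite -/(lead_coef Q) lead_coef_eq0.
Qed.

(** A bound 0 on the pole of [r + s y] means [deg r <= 0] and [deg s <= -2]; then [r] is regular and
    so is [s y = (s x ^ 2) (y / x ^ 2)]. *)
Lemma regularP z : regular z <-> pole_le z 0.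
Proof.
split; first exact: regular_pole.
move=> /andP[h0 h1]; rewrite (KE z).
have [e0 R0] : exists c, regular_value (iota (c0 z)) c.
  apply: regular_iota; move: h0; rewrite /rdeg_le expf_eq0 /=.
  by have [//|z0] := eqVneq (c0 z) 0; rewrite /= rdegX2 //; lia.
have [e1 R1] : exists c, regular_value (iota (c1 z * j 'X ^+ 2)) c.
  apply: regular_iota; have [z0|z0] := eqVneq (c1 z) 0; first by rewrite z0 mul0r rdeg_le0.
  have jX0 : j 'X != 0 by rewrite j_neq0 // polyX_eq0.
  have n1 : j f * c1 z ^+ 2 != 0 by rewrite mulf_neq0 ?jf_neq0 ?expf_neq0.
  have n2 : c1 z * j 'X ^+ 2 != 0 by rewrite mulf_neq0 ?expf_neq0.
  move: h1; rewrite /rdeg_le (negPf n1) (negPf n2) /= rdeg_jf //.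
  rewrite rdegM ?expf_neq0 // rdegX2 // rdeg_poly ?polyX_eq0 // size_polyX.
  by move: (rdeg _) => d; lia.
apply: (@regular_value_regular _ (e0 + e1 * 0)).
apply: regular_valueD => //.
have -> : iota (c1 z) * y = iota (c1 z * j 'X ^+ 2) * (y * x^-1 ^+ 2).
  by rewrite rmorphM rmorphXn -/x; field; exact: x_neq0.
by apply: regular_valueM => //; exact: regular_value_yinvx2.
Qed.


Lemma const_neq0 c : c != 0 -> const c != 0.
Proof. by rewrite fmorph_eq0. Qed.

Lemma Fr_cubic_point r s a b : 4 * a ^+ 3 + 27 * b ^+ 2 != 0 ->
  s ^+ 2 = r ^+ 3 + j a%:P * r + j b%:P -> exists c, r = j c%:P.
Proof.
move=> disc E; have [P [Q [cPQ Q0 rE]]] := j_frac r.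
have [U [V [cUV V0 sE]]] := j_frac s.
have jQ := j_neq0 Q0; have jV := j_neq0 V0.
have : U ^+ 2 * Q ^+ 3 = V ^+ 2 * cubic_form a b P Q.
  apply/eqP; rewrite -subr_eq0 -j_eq0 rmorphB subr_eq0; apply/eqP.
  rewrite /cubic_form -!mul_polyC !(rmorphM, rmorphD, rmorphXn).
  transitivity (s ^+ 2 * (j V ^+ 2 * j Q ^+ 3)); first by rewrite sE; field.
  by rewrite E rE; field.
move=> /(rational_point_const disc cPQ cUV Q0) [sP sQ].
exists (P`_0 / Q`_0).
have PE : P = (P`_0)%:P by apply: size1_polyC.
have QE : Q = (Q`_0)%:P by apply: size1_polyC.
have q0 : Q`_0 != 0 by apply: contraNneq Q0 => q0; rewrite QE q0.
apply: (mulIf jQ); rewrite rE divfK // {1}PE {2}QE -rmorphM -polyCM divfK //.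
Qed.

(** * Points of the target curve over the function field *)

Section EllipticPoint.
Variables (X Y : K) (a b : rat).
Hypothesis disc : 4 * a ^+ 3 + 27 * b ^+ 2 != 0.
Hypothesis XY : Y ^+ 2 = X ^+ 3 + const a * X + const b.
Hypothesis poleX : ~~ pole_le X 0.

Lemma X_neq0 : X != 0.
Proof. by apply: contraNneq poleX => ->; apply: pole_le0. Qed.

Lemma poleX_gt0 : 0 < pole X.
Proof. by rewrite ltNge -pole_leP // X_neq0. Qed.

Lemma pole_le_self z : pole_le z (pole z).
Proof. by have [->|z0] := eqVneq z 0; [apply: pole_le0 | rewrite pole_leP]. Qed.

Lemma pole_le_lin c d : pole_le (const c * X + const d) (pole X).
Proof.
apply: pole_leD; last by apply: pole_leW (pole_le_const d); apply: ltW poleX_gt0.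
by rewrite -[pole X]add0r; apply: pole_leM (pole_le_const _) (pole_le_self _).
Qed.

Lemma Y_neq0 : Y != 0.
Proof.
apply/eqP => Y0; have : pole_le (X ^+ 3) (pole X).
  have -> : X ^+ 3 = - (const a * X + const b).
    by apply/eqP; rewrite -addr_eq0 addrA -XY Y0 expr0n.
  by rewrite pole_leN pole_le_lin.
by rewrite pole_leP ?expf_neq0 ?X_neq0 // (FunctionField.poleX) ?X_neq0 //; have := poleX_gt0; lia.
Qed.


Lemma pole_XY : 2 * pole Y = 3 * pole X.
Proof.
have X0 := X_neq0; have Y0 := Y_neq0; have p0 := poleX_gt0.
apply/eqP; rewrite eq_le; apply/andP; split.
  rewrite -(FunctionField.poleX 2) // -pole_leP ?expf_neq0 // XY -addrA.
  apply: pole_leD; first by rewrite -(FunctionField.poleX 3) //; apply: pole_le_self.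
  by apply: pole_leW (pole_le_lin a b); lia.
have : pole_le (X ^+ 3) (Num.max (2 * pole Y) (pole X)).
  have -> : X ^+ 3 = Y ^+ 2 - (const a * X + const b) by rewrite XY; ring.
  apply: pole_leD.
    rewrite -(FunctionField.poleX 2) //; apply: pole_leW (pole_le_self _).
    by rewrite le_max lexx.
  by rewrite pole_leN; apply: pole_leW (pole_le_lin a b); rewrite le_max lexx orbT.
by rewrite pole_leP ?expf_neq0 // (FunctionField.poleX 3) //; move: (pole X) (pole Y) p0 => p q; lia.
Qed.

Lemma iota_not_point r s : ~ (X = iota r /\ Y = iota s).
Proof.
move=> [Xr Ys]; have [|c rE] := @Fr_cubic_point r s a b disc.
  by apply: (fmorph_inj iota); rewrite rmorphXn -Ys XY !rmorphD rmorphM rmorphXn -Xr.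
by move: poleX; rewrite Xr rE (pole_le_const c).
Qed.

(* [X, Y] and its conjugate have a sum which is a point over Q(x), hence a
   constant point; it is O because both points reduce to O at O. *)
Lemma conj_X : conjugate X = X.
Proof.
have X0 := X_neq0; have Y0 := Y_neq0; have p0 := poleX_gt0; have pXY := pole_XY.
apply/eqP; apply: contraT => ne.
have d0 : X - conjugate X != 0 by rewrite subr_eq0 eq_sym.
pose l := (Y - conjugate Y) / (X - conjugate X).
have lE : l * (X - conjugate X) = Y - conjugate Y by rewrite divfK.
have cl : conjugate l = l.
  have : conjugate l * conjugate (X - conjugate X) = conjugate (Y - conjugate Y) by rewrite -conjM lE.
  rewrite !conjD !conjN !conjK => E; apply: (mulIf d0).
  by rewrite lE -[RHS]opprB -E; ring.
pose m := Y - l * X.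
have mE : m = conjugate Y - l * conjugate X by transitivity (conjugate Y + (Y - conjugate Y) - l * X); [rewrite /m; ring | rewrite -lE; ring].
have cm : conjugate m = m by rewrite {1}/m conjD conjN conjM cl -mE.
have cXY : conjugate Y ^+ 2 = conjugate X ^+ 3 + const a * conjugate X + const b.
  have := congr1 conjugate XY; rewrite !conjD !conjM ![conjugate (const _)]conj_iota.
  by move=> E; rewrite [LHS]expr2 E /const; ring.
have YE : Y = l * X + m by rewrite /m; ring.
have cYE : conjugate Y = l * conjugate X + m by rewrite mE; ring.
(* The difference of the equations satisfied on the chord by the two conjugate points, divided by
   [X - conjugate X]. *)
have S : X ^+ 2 + X * conjugate X + conjugate X ^+ 2 + const a - l ^+ 2 * (X + conjugate X) - 2 * l * m = 0.
  apply: (mulIf d0); rewrite mul0r.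
  transitivity ((X ^+ 3 + const a * X + const b - (l * X + m) ^+ 2)
    - (conjugate X ^+ 3 + const a * conjugate X + const b - (l * conjugate X + m) ^+ 2)); first by ring.
  by rewrite -XY -cXY -YE -cYE !subrr.
(* Third intersection point of the chord through the two conjugate points. It is fixed by
   conjugation, hence a point over Q(x), and [x3] is constant. *)
pose x3 := l ^+ 2 - X - conjugate X; pose y3 := l * x3 + m.
have E3 : y3 ^+ 2 = x3 ^+ 3 + const a * x3 + const b.
  apply/eqP; rewrite -subr_eq0; apply/eqP.
  transitivity (- ((X ^+ 3 + const a * X + const b - (l * X + m) ^+ 2)
    + (x3 - X) * ((X ^+ 2 + X * conjugate X + conjugate X ^+ 2 + const a - l ^+ 2 * (X + conjugate X) - 2 * l * m)
      + (x3 - conjugate X) * (x3 + X + conjugate X - l ^+ 2)))); first by rewrite /y3; ring.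
  by rewrite S -XY -YE subrr /x3; ring.
have lI := conj_id cl; have mI := conj_id cm.
have cx3 : conjugate x3 = x3.
  by rewrite /x3 !conjD !conjN conjK expr2 conjM cl; ring.
have cy3 : conjugate y3 = y3 by rewrite /y3 conjD conjM cl cx3 cm.
have [c c3] : exists c, x3 = const c.
  have [|c cE] := @Fr_cubic_point (c0 x3) (c0 y3) a b disc.
    apply: (fmorph_inj iota); rewrite rmorphXn -(conj_id cy3) E3.
    by rewrite !rmorphD rmorphM rmorphXn -(conj_id cx3).
  by exists c; rewrite (conj_id cx3) cE.
have d3 : pole_le y3 0.
  have [->|y30] := eqVneq y3 0; first exact: pole_le0.
  have : pole_le (y3 ^+ 2) 0.
    by rewrite E3 c3 -rmorphXn -rmorphM -!rmorphD pole_le_const.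
  by rewrite !pole_leP ?expf_neq0 // (FunctionField.poleX 2) //; lia.
(* The slope can be computed with the constant point [(x3, y3)] in place of the conjugate one. By
   [pole_XY] the bound is half of [pole X]. *)
have pl : pole_le l (pole Y - pole X).
  have [->|l0] := eqVneq l 0; first exact: pole_le0.
  have E4 : l * (X - x3) = Y - y3 by rewrite /y3 /m; ring.
  have pYy : pole_le (Y - y3) (pole Y).
    by apply: pole_leD (pole_le_self _) _; rewrite pole_leN; apply: pole_leW d3; lia.
  have pXx : pole X <= pole (X - x3) /\ X - x3 != 0.
    have XE : X = (X - x3) + x3 by rewrite subrK.
    have Xx0 : X - x3 != 0.
      by apply: contraNneq poleX => E; rewrite XE E add0r c3 pole_le_const.
    split=> //; rewrite leNgt; apply/negP => lt.
    have : pole_le X (pole X - 1).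
      rewrite {1}XE; apply: pole_leD; first by rewrite pole_leP //; move: lt; clear; lia.
      by rewrite c3; apply: pole_leW (pole_le_const _); move: p0; clear; lia.
    by rewrite pole_leP //; clear; lia.
  case: pXx => pXx Xx0.
  have : pole l + pole (X - x3) <= pole Y.
    by rewrite -poleM // E4 -pole_leP // -E4 mulf_neq0.
  by rewrite pole_leP //; move: pXx; clear; lia.
(* The product is a symmetric expression in the constant point and the slope, so its pole is at most
   that of [l ^+ 2]; but its pole is twice [pole X]. *)
have : pole_le (X * conjugate X) (pole X).
  have -> : X * conjugate X = x3 ^+ 2 + const a + l ^+ 2 * x3 - 2 * (l * y3).
    apply/eqP; rewrite -subr_eq0; apply/eqP.
    transitivity (- (X ^+ 2 + X * conjugate X + conjugate X ^+ 2 + const a - l ^+ 2 * (X + conjugate X) - 2 * l * m)).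
      by rewrite /y3 /x3; ring.
    by rewrite S oppr0.
  have pc (c' : rat) : pole_le (const c') (pole X) by apply: pole_leW (pole_le_const _); lia.
  apply: pole_leD; last first.
    rewrite pole_leN mulr_natl mulr2n; apply: pole_leD.
      by apply: (@pole_leW _ ((pole Y - pole X) + 0)); [lia | apply: pole_leM].
    by apply: (@pole_leW _ ((pole Y - pole X) + 0)); [lia | apply: pole_leM].
  apply: pole_leD.
    by rewrite c3 -rmorphXn; apply: pole_leD.
  apply: (@pole_leW _ ((pole Y - pole X) + (pole Y - pole X) + 0)); first by lia.
  by apply: pole_leM; [rewrite expr2; apply: pole_leM | rewrite c3 pole_le_const].
have cX0 : conjugate X != 0 by rewrite conj_eq0.
by rewrite pole_leP ?mulf_neq0 // poleM // pole_conj; move: p0; clear; lia.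
Qed.

(** The other sign would put [(X, Y)] over Q(x), where all points have constant first coordinate. *)
Lemma conj_Y : conjugate Y = - Y.
Proof.
have : conjugate Y ^+ 2 = Y ^+ 2.
  have := congr1 conjugate XY; rewrite !conjD !conjM ![conjugate (const _)]conj_iota conj_X.
  by move=> E; rewrite [LHS]expr2 E XY /const; ring.
move/eqP; rewrite eqf_sqr => /orP[] /eqP // E.
by exfalso; apply: (@iota_not_point (c0 X) (c0 Y)); split; apply: conj_id; rewrite ?conj_X.
Qed.

Lemma XY_coord : X = iota (c0 X) /\ Y = iota (c1 Y) * y.
Proof.
split; first by apply: conj_id; apply: conj_X.
have : conjugate Y = - Y by apply: conj_Y.
rewrite /conjugate {3}(KE Y) => E.
have /eqP : iota (c0 Y) *+ 2 = 0 by rewrite mulr2n -[X in _ + X](addrK (iota (c1 Y) * y)) addrA -[X in X + _ - _](subrK (iota (c1 Y) * y)) E; ring.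
rewrite -mulr_natl -(rmorph_nat iota) -rmorphM fmorph_eq0 mulf_eq0 (negPf (natr_neq0 1)) /= => /eqP c00.
by rewrite {1}(KE Y) c00 rmorph0 add0r.
Qed.

End EllipticPoint.

(** * The degree of the function field over the pullback field *)

Definition pullback X Y z := exists g h : {poly {poly rat}},
  geval h X Y != 0 /\ z * geval h X Y = geval g X Y.

Section Pullback.
Variables (X Y : K).
Local Notation L := (pullback X Y).

Lemma pullback_geval g : L (geval g X Y).
Proof. by exists g, 1; rewrite geval1 oner_eq0 mulr1. Qed.

Lemma pullback_const c : L (const c).
Proof. by have := pullback_geval c%:P%:P; rewrite gevalCC. Qed.

Lemma pullback0 : L 0. Proof. by have := pullback_const 0; rewrite rmorph0. Qed.
Lemma pullback1 : L 1. Proof. by have := pullback_const 1; rewrite rmorph1. Qed.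

Lemma pullbackX : L X. Proof. by have := pullback_geval 'X; rewrite gevalX. Qed.
Lemma pullbackY : L Y. Proof. by have := pullback_geval 'X%:P; rewrite gevalY. Qed.

Lemma pullbackD z w : L z -> L w -> L (z + w).
Proof.
move=> [g [h [h0 E]]] [g' [h' [h0' E']]]; exists (g * h' + g' * h), (h * h').
by rewrite gevalD !gevalM mulf_neq0 // -E -E'; split=> //; ring.
Qed.

Lemma pullbackM z w : L z -> L w -> L (z * w).
Proof.
move=> [g [h [h0 E]]] [g' [h' [h0' E']]]; exists (g * g'), (h * h').
by rewrite !gevalM mulf_neq0 // -E -E'; split=> //; ring.
Qed.

Lemma pullbackN z : L z -> L (- z).
Proof. by move=> Lz; rewrite -mulN1r -(rmorphN1 const); apply: pullbackM Lz; apply: pullback_const. Qed.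

Lemma pullbackV z : L z -> L z^-1.
Proof.
have [->|z0] := eqVneq z 0; first by rewrite invr0.
move=> [g [h [h0 E]]]; exists h, g; rewrite -E mulf_neq0 //; split=> //.
by rewrite mulKf.
Qed.

End Pullback.

Definition has_degree (L : K -> Prop) (n : nat) := exists e : 'I_n -> K, forall z,
  exists! c : {ffun 'I_n -> K}, (forall i, L (c i)) /\ z = \sum_i c i * e i.

(** The value [p(r)]: for [X = iota r] this is the pullback of a function of the first
    coordinate. *)
Definition specialize (r : Fr) (p : {poly rat}) : Fr := (map_poly (j \o polyC) p).[r].

Section Degree.
Variables (X Y : K) (a b : rat) (r s : Fr) (P Q : {poly rat}).
Hypothesis XE : X = iota r.
Hypothesis YE : Y = iota s * y.
Hypothesis s0 : s != 0.
Hypothesis XY : Y ^+ 2 = X ^+ 3 + const a * X + const b.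
Hypothesis cPQ : coprimep P Q.
Hypothesis Q0 : Q != 0.
Hypothesis rE : r = j P / j Q.
Hypothesis sPQ : (size Q < size P)%N.
Local Notation L := (pullback X Y).
Local Notation n := (size P).-1.

Definition xspan z := exists c : nat -> K, (forall i, L (c i)) /\ z = \sum_(i < n) c i * x ^+ i.

Lemma n_gt0 : (0 < n)%N.
Proof. by have : (0 < size Q)%N; [rewrite size_poly_gt0 | move: sPQ; move: (size P) (size Q) => p q; clear; lia]. Qed.

Lemma xspanD z1 z2 : xspan z1 -> xspan z2 -> xspan (z1 + z2).
Proof.
move=> [c [Lc ->]] [d [Ld ->]]; exists (fun i => c i + d i).
split=> [i|]; first exact: pullbackD.
by rewrite -big_split; apply: eq_bigr => i _; rewrite mulrDl.
Qed.

Lemma xspanZ l z : L l -> xspan z -> xspan (l * z).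
Proof.
move=> Ll [c [Lc ->]]; exists (fun i => l * c i).
split=> [i|]; first exact: pullbackM.
by rewrite mulr_sumr; apply: eq_bigr => i _; rewrite mulrA.
Qed.

Lemma xspan_sum (m : nat) (F : nat -> K) : (forall i, (i < m)%N -> xspan (F i)) -> xspan (\sum_(i < m) F i).
Proof.
elim: m => [|m IH] H.
  rewrite big_ord0; exists (fun=> 0); split=> [i|]; first exact: pullback0.
  by rewrite big1 // => i _; rewrite mul0r.
by rewrite big_ord_recr /=; apply: xspanD; [apply: IH => i im; apply: H; apply: ltnW | apply: H].
Qed.

Lemma xspanX (k : nat) : (k < n)%N -> xspan (x ^+ k).
Proof.
move=> kn; exists (fun i => (i == k)%:R); split=> [i|].
  by rewrite -(rmorph_nat const); apply: pullback_const.
rewrite (bigD1 (Ordinal kn)) //= eqxx mul1r big1 ?addr0 // => i.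
by rewrite -val_eqE /= => /negPf ->; rewrite mul0r.
Qed.

Lemma iota_poly (p : {poly rat}) (m : nat) : (size p <= m)%N ->
  iota (j p) = \sum_(i < m) const p`_i * x ^+ i.
Proof.
move=> sp; have pE : p = \sum_(i < m) p`_i *: 'X^i.
  rewrite -poly_def; apply/polyP => k; rewrite coef_poly.
  by case: ltnP => // h; rewrite nth_default // (leq_trans sp).
rewrite {1}pE !rmorph_sum /=; apply: eq_bigr => i _.
by rewrite -mul_polyC !rmorphM !rmorphXn.
Qed.

(** [x] is a root of [P - X Q], whose degree in [x] is [n] with leading coefficient that of [P],
    since [Q] has smaller degree. *)
Lemma xspan_xn : xspan (x ^+ n).
Proof.
have P0 : P != 0 by rewrite -size_poly_gt0; apply: leq_trans sPQ.
have lP : P`_n != 0 by rewrite -/(lead_coef P) lead_coef_eq0.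
have E : iota (j P) = X * iota (j Q).
  by rewrite XE -rmorphM rE divfK // j_neq0.
have sQn : (size Q <= n)%N by move: sPQ; move: (size P) (size Q) => p q; clear; lia.
have sPn : (size P <= n.+1)%N by move: (size P) => p; clear; lia.
rewrite (iota_poly sPn) big_ord_recr /= (iota_poly sQn) in E.
have -> : x ^+ n = \sum_(i < n) (const (P`_n)^-1 * (X * const Q`_i - const P`_i)) * x ^+ i.
  apply: (mulfI (const_neq0 lP)).
  have -> : const P`_n * x ^+ n = X * (\sum_(i < n) const Q`_i * x ^+ i) - \sum_(i < n) const P`_i * x ^+ i.
    by rewrite -E; ring.
  rewrite !mulr_sumr -sumrB; apply: eq_bigr => i _.
  rewrite !mulrA -rmorphM divff // rmorph1 mul1r; ring.
apply: (xspan_sum (F := fun i => (const (P`_n)^-1 * (X * const Q`_i - const P`_i)) * x ^+ i)) => i lt.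
apply: xspanZ; last exact: xspanX.
apply: pullbackM; first exact: pullback_const.
apply: pullbackD; last by apply: pullbackN; apply: pullback_const.
by apply: pullbackM; [apply: pullbackX | apply: pullback_const].
Qed.

Lemma xspan_mulx z : xspan z -> xspan (z * x).
Proof.
move=> [c [Lc ->]]; rewrite mulr_suml.
apply: (xspan_sum (F := fun i => c i * x ^+ i * x)) => i lt.
rewrite -mulrA -exprSr; apply: xspanZ => //.
have [lt2|] := ltnP i.+1 n; first exact: xspanX.
by move=> le; have -> : i.+1 = n; [apply/eqP; rewrite eqn_leq lt | apply: xspan_xn].
Qed.

Lemma xspanM z w : xspan z -> xspan w -> xspan (z * w).
Proof.
move=> Sz [c [Lc ->]]; rewrite mulr_sumr.
apply: (xspan_sum (F := fun i => z * (c i * x ^+ i))) => i _.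
rewrite mulrCA; apply: xspanZ => //.
elim: (i) => [|k IH]; first by rewrite expr0 mulr1.
by rewrite exprSr mulrA; apply: xspan_mulx.
Qed.

Lemma xspan1 : xspan 1.
Proof. by rewrite -(expr0 x); apply: xspanX; apply: n_gt0. Qed.

Lemma xspanL l : L l -> xspan l.
Proof. by move=> Ll; rewrite -[l]mulr1; apply: xspanZ xspan1. Qed.

Lemma xspan_powers z (m : nat) : xspan z -> xspan (z ^+ m).
Proof.
by move=> Sz; elim: m => [|m IH]; [rewrite expr0; apply: xspan1 | rewrite exprS; apply: xspanM].
Qed.

Lemma xspan_inv_aux z (m : nat) (d : nat -> K) : z != 0 -> xspan z -> (forall i, L (d i)) ->
  (exists2 k, (k < m)%N & d k != 0) -> \sum_(k < m) d k * z ^+ k = 0 -> xspan z^-1.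
Proof.
move=> z0 Sz; elim: m d => [|m IH] d Ld [k lt dk]; first by [].
rewrite big_ord_recl /= expr0 mulr1.
have -> : \sum_(i < m) d (lift ord0 i) * z ^+ lift ord0 i = (\sum_(i < m) d i.+1 * z ^+ i) * z.
  by rewrite mulr_suml; apply: eq_bigr => i _; rewrite lift0 exprSr mulrA.
have [d0|d0] := eqVneq (d 0%N) 0.
  rewrite d0 add0r => /eqP; rewrite mulf_eq0 (negPf z0) orbF => /eqP.
  apply: (IH (fun i => d i.+1)) => [i|]; first exact: Ld.
  by case: k lt dk => [|k] lt dk; [rewrite d0 eqxx in dk | exists k].
move=> E; have -> : z^-1 = \sum_(i < m) (- (d 0%N)^-1 * d i.+1) * z ^+ i.
  have -> : \sum_(i < m) - (d 0%N)^-1 * d i.+1 * z ^+ i = - (d 0%N)^-1 * \sum_(i < m) d i.+1 * z ^+ i.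
    by rewrite mulr_sumr; apply: eq_bigr => i _; rewrite mulrA.
  move: (\sum_(i < m) _) E => S E; apply: (mulIf z0); rewrite mulVf //.
  apply: (mulfI d0); rewrite mulr1; transitivity (- (S * z)); last by field.
  by move/eqP: E; rewrite addr_eq0 => /eqP.
apply: (xspan_sum (F := fun i => - (d 0%N)^-1 * d i.+1 * z ^+ i)) => i _.
apply: xspanZ; last exact: xspan_powers.
by apply: pullbackM => //; apply: pullbackN; apply: pullbackV.
Qed.

Lemma pullback_dependence (m k : nat) (c : 'I_m -> 'I_k -> K) : (k < m)%N -> (forall i i', L (c i i')) ->
  exists d : 'I_m -> K, [/\ forall i, L (d i), exists i, d i != 0 & forall i', \sum_i d i * c i i' = 0].
Proof.
apply: subfield_dependence; [exact: pullback0|exact: pullback1|move=> ? ?; exact: pullbackD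
  |move=> ? ?; exact: pullbackM|exact: pullbackN|exact: pullbackV].
Qed.

Lemma xspan_family (m : nat) (v : 'I_m -> K) : (forall i, xspan (v i)) ->
  exists c : 'I_m -> nat -> K, forall i, (forall k, L (c i k)) /\ v i = \sum_(k < n) c i k * x ^+ k.
Proof.
elim: m v => [|m IH] v Sv; first by exists (fun _ _ => 0); case.
have [c cP] := IH (fun i => v (lift ord0 i)) (fun i => Sv _).
have [c' c'P] := Sv ord0.
exists (fun i => if unlift ord0 i is Some i' then c i' else c') => i.
by case: unliftP => [i'|] ->.
Qed.

(** The [n + 1] first powers of [z] lie in a span of [n] elements, so they are dependent;
    [xspan_inv_aux] solves the resulting equation for the inverse. *)
Lemma xspan_inv z : xspan z -> xspan z^-1.
Proof.
have [->|z0 Sz] := eqVneq z 0; first by rewrite invr0.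
have [c cP] := xspan_family (fun i : 'I_n.+1 => xspan_powers i Sz).
have [||d [Ld [k dk] E]] := @pullback_dependence n.+1 n (fun i k => c i k).
- by [].
- by move=> i i'; have [] := cP i.
apply: (@xspan_inv_aux z n.+1 (fun i => d (inord i))) => //.
  by exists k => //; rewrite inord_val.
rewrite (eq_bigr (fun i => \sum_(k < n) d i * c i k * x ^+ k)); last first.
  move=> i _; rewrite inord_val; have [_ ->] := cP i.
  by rewrite mulr_sumr; apply: eq_bigr => k' _; rewrite mulrA.
rewrite exchange_big big1 // => k' _.
by rewrite -mulr_suml E mul0r.
Qed.

Lemma xspan_poly (p : {poly rat}) : xspan (iota (j p)).
Proof.
rewrite (iota_poly (leqnn _)).
apply: (xspan_sum (F := fun i => const p`_i * x ^+ i)) => i _.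
apply: xspanZ; first exact: pullback_const.
by apply: xspan_powers; rewrite -[x]mul1r; apply: xspan_mulx; apply: xspan1.
Qed.

Lemma xspan_iota r' : xspan (iota r').
Proof.
have [P' [Q' [_ Q'0 ->]]] := j_frac r'.
by rewrite fmorph_div; apply: xspanM; [|apply: xspan_inv]; apply: xspan_poly.
Qed.

Lemma xspan_full z : xspan z.
Proof.
have Sy : xspan y.
  have -> : y = Y * iota s^-1 by rewrite YE mulrAC -rmorphM divff // rmorph1 mul1r.
  by apply: xspanM (xspan_iota _); apply: xspanL; apply: pullbackY.
by rewrite (KE z); apply: xspanD; [|apply: xspanM => //]; apply: xspan_iota.
Qed.


Local Notation spec := (specialize r).

Lemma specD p q : spec (p + q) = spec p + spec q.
Proof. by rewrite /specialize rmorphD hornerD. Qed.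
Lemma specM p q : spec (p * q) = spec p * spec q.
Proof. by rewrite /specialize rmorphM hornerM. Qed.
Lemma specC c : spec c%:P = j c%:P.
Proof. by rewrite /specialize map_polyC hornerC. Qed.
Lemma specX : spec 'X = r.
Proof. by rewrite /specialize map_polyX hornerX. Qed.
Lemma spec0 : spec 0 = 0.
Proof. by rewrite /specialize rmorph0 horner0. Qed.

Lemma specXn (k : nat) : spec ('X ^+ k) = r ^+ k.
Proof.
elim: k => [|k IH]; last by rewrite exprS specM specX IH exprS.
by rewrite !expr0; have := specC 1; rewrite !polyC1 rmorph1.
Qed.
Lemma specG : spec ('X ^+ 3 + a%:P * 'X + b%:P) = r ^+ 3 + j a%:P * r + j b%:P.
Proof. by rewrite !specD (specM a%:P) !specC specXn specX. Qed.

Lemma spec_den (p : {poly rat}) (J : nat) : (size p <= J.+1)%N -> exists N, j Q ^+ J * spec p = j N.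
Proof.
elim/poly_ind: p J => [|p c IH] J sp; first by exists 0; rewrite spec0 mulr0 rmorph0.
case: J sp => [|J] sp.
  have -> : p = 0.
    apply/eqP; rewrite -size_poly_leq0; move: sp; rewrite size_MXaddC.
    by case: eqP => [->|_] /=; rewrite ?size_poly0.
  by exists c%:P; rewrite mul0r add0r expr0 mul1r specC.
have [|N NE] := IH J.
  by move: sp; rewrite size_MXaddC; case: eqP => [->|_] //=; rewrite size_poly0.
exists (N * P + c%:P * Q ^+ J.+1).
rewrite specD specM specX specC rmorphD !rmorphM -NE rmorphXn rE exprS.
by field; rewrite j_neq0.
Qed.

(** Induction on the degree in [r]. With [A0] formed from the constant coefficients, a relation
    reads [r S + A0 = 0]; cleared of denominators it shows that [P] divides [A0] times a power of
    [Q]. Coprimality and [deg A0 < deg P] give [A0 = 0], and a factor [r] can be removed. *)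
Lemma spec_free (J : nat) (al : nat -> {poly rat}) : (forall i, (i < n)%N -> size (al i) <= J)%N ->
  \sum_(i < n) spec (al i) * j 'X ^+ i = 0 -> forall i, (i < n)%N -> al i = 0.
Proof.
elim: J al => [|J IH] al sal E i lt.
  by apply/eqP; rewrite -size_poly_leq0; apply: sal.
pose al' i := \poly_(k < J) (al i)`_k.+1.
have alE k : (k < n)%N -> al k = al' k * 'X + ((al k)`_0)%:P.
  move=> kn; apply/polyP => -[|m]; rewrite coefD coefMX coefC /= ?add0r // addr0 coef_poly.
  by case: ltnP => // Jm; rewrite nth_default // (leq_trans (sal _ kn)).
pose S := \sum_(k < n) spec (al' k) * j 'X ^+ k.
pose A0 : {poly rat} := \poly_(k < n) (al k)`_0.
have E1 : r * S + j A0 = 0.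
  rewrite -[RHS]E /S /A0 poly_def rmorph_sum mulr_sumr -big_split /=.
  apply: eq_bigr => k _; rewrite [in RHS]alE // specD specM specX specC -mul_polyC rmorphM rmorphXn; ring.
have [N NE] : exists N, j Q ^+ J * S = j N.
  have H k : exists N, j Q ^+ J * spec (al' k) = j N.
    by apply: spec_den; apply: leq_trans (size_poly _ _) _.
  rewrite /S; elim: (n) => [|m [N NE]].
    by exists 0; rewrite big_ord0 mulr0 rmorph0.
  have [N' N'E] := H m; exists (N + N' * 'X^m).
  by rewrite big_ord_recr /= mulrDr NE mulrA N'E rmorphD rmorphM rmorphXn.
have E2 : P * N = - A0 * Q ^+ J.+1.
  apply/eqP; rewrite -subr_eq0 -j_eq0 rmorphB !rmorphM -NE rmorphN rmorphXn.
  apply/eqP; transitivity (j Q ^+ J.+1 * (r * S + j A0)); last by rewrite E1 mulr0.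
  by rewrite rE exprS; field; rewrite j_neq0.
have A00 : A0 = 0.
  apply/eqP; apply: contraT => A00.
  have : P %| A0.
    rewrite -dvdpNr -(Gauss_dvdpl _ (_ : coprimep P (Q ^+ J.+1))) ?coprimep_expr //.
    by rewrite -E2 dvdp_mulr.
  move=> /(dvdp_leq A00); have := size_poly n (fun k => (al k)`_0); rewrite -/A0.
  by have := n_gt0; move: (size A0) (size P) => p q; clear; lia.
have a0 k : (k < n)%N -> (al k)`_0 = 0.
  by move=> kn; have /(congr1 (fun p : {poly rat} => p`_k)) := A00; rewrite coef_poly kn coef0.
have S0 : S = 0.
  apply: (mulfI (expf_neq0 J (j_neq0 Q0))); rewrite mulr0 NE.
  have P0 : P != 0 by rewrite -size_poly_gt0; apply: leq_trans sPQ.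
  have : P * N = 0 by rewrite E2 A00 oppr0 mul0r.
  by move/eqP; rewrite mulf_eq0 (negPf P0) /= => /eqP ->; rewrite rmorph0.
have := IH al' _ S0 i lt; rewrite alE // a0 // => -> //.
  by rewrite mul0r add0r.
by move=> k _; apply: size_poly.
Qed.

Lemma spec_eq0 p : (spec p == 0) = (p == 0).
Proof.
apply/eqP/eqP => [E|->]; last exact: spec0.
apply: (@spec_free (size p) (fun i => if i == 0%N then p else 0) _ _ 0%N n_gt0).
  by move=> [|i] _ /=; rewrite ?size_poly0.
rewrite (bigD1 (Ordinal n_gt0)) //= E mul0r add0r big1 // => i.
by rewrite -val_eqE /= => /negPf ->; rewrite spec0 mul0r.
Qed.

Lemma geval_repr g : exists al be, geval g X Y = iota (spec al) + iota (spec be) * Y.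
Proof.
elim/poly_ind: g => [|g c [al [be E]]].
  by exists 0, 0; rewrite /geval rmorph0 !horner0 spec0 rmorph0 mul0r addr0.
have [al' [be' E']] : exists al be, geval c%:P X Y = iota (spec al) + iota (spec be) * Y.
  elim/poly_ind: c => [|c d [al' [be' E']]].
    by exists 0, 0; rewrite gevalC rmorph0 horner0 spec0 rmorph0 mul0r addr0.
  exists (be' * ('X ^+ 3 + a%:P * 'X + b%:P) + d%:P), al'.
  rewrite polyCD polyCM gevalD gevalM gevalY gevalCC E' specD specM specG specC.
  transitivity (iota (spec be') * Y ^+ 2 + iota (spec al') * Y + const d); first by ring.
  by rewrite XY XE /const; ring.
exists (al * 'X + al'), (be * 'X + be').
by rewrite gevalD gevalM gevalX E E' XE !specD !specM specX; ring.
Qed.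

Lemma conj_repr al be : conjugate (iota (spec al) + iota (spec be) * Y) = iota (spec al) - iota (spec be) * Y.
Proof. by rewrite YE conjD !conjM !conj_iota conj_y; ring. Qed.

(** The denominator is made rational in [r] by multiplying with its conjugate; [ga] is its norm. *)
Lemma pullback_repr z : L z -> exists al be ga, ga != 0 /\
  z * iota (spec ga) = iota (spec al) + iota (spec be) * Y.
Proof.
move=> [g [h [h0 E]]]; have [a1 [b1 E1]] := geval_repr g; have [a2 [b2 E2]] := geval_repr h.
pose G : {poly rat} := 'X ^+ 3 + a%:P * 'X + b%:P.
have GE : iota (spec G) = Y ^+ 2.
  by rewrite XY XE /G specG /const; ring.
pose ga := a2 ^+ 2 - b2 ^+ 2 * G.
have specN p : spec (- p) = - spec p by apply/eqP; rewrite -addr_eq0 -specD addNr spec0.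
have gaE : iota (spec ga) = geval h X Y * conjugate (geval h X Y).
  by rewrite E2 conj_repr /ga specD specN specM !expr2 !specM rmorphD rmorphN !rmorphM GE; ring.
exists (a1 * a2 - b1 * b2 * G), (b1 * a2 - a1 * b2), ga; split.
  by rewrite -spec_eq0 -(fmorph_eq0 iota) gaE mulf_neq0 // conj_eq0.
rewrite gaE mulrA E E2 conj_repr E1 !specD !specN !specM !(rmorphD, rmorphN, rmorphM) GE; ring.
Qed.

Lemma common_denominator (c : nat -> K) (m : nat) : (forall i, L (c i)) ->
  exists ga (al be : nat -> {poly rat}), ga != 0 /\ forall i, (i < m)%N ->
    c i * iota (spec ga) = iota (spec (al i)) + iota (spec (be i)) * Y.
Proof.
move=> Lc; elim: m => [|m [ga [al [be [ga0 H]]]]].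
  by exists 1, (fun=> 0), (fun=> 0); rewrite oner_eq0.
have [al' [be' [ga' [ga'0 E']]]] := pullback_repr (Lc m).
exists (ga * ga'), (fun i => if i == m then al' * ga else al i * ga'),
  (fun i => if i == m then be' * ga else be i * ga'); rewrite mulf_neq0 //; split=> // i.
rewrite ltnS leq_eqVlt => /orP[/eqP ->|lt]; rewrite ?eqxx.
  rewrite !specM !rmorphM; transitivity (c m * iota (spec ga') * iota (spec ga)); first by ring.
  by rewrite E'; ring.
rewrite (ltn_eqF lt) !specM !rmorphM mulrA H //; ring.
Qed.

Lemma powers_free (c : nat -> K) : (forall i, L (c i)) -> \sum_(i < n) c i * x ^+ i = 0 ->
  forall i, (i < n)%N -> c i = 0.
Proof.
move=> Lc E i lt; have [ga [al [be [ga0 H]]]] := common_denominator n Lc.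
have g0 : iota (spec ga) != 0 by rewrite fmorph_eq0 spec_eq0.
have : iota (\sum_(k < n) spec (al k) * j 'X ^+ k) + iota (s * \sum_(k < n) spec (be k) * j 'X ^+ k) * y = 0.
  rewrite -[RHS](mul0r (iota (spec ga))) -E mulr_suml rmorphM !rmorph_sum mulrAC -YE mulr_sumr -big_split /=.
  apply: eq_bigr => k _; rewrite mulrAC H // !rmorphM !rmorphXn -/x; ring.
move=> /K0 [E1 /eqP]; rewrite mulf_eq0 (negPf s0) /= => /eqP E2.
have bound (d : nat -> {poly rat}) k : (k < n)%N -> (size (d k) <= \max_(k' < n) size (d k'))%N.
  by move=> kn; apply: (@leq_bigmax _ (fun k' : 'I_n => size (d k')) (Ordinal kn)).
apply: (mulIf g0); rewrite mul0r H // (spec_free (bound al) E1) // (spec_free (bound be) E2) //.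
by rewrite spec0 rmorph0 mul0r addr0.
Qed.

(** The powers [x ^ i] for [i < n] form a basis over the pullback field: they span since [x] has
    degree at most [n] and [y = Y / s], and they are free by [powers_free]. A basis of another
    length contradicts [pullback_dependence]. *)
Lemma has_degree_pullback (m : nat) : has_degree L m <-> m = n.
Proof.
have ordnat (m' : nat) (v : 'I_m' -> K) : exists v' : nat -> K, (forall i : 'I_m', v' i = v i)
    /\ ((forall i, L (v i)) -> forall i, L (v' i)).
  exists (fun i => if insub i is Some i' then v i' else 0); split=> [i|H i].
    by rewrite valK.
  by case: insub => [i'|]; [apply: H | apply: pullback0].
split; last first.
  move=> ->; exists (fun i => x ^+ i) => z; have [c [Lc zE]] := xspan_full z.
  exists [ffun i : 'I_n => c i]; split.
    split=> [i|]; first by rewrite ffunE.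
    by rewrite zE; apply: eq_bigr => i _; rewrite ffunE.
  move=> d [Ld zE']; apply/ffunP => i; rewrite ffunE.
  have [d' [dE /(_ Ld) Ld']] := ordnat n d.
  have := @powers_free (fun i => c i - d' i) _ _ i (ltn_ord i).
  rewrite dE => H; apply/eqP; rewrite -subr_eq0; apply/eqP; apply: H.
    by move=> k; apply: pullbackD => //; apply: pullbackN.
  under eq_bigr => k _ do rewrite mulrBl dE.
  by rewrite sumrB -zE -zE' subrr.
move=> [e eP]; case: (ltngtP m n) => // lt.
  have [c cP] : exists c : 'I_n -> 'I_m -> K, forall i, (forall k, L (c i k)) /\ x ^+ i = \sum_k c i k * e k.
    have H i : exists c : {ffun 'I_m -> K}, (forall k, L (c k)) /\ x ^+ i = \sum_k c k * e k.
      by have [c [h _]] := eP (x ^+ i); exists c.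
    have aux (p : nat) : exists c : 'I_p -> 'I_m -> K, forall i, (forall k, L (c i k)) /\ x ^+ i = \sum_k c i k * e k.
      elim: p => [|p [c cP]]; first by exists (fun _ _ => 0); case.
      have [c' c'P] := H p.
      exists (fun i => if unlift ord_max i is Some i' then c i' else c') => i.
      by case: unliftP => [i'|] -> //; rewrite lift_max.
    exact: aux.
  have [||d [Ld [k dk] E]] := @pullback_dependence n m c; [by [] | by move=> i k; have [] := cP i |].
  have [d' [dE /(_ Ld) Ld']] := ordnat n d.
  move/negP: dk; case; rewrite -dE; apply/eqP; apply: powers_free => //.
  transitivity (\sum_(i < n) \sum_(k < m) d i * c i k * e k).
    apply: eq_bigr => i _; rewrite dE; have [_ ->] := cP i.
    by rewrite mulr_sumr; apply: eq_bigr => k' _; rewrite mulrA.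
  by rewrite exchange_big big1 // => k' _; rewrite -mulr_suml E mul0r.
have [c cP] := xspan_family (fun i : 'I_m => xspan_full (e i)).
have [||d [Ld [k dk] E]] := @pullback_dependence m n (fun i k => c i k); [by [] | by move=> i k; have [] := cP i |].
have [d0 [_ uniq]] := eP 0.
have Z1 : d0 = [ffun=> 0].
  apply: uniq; split=> [i|]; first by rewrite ffunE; apply: pullback0.
  by rewrite big1 // => i _; rewrite ffunE mul0r.
have : d0 = [ffun i => d i].
  apply: uniq; split=> [i|]; first by rewrite ffunE.
  transitivity (\sum_(i < m) \sum_(k < n) d i * c i k * x ^+ k).
    rewrite exchange_big big1 // => k' _; rewrite -mulr_suml E mul0r //.
  apply: eq_bigr => i _; rewrite ffunE; have [_ ->] := cP i.
  by rewrite mulr_sumr; apply: eq_bigr => k' _; rewrite mulrA.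
rewrite Z1 => /ffunP /(_ k); rewrite !ffunE => d00.
by rewrite -d00 eqxx in dk.
Qed.

End Degree.

(** * Isogenies of degree 3 and roots of the 3-division polynomial *)

Section DegreeThreeIsogeny.
Variables (X Y : K) (a b : rat).
Hypothesis discf : 4 * A ^+ 3 + 27 * B ^+ 2 != 0.
Hypothesis disc : 4 * a ^+ 3 + 27 * b ^+ 2 != 0.
Hypothesis XY : Y ^+ 2 = X ^+ 3 + const a * X + const b.
Hypothesis poleX : ~ regular X.

Lemma degree3_psi3 : has_degree (pullback X Y) 3 ->
  exists e, 3 * e ^+ 4 + 6 * A * e ^+ 2 + 12 * B * e - A ^+ 2 = 0.
Proof.
have pX : ~~ pole_le X 0 by apply/negP => /regularP.
have X0 := X_neq0 pX; have pX0 := poleX_gt0 pX; have Y0 := Y_neq0 disc XY pX.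
have [XE YE] := XY_coord disc XY pX; set r := c0 X in XE; set s := c1 Y in YE.
have s0 : s != 0 by apply: contraNneq Y0 => s0; rewrite YE s0 rmorph0 mul0r.
have r0 : r != 0 by apply: contraNneq X0 => r0; rewrite XE r0 rmorph0.
have [P [Q [P0 Q0 cPQ rE]]] := ratfun_neq0 r0.
have sPQ : (size Q < size P)%N.
  by move: pX0; rewrite XE pole_iota // rE rdeg_div //; clear; lia.
move/(has_degree_pullback XE YE s0 XY cPQ Q0 rE sPQ) => n3.
have sP : size P = 4%N by move: n3 sPQ; case: (size P) => // p /= <-.
have [U [V [cUV V0 sE]]] := j_frac s.
have jQ := j_neq0 Q0; have jV := j_neq0 V0.
apply: (@psi3_root_of_degree3 A B a b P Q U V) => //; first by rewrite sP in sPQ.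
have E : j f * s ^+ 2 = r ^+ 3 + j a%:P * r + j b%:P.
  apply: (fmorph_inj iota); rewrite rmorphM rmorphXn -y2.
  transitivity (Y ^+ 2); first by rewrite YE; ring.
  by rewrite XY {1 2}XE /const !(rmorphD, rmorphM, rmorphXn).
apply/eqP; rewrite -subr_eq0 -j_eq0 rmorphB subr_eq0; apply/eqP.
have -> : j (cubic A B * U ^+ 2 * Q ^+ 3) = j f * j U ^+ 2 * j Q ^+ 3.
  by rewrite (rmorphM j (f * U ^+ 2)) (rmorphM j f) !rmorphXn.
move: (j f) E => jf E.
rewrite /cubic_form -!mul_polyC !(rmorphM, rmorphD, rmorphXn).
transitivity (jf * s ^+ 2 * (j V ^+ 2 * j Q ^+ 3)); first by rewrite sE; field.
by rewrite E rE; field.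
Qed.

End DegreeThreeIsogeny.

(* Velu's formulas for the subgroup {O, (e, +-y)}. *)
Lemma psi3_isogeny e : 4 * A ^+ 3 + 27 * B ^+ 2 != 0 ->
  3 * e ^+ 4 + 6 * A * e ^+ 2 + 12 * B * e - A ^+ 2 = 0 ->
  exists a b, 4 * a ^+ 3 + 27 * b ^+ 2 != 0 /\ exists X Y,
    [/\ Y ^+ 2 = X ^+ 3 + const a * X + const b, ~ regular X & has_degree (pullback X Y) 3].
Proof.
move=> discf psi.
pose f0 := e ^+ 3 + A * e + B; pose f1 := 3 * e ^+ 2 + A.
(* Velu's two invariants of the point: the map is [X = x + al / (x - e) + ga / (x - e) ^ 2]. *)
pose al := 2 * f1; pose ga := 4 * f0.
pose a := A - 5 * al; pose b := B - 7 * (ga + e * al).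
have f00 : f0 != 0 by apply: velu_nonsingular_pole discf psi.
have disc : 4 * a ^+ 3 + 27 * b ^+ 2 != 0 by apply: velu_nonsingular discf psi.
have ga0 : ga != 0 by apply: natr_mul_neq0.
have ga20 : 2 * ga != 0 by apply: natr_mul_neq0.
exists a, b; split=> //.
pose D : {poly rat} := 'X - e%:P.
pose P := 'X * D ^+ 2 + al%:P * D + ga%:P; pose Q := D ^+ 2.
pose S := D ^+ 3 - al%:P * D - (2 * ga)%:P.
have D0 : D != 0 by rewrite polyXsubC_eq0.
have Q0 : Q != 0 by rewrite expf_neq0.
have sD : size D = 2%N by apply: size_XsubC.
have sQ : size Q = 3%N by rewrite /Q size_exp_poly // sD.
have sP : size P = 4%N.
  have sXQ : size ('X * Q) = 4%N by rewrite mulrC size_mulX // sQ.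
  rewrite /P -addrA -/Q size_polyDl sXQ //; apply: leq_ltn_trans (size_polyD _ _) _; rewrite gtn_max.
  apply/andP; split; last by apply: leq_ltn_trans (size_polyC_leq1 _) _.
  by rewrite mul_polyC; apply: leq_ltn_trans (size_scale_leq _ _) _; rewrite sD.
have Pe : P.[e] = ga.
  by rewrite /P /D !(hornerD, hornerM, hornerX, hornerC, hornerN, horner_exp) subrr; ring.
have cPQ : coprimep P Q.
  by rewrite /Q coprimep_expr // coprimep_XsubC /root Pe.
have polyE : cubic A B * S ^+ 2 = P ^+ 3 + a%:P * P * Q ^+ 2 + b%:P * Q ^+ 3.
  apply/eqP; rewrite -subr_eq0; apply/eqP.
  (* The two sides differ by a multiple of the 3-division polynomial at [e]. *)
  transitivity ((3 * e ^+ 4 + 6 * A * e ^+ 2 + 12 * B * e - A ^+ 2)%:P *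
    ((3 * ga)%:P * D ^+ 2 + (2 * al)%:P * D ^+ 3 - 6 * D ^+ 5)); last by rewrite psi polyC0 mul0r.
  by rewrite cubicE /S /P /Q /D /a /b /ga /al /f0 /f1; ring.
have jD := j_neq0 D0; have jQ := j_neq0 Q0.
pose r := j P / j Q; pose s := j S / j D ^+ 3.
have sS : S != 0.
  apply/eqP => S0; have : D %| (2 * ga)%:P.
    have -> : (2 * ga)%:P = D * (D ^+ 2 - al%:P) - S by rewrite /S; ring.
    by rewrite S0 subr0 dvdp_mulr.
  move/dvdp_leq; rewrite polyC_eq0 ga20 => /(_ isT).
  by rewrite sD size_polyC ga20.
have s0 : s != 0 by rewrite mulf_neq0 ?invr_neq0 ?expf_neq0 ?j_neq0.
exists (iota r), (iota s * y).
have E : (iota s * y) ^+ 2 = iota r ^+ 3 + const a * iota r + const b.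
  rewrite exprMn y2 -!rmorphXn -rmorphM /const -rmorphM -!rmorphD; congr (iota _).
  have jE : j f * j S ^+ 2 = j P ^+ 3 + j a%:P * j P * (j D ^+ 2) ^+ 2 + j b%:P * (j D ^+ 2) ^+ 3.
    have gen (g p q c d k : {poly rat}) : g * p ^+ 2 = q ^+ 3 + c * q * (k ^+ 2) ^+ 2 + d * (k ^+ 2) ^+ 3 ->
        j g * j p ^+ 2 = j q ^+ 3 + j c * j q * (j k ^+ 2) ^+ 2 + j d * (j k ^+ 2) ^+ 3.
      by move=> /(congr1 j) E; rewrite -rmorphXn -rmorphM E; ring.
    exact: gen polyE.
  have jQE : j Q = j D ^+ 2 by rewrite /Q rmorphXn.
  rewrite /s /r jQE.
  move: (j f) jE => jf jE; transitivity (jf * j S ^+ 2 / j D ^+ 6); first by field.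
  by rewrite jE; field.
have sPQ : (size Q < size P)%N by rewrite sQ sP.
split=> //.
  move=> /regularP; have P0 : P != 0 by rewrite -size_poly_eq0 sP.
  have r0 : r != 0 by rewrite mulf_neq0 ?invr_neq0 ?j_neq0.
  by rewrite pole_leP ?fmorph_eq0 // pole_iota // rdeg_div // sP sQ.
by apply/(has_degree_pullback erefl erefl s0 E cPQ Q0 erefl sPQ); rewrite sP.
Qed.

End FunctionField.
End RationalFunctions.

(** * The concrete function field as a quotient of polynomials over Q(x) *)

Lemma in_qpolyC (R : comNzRingType) (h : {poly R}) c : in_qpoly h c%:P = qpolyC h c.
Proof.
apply: val_inj => /=; rewrite Pdiv.Ring.rmodp_small //.
exact: leq_ltn_trans (size_polyC_leq1 _) (size_mk_monic_gt1 _).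
Qed.

Lemma in_qpoly_linear (R : comNzRingType) (h : {poly R}) r s :
  in_qpoly h (r%:P + s%:P * 'X) = qpolyC h r + qpolyC h s * 'qX.
Proof. by rewrite in_qpolyD in_qpolyM !in_qpolyC. Qed.

Section Concrete.
Variables A B : rat.
Local Notation Fr := {fraction {poly rat}}.
Local Notation h := (curve_poly A B).
Local Notation j := (@tofrac {poly rat}).

Lemma curve_polyE : h = 'X ^+ 2 - (j (cubic A B))%:P.
Proof. by []. Qed.

Lemma size_curve_poly : size h = 3%N.
Proof.
rewrite curve_polyE size_polyDl size_polyXn // size_polyN.
by apply: leq_ltn_trans (size_polyC_leq1 _) _.
Qed.

Lemma curve_poly_monic : h \is monic.
Proof.
rewrite monicE curve_polyE lead_coefDl ?lead_coefXn //.
by rewrite size_polyN size_polyXn; apply: leq_ltn_trans (size_polyC_leq1 _) _.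
Qed.

Lemma tofrac_eq0' P : (j P == 0) = (P == 0). Proof. exact: tofrac_eq0. Qed.

(** A root would be a square root of [f] in Q(x), but squares have even degree and [f] has degree
    3. *)
Lemma curve_poly_irreducible : irreducible_poly h.
Proof.
apply: cubic_irreducible; first by rewrite size_curve_poly.
move=> r; apply/negP; rewrite /root curve_polyE hornerD hornerN hornerC hornerXn subr_eq0 => /eqP E.
have jf0 : j (cubic A B) != 0 by rewrite tofrac_eq0 -size_poly_eq0 size_cubic.
have r0 : r != 0 by apply: contraNneq jf0 => r0; rewrite -E r0 expr0n.
have := congr1 (rdeg tofrac_eq0' ratfun_fraction) E.
rewrite expr2 rdegM // rdeg_poly ?size_cubic -?size_poly_eq0 ?size_cubic //; lia.
Qed.

Lemma curve_poly_mi : monic_irreducible_poly h.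
Proof. by split; [apply: curve_poly_irreducible | apply: curve_poly_monic]. Qed.

Local Notation K := {poly %/ h with curve_poly_mi}.
Definition ff_embed : Fr -> K := qpolyC h.

Lemma ff_embed_zmod : zmod_morphism ff_embed.
Proof. exact: (qpolyC_is_zmod_morphism h). Qed.
Lemma ff_embed_monoid : monoid_morphism ff_embed.
Proof. exact: (qpolyC_is_monoid_morphism h). Qed.
HB.instance Definition _ := GRing.isZmodMorphism.Build Fr K ff_embed ff_embed_zmod.
HB.instance Definition _ := GRing.isMonoidMorphism.Build Fr K ff_embed ff_embed_monoid.

Definition ffy : K := 'qX : {poly %/ h}.
Definition coord0 (z : K) : Fr := ((z : {poly %/ h}) : {poly Fr})`_0.
Definition coord1 (z : K) : Fr := ((z : {poly %/ h}) : {poly Fr})`_1.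

Lemma mkh : mk_monic h = h.
Proof. exact: (mk_monicE curve_poly_mi). Qed.

Lemma in_qpoly_lin (r s : Fr) : (ff_embed r + ff_embed s * ffy : K) = in_qpoly h (r%:P + s%:P * 'X) :> {poly %/ h}.
Proof.
exact: esym (in_qpoly_linear h r s).
Qed.

Lemma ffy2 : ffy ^+ 2 = ff_embed (j (cubic A B)).
Proof.
have E : in_qpoly h ('X ^+ 2 - (j (cubic A B))%:P) = 0.
  by apply: val_inj => /=; rewrite -curve_polyE mkh Pdiv.RingMonic.rmodpp ?curve_poly_monic.
have Ce (c : Fr) : in_qpoly h c%:P = qpolyC h c.
  apply: val_inj => /=; rewrite Pdiv.Ring.rmodp_small // mkh size_curve_poly.
  exact: leq_ltn_trans (size_polyC_leq1 _) _.
apply/eqP; rewrite -subr_eq0; apply/eqP.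
move: E; rewrite rmorphB /= rmorphXn /= Ce; exact.
Qed.

Lemma ff_coord (z : K) : z = ff_embed (coord0 z) + ff_embed (coord1 z) * ffy.
Proof.
apply: etrans (esym (in_qpoly_lin _ _)).
have E : (in_qpoly h ((coord0 z)%:P + (coord1 z)%:P * 'X) : {poly Fr}) = (coord0 z)%:P + (coord1 z)%:P * 'X.
  apply: in_qpoly_small.
  rewrite mkh size_curve_poly; apply: leq_ltn_trans (size_polyD _ _) _; rewrite gtn_max.
  apply/andP; split; first by apply: leq_ltn_trans (size_polyC_leq1 _) _.
  by rewrite mul_polyC; apply: leq_ltn_trans (size_scale_leq _ _) _; rewrite size_polyX.
apply: val_inj; rewrite [RHS]E.
apply/polyP => i; rewrite coefD coefC coefCM coefX /coord0 /coord1.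
case: i => [|[|i]] /=; rewrite ?mulr0 ?mulr1 ?addr0 ?add0r //.
rewrite nth_default //; have := size_mk_monic (z : {poly %/ h}).
by move: (size _) => m; rewrite mkh size_curve_poly ltnS => /leq_trans; apply.
Qed.

Lemma ff_free (r s : Fr) : ff_embed r + ff_embed s * ffy = 0 -> r = 0 /\ s = 0.
Proof.
move=> E; have E2 : in_qpoly h (r%:P + s%:P * 'X) = 0 by rewrite -in_qpoly_lin E.
have : (in_qpoly h (r%:P + s%:P * 'X) : {poly Fr}) = r%:P + s%:P * 'X.
  apply: in_qpoly_small; rewrite mkh size_curve_poly.
  apply: leq_ltn_trans (size_polyD _ _) _; rewrite gtn_max.
  apply/andP; split; first by apply: leq_ltn_trans (size_polyC_leq1 _) _.
  by rewrite mul_polyC; apply: leq_ltn_trans (size_scale_leq _ _) _; rewrite size_polyX.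
rewrite E2 => /polyP H; split.
  by have := H 0%N; rewrite coef0 coefD coefC coefCM coefX mulr0 addr0.
by have := H 1%N; rewrite coef0 coefD coefC coefCM coefX mulr1 add0r.
Qed.

Theorem isogeny3_psi3 : 4 * A ^+ 3 + 27 * B ^+ 2 != 0 -> has_isogeny_of_degree A B 3 <->
  exists e : rat, 3 * e ^+ 4 + 6 * A * e ^+ 2 + 12 * B * e - A ^+ 2 = 0.
Proof.
move=> disc; split.
  move=> [a [b [d [X [Y [[XY reg] deg]]]]]].
  exact: (@degree3_psi3 Fr j tofrac_eq0' ratfun_fraction K ff_embed ffy A B coord0 coord1
    ffy2 ff_coord ff_free X Y a b disc d XY reg deg).
move=> [e psi].
have [a [b [d [X [Y [XY reg deg]]]]]] := @psi3_isogeny Fr j tofrac_eq0' ratfun_fraction K ff_embed ffy A B coord0 coord1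
    ffy2 ff_coord ff_free e disc psi.
by exists a, b; split=> //; exists X, Y; split.
Qed.

End Concrete.

(** * Minimal models and integral roots *)

Section MinimalModels.
Local Open Scope nat_scope.

Definition squarefree n := [forall k : 'I_n.+1, (k ^ 2 %| n) ==> (k == 1 :> nat)].

Lemma squarefreeP n : 0 < n -> reflect (forall k, k ^ 2 %| n -> k = 1) (squarefree n).
Proof.
move=> n0; apply: (iffP forallP) => [H k kn|H k]; last by apply/implyP => /H /eqP.
have kle : k < n.+1.
  rewrite ltnS; case: k kn => // k kn; apply: leq_trans (dvdn_leq n0 kn).
  by rewrite -{1}[k.+1]muln1 expnS expn1 leq_mul2l.
by have /implyP := H (Ordinal kle) => /(_ kn) /eqP.
Qed.

Lemma coprime_quotient_gcd m n : 0 < m -> coprime (m %/ gcdn m n) (n %/ gcdn m n).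
Proof.
move=> m0; have g0 : 0 < gcdn m n by rewrite gcdn_gt0 m0.
rewrite /coprime -(eqn_pmul2r g0) mul1n -{1 2 4}[gcdn m n]/(gcdn m n).
by rewrite muln_gcdl !divnK ?dvdn_gcdl ?dvdn_gcdr.
Qed.

Lemma squarefree_dvdn_sqr d s : 0 < d -> squarefree d -> d %| s ^ 2 -> d %| s.
Proof.
move=> d0 /(squarefreeP d0) sf ds; set g := gcdn d s.
have g0 : 0 < g by rewrite gcdn_gt0 d0.
have dE : d = d %/ g * g by rewrite divnK ?dvdn_gcdl.
have sE : s = s %/ g * g by rewrite divnK ?dvdn_gcdr.
have cop := coprime_quotient_gcd s d0; rewrite -/g in cop.
have d1 : d %/ g %| g.
  rewrite -(Gauss_dvdl _ (_ : coprime (d %/ g) ((s %/ g) ^ 2))) ?coprimeXr //.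
  rewrite -(dvdn_pmul2r g0) -dE (_ : _ * g = s ^ 2) // [in RHS]sE; ring.
have /sf : (d %/ g) ^ 2 %| d by rewrite {2}dE expnS expn1 dvdn_pmul2l // divn_gt0 // dvdn_leq // dvdn_gcdl.
by move=> dg1; rewrite dE dg1 mul1n dvdn_gcdr.
Qed.

Definition sqrt_part n := \max_(k < n.+1 | k ^ 2 %| n) k.

Lemma sqrt_part_dvd n : 0 < n -> sqrt_part n ^ 2 %| n.
Proof.
move=> n0; rewrite /sqrt_part.
have [|k kP ->] := @eq_bigmax_cond _ (fun k : 'I_n.+1 => k ^ 2 %| n) (fun k => k : nat).
  by apply/card_gt0P; exists (inord 1); rewrite unfold_in inordK ?dvd1n.
by [].
Qed.

Lemma dvdn_leq_sqr k n : 0 < n -> k ^ 2 %| n -> k <= n.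
Proof.
move=> n0; case: k => // k kn; apply: leq_trans (dvdn_leq n0 kn).
by rewrite -{1}[k.+1]muln1 expnS expn1 leq_mul2l.
Qed.

Lemma leq_sqrt_part k n : 0 < n -> k ^ 2 %| n -> k <= sqrt_part n.
Proof.
move=> n0 kn; have kle : k < n.+1 by rewrite ltnS dvdn_leq_sqr.
exact: (@leq_bigmax_cond _ (fun k : 'I_n.+1 => k ^ 2 %| n) (fun k => k : nat) (Ordinal kle)).
Qed.

Lemma sqrt_part_gt0 n : 0 < n -> 0 < sqrt_part n.
Proof. by move=> n0; apply: leq_sqrt_part => //; rewrite dvd1n. Qed.

Lemma sqrt_part_factor n : 0 < n -> exists d, [/\ 0 < d, squarefree d & n = d * sqrt_part n ^ 2].
Proof.
move=> n0; have u0 := sqrt_part_gt0 n0; set u := sqrt_part n in u0 *.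
have nE : n = n %/ u ^ 2 * u ^ 2 by rewrite divnK // sqrt_part_dvd.
have d0 : 0 < n %/ u ^ 2 by rewrite divn_gt0 ?expn_gt0 ?u0 // dvdn_leq // sqrt_part_dvd.
exists (n %/ u ^ 2); split=> //; apply/squarefreeP => // k kd.
have : (k * u) ^ 2 %| n by rewrite expnMn nE dvdn_mul.
move/(leq_sqrt_part n0); rewrite -/u => le.
have k0 : 0 < k by case: k kd {le} => //; rewrite expnS mul0n dvd0n; case: (_ %/ _) d0.
apply/eqP; rewrite eqn_leq k0 andbT.
by move: le; rewrite -{2}[u]mul1n leq_pmul2r.
Qed.

(** Write [n = d u ^ 2] with [d] squarefree. After division by the gcd with [u], the square of the
    remaining factor of [k] divides [d]. *)
Lemma dvdn_sqrt_part k n : 0 < n -> (k ^ 2 %| n) = (k %| sqrt_part n).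
Proof.
move=> n0; apply/idP/idP => [kn|ku]; last first.
  by apply: dvdn_trans (sqrt_part_dvd n0); rewrite dvdn_exp2r.
have [d [d0 sf nE]] := sqrt_part_factor n0; set u := sqrt_part n in nE *.
have u0 : 0 < u := sqrt_part_gt0 n0.
have k0 : 0 < k by case: k kn => //; rewrite expnS mul0n dvd0n; case: (n) n0.
set g := gcdn k u; have g0 : 0 < g by rewrite gcdn_gt0 k0.
have kE : k = k %/ g * g by rewrite divnK ?dvdn_gcdl.
have uE : u = u %/ g * g by rewrite divnK ?dvdn_gcdr.
have cop := coprime_quotient_gcd u k0; rewrite -/g in cop.
have : (k %/ g) ^ 2 %| d.
  rewrite -(Gauss_dvdl _ (_ : coprime ((k %/ g) ^ 2) ((u %/ g) ^ 2))); last by rewrite coprimeXl ?coprimeXr.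
  rewrite -(@dvdn_pmul2r (g ^ 2)) ?expn_gt0 ?g0 // -expnMn -kE -mulnA -expnMn -uE -nE //.
move/(squarefreeP d0): sf => sf /sf k1.
by rewrite kE k1 mul1n dvdn_gcdr.
Qed.

(** With [3 a = d u ^ 2] and [d] squarefree, [a | 3 D ^ 2] means [d u ^ 2 | (3 D) ^ 2], that is
    [d u | 3 D]; and [d u = 3 (a / u)]. This is how [s(3 a)] enters the count. *)
Lemma dvdn_3sqr a D : 0 < a -> (a %| 3 * D ^ 2) = (a %/ sqrt_part (3 * a) %| D) /\ sqrt_part (3 * a) %| a.
Proof.
move=> a0; have a30 : 0 < 3 * a by rewrite muln_gt0.
have [d [d0 sf aE]] := sqrt_part_factor a30; set u := sqrt_part (3 * a) in aE *.
have u0 : 0 < u := sqrt_part_gt0 a30.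
have ua : u %| a.
  have [/dvdnP [v uE]|u3] := boolP (3 %| u).
    rewrite -(@dvdn_pmul2l 3) // aE; apply/dvdnP; exists (d * v).
    by rewrite expnS expn1 {1}uE; ring.
  have : u %| 3 * a by rewrite aE expnS expn1 mulnA dvdn_mull.
  by rewrite Gauss_dvdr // coprime_sym prime_coprime.
split=> //; set w := a %/ u.
have wE : d * u = 3 * w.
  apply/eqP; rewrite -(eqn_pmul2r u0) -!mulnA divnK // aE; apply/eqP; ring.
rewrite -(@dvdn_pmul2l 3) // mulnA (_ : 3 * 3 * D ^ 2 = (3 * D) ^ 2); last by ring.
rewrite aE -[w %| D](@dvdn_pmul2l 3) // -wE.
apply/idP/idP => [H|/dvdnP [q ->]]; last first.
  by apply/dvdnP; exists (q ^ 2 * d); ring.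
have : u %| 3 * D.
  by rewrite -(@dvdn_pexp2r _ _ 2) //; apply: dvdn_trans H; rewrite dvdn_mull.
move=> /dvdnP [s sE]; rewrite sE in H *; rewrite dvdn_pmul2r //.
apply: squarefree_dvdn_sqr => //.
by rewrite -(@dvdn_pmul2r (u ^ 2)) ?expn_gt0 ?u0 // -expnMn.
Qed.

(** * The Moebius function *)

Lemma squarefree_pmul p d : prime p -> 0 < d -> ~~ (p %| d) -> squarefree (p * d) = squarefree d.
Proof.
move=> pp d0 pd; have p0 := prime_gt0 pp; have pd0 : 0 < p * d by rewrite muln_gt0 p0.
apply/(squarefreeP pd0)/(squarefreeP d0) => H k kd; apply: H; first by rewrite dvdn_mull.
have cop : coprime (k ^ 2) p.
  rewrite coprime_sym prime_coprime //; apply: contra pd.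
  rewrite Euclid_dvdX // andbT => pk.
  have : p ^ 2 %| p * d by apply: dvdn_trans kd; apply: dvdn_exp2r.
  by rewrite expnS expn1 dvdn_pmul2l.
by rewrite Gauss_dvdr in kd.
Qed.

Lemma size_primes_pmul p d : prime p -> 0 < d -> ~~ (p %| d) -> size (primes (p * d)) = (size (primes d)).+1.
Proof.
move=> pp d0 pd; have p0 := prime_gt0 pp.
rewrite -/(size (p :: primes d)); apply: perm_size; apply: uniq_perm.
- exact: primes_uniq.
- by rewrite /= primes_uniq mem_primes pp d0 pd.
move=> q; rewrite primesM // in_cons; congr (_ || _).
by rewrite (primes_prime pp) inE.
Qed.

Definition mobius n : int := if squarefree n then ((-1) ^+ size (primes n))%R else 0%R.

Lemma mobius_pmul p d : prime p -> 0 < d -> ~~ (p %| d) -> mobius (p * d) = (- mobius d)%R.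
Proof.
move=> pp d0 pd; rewrite /mobius squarefree_pmul // size_primes_pmul //.
by case: ifP => _; rewrite ?oppr0 // exprS mulN1r.
Qed.

Lemma mobius1 : mobius 1 = 1%R.
Proof.
rewrite /mobius ifT //; apply/squarefreeP => // k; rewrite dvdn1 => /eqP.
by rewrite expnS expn1; case: k => [|[|k]] // /eqP; rewrite eqn_mul1 => /andP[].
Qed.

Lemma mobius_norm n : (`|mobius n| <= 1)%R.
Proof. by rewrite /mobius; case: ifP => _; rewrite ?normr0 // normrX normrN1 expr1n. Qed.

Lemma mobius_sqr p d : prime p -> 0 < d -> p ^ 2 %| d -> mobius d = 0%R.
Proof.
move=> pp d0 pd; rewrite /mobius ifF //; apply/negbTE/negP => /(squarefreeP d0) /(_ p pd) p1.
by rewrite p1 in pp.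
Qed.

(** For the least prime [p] of [n], the divisors [d] and [p d] with [d] prime to [p] cancel, and
    multiples of [p ^ 2] contribute 0. *)
Lemma sum_mobius_divisors n : 0 < n -> \big[+%R/0%R]_(d <- divisors n) mobius d = ((n == 1)%:R)%R.
Proof.
move=> n0; have [->|n1] := eqVneq n 1; first by rewrite big_seq1 mobius1.
have pp : prime (pdiv n) by rewrite pdiv_prime //; case: n n0 n1 => [|[]].
set p := pdiv n in pp; have pn : p %| n by apply: pdiv_dvd.
have p0 := prime_gt0 pp.
rewrite (bigID (fun d => p %| d)) /= (bigID (fun d => p ^ 2 %| d)) /= big1_seq ?add0r; last first.
  move=> d /andP[/andP[_ pd] dn]; apply: (mobius_sqr pp) pd.
  by move: dn; rewrite -dvdn_divisors // => /dvdn_gt0; apply.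
rewrite -big_filter -[X in (_ + X)%R]big_filter.
have -> : (\sum_(d <- [seq d <- divisors n | (p %| d) && ~~ (p ^ 2 %| d)]%N) mobius d
    = \sum_(d <- [seq (p * d)%N | d <- [seq d <- divisors n | ~~ (p %| d)%N]]) mobius d)%R.
  apply: perm_big; apply: uniq_perm.
  - by rewrite filter_uniq // divisors_uniq.
  - rewrite map_inj_uniq ?filter_uniq ?divisors_uniq // => x y /eqP.
    by rewrite eqn_pmul2l // => /eqP.
  move=> d; rewrite mem_filter -dvdn_divisors //; apply/andP/mapP.
    move=> [/andP[/dvdnP [k ->]]]; rewrite mulnC expnS expn1 dvdn_pmul2l // => pk kn.
    exists k => //; rewrite mem_filter pk -dvdn_divisors //.
    by apply: dvdn_trans kn; rewrite dvdn_mull.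
  move=> [k]; rewrite mem_filter -dvdn_divisors // => /andP[pk kn] ->.
  split; first by rewrite dvdn_mulr // expnS expn1 dvdn_pmul2l.
  by rewrite Gauss_dvd ?pn // prime_coprime.
rewrite big_map -big_split big1_seq //= => d; rewrite mem_filter -dvdn_divisors // => /andP[pd dn].
rewrite mobius_pmul ?addNr //.
by apply: dvdn_gt0 dn.
Qed.

Lemma sum_mobius n N : 0 < n -> n <= N -> (\sum_(1 <= d < N.+1 | (d %| n)%N) mobius d = (n == 1)%:R)%R.
Proof.
move=> n0 nN; rewrite -sum_mobius_divisors // -big_filter; apply: perm_big.
apply: uniq_perm; rewrite ?filter_uniq ?iota_uniq ?divisors_uniq // => d.
rewrite mem_filter mem_index_iota -dvdn_divisors //.
apply/andP/idP => [[]//|dn]; split=> //.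
by rewrite (dvdn_gt0 n0 dn) ltnS (leq_trans (dvdn_leq n0 dn)).
Qed.

(** Among the [t] dividing [s(n)], the Moebius sum over the divisors [g] of [s(n) / t] selects
    [t = s(n)]. The ranges extend to an arbitrary [N >= n] so that sums over [n] can be exchanged
    with them. *)
Lemma sqrt_partE n N : 0 < n -> n <= N ->
  ((sqrt_part n)%:R = \sum_(1 <= g < N.+1) \sum_(1 <= t < N.+1 | ((g * t) ^ 2 %| n)%N) mobius g * t%:R :> int)%R.
Proof.
move=> n0 nN; set u := sqrt_part n; have u0 : 0 < u := sqrt_part_gt0 n0.
have uN : u <= N by apply: leq_trans nN; apply: dvdn_leq_sqr (sqrt_part_dvd n0).
under eq_bigr do rewrite big_mkcond.
rewrite exchange_big /=.
transitivity (\sum_(1 <= t < N.+1) (t == u)%:R * t%:R : int)%R.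
  rewrite (bigD1_seq u) ?iota_uniq ?mem_index_iota ?u0 ?ltnS //= eqxx mul1r big1 ?addr0 // => t.
  by move=> /negPf ->; rewrite mul0r.
apply: eq_big_seq => t; rewrite mem_index_iota => /andP[t0 tN].
rewrite -big_mkcond /= -mulr_suml; congr (_ * _)%R.
under eq_bigl => g do rewrite dvdn_sqrt_part // -/u.
have [tdu|tdu] := boolP (t %| u); last first.
  rewrite big_pred0 => [|g]; last first.
    by apply/negP => H; move/negP: tdu; apply; apply: dvdn_trans H; apply: dvdn_mull.
  by rewrite (_ : t == u = false) //; apply/negP => /eqP E; rewrite E dvdnn in tdu.
have dvE g : (g * t %| u) = (g %| u %/ t) by rewrite -[in LHS](divnK tdu) dvdn_pmul2r.
under eq_bigl do rewrite dvE.
rewrite sum_mobius ?divn_gt0 //; last 2 first.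
- exact: dvdn_leq.
- by apply: leq_trans uN; apply: leq_div.
congr ((nat_of_bool _)%:R)%R; apply/eqP/eqP => [->|E]; first by rewrite divnn u0.
by rewrite -(divnK tdu) E mul1n.
Qed.

(** * Divisibility of a curve by a twist *)

Section TwistDivisors.
Variables A B : int.
Hypothesis AB0 : (A != 0)%R || (B != 0)%R.

Definition twist_dvd (e : nat) := (e ^ 4 %| `|A|) && (e ^ 6 %| `|B|).

Lemma twist_dvd_leq e : twist_dvd e -> e <= `|A| + `|B|.
Proof.
move=> /andP[h1 h2].
have aux k m : 0 < m -> e ^ k.+1 %| m -> e <= m.
  move=> m0; case: e {h1 h2} => // e h; apply: leq_trans (dvdn_leq m0 h).
  by rewrite expnS -{1}[e.+1]muln1 leq_mul2l expn_gt0.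
case/orP: AB0 => H.
  by apply: leq_trans (aux 3 _ _ h1) (leq_addr _ _); rewrite absz_gt0.
by apply: leq_trans (aux 5 _ _ h2) (leq_addl _ _); rewrite absz_gt0.
Qed.

Definition twist_max := \max_(e < (`|A| + `|B|).+1 | twist_dvd e) e.

Lemma twist_max_dvd : twist_dvd twist_max.
Proof.
rewrite /twist_max.
have [|k kP ->] := @eq_bigmax_cond _ (fun k : 'I_(`|A| + `|B|).+1 => twist_dvd k) (fun k => k : nat); last by [].
apply/card_gt0P; exists (inord 1); rewrite unfold_in inordK /twist_dvd ?exp1n ?dvd1n //.
by rewrite ltnS addn_gt0 !absz_gt0.
Qed.

Lemma leq_twist_max e : twist_dvd e -> e <= twist_max.
Proof.
move=> te; have lt : e < (`|A| + `|B|).+1 by rewrite ltnS twist_dvd_leq.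
exact: (@leq_bigmax_cond _ (fun k : 'I_(`|A| + `|B|).+1 => twist_dvd k) (fun k => k : nat) (Ordinal lt)).
Qed.

Lemma twist_max_gt0 : 0 < twist_max.
Proof. by apply: leq_twist_max; rewrite /twist_dvd !exp1n !dvd1n. Qed.

(** The base on the left is the least common multiple of [e] and [f]. *)
Lemma dvdn_exp_lcm k e f m : 0 < e -> 0 < f -> e ^ k %| m -> f ^ k %| m ->
  (e %/ gcdn e f * (f %/ gcdn e f) * gcdn e f) ^ k %| m.
Proof.
move=> e0 f0 /dvdnP [q qE] fm; set g := gcdn e f.
have g0 : 0 < g by rewrite gcdn_gt0 e0.
have eE : e = e %/ g * g by rewrite divnK ?dvdn_gcdl.
have fE : f = f %/ g * g by rewrite divnK ?dvdn_gcdr.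
have cop := coprime_quotient_gcd f e0; rewrite -/g in cop.
have mE : m = q * (e %/ g) ^ k * g ^ k by rewrite qE {1}eE expnMn mulnA.
rewrite expnMn mE dvdn_pmul2r ?expn_gt0 ?g0 // expnMn Gauss_dvd; last by rewrite coprimeXl ?coprimeXr.
rewrite dvdn_mull //=; move: fm; rewrite {1}fE expnMn mE dvdn_pmul2r ?expn_gt0 ?g0 //.
Qed.

(** The admissible [e] are closed under least common multiples, so they are the divisors of the
    largest one. This makes Moebius inversion applicable to minimality. *)
Lemma twist_dvdE e : 0 < e -> twist_dvd e = (e %| twist_max).
Proof.
move=> e0; apply/idP/idP => [te|]; last first.
  move=> /dvdnP [k kE]; have := twist_max_dvd; rewrite /twist_dvd kE !expnMn => /andP[h1 h2].
  by rewrite (dvdn_trans (dvdn_mull _ _) h1) // (dvdn_trans (dvdn_mull _ _) h2).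
set f := twist_max; have f0 : 0 < f := twist_max_gt0.
set g := gcdn e f; have g0 : 0 < g by rewrite gcdn_gt0 e0.
have := twist_max_dvd; rewrite -/f => tf.
have : twist_dvd (e %/ g * (f %/ g) * g).
  by case/andP: te => h1 h2; case/andP: tf => h3 h4; rewrite /twist_dvd !dvdn_exp_lcm.
move/leq_twist_max; rewrite -/f -mulnA divnK ?dvdn_gcdr // -{2}[f]mul1n leq_pmul2r // => le.
have eE : e = e %/ g * g by rewrite divnK ?dvdn_gcdl.
have : 0 < e %/ g by rewrite divn_gt0 // dvdn_leq // dvdn_gcdl.
by move=> lt; rewrite eE (_ : e %/ g = 1) ?mul1n ?dvdn_gcdr //; apply/eqP; rewrite eqn_leq le.
Qed.

Definition minimal_model := ~~ [exists l : 'I_(`|A| + `|B|).+1, prime l && twist_dvd l].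

Lemma minimal_modelP : minimal_model <-> ~ exists l : nat, [/\ prime l, (l%:Z ^+ 4 %| A)%Z & (l%:Z ^+ 6 %| B)%Z].
Proof.
have E l : twist_dvd l = (l%:Z ^+ 4 %| A)%Z && (l%:Z ^+ 6 %| B)%Z.
  by rewrite /twist_dvd !dvdzE !abszX.
rewrite /minimal_model; split.
  move=> /existsPn H [l [pl h1 h2]].
  have tl : twist_dvd l by rewrite E h1.
  have lt : l < (`|A| + `|B|).+1 by rewrite ltnS twist_dvd_leq.
  by have := H (Ordinal lt); rewrite /= pl tl.
move=> H; apply/existsPn => l; apply/negP => /andP[pl]; rewrite E => /andP[h1 h2].
by apply: H; exists l.
Qed.

Lemma minimal_twist_max : minimal_model = (twist_max == 1).
Proof.
apply/idP/eqP => [/existsPn H|H].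
  apply/eqP; apply: contraT => ne; have f0 := twist_max_gt0.
  have pp : prime (pdiv twist_max) by rewrite pdiv_prime //; case: twist_max f0 ne => [|[]].
  have tp : twist_dvd (pdiv twist_max) by rewrite twist_dvdE ?pdiv_dvd // prime_gt0.
  have lt : pdiv twist_max < (`|A| + `|B|).+1 by rewrite ltnS twist_dvd_leq.
  by have := H (Ordinal lt); rewrite /= pp tp.
apply/existsPn => l; apply/negP => /andP[pl tl].
by move: tl; rewrite twist_dvdE ?prime_gt0 // H dvdn1 => /eqP l1; rewrite l1 in pl.
Qed.

Lemma sum_mobius_twist N : `|A| + `|B| <= N ->
  (\sum_(1 <= e < N.+1 | twist_dvd e) mobius e = minimal_model%:R)%R.
Proof.
move=> le; rewrite minimal_twist_max -(@sum_mobius twist_max N) ?twist_max_gt0 //; last first.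
  by apply: leq_trans le; apply: twist_dvd_leq; apply: twist_max_dvd.
rewrite big_seq_cond [RHS]big_seq_cond; apply: eq_bigl => e.
rewrite mem_index_iota; case: (posnP e) => [->//|e0].
by rewrite twist_dvdE.
Qed.

End TwistDivisors.

Local Open Scope ring_scope.

(** * Integral roots of the 3-division polynomial *)

Definition psi3 (A B a : int) : int := 3 * a ^+ 4 + 6 * A * a ^+ 2 + 12 * B * a - A ^+ 2.

(** The denominator [v] of a root divides the leading coefficient 3. If [v = 3], the equation gives
    [3 | u ^ 4], against coprimality. *)
Lemma psi3_integral_root (A B : int) :
  (exists e : rat, 3 * e ^+ 4 + 6 * A%:~R * e ^+ 2 + 12 * B%:~R * e - A%:~R ^+ 2 = 0) <->
  exists a : int, psi3 A B a = 0.
Proof.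
split=> [[e E]|[a E]]; last first.
  exists a%:~R; have /(congr1 (fun z : int => z%:~R : rat)) := E.
  by rewrite mulr0z => <-; rewrite /psi3; ring.
pose u := numq e; pose v := denq e.
have v0 : v != 0 by apply: denq_neq0.
have vr0 : (v%:~R : rat) != 0 by rewrite intr_eq0.
have eE : e = u%:~R / v%:~R by rewrite divq_num_den.
have E2 : 3 * u ^+ 4 + 6 * A * u ^+ 2 * v ^+ 2 + 12 * B * u * v ^+ 3 - A ^+ 2 * v ^+ 4 = 0.
  apply/eqP; rewrite -(intr_eq0 rat); apply/eqP.
  transitivity ((3 * e ^+ 4 + 6 * A%:~R * e ^+ 2 + 12 * B%:~R * e - A%:~R ^+ 2) * v%:~R ^+ 4); last by rewrite E mul0r.
  by rewrite eE !(rmorphD, rmorphB, rmorphM, rmorphXn) /=; field.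
have cop : coprimez v (u ^+ 4).
  by rewrite coprimezE /= ?abszX ?coprimeXr // coprime_sym; have := coprime_num_den e.
have v3 : (v %| 3)%Z.
  rewrite -(Gauss_dvdzl _ cop); apply/dvdzP.
  exists (- (6 * A * u ^+ 2 * v + 12 * B * u * v ^+ 2 - A ^+ 2 * v ^+ 3)).
  by apply/eqP; rewrite -subr_eq0 -E2; apply/eqP; ring.
have vpos : 0 < v by apply: denq_gt0.
have [v1|v3'] : v = 1 \/ v = 3.
- have aux (w : int) : 0 < w -> (`|w| %| 3)%N -> w = 1 \/ w = 3.
    move=> w0 wd; have le : (`|w| <= 3)%N by apply: dvdn_leq.
    have : w <> 2 by move=> w2; rewrite w2 in wd.
    by move: w0 le; clear; lia.
  by apply: aux => //; move: v3; rewrite dvdzE.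
- exists u; rewrite /psi3 -E2 v1; ring.
exfalso; rewrite v3' in E2 cop.
have : (3 %| u ^+ 4)%Z.
  apply/dvdzP; exists (9 * A ^+ 2 - 6 * A * u ^+ 2 - 36 * B * u).
  have : 3 * (u ^+ 4 - (9 * A ^+ 2 - 6 * A * u ^+ 2 - 36 * B * u) * 3) = 0 by rewrite -E2; ring.
  by move/eqP; rewrite mulf_eq0 /= subr_eq0 => /eqP.
move: cop; rewrite /coprimez => /eqP; rewrite /gcdz => -[g1] ; rewrite dvdzE => d.
by have : (`|3%R| %| gcdn `|3%R| `|u ^+ 4|)%N; [rewrite dvdn_gcd d dvdnn | rewrite [gcdn _ _]g1].
Qed.

Lemma psi3_param (A B a : int) : a != 0 -> psi3 A B a = 0 <->
  exists D, A = 3 * a ^+ 2 + 6 * D /\ a * B = 3 * D ^+ 2 - a ^+ 4.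
Proof.
move=> a0; rewrite /psi3; split=> [E|[D [-> E]]]; last first.
  transitivity (12 * (a * B) - 36 * D ^+ 2 + 12 * a ^+ 4); first by ring.
  by rewrite E; ring.
have [A1 AE] : exists A1, A = 3 * A1.
  have : (3 %| A ^+ 2)%Z.
    apply/dvdzP; exists (a ^+ 4 + 2 * A * a ^+ 2 + 4 * B * a).
    by apply/eqP; rewrite -subr_eq0 -oppr_eq0 -E; apply/eqP; ring.
  rewrite dvdzE abszX Euclid_dvdX // => /andP[h _].
  have /dvdzP [A1 AE] : (3 %| A)%Z by rewrite dvdzE.
  by exists A1; rewrite AE mulrC.
pose C := A1 - a ^+ 2.
have E1 : 3 * C ^+ 2 = 4 * (a * B + a ^+ 4).
  apply: (mulfI (_ : 3 != 0)) => //; rewrite AE in E.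
  by apply/eqP; rewrite -subr_eq0 -oppr_eq0 -E /C; apply/eqP; ring.
have [D DE] : exists D, C = 2 * D.
  have : (2 %| 3 * C ^+ 2)%Z by rewrite E1; apply/dvdzP; exists (2 * (a * B + a ^+ 4)); ring.
  rewrite dvdzE abszM abszX Gauss_dvdr // Euclid_dvdX // => /andP[h _].
  have /dvdzP [D DE] : (2 %| C)%Z by rewrite dvdzE.
  by exists D; rewrite DE mulrC.
exists D; split; first by rewrite AE -(subrK (a ^+ 2) A1) -/C DE; ring.
apply: (mulfI (_ : 4 != 0)) => //; rewrite DE in E1.
by apply/eqP; rewrite -subr_eq0; apply/eqP; transitivity (4 * (a * B + a ^+ 4) - 3 * (2 * D) ^+ 2); [ring | rewrite -E1 subrr].
Qed.

(** In this parametrization [a ^ 2] times [4 A ^ 3 + 27 B ^ 2] is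
    [27 (a ^ 2 + D) ^ 3 (5 a ^ 2 + 9 D)]. *)
Lemma disc_param (a D B : int) : a != 0 -> a * B = 3 * D ^+ 2 - a ^+ 4 ->
  4 * (3 * a ^+ 2 + 6 * D) ^+ 3 + 27 * B ^+ 2 = 0 -> D = - a ^+ 2 \/ 9 * D = - (5 * a ^+ 2).
Proof.
move=> a0 E d0; have : 27 * ((a ^+ 2 + D) ^+ 3 * (5 * a ^+ 2 + 9 * D)) = 0.
  transitivity (a ^+ 2 * (4 * (3 * a ^+ 2 + 6 * D) ^+ 3 + 27 * B ^+ 2)); last by rewrite d0 mulr0.
  transitivity (4 * a ^+ 2 * (3 * a ^+ 2 + 6 * D) ^+ 3 + 27 * (a * B) ^+ 2); last by ring.
  by rewrite E; ring.
move/eqP; rewrite !mulf_eq0 /= => /orP[|] /eqP H; [left | right]; last first.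
  by apply/eqP; rewrite -subr_eq0 -H; apply/eqP; ring.
apply/eqP; rewrite -addr_eq0 addrC; move/eqP: H.
by rewrite !orbb.
Qed.

(** Eliminating [B] from the two equations. The conclusion makes [-3 r b] a square, which is why two
    roots are rare. *)
Lemma psi3_two_roots (A B r b : int) : r != b -> r != 0 -> b != 0 ->
  psi3 A B r = 0 -> psi3 A B b = 0 -> (A + 3 * r * b) ^+ 2 = - 3 * r * b * (r - b) ^+ 2.
Proof.
rewrite /psi3 => rb r0 b0 Er Eb.
have H : (r - b) * ((A + 3 * r * b) ^+ 2 + 3 * r * b * (r - b) ^+ 2) = 0.
  transitivity (r * (3 * b ^+ 4 + 6 * A * b ^+ 2 + 12 * B * b - A ^+ 2) * (-1)
     + b * (3 * r ^+ 4 + 6 * A * r ^+ 2 + 12 * B * r - A ^+ 2)); last by rewrite Er Eb !mulr0 mul0r addr0.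
  by ring.
move/eqP: H; rewrite mulf_eq0 subr_eq0 (negPf rb) /= addr_eq0 => /eqP ->.
by ring.
Qed.

End MinimalModels.

From mathcomp Require Import finmap.
From mathcomp Require Import all_classical all_reals all_analysis.
From mathcomp Require Import measurable_realfun ring lra zify.
Import Order.TTheory GRing.Theory Num.Theory numFieldNormedType.Exports.
Local Open Scope classical_set_scope.
Local Open Scope ring_scope.

Local Notation truncn := Num.truncn.

(** * Asymptotic sums *)

Section PartialSums.
Variable R : realType.
Implicit Types (u v : nat -> R) (l : R).

Definition psum u N : R := \sum_(1 <= g < N.+1) u g.

Lemma psumS u N : psum u N.+1 = psum u N + u N.+1.
Proof. by rewrite /psum big_nat_recr. Qed.

Lemma psum0 u : psum u 0 = 0.
Proof. by rewrite /psum big_nil. Qed.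

Lemma psum_series u : psum u = series (fun k => u k.+1).
Proof. by apply/funext => N; rewrite /psum /series /= big_add1. Qed.

Lemma psum_is_cvg u v (M : R) : (forall g, (0 < g)%N -> `|u g| <= v g) ->
  (forall N, psum v N <= M) -> exists l, psum u @ \oo --> l.
Proof.
move=> uv vM; exists (limn (psum u)); suff : cvgn (psum u) by [].
rewrite psum_series; apply: normed_cvg; apply: nondecreasing_is_cvgn.
  by apply/nondecreasing_seqP => n; rewrite /= /series /= big_nat_recr //= lerDl.
exists M => _ [n _ <-]; apply: le_trans (vM n); rewrite psum_series /series /=.
by apply: ler_sum => i _; apply: uv.
Qed.

Lemma cvgn_dist_le (b : nat -> R) (a l K : R) : b @ \oo --> l ->
  (\forall N \near \oo, `|a - b N| <= K) -> `|a - l| <= K.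
Proof.
move=> bl H; have c : (fun N => `|a - b N|) @ \oo --> `|a - l|.
  by apply: cvg_norm; apply: cvgB => //; apply: cvg_cst.
by rewrite -(cvg_lim _ c) //; apply: limr_le => //; apply: cvgP c.
Qed.

Lemma psum_inv32 N : psum (fun g => (g%:R * Num.sqrt g%:R)^-1) N <= 3.
Proof.
suff H n : psum (fun g => (g%:R * Num.sqrt g%:R)^-1) n.+1 <= 3 - 2 / Num.sqrt (n.+1%:R : R).
  case: N => [|n]; first by rewrite psum0.
  by apply: le_trans (H n) _; rewrite gerBl divr_ge0 ?sqrtr_ge0.
elim: n => [|n IH].
  by rewrite psumS psum0 add0r sqrtr1 mulr1 invr1 mulr1; lra.
rewrite psumS; apply: le_trans (lerD IH (lexx _)) _.
set p := Num.sqrt n.+1%:R; set q := Num.sqrt n.+2%:R.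
have p0 : 0 < p by rewrite sqrtr_gt0 ltr0n.
have q0 : 0 < q by rewrite sqrtr_gt0 ltr0n.
have pE : p ^+ 2 = n.+1%:R by rewrite sqr_sqrtr // ler0n.
have qE : q ^+ 2 = n.+2%:R by rewrite sqr_sqrtr // ler0n.
have E : q ^+ 2 = p ^+ 2 + 1 by rewrite pE qE -natr1.
have pq : p <= q by rewrite ler_sqrt ?ler_nat ?ltr0n.
rewrite -qE.
have -> : (q ^+ 2 * q)^-1 = (q ^+ 3)^-1 by rewrite -exprSr.
suff : (q ^+ 3)^-1 <= 2 / p - 2 / q by lra.
have -> : 2 / p - 2 / q = 2 / (p * q * (p + q)).
  have : (q - p) * (p + q) = 1 by rewrite (_ : 1 = q ^+ 2 - p ^+ 2); [ring | rewrite E; ring].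
  move=> H; rewrite -[2 in RHS]mulr1 -H; field; rewrite !gt_eqF ?addr_gt0 //.
rewrite ler_pdivlMr; last by rewrite !mulr_gt0 ?addr_gt0.
rewrite mulrC ler_pdivrMr ?exprn_gt0 //.
have -> : 2 * q ^+ 3 = q * q * (q + q) by ring.
by apply: ler_pM; rewrite ?mulr_ge0 ?addr_ge0 ?(ltW p0) ?(ltW q0) ?lerD ?ler_wpM2r // (ltW q0).
Qed.

Lemma psum_inv2 N : psum (fun g => (g%:R ^+ 2)^-1) N <= 2.
Proof.
suff H n : psum (fun g => (g%:R ^+ 2)^-1) n.+1 <= 2 - (n.+1%:R : R)^-1.
  case: N => [|n]; first by rewrite psum0.
  by apply: le_trans (H n) _; rewrite gerBl invr_ge0.
elim: n => [|n IH]; first by rewrite psumS psum0; lra.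
rewrite psumS; apply: le_trans (lerD IH (lexx _)) _.
suff : (n.+2%:R ^+ 2)^-1 <= (n.+1%:R : R)^-1 - n.+2%:R^-1.
  by move: (n.+2%:R ^- 2) (n.+1%:R^-1) (n.+2%:R^-1) => a b c; lra.
have n1 : (0 : R) < n.+1%:R by rewrite ltr0n.
have n2 : (n.+2%:R : R) = n.+1%:R + 1 by rewrite natr1.
rewrite n2; move: (n.+1%:R) n1 => x x0.
have -> : x^-1 - (x + 1)^-1 = (x * (x + 1))^-1 by field; rewrite !gt_eqF //; lra.
by rewrite lef_pV2 ?posrE ?mulr_gt0 ?exprn_gt0 ?addr_gt0 // expr2 ler_pM2r ?lerDl //; lra.
Qed.

Lemma ln_le_pow4 (x : R) : 0 < x -> ln x <= 4 * x `^ (1/4).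
Proof.
move=> x0; have : ln (x `^ (1/4)) < x `^ (1/4) by apply: ln_sublinear; apply: powR_gt0.
by rewrite ln_powR; lra.
Qed.

Lemma ln_le_sqrt (x : R) : 0 < x -> ln x <= 2 * Num.sqrt x.
Proof.
move=> x0; have : ln (x `^ (1/2)) < x `^ (1/2) by apply: ln_sublinear; apply: powR_gt0.
by rewrite ln_powR div1r powR12_sqrt ?(ltW x0) //; move: (Num.sqrt x) => s; lra.
Qed.

End PartialSums.

(** * Functions with an expansion x^2 (c log x + c') and error x^(7/4) *)

Section Asymptotics.
Variable R : realType.
Implicit Types (F G : R -> R) (c x : R).

(** The exponent 7/4 is what the hyperbola method delivers below. It exceeds 3/2, which makes the
    integral of [err (hfun b)] converge, as well as the sum of [g ^ 2 err (g ^ (-2))]. *)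
Definition err x : R := x `^ (7/4).

(** The bound includes small [x], because [x] will be replaced by [T * hfun b] and [x / g ^ 2]. The
    constant [c'] is left existential; it collects into [c_2]. *)
Definition good F c := exists c' C : R, forall x, 0 < x ->
  `|F x - x ^+ 2 * (c * ln x + c')| <= C * err x.

Lemma err_gt0 x : 0 < x -> 0 < err x.
Proof. exact: powR_gt0. Qed.

Lemma err_ge0 x : 0 <= err x.
Proof. exact: powR_ge0. Qed.

Lemma errM x y : 0 <= x -> 0 <= y -> err (x * y) = err x * err y.
Proof. exact: powRM. Qed.

Lemma errV x : 0 < x -> err x^-1 = (err x)^-1.
Proof.
move=> x0; apply: (mulfI (_ : err x != 0)); first by rewrite gt_eqF ?err_gt0.
rewrite -errM ?invr_ge0 ?ltW // mulfV ?gt_eqF // mulfV ?gt_eqF ?err_gt0 //.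
by rewrite /err powR1.
Qed.

Lemma good_ext F G c : (forall x, 0 < x -> F x = G x) -> good G c -> good F c.
Proof. by move=> FG [c' [C H]]; exists c', C => x x0; rewrite FG // H. Qed.

Lemma goodD F G c d : good F c -> good G d -> good (fun x => F x + G x) (c + d).
Proof.
move=> [c' [C H]] [d' [D K]]; exists (c' + d'), (C + D) => x x0.
rewrite (_ : _ - _ = (F x - x ^+ 2 * (c * ln x + c')) + (G x - x ^+ 2 * (d * ln x + d'))); last by ring.
by apply: le_trans (ler_normD _ _) _; rewrite mulrDl lerD ?H ?K.
Qed.

Lemma goodZ (k : R) F c : good F c -> good (fun x => k * F x) (k * c).
Proof.
move=> [c' [C H]]; exists (k * c'), (`|k| * C) => x x0.
rewrite (_ : _ - _ = k * (F x - x ^+ 2 * (c * ln x + c'))); last by ring.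
by rewrite normrM -[leRHS]mulrA; apply: ler_wpM2l => //; apply: H.
Qed.

Lemma good_dil (m : R) F c : 0 < m -> good F c -> good (fun x => F (x / m)) (c / m ^+ 2).
Proof.
move=> m0 [c' [C H]]; exists ((c' - c * ln m) / m ^+ 2), (C / err m) => x x0.
have := H (x / m) (divr_gt0 x0 m0); rewrite ln_div ?posrE //.
rewrite errM ?invr_ge0 ?(ltW m0) ?(ltW x0) // errV // mulrA [C / _ * _]mulrAC.
by congr (`| _ - _| <= _); field; rewrite gt_eqF.
Qed.

Lemma err_ge1 x k : 1 <= x -> k <= 7/4 -> x `^ k <= err x.
Proof. by move=> x1 k1; apply: ler_powR. Qed.

Lemma err_le1 x k : 0 < x <= 1 -> 7/4 <= k -> x `^ k <= err x.
Proof. by move=> x1 k1; apply: ger_powR. Qed.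

Lemma sqr_le_err x : 0 < x <= 1 -> x ^+ 2 <= err x.
Proof.
move=> x1; have x0 : 0 <= x by case/andP: x1 => /ltW.
by rewrite -powR_mulrn //; apply: err_le1 => //; lra.
Qed.

Lemma sqr_ln_le_err x : 0 < x <= 1 -> x ^+ 2 * `|ln x| <= 4 * err x.
Proof.
move=> /andP[x0 x1]; rewrite ler0_norm ?ln_le0 // -lnV ?posrE //.
have H := ln_le_pow4 (_ : 0 < x^-1); rewrite invr_gt0 in H.
apply: le_trans (ler_wpM2l _ (H x0)) _; first by rewrite exprn_ge0 ?ltW.
rewrite mulrCA ler_pM2l // -powR_inv1 ?(ltW x0) // -powRrM -powR_mulrn ?(ltW x0) // -powRD.
  by rewrite /err (_ : 2%:R + -1 * (1/4) = 7/4 :> R) //; field.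
by rewrite (gt_eqF x0) implybT.
Qed.

(** On the unit interval the main term itself is at most a multiple of [err], so a function
    vanishing there needs an estimate only for [x >= 1]. *)
Lemma good_zero F c : (forall x, 0 < x < 1 -> F x = 0) ->
  (exists c' C, forall x, 1 <= x -> `|F x - x ^+ 2 * (c * ln x + c')| <= C * err x) -> good F c.
Proof.
move=> F0 [c' [C H]]; exists c', (`|C| + (`|c| * 4 + `|c'|)) => x x0.
have [x1|x1] := lerP 1 x.
  apply: le_trans (H x x1) _; apply: ler_wpM2r; first exact: err_ge0.
  by apply: le_trans (ler_norm C) _; rewrite lerDl addr_ge0 ?mulr_ge0.
have x01 : 0 < x <= 1 by rewrite x0 ltW.
rewrite F0 ?x0 // sub0r normrN.
apply: le_trans (_ : (`|c| * 4 + `|c'|) * err x <= _); last by apply: ler_wpM2r; rewrite ?err_ge0 ?lerDr.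
rewrite mulrDr; apply: le_trans (ler_normD _ _) _; rewrite mulrDl lerD //.
  rewrite mulrCA normrM -mulrA; apply: ler_wpM2l => //.
  rewrite normrM ger0_norm ?exprn_ge0 ?(ltW x0) //.
  exact: sqr_ln_le_err.
rewrite normrM mulrC; apply: ler_wpM2l => //.
by rewrite ger0_norm ?exprn_ge0 ?(ltW x0) // sqr_le_err.
Qed.

(* Since [F] is controlled on the whole half-line, the sum over [g] can be taken over all [g]. *)
Lemma good_sum F c (w : nat -> R) (W : R) (S : R -> R) : good F c ->
  (forall g, (0 < g)%N -> `|w g| <= g%:R ^+ 2) ->
  psum (fun g => w g / g%:R ^+ 4) @ \oo --> W ->
  (forall x, 0 < x -> \forall N \near \oo, S x = psum (fun g => w g * F (x / g%:R ^+ 2)) N) ->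
  good S (c * W).
Proof.
move=> [c' [C H]] w2 cW SE.
have C0 : 0 <= C by have := H 1 ltr01; rewrite /err powR1 mulr1; apply: le_trans.
have r0 g : (0 < g)%N -> (0 : R) < g%:R by rewrite ltr0n.
(* The series with the extra [ln g] is dominated by the sum of [2 g ^ (-3/2)]. *)
have [L cL] : exists L : R, psum (fun g => w g * ln (g%:R) / g%:R ^+ 4) @ \oo --> L.
  apply: (@psum_is_cvg _ _ (fun g => 2 * (g%:R * Num.sqrt g%:R)^-1) (2 * 3)) => [g g0|N]; last first.
    by rewrite /psum -mulr_sumr ler_pM2l //; apply: psum_inv32.
  have g1 := r0 g g0; have l0 : 0 <= ln (g%:R : R) by rewrite ln_ge0 // ler1n.
  rewrite normrM normfV [in `|_ ^+ 4|]ger0_norm ?exprn_ge0 // normrM [ `|ln _|]ger0_norm //.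
  apply: le_trans (_ : (g%:R ^+ 2 * (2 * Num.sqrt g%:R)) / g%:R ^+ 4 <= _).
    by rewrite ler_pM2r ?invr_gt0 ?exprn_gt0 // ler_pM ?w2 ?ln_le_sqrt.
  have s0 : 0 < Num.sqrt (g%:R : R) by rewrite sqrtr_gt0.
  have sE : (g%:R : R) = Num.sqrt g%:R ^+ 2 by rewrite sqr_sqrtr // ltW.
  by move: s0 sE; move: (Num.sqrt _) => s s0 ->; rewrite le_eqVlt; apply/orP; left; apply/eqP; field; rewrite gt_eqF.
(* [ln (x / g ^ 2) = ln x - 2 ln g] sends [- 2 c L] into the constant term; the factor 3 bounds the
   sum of [g ^ (-3/2)]. *)
exists (c' * W - 2 * c * L), (C * 3) => x x0.
have cvg : (fun N => x ^+ 2 * ((c * ln x + c') * psum (fun g => w g / g%:R ^+ 4) N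
     - 2 * c * psum (fun g => w g * ln g%:R / g%:R ^+ 4) N)) @ \oo -->
     x ^+ 2 * (c * W * ln x + (c' * W - 2 * c * L)).
  rewrite (_ : c * W * ln x + _ = (c * ln x + c') * W - 2 * c * L); last by ring.
  by apply: cvgMr; apply: cvgB; apply: cvgMr.
apply: (cvgn_dist_le cvg); near=> N.
have -> : S x = psum (fun g => w g * F (x / g%:R ^+ 2)) N by near: N; apply: SE.
rewrite /psum !mulr_sumr -sumrB mulr_sumr -sumrB.
apply: le_trans (ler_norm_sum _ _ _) _.
apply: le_trans (_ : C * err x * psum (fun g => (g%:R * Num.sqrt g%:R)^-1) N <= _); last first.
  rewrite [leRHS]mulrAC ler_wpM2l ?mulr_ge0 ?err_ge0 //; exact: psum_inv32.
rewrite /psum mulr_sumr big_nat_cond [leRHS]big_nat_cond; apply: ler_sum => g; rewrite andbT => /andP[g0 _].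
have g1 := r0 g g0; have g2 : (0 : R) < g%:R ^+ 2 by rewrite exprn_gt0.
have := H (x / g%:R ^+ 2) (divr_gt0 x0 g2); rewrite ln_div ?posrE // lnXn //.
set G := F _ => HG.
rewrite (_ : _ - _ = w g * (G - (x / g%:R ^+ 2) ^+ 2 * (c * (ln x - ln g%:R *+ 2) + c'))); last first.
  by field; rewrite gt_eqF.
rewrite normrM; apply: le_trans (ler_pM _ _ (w2 g g0) HG) _ => //.
have gE : err (g%:R ^+ 2) = g%:R ^+ 3 * Num.sqrt g%:R.
  rewrite /err -!powR_mulrn ?ltW // -powRrM -powR12_sqrt ?ltW // -powRD; last by rewrite (gt_eqF g1) implybT.
  by congr (_ `^ _); lra.
have s0 : 0 < Num.sqrt (g%:R : R) by rewrite sqrtr_gt0.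
rewrite errM ?invr_ge0 ?(ltW x0) ?(ltW g2) // errV // gE.
by rewrite le_eqVlt; apply/orP; left; apply/eqP; field; rewrite !gt_eqF.
Unshelve. all: by end_near. Qed.

End Asymptotics.

Lemma sum_dvdn_reindex (V : nmodType) g N (f : nat -> V) : (0 < g)%N ->
  \sum_(1 <= n < N.+1 | (g %| n)%N) f n = \sum_(1 <= m < (N %/ g).+1) f (m * g)%N.
Proof.
move=> g0; rewrite -big_filter -[RHS](big_map (fun m => (m * g)%N) xpredT f); apply: perm_big.
apply: uniq_perm; rewrite ?filter_uniq ?iota_uniq //.
  by rewrite map_inj_uniq ?iota_uniq // => a b /eqP; rewrite eqn_pmul2r // => /eqP.
move=> n; rewrite mem_filter mem_index_iota; apply/andP/mapP => [[/dvdnP[m ->] /andP[m0 mN]]|[m]].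
  rewrite ltnS in mN; exists m => //; rewrite mem_index_iota ltnS leq_divRL // mN andbT.
  by case: m m0 {mN}.
rewrite mem_index_iota ltnS leq_divRL // => /andP[m0 mN] ->.
by rewrite dvdn_mull // muln_gt0 m0 g0 ltnS.
Qed.

(** * The inverse of a Dirichlet series with completely multiplicative coefficients 0 and 1 *)

Section MobiusSeries.
Variable R : realType.
Variable chi : pred nat.
Hypothesis chi1 : chi 1%N.
Hypothesis chiM : forall a b, chi (a * b)%N = chi a && chi b.
Variable s : nat.
Hypothesis s2 : (1 < s)%N.

Definition mu g : R := (mobius g)%:~R.

Lemma mu_norm g : `|mu g| <= 1.
Proof. by rewrite /mu -intr_norm -[1]/(1%:~R) ler_int mobius_norm. Qed.

Definition dirichlet m : R := (chi m)%:R / m%:R ^+ s.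

Lemma dirichlet_ge0 m : 0 <= dirichlet m.
Proof. by rewrite /dirichlet divr_ge0 ?exprn_ge0. Qed.

Lemma invX_le2 m : (0 < m)%N -> (m%:R ^+ s)^-1 <= (m%:R ^+ 2)^-1 :> R.
Proof.
move=> m0; rewrite lef_pV2 ?posrE ?exprn_gt0 ?ltr0n //.
by apply: ler_weXn2l => //; rewrite ler1n.
Qed.

Lemma dirichlet_le m : (0 < m)%N -> dirichlet m <= (m%:R ^+ 2)^-1.
Proof.
move=> m0; apply: le_trans (invX_le2 m0); rewrite /dirichlet.
by rewrite -[leRHS]mul1r ler_wpM2r ?invr_ge0 ?exprn_ge0 // lern1 leq_b1.
Qed.

Lemma dirichlet_cvg : exists Z : R, psum dirichlet @ \oo --> Z.
Proof.
apply: (@psum_is_cvg _ _ (fun g => (g%:R ^+ 2)^-1) 2) => [g g0|N]; last exact: psum_inv2.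
by rewrite ger0_norm ?dirichlet_ge0 ?dirichlet_le.
Qed.

Section Tail.
Variable Z : R.
Hypothesis ZE : psum dirichlet @ \oo --> Z.

Lemma dirichlet_tail k : (0 < k)%N -> `|Z - psum dirichlet k| <= k%:R^-1.
Proof.
move=> k0; rewrite distrC; apply: (cvgn_dist_le ZE).
have H m : 0 <= psum dirichlet (k + m) - psum dirichlet k <= k%:R^-1 - (k + m)%:R^-1.
  elim: m => [|m /andP[IH1 IH2]]; first by rewrite addn0 !subrr lexx.
  rewrite addnS psumS; apply/andP; split.
    by have := dirichlet_ge0 (k + m).+1; lra.
  have := dirichlet_le (ltn0Sn (k + m)).
  have x0 : 0 < ((k + m)%:R : R) by rewrite ltr0n addn_gt0 k0.
  have : ((k + m).+1%:R ^+ 2)^-1 <= (k + m)%:R^-1 - (k + m).+1%:R^-1 :> R.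
    rewrite -natr1; move: (k + m)%:R x0 => x x0.
    have -> : x^-1 - (x + 1)^-1 = (x * (x + 1))^-1 by field; rewrite !gt_eqF //; lra.
    by rewrite lef_pV2 ?posrE ?mulr_gt0 ?exprn_gt0 ?addr_gt0 // expr2 ler_pM2r ?lerDl //; lra.
  move: IH2; move: (psum _ _) (psum _ _) (dirichlet _) ((k + m).+1%:R ^- 2) ((k + m).+1%:R^-1) ((k + m)%:R^-1) (k%:R^-1).
  by move=> a b c d e f g; lra.
near=> N; have kN : (k <= N)%N by near: N; apply: nbhs_infty_ge.
rewrite distrC; have := H (N - k)%N; rewrite subnKC // => /andP[h1 h2].
rewrite ger0_norm //; apply: le_trans h2 _.
by rewrite gerBl invr_ge0.
Unshelve. all: by end_near. Qed.

Lemma dirichlet_ge1 : 1 <= Z.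
Proof.
have <- : psum dirichlet 1 = 1.
  by rewrite psumS psum0 /dirichlet chi1 expr1n divr1 add0r.
rewrite -(cvg_lim _ ZE) //; apply: nondecreasing_cvgn_le; last by apply: cvgP ZE.
by apply/nondecreasing_seqP => n; rewrite psumS lerDl dirichlet_ge0.
Qed.

(** A finite identity: grouping the terms by [n = g m] leaves the Moebius sum over the divisors of
    [n], which is nonzero only at [n = 1]. *)
Lemma mobius_inversion_sum N : (0 < N)%N ->
  \sum_(1 <= g < N.+1) mu g * dirichlet g * psum dirichlet (N %/ g) = 1.
Proof.
move=> N0.
transitivity (\sum_(1 <= g < N.+1) \sum_(1 <= n < N.+1 | (g %| n)%N) mu g * dirichlet n).
  rewrite big_nat_cond [RHS]big_nat_cond; apply: eq_bigr => g; rewrite andbT => /andP[g0 _].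
  rewrite sum_dvdn_reindex // /psum mulr_sumr; apply: eq_bigr => m _.
  rewrite -mulrA; congr (_ * _).
  rewrite /dirichlet chiM natrM exprMn; case: (chi g); case: (chi m); rewrite ?mul0r ?mulr0 //.
  by rewrite !mul1r invfM mulrC.
under eq_bigr do rewrite big_mkcond; rewrite exchange_big /=.
transitivity (\sum_(1 <= n < N.+1) dirichlet n * (n == 1%N)%:R).
  rewrite big_nat_cond [RHS]big_nat_cond; apply: eq_bigr => n; rewrite andbT => /andP[n0 nN].
  rewrite -big_mkcond /= -mulr_suml mulrC; congr (_ * _).
  have /(congr1 (fun z : int => z%:~R : R)) := @sum_mobius n N n0 nN.
  by rewrite rmorph_sum /= => ->; case: eqP.
rewrite big_ltn // eqxx mulr1 /dirichlet chi1 expr1n divr1 big_nat_cond big1 ?addr0 // => i.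
by rewrite andbT => /andP[/gtn_eqF -> _]; rewrite mulr0.
Qed.

(** In [mobius_inversion_sum] each partial sum up to [N %/ g] is replaced by [Z]. This costs at most
    the inverse of [N %/ g], hence at most [2 sqrt (g / N)], and the sum of [g ^ (-3/2)] is at most
    3. *)
Lemma mobius_dirichlet_le N : (0 < N)%N ->
  `|1 - Z * psum (fun g => mu g * dirichlet g) N| <= 6 / Num.sqrt N%:R.
Proof.
move=> N0; have NR : (0 : R) < N%:R by rewrite ltr0n.
have sN : 0 < Num.sqrt (N%:R : R) by rewrite sqrtr_gt0.
rewrite -{1}(mobius_inversion_sum N0) /psum mulr_sumr -sumrB.
apply: le_trans (ler_norm_sum _ _ _) _.
apply: le_trans (_ : 2 / Num.sqrt N%:R * psum (fun g => (g%:R * Num.sqrt g%:R)^-1) N <= _); last first.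
  rewrite (_ : 6 / Num.sqrt N%:R = 2 / Num.sqrt N%:R * 3); last by field; rewrite gt_eqF.
  by apply: ler_wpM2l; rewrite ?divr_ge0 ?(ltW sN) //; apply: psum_inv32.
rewrite /psum mulr_sumr big_nat_cond [leRHS]big_nat_cond; apply: ler_sum => g; rewrite andbT => /andP[g0 gN].
have gR : (0 : R) < g%:R by rewrite ltr0n.
have k0 : (0 < N %/ g)%N by rewrite divn_gt0.
rewrite [Z * _]mulrC -mulrBr normrM [ `|mu g * _|]normrM.
have -> : 2 / Num.sqrt N%:R / (g%:R * Num.sqrt g%:R) = (1 * (g%:R ^+ 2)^-1) * (2 * Num.sqrt g%:R / Num.sqrt N%:R) :> R.
  have s0 : 0 < Num.sqrt (g%:R : R) by rewrite sqrtr_gt0.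
  have sE : (g%:R : R) = Num.sqrt g%:R ^+ 2 by rewrite sqr_sqrtr // ltW.
  by move: s0 sE; move: (Num.sqrt g%:R) => p p0 ->; field; rewrite !gt_eqF.
apply: ler_pM; rewrite ?mulr_ge0 //.
  by apply: ler_pM; rewrite ?mu_norm // ger0_norm ?dirichlet_ge0 ?dirichlet_le.
rewrite distrC; apply: le_trans (dirichlet_tail k0) _.
rewrite ler_pdivlMr // mulrC ler_pdivrMr ?ltr0n //.
rewrite -(@ler_pXn2r _ 2) ?nnegrE ?mulr_ge0 // !exprMn !sqr_sqrtr ?ler0n //.
have : (N < (N %/ g).+1 * g)%N by rewrite -ltn_divLR.
move: (N %/ g)%N k0 => k k0 lt.
rewrite -!natrX -!natrM ler_nat; apply: ltnW; apply: leq_trans lt _.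
by clear -k0; nia.
Qed.

Lemma mobius_series : psum (fun g => mu g * dirichlet g) @ \oo --> Z^-1.
Proof.
have Z1 := dirichlet_ge1; have Z0 : 0 < Z by apply: lt_le_trans Z1.
apply/cvgrPdist_le => e e0; near=> N.
have N0 : (0 < N)%N by near: N; apply: nbhs_infty_gt.
apply: le_trans (_ : 6 / Num.sqrt N%:R <= _).
  have := mobius_dirichlet_le N0; set m := psum _ N => H.
  have -> : Z^-1 - m = (1 - Z * m) / Z by field; rewrite gt_eqF.
  rewrite normrM normfV [ `|Z|]ger0_norm ?(ltW Z0) // ler_pdivrMr //.
  by apply: le_trans H _; rewrite ler_peMr // divr_ge0 ?sqrtr_ge0.
rewrite ler_pdivrMr ?sqrtr_gt0 ?ltr0n // mulrC -ler_pdivrMr //.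
rewrite -(@ler_pXn2r _ 2) ?nnegrE ?divr_ge0 ?sqrtr_ge0 ?(ltW e0) // sqr_sqrtr ?ler0n //.
by near: N; apply: nbhs_infty_ger.
Unshelve. all: by end_near. Qed.

End Tail.
End MobiusSeries.

Lemma zeta_cvg (R : realType) s : (1 < s)%N ->
  psum (@dirichlet R xpredT s) @ \oo --> limn (fun n => \sum_(0 <= k < n) ((k.+1%:R : R) `^ s%:R)^-1).
Proof.
move=> s2; have [Z cZ] := @dirichlet_cvg R xpredT s s2.
suff -> : (fun n => \sum_(0 <= k < n) ((k.+1%:R : R) `^ s%:R)^-1) = psum (@dirichlet R xpredT s) by rewrite (cvg_lim _ cZ).
rewrite psum_series; apply/funext => n; apply: eq_bigr => k _.
by rewrite /dirichlet powR_mulrn // mul1r.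
Qed.

(** The factor 8/9 is the inverse of the Euler factor at 3. *)
Lemma dirichlet_not3 (R : realType) (Z : R) : psum (@dirichlet R xpredT 2) @ \oo --> Z ->
  psum (@dirichlet R (fun m => ~~ (3 %| m)%N) 2) @ \oo --> (8/9 * Z).
Proof.
move=> cZ.
have -> : psum (@dirichlet R (fun m => ~~ (3 %| m)%N) 2) =
    (fun N => psum (@dirichlet R xpredT 2) N - 9^-1 * psum (@dirichlet R xpredT 2) (N %/ 3)).
  apply/funext => N; apply/eqP; rewrite -subr_eq0 opprB addrCA -opprB subr_eq0; apply/eqP.
  have -> : 9^-1 * psum (@dirichlet R xpredT 2) (N %/ 3) = \sum_(1 <= n < N.+1 | (3 %| n)%N) @dirichlet R xpredT 2 n.
    rewrite sum_dvdn_reindex // /psum mulr_sumr; apply: eq_bigr => m _.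
    rewrite /dirichlet natrM /=; have [->|m0] := eqVneq (m%:R : R) 0.
      by rewrite mul0r expr0n invr0 !mulr0.
    by field.
  rewrite [LHS]big_mkcond -sumrB; apply: eq_bigr => m _; rewrite /dirichlet.
  by case: (3 %| m)%N; rewrite ?mul0r ?subr0 ?subrr.
have -> : 8/9 * Z = Z - 9^-1 * Z by field.
apply: cvgB => //; apply: cvgMr; apply: cvg_comp cZ.
apply/cvgnyPge => k; near=> N; rewrite leq_divRL //; near: N; exact: nbhs_infty_ge.
Unshelve. all: by end_near. Qed.

(** * Elementary sums of powers *)

Section PowerSums.
Variable R : realType.
Implicit Types x y : R.

Lemma truncn_bounds x : 1 <= x -> exists k : nat,
  [/\ truncn x = k, (0 < k)%N, 1 <= (k%:R : R), k%:R <= x & x < k%:R + 1].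
Proof.
move=> x1; have k0 : (0 < truncn x)%N by rewrite truncn_gt0.
have x0 : 0 <= x by apply: le_trans x1.
exists (truncn x); rewrite k0 ler1n k0 natr1; have /andP[-> ->] := truncn_itv x0.
by split.
Qed.

Lemma psum_id k : psum (fun n => n%:R) k = k%:R * (k%:R + 1) / 2 :> R.
Proof.
elim: k => [|k IH]; first by rewrite psum0 !mul0r.
by rewrite psumS IH -natr1; field.
Qed.

Lemma psum_cube k : psum (fun n => n%:R ^+ 3) k = (k%:R * (k%:R + 1) / 2) ^+ 2 :> R.
Proof.
elim: k => [|k IH]; first by rewrite psum0 !mul0r expr0n.
by rewrite psumS IH -natr1; field.
Qed.

Lemma psum_id_approx y : 0 <= y -> `|psum (fun n => n%:R) (truncn y) - y ^+ 2 / 2| <= y.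
Proof.
move=> y0; have [/truncn_bounds [k [-> k0 k1 ky yk]]|y1] := lerP 1 y.
  rewrite psum_id ler_norml; apply/andP; split; nra.
rewrite (_ : truncn y = 0%N) ?psum0 ?sub0r ?normrN; last by apply/truncn0Pn; rewrite -ltNge.
by rewrite ger0_norm; nra.
Qed.

Lemma psum_cube_approx y : 0 <= y -> `|psum (fun n => n%:R ^+ 3) (truncn y) - y ^+ 4 / 4| <= 3 * y ^+ 3.
Proof.
move=> y0; have [/truncn_bounds [k [-> k0 k1 ky yk]]|y1] := lerP 1 y; last first.
  rewrite (_ : truncn y = 0%N) ?psum0 ?sub0r ?normrN; last by apply/truncn0Pn; rewrite -ltNge.
  have y3 : 0 <= y ^+ 3 by rewrite exprn_ge0.
  by rewrite ger0_norm (exprS y 3); nra.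
rewrite psum_cube; move: (k%:R) k1 ky yk => z z1 zy yz.
have a3 : z ^+ 3 <= y ^+ 3 by rewrite ler_pXn2r ?nnegrE //; lra.
have b4 : z ^+ 4 <= y ^+ 4 by rewrite ler_pXn2r ?nnegrE //; lra.
have c4 : y ^+ 4 <= (z + 1) ^+ 4 by rewrite ler_pXn2r ?nnegrE //; lra.
rewrite ler_norml; apply/andP; split.
  apply: le_trans (_ : - 3 * z ^+ 3 <= _); first by lra.
  apply: le_trans (_ : (z * (z + 1) / 2) ^+ 2 - (z + 1) ^+ 4 / 4 <= _); last by lra.
  rewrite -subr_ge0 (_ : _ - _ = (10 * z ^+ 3 - 5 * z ^+ 2 - 4 * z - 1) / 4); last by field.
  by rewrite divr_ge0 //; nra.
apply: le_trans (_ : 3 * z ^+ 3 <= _); last by lra.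
apply: le_trans (_ : (z * (z + 1) / 2) ^+ 2 - z ^+ 4 / 4 <= _); first by lra.
rewrite -subr_ge0 (_ : _ - _ = (10 * z ^+ 3 - z ^+ 2) / 4); last by field.
by rewrite divr_ge0 //; nra.
Qed.

Lemma psum_invsqrt k : psum (fun n => (Num.sqrt n%:R)^-1) k <= 2 * Num.sqrt (k%:R : R).
Proof.
elim: k => [|k IH]; first by rewrite psum0 mulr_ge0 ?sqrtr_ge0.
rewrite psumS; apply: le_trans (lerD IH (lexx _)) _.
set p := Num.sqrt k%:R; set q := Num.sqrt k.+1%:R.
have p0 : 0 <= p by rewrite sqrtr_ge0.
have q0 : 0 < q by rewrite sqrtr_gt0 ltr0n.
have E : q ^+ 2 = p ^+ 2 + 1 by rewrite !sqr_sqrtr ?ler0n // natr1.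
rewrite -(ler_pM2r q0) mulrDl mulVf ?gt_eqF //.
have : 0 <= (q - p) ^+ 2 by rewrite sqr_ge0.
nra.
Qed.

(** [gam] is Euler's constant: the harmonic sum minus the logarithm decreases, and it increases once
    [1 / n] is subtracted. *)
Lemma harmonic_approx : exists gam : R, forall y, 1 <= y ->
  `|psum (fun n => n%:R^-1) (truncn y) - ln y - gam| <= 2 / y.
Proof.
pose a n := psum (fun n => n%:R^-1) n.+1 - ln (n.+1%:R : R).
have step n : (n.+2%:R : R)^-1 <= ln (n.+2%:R : R) - ln (n.+1%:R : R) <= n.+1%:R^-1.
  have n1 : (0 : R) < n.+1%:R by rewrite ltr0n.
  have n2 : (0 : R) < n.+2%:R by rewrite ltr0n.
  have E : n.+2%:R = n.+1%:R + 1 :> R by rewrite natr1.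
  apply/andP; split.
    rewrite -opprB -ln_div ?posrE // lerNr.
    have := @le_ln1Dx R (- n.+2%:R^-1); rewrite (_ : 1 + _ = n.+1%:R / n.+2%:R).
      by apply; rewrite ltrN2 invf_lt1 // ltr1n.
    by rewrite E; field; rewrite gt_eqF // -E.
  rewrite -ln_div ?posrE //; have := @le_ln1Dx R (n.+1%:R^-1); rewrite (_ : 1 + _ = n.+2%:R / n.+1%:R).
    by move=> H; apply: H; apply: (lt_trans (ltrN10 R)); rewrite invr_gt0.
  by rewrite E; field; rewrite gt_eqF.
have dec : nonincreasing_seq a.
  apply/nonincreasing_seqP => n; rewrite /a [in leLHS]psumS; have /andP[] := step n.
  by move: (n.+1%:R^-1) (n.+2%:R^-1) (ln _) (ln _) (psum _ _) => b c d e f; lra.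
have inc : nondecreasing_seq (fun n => a n - n.+1%:R^-1).
  apply/nondecreasing_seqP => n; rewrite /a [in leRHS]psumS; have /andP[] := step n.
  by move: (n.+1%:R^-1) (n.+2%:R^-1) (ln _) (ln _) (psum _ _) => b c d e f; lra.
have a0 n : 0 <= a n - n.+1%:R^-1.
  by apply: le_trans (inc 0%N n (leq0n n)); rewrite /a psumS psum0 ln1 add0r invr1 !subr0 subrr.
have ca : cvgn a.
  apply: nonincreasing_is_cvgn => //; exists 0 => _ [n _ <-].
  by apply: le_trans (a0 n) _; rewrite gerBl invr_ge0.
exists (limn a) => y /truncn_bounds [k [-> k0 k1 ky yk]].
case: k k0 k1 ky yk => // n _; set z := n.+1%:R => z1 zy yz.
have z0 : 0 < z by lra.
have y0 : 0 < y by lra.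
have h1 : limn a <= a n by apply: nonincreasing_cvgn_ge.
have h2 : a n - z^-1 <= limn a.
  apply: limr_ge => //; near=> m; apply: le_trans (inc n m _) _; last by rewrite gerBl invr_ge0.
  by near: m; apply: nbhs_infty_ge.
have h3 : 0 <= ln y - ln z by rewrite subr_ge0 ler_ln ?posrE.
have h4 : ln y - ln z <= z^-1.
  rewrite -ln_div ?posrE //; have := @le_ln1Dx R (y / z - 1); rewrite [1 + _]addrC subrK => H.
  apply: le_trans (H _) _.
    by rewrite ltrBrDr addNr divr_gt0.
  by rewrite -(ler_pM2r z0) mulrBl mulfVK ?gt_eqF // mulVf ?gt_eqF //; lra.
apply: le_trans (_ : z^-1 <= _); last first.
  by rewrite -(ler_pM2r y0) mulfVK ?gt_eqF // mulrC ler_pdivrMr //; lra.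
have [l lE] : exists l : R, l = limn a by exists (limn a).
move: h1 h2; rewrite -lE /a -/z; move: (psum _ _) (ln z) (ln y) (z^-1) h3 h4 => p q r w h3 h4 h1 h2.
by rewrite ler_norml; apply/andP; split; lra.
Unshelve. all: by end_near. Qed.

End PowerSums.

Lemma sum_widen0 (V : nmodType) K N (f : nat -> V) : (K <= N)%N ->
  (forall i, (K < i)%N -> f i = 0) -> \sum_(1 <= i < N.+1) f i = \sum_(1 <= i < K.+1) f i.
Proof.
move=> KN H; rewrite (@big_cat_nat _ _ _ K.+1) //= [X in _ + X]big_nat_cond [X in _ + X]big1 ?addr0 // => i.
by rewrite andbT => /andP[/H].
Qed.

(** * Weighted pairs (t, n) under the curve n t^2 = x *)

Section LatticePairs.
Variable R : realType.
Implicit Types (x : R) (chi : pred nat).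

(** By [sqrt_partE] the sum of [b s(b)] is a sum of [mu(g) b t] over [(g t) ^ 2 | b]; for
    [b = n (g t) ^ 2] the factor [b t] is [g ^ 2] times this weight, and [b <= y] becomes
    [n t ^ 2 <= y / g ^ 2]. *)
Definition weight chi x t n : R :=
  if [&& chi t, chi n & (n * t ^ 2)%:R <= x] then (n * t ^ 3)%:R else 0.

Definition pairs chi K L x := \sum_(1 <= t < K.+1) \sum_(1 <= n < L.+1) weight chi x t n.

Definition pair_sum chi x := pairs chi (truncn x) (truncn x) x.

Lemma weight_eq0 chi x t n k : x < k.+1%:R -> (0 < n)%N -> (0 < t)%N -> (k < n)%N || (k < t)%N ->
  weight chi x t n = 0.
Proof.
move=> xk n0 t0 H; rewrite /weight; case: ifP => // /and3P[_ _ le].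
have : (n * t ^ 2)%:R < k.+1%:R :> R by apply: le_lt_trans xk.
by rewrite ltr_nat ltnS leqNgt; case/orP: H => H; (have -> : (k < n * t ^ 2)%N by nia).
Qed.

Lemma pairsE chi K L x : (truncn x <= K)%N -> (truncn x <= L)%N -> pairs chi K L x = pair_sum chi x.
Proof.
move=> xK xL; have xk := truncnS_gt x; rewrite /pair_sum /pairs (sum_widen0 xK) => [|t xt]; last first.
  by rewrite big_nat_cond big1 // => n; rewrite andbT => /andP[n0 _]; rewrite (weight_eq0 _ xk) ?xt ?orbT //; lia.
rewrite big_nat_cond [RHS]big_nat_cond; apply: eq_bigr => t; rewrite andbT => /andP[t0 _].
apply: sum_widen0 => // n xn; rewrite (weight_eq0 _ xk) ?xn //; lia.
Qed.

Lemma pair_sum_lt1 chi x : x < 1 -> pair_sum chi x = 0.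
Proof.
move=> x1; rewrite /pair_sum /pairs (_ : truncn x = 0%N) ?big_geq //.
by apply/truncn0Pn; rewrite -ltNge.
Qed.

Lemma weight_dil (x : R) (t n : nat) :
  weight xpredT x t (n * 3) = 3 * weight xpredT (x / 3) t n /\
  weight xpredT x (t * 3) n = 27 * weight xpredT (x / 9) t n.
Proof.
rewrite /weight /=; split.
  rewrite ler_pdivlMr // (_ : (n * t ^ 2)%:R * 3 = (n * 3 * t ^ 2)%:R); last by rewrite !natrM; ring.
  by case: ifP => _; rewrite ?mulr0 // !natrM; ring.
rewrite ler_pdivlMr // (_ : (n * t ^ 2)%:R * 9 = (n * (t * 3) ^ 2)%:R); last by rewrite !natrM ?natrX ?natrM; ring.
by case: ifP => _; rewrite ?mulr0 // !natrM ?natrX ?natrM; ring.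
Qed.

Lemma truncn_div x k : (0 < k)%N -> 0 <= x -> (truncn (x / k%:R) <= truncn x %/ k)%N.
Proof.
move=> k0 x0; have kR : (0 : R) < k%:R by rewrite ltr0n.
have d0 : 0 <= x / k%:R by rewrite divr_ge0.
rewrite leq_divRL // truncn_ge_nat // natrM -ler_pdivlMr //.
by rewrite truncn_le.
Qed.

(** Inclusion and exclusion on [3 | n] and [3 | t]. Replacing [n] by [3 n] scales [x] by 1/3 and the
    weight by 3; replacing [t] by [3 t] scales them by 1/9 and 27. *)
Lemma pair_sum_not3 x : 0 <= x -> pair_sum (fun m => ~~ (3 %| m)%N) x =
  pair_sum xpredT x - 3 * pair_sum xpredT (x / 3) - 27 * pair_sum xpredT (x / 9)
  + 81 * pair_sum xpredT (x / 27).
Proof.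
move=> x0; set N := truncn x.
have wE t n : weight (fun m => ~~ (3 %| m)%N) x t n = weight xpredT x t n
   - (if (3 %| n)%N then weight xpredT x t n else 0) - (if (3 %| t)%N then weight xpredT x t n else 0)
   + (if (3 %| t)%N then (if (3 %| n)%N then weight xpredT x t n else 0) else 0).
  rewrite /weight; case: (3 %| t)%N; case: (3 %| n)%N => /=; ring.
have col (y : R) (t : nat) : \sum_(1 <= n < N.+1) (if (3 %| n)%N then weight xpredT y t n else 0)
    = 3 * \sum_(1 <= n < (N %/ 3).+1) weight xpredT (y / 3) t n.
  rewrite -big_mkcond sum_dvdn_reindex // mulr_sumr; apply: eq_bigr => n _.
  by case: (weight_dil y t n).
have row (f : nat -> R) : \sum_(1 <= t < N.+1) (if (3 %| t)%N then f t else 0) = \sum_(1 <= t < (N %/ 3).+1) f (t * 3)%N.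
  by rewrite -big_mkcond sum_dvdn_reindex.
have tE k : (0 < k)%N -> (truncn (x / k%:R) <= N %/ k)%N by move=> k0; apply: truncn_div.
have t3 := tE 3%N isT; have t9 := tE 9%N isT; have t27 := tE 27%N isT.
have N3 : (N %/ 3 <= N)%N by apply: leq_div.
have N9 : (N %/ 9 <= N %/ 3)%N by apply: leq_div2l.
have N27 : (N %/ 27 <= N %/ 3)%N by apply: leq_div2l.
rewrite -(@pairsE xpredT N (N %/ 3) (x / 3)) ?(leq_trans t3) //.
rewrite -(@pairsE xpredT (N %/ 3) N (x / 9)) ?(leq_trans t9) ?(leq_trans N9) //.
rewrite -(@pairsE xpredT (N %/ 3) (N %/ 3) (x / 27)) ?(leq_trans t27) //.
rewrite /pair_sum -/N /pairs.
under eq_bigr do under eq_bigr do rewrite wE.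
under eq_bigr do rewrite big_split /= !sumrB col.
rewrite big_split /= !sumrB; congr (_ - _ - _ + _).
- by rewrite mulr_sumr.
- rewrite exchange_big /=; under eq_bigr do rewrite row.
  rewrite exchange_big /= mulr_sumr; apply: eq_bigr => t _; rewrite mulr_sumr; apply: eq_bigr => n _.
  by case: (weight_dil x t n).
- rewrite exchange_big /=; under eq_bigr => n _ do rewrite (row (fun t => if (3 %| n)%N then weight xpredT x t n else 0)).
  rewrite exchange_big /= mulr_sumr; apply: eq_bigr => t _.
  rewrite col mulr_sumr mulr_sumr; apply: eq_bigr => n _.
  case: (weight_dil (x / 3) t n) => _ ->; rewrite mulrA -natrM (_ : x / 3 / 9 = x / 27) //; last by field.
Qed.

End LatticePairs.

(** * The hyperbola method *)

Section Hyperbola.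
Variable R : realType.
Implicit Types (x : R).

Lemma psum_if (u : nat -> R) K N : (K <= N)%N ->
  \sum_(1 <= n < N.+1) (if (n <= K)%N then u n else 0) = psum u K.
Proof.
move=> KN; rewrite (sum_widen0 KN) => [|i]; last by rewrite ltnNge => /negPf ->.
by rewrite /psum big_nat_cond [RHS]big_nat_cond; apply: eq_bigr => i; rewrite andbT ltnS => /andP[_ ->].
Qed.

Lemma weight_row x t N : 0 <= x -> (0 < t)%N -> (truncn x <= N)%N ->
  \sum_(1 <= n < N.+1) weight xpredT x t n = t%:R ^+ 3 * psum (fun n => n%:R) (truncn (x / t%:R ^+ 2)).
Proof.
move=> x0 t0 xN; have tR : (0 : R) < t%:R ^+ 2 by rewrite exprn_gt0 ?ltr0n.
have d0 : 0 <= x / t%:R ^+ 2 by rewrite divr_ge0 // ltW.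
have le : (truncn (x / t%:R ^+ 2) <= N)%N.
  apply: leq_trans xN; apply: le_truncn; rewrite ler_pdivrMr // ler_peMr //.
  by rewrite exprn_ege1 // ler1n.
rewrite -(psum_if _ le) mulr_sumr; apply: eq_bigr => n _.
rewrite truncn_ge_nat // ler_pdivlMr // /weight /= natrM natrX.
by case: ifP => _; rewrite ?mulr0 // natrM natrX mulrC.
Qed.

Lemma weight_col x n N : 1 <= x -> (0 < n)%N -> (truncn x <= N)%N ->
  \sum_(1 <= t < N.+1) weight xpredT x t n = n%:R * psum (fun n => n%:R ^+ 3) (truncn (Num.sqrt (x / n%:R))).
Proof.
move=> x1 n0 xN; have x0 : 0 <= x by apply: le_trans x1.
have nR : (0 : R) < n%:R by rewrite ltr0n.
have n1 : (1 : R) <= n%:R by rewrite ler1n.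
have d0 : 0 <= x / n%:R by rewrite divr_ge0 // ltW.
have le : (truncn (Num.sqrt (x / n%:R)) <= N)%N.
  apply: leq_trans xN; apply: le_truncn.
  rewrite -(@ler_pXn2r _ 2) ?nnegrE ?sqrtr_ge0 // sqr_sqrtr // ler_pdivrMr //.
  by apply: le_trans (_ : x ^+ 2 * 1 <= _); [nra | rewrite ler_wpM2l // sqr_ge0].
rewrite -(psum_if _ le) mulr_sumr; apply: eq_bigr => t _.
rewrite truncn_ge_nat ?sqrtr_ge0 // /weight /=.
have -> : ((n * t ^ 2)%:R <= x) = (t%:R <= Num.sqrt (x / n%:R)).
  rewrite -[RHS](@ler_pXn2r _ 2) ?nnegrE ?sqrtr_ge0 // sqr_sqrtr // ler_pdivlMr //.
  by rewrite natrM natrX mulrC.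
by case: ifP => _; rewrite ?mulr0 // natrM natrX.
Qed.

(** The pairs with [t <= U], plus those with [n <= M], minus those with both. A pair with [t > U]
    has [n <= M], and a pair with both satisfies [n t ^ 2 <= x] automatically. *)
Lemma hyperbola x U : 1 <= x -> (0 < U)%N -> U%:R ^+ 2 <= x ->
  let M := truncn (x / U%:R ^+ 2) in
  pair_sum xpredT x = \sum_(1 <= t < U.+1) t%:R ^+ 3 * psum (fun n => n%:R) (truncn (x / t%:R ^+ 2))
   + \sum_(1 <= n < M.+1) n%:R * psum (fun n => n%:R ^+ 3) (truncn (Num.sqrt (x / n%:R)))
   - psum (fun n => n%:R) M * psum (fun n => n%:R ^+ 3) U.
Proof.
move=> x1 U0 Ux M; have x0 : 0 <= x by apply: le_trans x1.
have U1 : (1 : R) <= U%:R by rewrite ler1n.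
have U2 : (0 : R) < U%:R ^+ 2 by rewrite exprn_gt0 ?ltr0n.
rewrite /pair_sum /pairs; set N := truncn x.
have UN : (U <= N)%N by rewrite truncn_ge_nat //; apply: le_trans Ux; nra.
have MN : (M <= N)%N.
  by apply: le_truncn; rewrite ler_pdivrMr // ler_peMr // exprn_ege1.
have d0 : 0 <= x / U%:R ^+ 2 by rewrite divr_ge0 // ltW.
rewrite (@big_cat_nat _ _ _ U.+1) //= -addrA; congr (_ + _).
  rewrite big_nat_cond [RHS]big_nat_cond; apply: eq_bigr => t; rewrite andbT => /andP[t0 _].
  exact: weight_row.
transitivity (\sum_(U.+1 <= t < N.+1) \sum_(1 <= n < M.+1) weight xpredT x t n).
  rewrite big_nat_cond [RHS]big_nat_cond; apply: eq_bigr => t; rewrite andbT => /andP[Ut _].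
  apply: sum_widen0 => // n Mn; rewrite /weight /=; case: ifP => // le; exfalso.
  move: Mn; rewrite ltnNge => /negP; apply; rewrite truncn_ge_nat // ler_pdivlMr //.
  apply: le_trans le; rewrite natrM natrX ler_wpM2l // ler_pXn2r ?nnegrE // ler_nat.
  exact: ltnW.
rewrite exchange_big /= {1 2}/psum mulr_suml -sumrB.
rewrite big_nat_cond [RHS]big_nat_cond; apply: eq_bigr => n; rewrite andbT ltnS => /andP[n0 nM].
rewrite -(@weight_col x n N) // [X in _ = X - _](@big_cat_nat _ _ _ U.+1) //= addrAC.
rewrite [X in _ = X + _](_ : _ = 0) ?add0r // /psum mulr_sumr -sumrB big_nat_cond big1 // => t.
rewrite andbT ltnS => /andP[t0 tU]; rewrite /weight /=.
suff -> : (n * t ^ 2)%:R <= x by rewrite natrM natrX subrr.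
have : n%:R <= x / U%:R ^+ 2 by rewrite -truncn_ge_nat.
rewrite ler_pdivlMr // => le; apply: le_trans le; rewrite natrM natrX ler_wpM2l // ler_pXn2r ?nnegrE ?ler_nat //.
Qed.

(** The cut [U] is the integer part of [x ^ (1/4)]. Rows and overlap then cost a multiple of
    [x U ^ 2], columns and overlap a multiple of [x ^ 2 / U], and both are [O(x ^ (7/4))]. *)
Lemma good_pair_sum : good (pair_sum (R := R) xpredT) (1 / 4).
Proof.
apply: good_zero => [x /andP[_ x1]|]; first exact: pair_sum_lt1.
have [gam H] := harmonic_approx R.
(* Rows give [1/2 (ln U + gam)], columns [1/4 (ln x - 2 ln U + gam)], the overlap [1/8], each times
   [x ^ 2]; the logarithms of [U] cancel. *)
exists (3 / 4 * gam - 1 / 8), 21 => x x1.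
have x0 : 0 < x by apply: lt_le_trans x1.
pose q := x `^ (1/4).
have q1 : 1 <= q by rewrite -(powRr0 x); apply: ler_powR => //; lra.
have q0 : 0 < q by apply: lt_le_trans q1.
have q4 : x = q ^+ 4.
  by rewrite -powR_mulrn ?ltW // -powRrM (_ : 1/4 * 4%:R = 1) ?powRr1 ?ltW //; lra.
have q7 : err x = q ^+ 7.
  by rewrite -powR_mulrn ?ltW // -powRrM /err; congr (_ `^ _); lra.
have [U [UE U0 U1 Uq qU]] := truncn_bounds q1.
have qU2 : q <= 2 * U%:R by lra.
have UR : (0 : R) < U%:R by apply: lt_le_trans U1.
have Ux : U%:R ^+ 2 <= x.
  rewrite q4; apply: le_trans (_ : q ^+ 2 <= _); first by rewrite ler_pXn2r ?nnegrE // ltW.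
  by apply: ler_weXn2l.
rewrite (hyperbola x1 U0 Ux); set y := x / U%:R ^+ 2; set M := truncn y.
have U2 : (0 : R) < U%:R ^+ 2 by rewrite exprn_gt0.
have y1 : 1 <= y by rewrite ler_pdivlMr // mul1r.
have y0 : 0 < y by apply: lt_le_trans y1.
have yE : x = y * U%:R ^+ 2 by rewrite mulfVK ?gt_eqF.
have HU := H _ U1; rewrite natrK in HU.
have HM := H _ y1; rewrite -/M in HM.
have E1 : `|\sum_(1 <= t < U.+1) t%:R ^+ 3 * psum (fun n => n%:R) (truncn (x / t%:R ^+ 2))
     - x ^+ 2 / 2 * psum (fun n => n%:R^-1) U| <= x * U%:R ^+ 2.
  rewrite /psum mulr_sumr -sumrB; apply: le_trans (ler_norm_sum _ _ _) _.
  apply: le_trans (_ : x * psum (fun n => n%:R) U <= _); last first.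
    by rewrite ler_wpM2l ?(ltW x0) // psum_id; nra.
  rewrite /psum mulr_sumr big_nat_cond [leRHS]big_nat_cond; apply: ler_sum => t; rewrite andbT => /andP[t0 _].
  have tR : (0 : R) < t%:R by rewrite ltr0n.
  have d0 : 0 <= x / t%:R ^+ 2 by rewrite divr_ge0 ?exprn_ge0 ?(ltW x0).
  have := psum_id_approx d0; rewrite /psum; set s := \sum_(_ <= _ < _) _ => B.
  rewrite (_ : _ - _ = t%:R ^+ 3 * (s - (x / t%:R ^+ 2) ^+ 2 / 2)); last by field; rewrite gt_eqF.
  rewrite normrM ger0_norm ?exprn_ge0 //; apply: le_trans (ler_wpM2l _ B) _; first by rewrite exprn_ge0.
  by rewrite le_eqVlt; apply/orP; left; apply/eqP; field; rewrite gt_eqF.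
have E2 : `|\sum_(1 <= n < M.+1) n%:R * psum (fun n => n%:R ^+ 3) (truncn (Num.sqrt (x / n%:R)))
     - x ^+ 2 / 4 * psum (fun n => n%:R^-1) M| <= 6 * (x ^+ 2 / U%:R).
  rewrite /psum mulr_sumr -sumrB; apply: le_trans (ler_norm_sum _ _ _) _.
  have sx : 0 < Num.sqrt x by rewrite sqrtr_gt0.
  have sxE : x = Num.sqrt x ^+ 2 by rewrite sqr_sqrtr // ltW.
  apply: le_trans (_ : 3 * Num.sqrt x ^+ 3 * psum (fun n => (Num.sqrt n%:R)^-1) M <= _).
    rewrite /psum mulr_sumr big_nat_cond [leRHS]big_nat_cond; apply: ler_sum => t; rewrite andbT => /andP[t0 _].
    have tR : (0 : R) < t%:R by rewrite ltr0n.
    have := psum_cube_approx (sqrtr_ge0 (x / t%:R)); rewrite /psum; set s := \sum_(_ <= _ < _) _.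
    rewrite sqrtrM ?(ltW x0) // sqrtrV ?(ltW tR) // => B.
    have st : 0 < Num.sqrt (t%:R : R) by rewrite sqrtr_gt0.
    have stE : t%:R = Num.sqrt t%:R ^+ 2 :> R by rewrite sqr_sqrtr // ltW.
    rewrite (_ : _ - _ = t%:R * (s - (Num.sqrt x / Num.sqrt t%:R) ^+ 4 / 4)); last first.
      by rewrite {1}sxE {1 2 3}stE; move: st sx; move: (Num.sqrt t%:R) (Num.sqrt x) => a b a0 b0; field; rewrite gt_eqF.
    rewrite normrM ger0_norm //; apply: le_trans (ler_wpM2l _ B) _ => //.
    rewrite {1}stE; move: st sx; move: (Num.sqrt t%:R) (Num.sqrt x) => a b a0 b0.
    by rewrite le_eqVlt; apply/orP; left; apply/eqP; field; rewrite gt_eqF.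
  apply: le_trans (ler_wpM2l _ (psum_invsqrt _ M)) _; first by rewrite mulr_ge0 ?exprn_ge0 // ltW.
  have sM : Num.sqrt (M%:R : R) <= Num.sqrt x / U%:R.
    rewrite -(@ler_pXn2r _ 2) ?nnegrE ?sqrtr_ge0 ?divr_ge0 ?(ltW UR) ?(ltW sx) //.
    rewrite sqr_sqrtr // exprMn exprVn -sxE -/y -truncn_ge_nat //; exact: ltW.
  apply: le_trans (_ : 3 * Num.sqrt x ^+ 3 * (2 * (Num.sqrt x / U%:R)) <= _).
    by apply: ler_wpM2l; rewrite ?mulr_ge0 ?exprn_ge0 ?(ltW sx) // ler_wpM2l.
  rewrite [in leRHS]sxE; move: sx; move: (Num.sqrt x) => b b0.
  by rewrite le_eqVlt; apply/orP; left; apply/eqP; field; rewrite gt_eqF.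
have E3 : `|psum (fun n => n%:R) M * psum (fun n => n%:R ^+ 3) U - x ^+ 2 / 8| <= 2 * (x * U%:R ^+ 2) + x ^+ 2 / U%:R.
  have := psum_id_approx (ltW y0); rewrite -/M; set s := psum _ _ => B.
  rewrite psum_cube; set c := (_ ^+ 2).
  have cE : `|c - U%:R ^+ 4 / 4| <= U%:R ^+ 3.
    rewrite /c; move: (U%:R) U1 => u u1; rewrite ger0_norm; last by rewrite subr_ge0; nra.
    by nra.
  rewrite (_ : _ - _ = (s - y ^+ 2 / 2) * c + y ^+ 2 / 2 * (c - U%:R ^+ 4 / 4)); last by rewrite yE; field.
  have c0 : 0 <= c by apply: sqr_ge0.
  have c2 : c <= 2 * U%:R ^+ 4.
    by move: cE; rewrite ler_norml; have : U%:R ^+ 3 <= U%:R ^+ 4 :> R; [exact: ler_weXn2l | move=> e /andP[_ f]; lra].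
  clearbody c; apply: le_trans (ler_normD _ _) _; apply: lerD.
    rewrite normrM; apply: le_trans (_ : y * (2 * U%:R ^+ 4) <= _).
      by apply: ler_pM => //; rewrite ger0_norm.
    by rewrite yE le_eqVlt; apply/orP; left; apply/eqP; ring.
  rewrite normrM ger0_norm ?divr_ge0 ?sqr_ge0 //.
  apply: le_trans (ler_wpM2l _ cE) _; first by rewrite divr_ge0 ?sqr_ge0.
  rewrite yE (_ : (y * U%:R ^+ 2) ^+ 2 / U%:R = y ^+ 2 * U%:R ^+ 3); last by field; rewrite gt_eqF.
  by rewrite ler_wpM2r ?exprn_ge0 // ler_piMr ?sqr_ge0 //; lra.
move: E1 E2 E3; set s1 := \sum_(_ <= _ < _) _; set s2 := \sum_(_ <= _ < _) _; set s3 := psum _ M * psum _ U.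
have lnE : ln y = ln x - 2 * ln U%:R by rewrite ln_div ?posrE // lnXn // mulr_natl.
move=> E1 E2 E3.
set hU := psum (fun n => n%:R^-1) U in HU E1; set hM := psum (fun n => n%:R^-1) M in HM E2.
have X0 : 0 <= x ^+ 2 by rewrite sqr_ge0.
have F1 : `|x ^+ 2 / 2 * hU - x ^+ 2 / 2 * (ln U%:R + gam)| <= x ^+ 2 / U%:R.
  rewrite -mulrBr normrM ger0_norm ?divr_ge0 // opprD addrA.
  apply: le_trans (ler_wpM2l _ HU) _; first by rewrite divr_ge0.
  by rewrite le_eqVlt; apply/orP; left; apply/eqP; field; rewrite gt_eqF.
have F2 : `|x ^+ 2 / 4 * hM - x ^+ 2 / 4 * (ln x - 2 * ln U%:R + gam)| <= x ^+ 2 / U%:R.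
  rewrite -mulrBr normrM ger0_norm ?divr_ge0 // opprD addrA -lnE.
  apply: le_trans (ler_wpM2l _ HM) _; first by rewrite divr_ge0.
  have yU : U%:R <= y.
    rewrite ler_pdivlMr // -exprS q4; apply: le_trans (_ : q ^+ 3 <= _).
      by rewrite ler_pXn2r ?nnegrE // ltW.
    exact: ler_weXn2l.
  have : y^-1 <= U%:R^-1 by rewrite lef_pV2 ?posrE.
  have : 0 <= y^-1 by rewrite invr_ge0 ltW.
  move: (y^-1) (U%:R^-1) (x ^+ 2) X0 => a b X X0 a0 ab.
  have : 0 <= X * (b - a) by rewrite mulr_ge0 ?subr_ge0.
  have : 0 <= X * a by rewrite mulr_ge0.
  lra.
have G1 : x * U%:R ^+ 2 <= q ^+ 7.
  rewrite q4; apply: le_trans (_ : q ^+ 4 * q ^+ 2 <= _).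
    by rewrite ler_wpM2l ?exprn_ge0 ?(ltW q0) // ler_pXn2r ?nnegrE // ltW.
  by rewrite -exprD; apply: ler_weXn2l.
have G2 : x ^+ 2 / U%:R <= 2 * q ^+ 7.
  have e8 : (q ^+ 4) ^+ 2 = q ^+ 7 * q by ring.
  have e9 : 2 * q ^+ 7 * U%:R = q ^+ 7 * (2 * U%:R) by ring.
  rewrite ler_pdivrMr // q4 e8 e9; apply: ler_wpM2l => //.
  by rewrite exprn_ge0 // ltW.
rewrite q7; move: E1 E2 E3 F1 F2 G1 G2.
move: (x * U%:R ^+ 2) (x ^+ 2 / U%:R) (q ^+ 7) => a b c.
move: (x ^+ 2 / 2 * hU) (x ^+ 2 / 4 * hM) => p1 p2.
move: (ln x) (ln U%:R) (x ^+ 2) => lx lu X.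
rewrite !ler_norml => /andP[a1 b1] /andP[a2 b2] /andP[a3 b3] /andP[a4 b4] /andP[a5 b5] a6 a7.
by apply/andP; split; lra.
Qed.

End Hyperbola.

(** * Sums of b s(b) and of a s(3 a) *)

Section SqrtPartSums.
Variable R : realType.
Implicit Types (x y : R) (chi : pred nat).

Definition sqrt_sum chi y : R :=
  \sum_(1 <= b < (truncn y).+1) (if chi b then (b * sqrt_part b)%:R else 0).

Lemma sqrt_sum_mobius chi y N : (forall a b, chi (a * b)%N = chi a && chi b) ->
  0 <= y -> (truncn y <= N)%N ->
  sqrt_sum chi y = psum (fun g => ((chi g)%:R * mu R g * g%:R ^+ 2) * pair_sum chi (y / g%:R ^+ 2)) N.
Proof.
move=> chiM y0; set K := truncn y => KN.
transitivity (\sum_(1 <= g < N.+1) \sum_(1 <= t < N.+1) mu R g * t%:R *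
    \sum_(1 <= b < K.+1 | ((g * t) ^ 2 %| b)%N) (if chi b then b%:R else 0)).
  rewrite /sqrt_sum; under [RHS]eq_bigr do under eq_bigr do rewrite mulr_sumr big_mkcond.
  under [RHS]eq_bigr do rewrite exchange_big /=.
  rewrite [RHS]exchange_big /= big_nat_cond [RHS]big_nat_cond; apply: eq_bigr => b.
  rewrite andbT ltnS => /andP[b0 bK].
  have /(congr1 (fun z : int => z%:~R : R)) := sqrt_partE b0 (leq_trans bK KN).
  rewrite mulrz_nat natrM => ->; case: ifP => _.
    rewrite mulrC rmorph_sum /= mulr_suml; apply: eq_bigr => g _.
    rewrite big_mkcond /= rmorph_sum /= mulr_suml; apply: eq_bigr => t _.
    by case: ifP => _; rewrite ?mul0r // rmorphM /= mulrz_nat.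
  by rewrite big1 // => g _; rewrite big1 // => t _; rewrite mulr0; case: ifP.
rewrite /psum big_nat_cond [RHS]big_nat_cond; apply: eq_bigr => g; rewrite andbT => /andP[g0 _].
have gR : (0 : R) < g%:R ^+ 2 by rewrite exprn_gt0 ?ltr0n.
have le : (truncn (y / g%:R ^+ 2) <= N)%N.
  apply: leq_trans KN; apply: le_truncn; rewrite ler_pdivrMr // ler_peMr //.
  by rewrite exprn_ege1 // ler1n.
rewrite -(pairsE chi le le) /pairs mulr_sumr.
rewrite big_nat_cond [RHS]big_nat_cond; apply: eq_bigr => t; rewrite andbT => /andP[t0 _].
have gt0 : (0 < (g * t) ^ 2)%N by rewrite expn_gt0 muln_gt0 g0 t0.
rewrite sum_dvdn_reindex // mulr_sumr.
have le2 : (K %/ (g * t) ^ 2 <= N)%N by apply: leq_trans KN; apply: leq_div.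
rewrite -[LHS](psum_if _ le2) mulr_sumr; apply: eq_bigr => n _.
rewrite leq_divRL // truncn_ge_nat // /weight ler_pdivlMr //.
have -> : (n * t ^ 2)%:R * g%:R ^+ 2 = (n * (g * t) ^ 2)%:R :> R by rewrite -natrX -natrM; congr (_%:R); ring.
rewrite expnS expn1 !chiM; case: (chi g); case: (chi t); case: (chi n) => /=; rewrite ?mulr0 ?mul0r ?if_same //.
case: ifP => _; rewrite ?mulr0 //.
by rewrite !natrM; ring.
Qed.

Lemma good_sqrt_sum chi (c Z : R) : (forall a b, chi (a * b)%N = chi a && chi b) -> chi 1%N ->
  psum (@dirichlet R chi 2) @ \oo --> Z -> good (pair_sum chi) c -> good (sqrt_sum chi) (c / Z).
Proof.
move=> chiM chi1 cZ gP.
apply: (good_sum (w := fun g => (chi g)%:R * mu R g * g%:R ^+ 2) gP).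
- move=> g _; rewrite normrM [ `|_ ^+ 2|]ger0_norm ?sqr_ge0 //.
  rewrite -[leRHS]mul1r ler_wpM2r ?sqr_ge0 // normrM -[leRHS]mulr1.
  by apply: ler_pM; rewrite ?mu_norm // ger0_norm // lern1 leq_b1.
- have := mobius_series chi1 chiM (isT : (1 < 2)%N) cZ.
  apply: cvg_trans; apply: near_eq_cvg; near=> N.
  rewrite /psum big_nat_cond [RHS]big_nat_cond; apply: eq_bigr => g; rewrite andbT => /andP[g0 _].
  have gR : (g%:R : R) != 0 by rewrite pnatr_eq0 -lt0n.
  by rewrite /dirichlet; field.
move=> x x0; near=> N; apply: sqrt_sum_mobius => //; first exact: ltW.
by near: N; apply: nbhs_infty_ge.
Unshelve. all: by end_near. Qed.

Definition sqrt_sum3 x : R := \sum_(1 <= a < (truncn x).+1) (a * sqrt_part (3 * a))%:R.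

(** With [b = 3 a] the sum runs over multiples of 3 up to [3 x]. It is written as all [b] minus the
    [b] prime to 3 because these two conditions, unlike divisibility by 3, are completely
    multiplicative. *)
Lemma sqrt_sum3E x : 0 <= x ->
  sqrt_sum3 x = 3^-1 * (sqrt_sum xpredT (3 * x) - sqrt_sum (fun m => ~~ (3 %| m)%N) (3 * x)).
Proof.
move=> x0; have x30 : 0 <= 3 * x by rewrite mulr_ge0.
rewrite /sqrt_sum -sumrB.
rewrite [X in _ = _ * X](eq_bigr (fun b => if (3 %| b)%N then (b * sqrt_part b)%:R else 0)); last first.
  by move=> b _; case: (3 %| b)%N; rewrite /= ?subr0 ?subrr.
rewrite -big_mkcond sum_dvdn_reindex //.
have -> : (truncn (3 * x) %/ 3)%N = truncn x.
  apply/eqP; rewrite eqn_leq; apply/andP; split; last first.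
    by rewrite leq_divRL // truncn_ge_nat // natrM mulrC ler_pM2l // truncn_le.
  have := truncn_le (3 * x); rewrite x30 => h.
  rewrite truncn_ge_nat // -(@ler_pM2l _ 3) //; apply: le_trans h.
  by rewrite -[3]/(3%:R) -natrM ler_nat mulnC leq_trunc_div.
rewrite mulr_sumr; apply: eq_bigr => a _; rewrite mulnC (mulnC 3) !natrM.
by field.
Qed.

Lemma good_sqrt_sum3 (Z : R) : psum (@dirichlet R xpredT 2) @ \oo --> Z -> good sqrt_sum3 (3 / (8 * Z)).
Proof.
move=> cZ; have Z1 := dirichlet_ge1 (isT : xpredT 1%N) cZ.
have Z0 : Z != 0 by rewrite gt_eqF //; apply: lt_le_trans Z1.
have cZ3 := dirichlet_not3 cZ.
have gP := good_pair_sum R.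
have gP3 : good (pair_sum (R := R) (fun m => ~~ (3 %| m)%N)) (1 / 9).
  apply: (@good_ext _ _ (fun x => pair_sum xpredT x + (- 3) * pair_sum xpredT (x / 3)
    + (- 27) * pair_sum xpredT (x / 9) + 81 * pair_sum xpredT (x / 27))).
    by move=> x x0; rewrite pair_sum_not3 ?(ltW x0) //; ring.
  (* The value is [1/4 (1 - 1/3) ^ 2], one factor each for [n] and [t]. *)
  rewrite (_ : 1 / 9 = 1 / 4 + (- 3) * (1 / 4 / 3 ^+ 2) + (- 27) * (1 / 4 / 9 ^+ 2) + 81 * (1 / 4 / 27 ^+ 2)); last by field.
  by do !apply: goodD => //; apply: goodZ; apply: good_dil.
have n3M a b : ~~ (3 %| a * b)%N = ~~ (3 %| a)%N && ~~ (3 %| b)%N by rewrite Euclid_dvdM // negb_or.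
have g1 := good_sqrt_sum (fun _ _ => erefl) (isT : xpredT 1%N) cZ gP.
have g2 := good_sqrt_sum n3M isT cZ3 gP3.
apply: (@good_ext _ _ (fun x => 3^-1 * (sqrt_sum xpredT (x / 3^-1) + (-1) * sqrt_sum (fun m => ~~ (3 %| m)%N) (x / 3^-1)))).
  by move=> x x0; rewrite sqrt_sum3E ?(ltW x0) // invrK mulN1r (mulrC x).
rewrite (_ : 3 / (8 * Z) = 3^-1 * (1 / 4 / Z / 3^-1 ^+ 2 + (-1) * (1 / 9 / (8 / 9 * Z) / 3^-1 ^+ 2))); last by field.
apply: goodZ; apply: goodD; last apply: goodZ.
  by apply: (good_dil (F := sqrt_sum xpredT)).
by apply: (good_dil (F := sqrt_sum _)).
Qed.

End SqrtPartSums.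

(** * The function h *)

Section HeightFunction.
Variable R : realType.
Implicit Types x y beta : R.

Local Notation mu := (@lebesgue_measure R).

Definition quad beta : R := 1 + 2 * beta - 1 / 3 * beta ^+ 2.

(* [h beta] is the [-1/6]-th power of [hmax beta]. *)
Definition hmax beta : R := Num.max (4 * `|beta| ^+ 3) (27 / 16 * quad beta ^+ 2).

Definition hfun beta : R := hmax beta `^ (- (1 / 6)).

(** [hmax] has a positive lower bound and quartic growth, so [hfun] decays like [|beta| ^ (-2/3)].
    For [|beta| <= 9] the bound [hmax >= 1/16] suffices, as [16 (1 + 9 ^ 4) = 104992]; beyond 9 the
    quadratic dominates. *)
Lemma hmax_ge beta : 1 + beta ^+ 4 <= 105 * 1000 * hmax beta.
Proof.
have b4 : beta ^+ 4 = `|beta| ^+ 4 by rewrite -normrX ger0_norm // exprn_even_ge0.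
have [le|lt] := lerP `|beta| 9.
  have : 16^-1 <= hmax beta.
    rewrite /hmax le_max; apply/orP.
    have [le1|lt1] := lerP 4^-1 `|beta|; [left|right].
      have : 4^-1 ^+ 3 <= `|beta| ^+ 3 by rewrite ler_pXn2r ?nnegrE.
      lra.
    move: lt1; rewrite ltr_norml => /andP[l1 l2].
    have : 9/20 <= quad beta by rewrite /quad; nra.
    by nra.
  have : `|beta| ^+ 4 <= 9 ^+ 4 by rewrite ler_pXn2r ?nnegrE.
  by rewrite b4; lra.
apply: le_trans (_ : 105 * 1000 * (27 / 16 * quad beta ^+ 2) <= _); last first.
  have : 27 / 16 * quad beta ^+ 2 <= hmax beta by rewrite /hmax le_max lexx orbT.
  by lra.
have h : beta ^+ 2 / 12 <= - quad beta.
  rewrite /quad; have b2 : beta ^+ 2 = `|beta| ^+ 2 by rewrite real_normK ?num_real.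
  by rewrite b2; have := ler_norm beta; nra.
have : (beta ^+ 2 / 12) ^+ 2 <= quad beta ^+ 2.
  by rewrite -[leRHS]sqrrN ler_pXn2r ?nnegrE ?(le_trans _ h) ?divr_ge0 ?sqr_ge0.
have : 9 ^+ 4 <= beta ^+ 4 by rewrite b4 ler_pXn2r ?nnegrE // ltW.
have -> : (beta ^+ 2 / 12) ^+ 2 = beta ^+ 4 / 144 by field.
lra.
Qed.

Lemma hmax_gt0 beta : 0 < hmax beta.
Proof.
have := hmax_ge beta; have : 0 <= beta ^+ 4 by rewrite exprn_even_ge0.
lra.
Qed.

Lemma hfun_gt0 beta : 0 < hfun beta.
Proof. by apply: powR_gt0; apply: hmax_gt0. Qed.

Lemma hfunX6 beta : hfun beta ^+ 6 = (hmax beta)^-1.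
Proof.
rewrite -powR_mulrn ?powR_ge0 // -powRrM (_ : _ * _ = -1); last by field.
by rewrite powR_inv1 // ltW // hmax_gt0.
Qed.

Lemma le_hfun y beta : 0 < y -> (y <= hfun beta) = (y ^+ 6 * hmax beta <= 1).
Proof.
move=> y0; rewrite -(@ler_pXn2r _ 6) ?nnegrE ?(ltW y0) ?(ltW (hfun_gt0 _)) //.
by rewrite hfunX6 -[_^-1]div1r ler_pdivlMr ?hmax_gt0 //.
Qed.

Lemma hfun_le2 beta : hfun beta <= 2.
Proof.
rewrite leNgt; apply/negP => /ltW; rewrite le_hfun //; apply/negP; rewrite -ltNge.
have : 16^-1 <= hmax beta; last by lra.
rewrite /hmax le_max; apply/orP.
have [le1|lt1] := lerP 4^-1 `|beta|; [left|right].
  have : 4^-1 ^+ 3 <= `|beta| ^+ 3 by rewrite ler_pXn2r ?nnegrE.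
  lra.
move: lt1; rewrite ltr_norml => /andP[l1 l2].
have : 9/20 <= quad beta by rewrite /quad; nra.
by nra.
Qed.

Lemma le_quot_oo y n d : 0 < y -> 0 <= n -> 0 <= d -> (y%:E <= quot_oo n d)%E = (y * d <= n).
Proof.
move=> y0 n0 d0; rewrite /quot_oo; case: eqP => [->|/eqP dn]; first by rewrite leey mulr0 n0.
by rewrite lee_fin ler_pdivlMr // lt_neqAle eq_sym dn d0.
Qed.

Lemma powR_pow6 (x : R) (k n : nat) : 0 <= x -> (k * n = 6)%N -> (x `^ (1 / k%:R)) ^+ 6 = x ^+ n.
Proof.
move=> x0 kn; rewrite -powR_mulrn ?powR_ge0 // -powRrM -kn natrM mul1r mulKf ?powR_mulrn //.
by rewrite pnatr_eq0; case: k kn.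
Qed.

(** Sixth powers remove the roots, and multiplying out the denominators turns the convention about
    [+oo] into a true inequality, so no case of a vanishing denominator remains. [h_betaE] recovers
    equality from these comparisons. *)
Lemma le_h_beta y beta : 0 < y -> (y%:E <= h_beta beta)%E = (y <= hfun beta).
Proof.
move=> y0; rewrite /h_beta le_min /f_beta /g_beta !le_quot_oo ?mulr_ge0 ?powR_ge0 //.
rewrite le_hfun // /hmax maxr_pMr ?exprn_ge0 ?(ltW y0) // ge_max.
rewrite -(@ler_pXn2r _ 6) ?nnegrE ?mulr_ge0 ?powR_ge0 ?(ltW y0) //.
rewrite -[in X in _ && X](@ler_pXn2r _ 6) ?nnegrE ?mulr_ge0 ?powR_ge0 ?(ltW y0) //.
rewrite !exprMn (powR_pow6 (k := 3) (n := 2)) // (powR_pow6 (k := 2) (n := 3)) //.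
rewrite (powR_pow6 (k := 2) (n := 3)) // (powR_pow6 (k := 3) (n := 2)) // (powR_pow6 (k := 3) (n := 2)) //.
rewrite expr1n real_normK ?num_real // -/(quad beta).
congr (_ && _); first by congr (_ <= _); ring.
by apply/idP/idP => h; lra.
Qed.

Lemma h_betaE beta : h_beta beta = (hfun beta)%:E.
Proof.
apply/eqP; rewrite eq_le le_h_beta ?hfun_gt0 // lexx andbT leNgt; apply/negP.
have h0 := hfun_gt0 beta.
case E : (h_beta beta) => [s| |] //; rewrite ?lte_fin => lt.
  have := lexx s%:E; rewrite -{2}E le_h_beta ?(lt_trans h0) //.
  by rewrite leNgt lt.
have := leey (hfun beta + 1)%:E; rewrite -E le_h_beta ?addr_gt0 //.
by rewrite gerDl ler10.
Qed.

Lemma measurable_hfun : measurable_fun [set: R] hfun.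
Proof.
have m : measurable_fun [set: R] hmax.
  apply: continuous_measurable_fun => x.
  apply: (@continuous_max R R (fun b => 4 * `|b| ^+ 3) (fun b => 27 / 16 * quad b ^+ 2) x).
    apply: cvgMr; apply: (@continuous_comp R R R (fun b => `|b|) (fun z => z ^+ 3)).
      exact: norm_continuous.
    exact: exprn_continuous.
  apply: cvgMr; apply: (@continuous_comp R R R quad (fun z => z ^+ 2)); last exact: exprn_continuous.
  apply: cvgB; first by apply: cvgD; [exact: cvg_cst|apply: cvgMr; exact: cvg_id].
  by apply: cvgMr; exact: exprn_continuous.
exact: (measurableT_comp (measurable_powR _) m).
Qed.

Lemma continuous_powR (a x : R) : 0 < x -> {for x, continuous (fun z : R => z `^ a)}.
Proof.
move=> x0; have d := is_derive1_powR a x0.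
by apply: differentiable_continuous; apply/derivable1_diffP; apply: ex_derive.
Qed.

Lemma cvg_powR (a x : R) (f : R -> R) : {for x, continuous f} -> 0 < f x ->
  {for x, continuous (fun z : R => f z `^ a)}.
Proof. by move=> cf fx; exact: (@continuous_comp R R R f (fun z : R => z `^ a) x cf (@continuous_powR a (f x) fx)). Qed.

Definition decay beta : R := (1 + `|beta|) `^ (- (7 / 6)).

Lemma integrable_decay : mu.-integrable [set: R] (EFin \o decay).
Proof.
have cd : continuous decay.
  move=> x; apply: (@cvg_powR _ x (fun z => 1 + `|z|)); last by rewrite ltr_pwDl.
  by apply: cvgD; [exact: cvg_cst | exact: norm_continuous].
apply/integrableP; split.
  by apply/measurable_EFinP; apply: continuous_measurable_fun.
under eq_integral => x _ do rewrite /= ger0_norm ?powR_ge0 //.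
rewrite ge0_symfun_integralT //; last 2 first.
- by move=> x; rewrite powR_ge0.
- by move=> x; rewrite /decay /= normrN.
rewrite -set_itvcy.
pose F x : R := - 6 * (1 + x) `^ (- (1/6)).
have -> : (\int[mu]_(x in `[0%R, +oo[) (decay x)%:E)%E = (\int[mu]_(x in `[0%R, +oo[) ((1 + x) `^ (- (7/6)))%:E)%E.
  by apply: eq_integral => x; rewrite inE /= in_itv /= andbT => x0; rewrite /decay ger0_norm.
have dF x : 0 <= x -> is_derive x 1 F ((1 + x) `^ (- (7/6))).
  move=> x0; have x1 : 0 < 1 + x by lra.
  have d1 : is_derive x 1 (fun z : R => 1 + z) (0 + 1) by apply: is_deriveD.
  have d2 := is_derive1_comp (f := fun z => z `^ (- (1/6))) (is_derive1_powR (- (1/6)) x1) d1.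
  have d3 : is_derive x 1 F (- 6 *: (- (1 / 6) * (1 + x) `^ (- (1 / 6) - 1) * (0 + 1))) by apply: is_deriveZ.
  apply: (is_derive_eq d3).
  rewrite (_ : - (1 / 6) - 1 = - (7 / 6)); last by field.
  by rewrite /GRing.scale /=; field.
rewrite (@ge0_continuous_FTC2y _ _ F 0 0).
- by rewrite -EFinB -EFinM ltry.
- by move=> x _; rewrite powR_ge0.
- apply: continuous_in_subspaceT => x; rewrite inE /= in_itv /= andbT => x0.
  apply: (@cvg_powR _ x (fun z => 1 + z)); last by lra.
  by apply: cvgD; [exact: cvg_cst | exact: cvg_id].
- rewrite -[X in _ --> X](mulr0 (- 6)); apply: cvgMr.
  apply/cvgrPdist_le => e e0; near=> x.
  have x0 : 0 < x by near: x; apply: nbhs_pinfty_gt; rewrite num_real.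
  rewrite sub0r normrN ger0_norm ?powR_ge0 //.
  rewrite -(@ler_pXn2r _ 6) ?nnegrE ?powR_ge0 ?(ltW e0) //.
  rewrite -powR_mulrn ?powR_ge0 // -powRrM (_ : _ * _ = -1); last by field.
  rewrite powR_inv1; last by lra.
  rewrite -[leRHS]invrK lef_pV2 ?posrE ?invr_gt0 ?exprn_gt0 //; last by lra.
  apply: le_trans (_ : x <= _); last by lra.
  by near: x; apply: nbhs_pinfty_ge; rewrite num_real.
- by move=> x x0; have := dF x (ltW x0) => d; apply: ex_derive.
- have d := dF 0 (lexx _); apply: cvg_at_right_filter.
  by apply: differentiable_continuous; apply/derivable1_diffP; apply: ex_derive.
- by move=> x; rewrite in_itv /= andbT => x0; rewrite derive1E; have d := dF x (ltW x0); apply: derive_val.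
Unshelve. all: by end_near. Qed.

(** [hfun ^ 6] is the inverse of [hmax] and [7/4 = 6 * 7/24], so the claim reduces to
    [(1 + |b|) ^ 4 <= 8 (1 + b ^ 4)] and [hmax_ge]. *)
Lemma err_hfun_le : exists K, 0 <= K /\ forall beta, err (hfun beta) <= K * decay beta.
Proof.
have [M M0 HM] : exists2 M : R, 0 <= M & forall beta, 1 + beta ^+ 4 <= M * hmax beta.
  by exists (105 * 1000); [apply: mulr_ge0; apply: ler0n | exact: hmax_ge].
exists ((8 * M) `^ (7 / 24)); split; first exact: powR_ge0.
move=> b; have b0 : 0 < 1 + `|b| by rewrite ltr_pwDl.
have -> : err (hfun b) = (hfun b ^+ 6) `^ (7 / 24).
  rewrite -(powR_mulrn 6 (ltW (hfun_gt0 b))) -powRrM /err (_ : 7 / 4 = 6%:R * (7 / 24)) //.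
  by field.
have -> : decay b = ((1 + `|b|) ^- 4) `^ (7 / 24).
  rewrite -(powR_invn 4 (ltW b0)) -powRrM /decay (_ : - (7 / 6) = - 4%:R * (7 / 24)) //.
  by field.
rewrite -powRM ?invr_ge0 ?exprn_ge0 ?(ltW b0) ?mulr_ge0 //.
apply: ge0_ler_powR; rewrite ?nnegrE.
- by lra.
- by apply: exprn_ge0; apply: ltW (hfun_gt0 _).
- by apply: divr_ge0; [apply: mulr_ge0 | apply: exprn_ge0; apply: ltW].
rewrite hfunX6 ler_pdivlMr ?exprn_gt0 // mulrC ler_pdivrMr ?hmax_gt0 //.
rewrite -mulrA; apply: le_trans (ler_wpM2l _ (HM b)) => //.
have -> : b ^+ 4 = `|b| ^+ 4 by rewrite -normrX ger0_norm // exprn_even_ge0.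
move: (normr_ge0 b); move: `|b| => z z0.
rewrite -subr_ge0 (_ : _ - _ = (z - 1) ^+ 2 * (7 * z ^+ 2 + 10 * z + 7)); last by ring.
by rewrite mulr_ge0 ?sqr_ge0 // !addr_ge0 ?mulr_ge0 ?sqr_ge0.
Qed.

Lemma integrable_err_hfun : mu.-integrable [set: R] (EFin \o (fun b => err (hfun b))).
Proof.
have [K [K0 H]] := err_hfun_le.
apply: (@le_integrable _ _ _ mu [set: R] measurableT _ (fun x => (K * decay x)%:E)).
- apply/measurable_EFinP; apply: (measurableT_comp (measurable_powR _)); exact: measurable_hfun.
- by move=> x _; rewrite /= lee_fin !ger0_norm ?err_ge0 // mulr_ge0 ?powR_ge0.
- by have := integrableZl measurableT K integrable_decay; apply: eq_integrable.
Qed.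

Lemma integrable_le_err (f : R -> R) (C : R) : measurable_fun [set: R] f ->
  (forall b, `|f b| <= C * err (hfun b)) -> mu.-integrable [set: R] (EFin \o f).
Proof.
move=> mf H; apply: (@le_integrable _ _ _ mu [set: R] measurableT _ (fun x => (C * err (hfun x))%:E)).
- exact/measurable_EFinP.
- by move=> x _; rewrite /= lee_fin; apply: le_trans (H x) (ler_norm _).
- by have := integrableZl measurableT C integrable_err_hfun; apply: eq_integrable.
Qed.

Lemma sqr_hfun_le b : hfun b ^+ 2 <= 4 * err (hfun b).
Proof.
have h0 := hfun_gt0 b; have h2 := hfun_le2 b; have [h1|h1] := lerP (hfun b) 1.
  by have := @sqr_le_err R (hfun b); rewrite h0 h1 => /(_ isT); have := err_ge0 (hfun b); lra.
have : 1 <= err (hfun b).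
  by rewrite -(powRr0 (hfun b)); apply: err_ge1; rewrite ?(ltW h1) //; lra.
nra.
Qed.

Lemma sqr_ln_hfun_le b : `|hfun b ^+ 2 * ln (hfun b)| <= 8 * err (hfun b).
Proof.
have h0 := hfun_gt0 b; have h2 := hfun_le2 b; rewrite normrM ger0_norm ?sqr_ge0 //.
have [h1|h1] := lerP (hfun b) 1.
  by have := @sqr_ln_le_err R (hfun b); rewrite h0 h1 => /(_ isT); have := err_ge0 (hfun b); lra.
have e1 : 1 <= err (hfun b).
  by rewrite -(powRr0 (hfun b)); apply: err_ge1; rewrite ?(ltW h1) //; lra.
rewrite ger0_norm ?ln_ge0 ?(ltW h1) //.
have l1 := ln_sublinear h0; have l0 : 0 <= ln (hfun b) by rewrite ln_ge0 // ltW.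
apply: le_trans (_ : 2 ^+ 2 * 2 <= _); last by lra.
by apply: ler_pM; rewrite ?sqr_ge0 // ?ler_pXn2r ?nnegrE ?(ltW h0) //; lra.
Qed.

Lemma measurable_sqr_hfun : measurable_fun [set: R] (fun b => hfun b ^+ 2).
Proof. by apply: measurable_funX; exact: measurable_hfun. Qed.

Lemma integrable_sqr_hfun : mu.-integrable [set: R] (EFin \o (fun b => hfun b ^+ 2)).
Proof.
apply: (integrable_le_err (C := 4)) => [|b]; first exact: measurable_sqr_hfun.
by rewrite ger0_norm ?sqr_ge0 // sqr_hfun_le.
Qed.

Lemma integrable_sqr_ln_hfun : mu.-integrable [set: R] (EFin \o (fun b => hfun b ^+ 2 * ln (hfun b))).
Proof.
apply: (integrable_le_err (C := 8)) => [|b]; last exact: sqr_ln_hfun_le.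
apply: measurable_funM; first exact: measurable_sqr_hfun.
by apply: measurableT_comp; [exact: measurable_ln | exact: measurable_hfun].
Qed.

(** [ln (T h) = ln T + ln h]: the logarithm of [T] keeps the coefficient [c] times the integral of
    [h ^ 2], and the integral of [h ^ 2 ln h] joins the constant term. The error factors because
    [err] is multiplicative. *)
Lemma good_integral (F : R -> R) c : (forall T, 0 < T -> mu.-integrable [set: R] (EFin \o (fun b => F (T * hfun b)))) ->
  good F c -> good (fun T => \int[mu]_b F (T * hfun b)) (c * \int[mu]_b (hfun b ^+ 2)).
Proof.
move=> iF [c' [C H]]; set I := \int[mu]_b _; set L := \int[mu]_b (hfun b ^+ 2 * ln (hfun b)).
exists (c * L + c' * I), (C * \int[mu]_b err (hfun b)) => T T0.
pose G b := (T ^+ 2 * (c * ln T + c')) * hfun b ^+ 2 + (T ^+ 2 * c) * (hfun b ^+ 2 * ln (hfun b)).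
have i1 : mu.-integrable [set: R] (EFin \o (fun b => (T ^+ 2 * (c * ln T + c')) * hfun b ^+ 2)).
  by have := integrableZl measurableT (T ^+ 2 * (c * ln T + c')) integrable_sqr_hfun; apply: eq_integrable.
have i2 : mu.-integrable [set: R] (EFin \o (fun b => (T ^+ 2 * c) * (hfun b ^+ 2 * ln (hfun b)))).
  by have := integrableZl measurableT (T ^+ 2 * c) integrable_sqr_ln_hfun; apply: eq_integrable.
have iG : mu.-integrable [set: R] (EFin \o G) by have := integrableD measurableT i1 i2; apply: eq_integrable.
have -> : T ^+ 2 * (c * I * ln T + (c * L + c' * I)) = \int[mu]_b G b.
  rewrite /G RintegralD // !RintegralZl //; first by rewrite -/I -/L; ring.
    exact: integrable_sqr_ln_hfun.
  exact: integrable_sqr_hfun.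
rewrite -RintegralB //; last exact: iF.
have iFG : mu.-integrable [set: R] (EFin \o (fun b => F (T * hfun b) - G b)).
  by have := integrableB measurableT (iF T T0) iG; apply: eq_integrable.
apply: le_trans (le_normr_Rintegral measurableT iFG) _.
have ie : mu.-integrable [set: R] (EFin \o (fun b => (C * err T) * err (hfun b))).
  by have := integrableZl measurableT (C * err T) integrable_err_hfun; apply: eq_integrable.
rewrite mulrAC -RintegralZl //; last exact: integrable_err_hfun.
apply: le_Rintegral => //.
  by have := integrable_norm iFG; apply: eq_integrable.
move=> b _; have h0 := hfun_gt0 b; have := H (T * hfun b) (mulr_gt0 T0 h0).
rewrite lnM ?posrE // errM ?(ltW T0) ?(ltW h0) // mulrA; congr (`| _ - _| <= _).
by rewrite /G; ring.
Qed.

End HeightFunction.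

(** * Lattice points *)

Section Counting.

Definition cnt (T : choiceType) (S : set T) : nat := #|` fset_set S|%fset.

Lemma finite_mem_seq (T : choiceType) (S : set T) (s : seq T) :
  (forall x, S x -> x \in s) -> finite_set S.
Proof. by move=> H; apply: (sub_finite_set _ (finite_seq s)) => x /H. Qed.

Lemma cnt_inj (T U : choiceType) (S : set T) (S' : set U) (f : T -> U) :
  finite_set S -> finite_set S' -> (forall x, S x -> S' (f x)) ->
  (forall x y, S x -> S y -> f x = f y -> x = y) -> (cnt S <= cnt S')%N.
Proof.
move=> fS fS' SS' inj.
have <- : #|` (f @` fset_set S)|%fset = cnt S.
  rewrite card_in_imfset // => x y; rewrite !in_fset_set // !inE; exact: inj.
apply: fsubset_leq_card; apply/fsubsetP => _ /imfsetP [x /= xS ->].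
by move: xS; rewrite !in_fset_set // !inE; apply: SS'.
Qed.

Lemma cnt_bij (T U : choiceType) (S : set T) (S' : set U) (f : T -> U) (g : U -> T) :
  finite_set S -> finite_set S' -> (forall x, S x -> S' (f x)) -> (forall y, S' y -> S (g y)) ->
  (forall x, S x -> g (f x) = x) -> (forall y, S' y -> f (g y) = y) -> cnt S = cnt S'.
Proof.
move=> fS fS' SS' S'S gf fg; apply/eqP; rewrite eqn_leq; apply/andP; split.
  by apply: (cnt_inj fS fS' SS') => x y Sx Sy E; rewrite -(gf x) // E gf.
by apply: (cnt_inj fS' fS S'S) => x y Sx Sy E; rewrite -(fg x) // E fg.
Qed.

Lemma cnt_sub (T : choiceType) (S S' : set T) : finite_set S' -> S `<=` S' -> (cnt S <= cnt S')%N.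
Proof. by move=> fS SS'; apply: (@cnt_inj _ _ _ _ id) => //; apply: sub_finite_set SS' fS. Qed.

Lemma cnt_setU (T : choiceType) (A B : set T) : finite_set A -> finite_set B -> (cnt (A `|` B) <= cnt A + cnt B)%N.
Proof. by move=> fA fB; rewrite /cnt fset_setU // cardfsU leq_subr. Qed.

Lemma cnt_count (T : choiceType) (S : set T) (s : seq T) : uniq s -> (forall x, S x -> x \in s) ->
  cnt S = count (fun x => `[< S x >]) s.
Proof.
move=> us H; have fS := finite_mem_seq H.
rewrite -size_filter; apply: perm_size; apply: uniq_perm; rewrite ?filter_uniq ?fset_uniq // => x.
rewrite mem_filter (_ : x \in enum_fset _ = (x \in fset_set S)) // in_fset_set //.
apply/idP/andP => [|[/asboolP Sx _]]; rewrite inE // => Sx.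
by split=> //; apply: H.
Qed.

Lemma cnt_fibers (T U : choiceType) (V : set (T * U)) (s : seq T) : uniq s -> finite_set V ->
  (forall a D, V (a, D) -> a \in s) -> cnt V = (\sum_(a <- s) cnt [set D | V (a, D)])%N.
Proof.
move=> us fV H; pose t := enum_fset (fset_set (snd @` V)).
have tP a D : V (a, D) -> D \in t.
  move=> aD; rewrite (_ : D \in t = (D \in fset_set (snd @` V))) // in_fset_set; last exact: finite_image.
  by rewrite inE; exists (a, D).
rewrite (@cnt_count _ V [seq (a, D) | a <- s, D <- t]); last 2 first.
- apply: allpairs_uniq => //; first exact: fset_uniq.
  by move=> [a b] [c d].
- move=> [a D] aD; apply/allpairsP; exists (a, D); split=> //; [exact: H aD | exact: tP aD].
rewrite count_flatten sumnE !big_map; apply: eq_bigr => a _.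
rewrite (@cnt_count _ _ t) ?fset_uniq //; last by move=> D; apply: tP.
by rewrite count_map.
Qed.

End Counting.

(** * Points of an arithmetic progression in an interval *)

Section LatticePoints.
Variable R : realType.
Local Notation lam := (@lebesgue_measure R).
Implicit Types (I : set R) (s x y : R).

Lemma lebesgue_le I x y : measurable I -> x <= y -> (forall z, I z -> x <= z <= y) ->
  lam I \is a fin_num /\ fine (lam I) <= y - x.
Proof.
move=> mI xy H; have le : (lam I <= (y - x)%:E)%E.
  have -> : (y - x)%:E = lam `[x, y].
    rewrite lebesgue_measure_itv /= lte_fin lt_neqAle xy andbT.
    by case: eqP => [->|_] //=; rewrite subrr.
  by apply: le_measure; rewrite ?inE // => z /H; rewrite /= in_itv.
have fn : lam I \is a fin_num by rewrite ge0_fin_numE //; apply: le_lt_trans le (ltry _).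
by split=> //; rewrite -lee_fin fineK.
Qed.

Lemma lebesgue_ge I x y : measurable I -> lam I \is a fin_num -> x <= y ->
  (forall z, x <= z <= y -> I z) -> y - x <= fine (lam I).
Proof.
move=> mI fn xy H; rewrite -lee_fin fineK //.
have -> : (y - x)%:E = lam `[x, y].
  rewrite lebesgue_measure_itv /= lte_fin lt_neqAle xy andbT.
  by case: eqP => [->|_] //=; rewrite subrr.
by apply: le_measure; rewrite ?inE // => z; rewrite /= in_itv; apply: H.
Qed.

(** Let [a] and [b] be the extreme indices in [I]: the count is [b - a + 1], and the length lies
    between [d (b - a)] and [d (b - a + 2)]. If there is no index, [I] fits between two consecutive
    points. *)
Lemma lattice_interval I s d (K : nat) : 0 < d -> is_interval I ->
  (forall x, I x -> s <= x < s + d * K%:R) ->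
  `|(count (fun j => `[< I (s + d * j%:R) >]) (iota 0 K))%:R - fine (lam I) / d| <= 1.
Proof.
move=> d0 iI bI; have mI := is_interval_measurable iI.
have sK : s <= s + d * K%:R by rewrite lerDl mulr_ge0 // ltW.
have [fn _] := @lebesgue_le I s (s + d * K%:R) mI sK (fun z Iz => let: conj a b := andP (bI z Iz) in introT andP (conj a (ltW b))).
have ltK j : I (s + d * j%:R) -> (j < K)%N.
  by move=> /bI /andP[_]; rewrite ltrD2l ltr_pM2l // ltr_nat.
have [[j Ij]|nI] := pselect (exists j : nat, I (s + d * j%:R)); last first.
  rewrite (_ : count _ _ = 0%N); last first.
    apply/eqP; rewrite -leqn0 leqNgt -has_count; apply/hasPn => j _; apply/asboolPn => Ij.
    by apply: nI; exists j.
  rewrite sub0r normrN ger0_norm ?divr_ge0 ?fine_ge0 ?(ltW d0) // ler_pdivrMr // mul1r.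
  have [[x Ix]|nx] := pselect (exists x, I x); last first.
    rewrite (_ : I = set0) ?measure0 ?fine0 ?ltW //.
    by apply/seteqP; split=> // x Ix; apply: nx; exists x.
  have /andP[sx xK] := bI x Ix.
  pose j := truncn ((x - s) / d); have q0 : 0 <= (x - s) / d by rewrite divr_ge0 ?subr_ge0 // ltW.
  have /andP[] := truncn_itv q0; rewrite -/j ler_pdivlMr // ltr_pdivrMr // => h1 h2.
  have bnd z : I z -> s + d * j%:R <= z <= s + d * j.+1%:R.
    move=> Iz; apply/andP; split.
      rewrite leNgt; apply/negP => lt; apply: nI; exists j; apply: (iI _ _ Iz Ix).
      by rewrite (ltW lt) /=; lra.
    rewrite leNgt; apply/negP => lt; apply: nI; exists j.+1; apply: (iI _ _ Ix Iz).
    by rewrite (ltW lt) andbT; lra.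
  have jj : s + d * j%:R <= s + d * j.+1%:R by rewrite lerD2l ler_pM2l // ler_nat.
  have [_ ] := lebesgue_le mI jj bnd.
  by rewrite -natr1; lra.
pose P j := `[< I (s + d * j%:R) >].
have exP : exists j, P j by exists j; apply/asboolP.
have ubP i : P i -> (i <= K)%N by move=> /asboolP /ltK /ltnW.
case: (ex_minnP exP) => a /asboolP Ia mina; case: (ex_maxnP exP ubP) => b /asboolP Ib maxb.
have ab : (a <= b)%N by apply: mina; apply/asboolP.
have mid i : (a <= i <= b)%N -> I (s + d * i%:R).
  move=> /andP[h1 h2]; apply: (iI _ _ Ia Ib).
  by rewrite !lerD2l !ler_pM2l // !ler_nat h1 h2.
have -> : count (fun j => `[< I (s + d * j%:R) >]) (iota 0 K) = (b - a).+1.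
  rewrite -size_filter -(size_iota a (b - a).+1); apply: perm_size.
  apply: uniq_perm; rewrite ?filter_uniq ?iota_uniq // => i.
  rewrite mem_filter !mem_iota add0n addnS ltnS subnKC //; apply/andP/andP.
    by move=> [Pi _]; split; [apply: mina | apply: maxb].
  move=> h; have Ii := mid i (introT andP h); split; first exact/asboolP.
  by rewrite leq0n /=; apply: ltK.
have e1 : d * (b%:R - a%:R) <= fine (lam I).
  have -> : d * (b%:R - a%:R) = (s + d * b%:R) - (s + d * a%:R) by ring.
  apply: lebesgue_ge => //; first by rewrite lerD2l ler_pM2l // ler_nat.
  by move=> z zz; apply: (iI _ _ Ia Ib).
have e2 : fine (lam I) <= d * (b%:R - a%:R + 2).
  have -> : d * (b%:R - a%:R + 2) = (s + d * (b%:R + 1)) - (s + d * (a%:R - 1)) by ring.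
  have [] // := @lebesgue_le I (s + d * (a%:R - 1)) (s + d * (b%:R + 1)) mI.
    by rewrite lerD2l ler_pM2l //; have : (a%:R : R) <= b%:R; [rewrite ler_nat | lra].
  move=> z Iz; apply/andP; split.
    rewrite leNgt; apply/negP => lt; case: a Ia mina {ab mid e1} lt => [|a] Ia mina lt.
      by have /andP[sz _] := bI z Iz; nra.
    have : P a.
      apply/asboolP; apply: (iI _ _ Iz Ia); rewrite lerD2l ler_pM2l // ler_nat leqnSn andbT.
      by move: lt; rewrite -natr1 addrK => /ltW.
    by move/mina; rewrite ltnn.
  rewrite leNgt; apply/negP => lt.
  have : P b.+1.
    apply/asboolP; apply: (iI _ _ Ib Iz); rewrite lerD2l ler_pM2l // ler_nat leqnSn /=.
    by rewrite -natr1 ltW.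
  by move/maxb; rewrite ltnn.
have e3 : b%:R - a%:R <= fine (lam I) / d by rewrite ler_pdivlMr // mulrC.
have e4 : fine (lam I) / d <= b%:R - a%:R + 2 by rewrite ler_pdivrMr // mulrC.
by rewrite -natr1 natrB // ler_norml; apply/andP; split; lra.
Qed.

End LatticePoints.

(** * Pairs (a, D) with a given bound on the height *)

Section RootCount.
Variable R : realType.
Local Notation lam := (@lebesgue_measure R).
Implicit Types (T y beta : R).

Lemma ht_real (A B : int) : (ht (A, B))%:~R = Num.max (4 * `|A%:~R| ^+ 3) (27 * B%:~R ^+ 2) :> R.
Proof.
have h1 : (`|4 * A ^+ 3|)%:~R = 4 * `|A%:~R| ^+ 3 :> R.
  by rewrite intr_norm rmorphM rmorphXn /= normrM normrX ger0_norm.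
have h2 : (`|27 * B ^+ 2|)%:~R = 27 * B%:~R ^+ 2 :> R.
  by rewrite intr_norm rmorphM rmorphXn /= ger0_norm // mulr_ge0 // sqr_ge0.
rewrite -h1 -h2 /ht /=; case: (lerP `|4 * A ^+ 3| `|27 * B ^+ 2|) => h.
  by rewrite max_r // ler_int.
by rewrite max_l // ler_int ltW.
Qed.

Definition param (a D : int) : R := 3 + 6 * D%:~R / a%:~R ^+ 2.

(** Homogeneity: with [beta = param a D] one has [A = a ^ 2 beta] and
    [B = - a ^ 3 quad beta / 4]. *)
Lemma ht_param (A B a D : int) : a != 0 -> A = 3 * a ^+ 2 + 6 * D -> a * B = 3 * D ^+ 2 - a ^+ 4 ->
  (ht (A, B))%:~R = a%:~R ^+ 6 * hmax (param a D).
Proof.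
move=> a0 AE BE; have aR : (a%:~R : R) != 0 by rewrite intr_eq0.
have ae : 0 <= (a%:~R : R) ^+ 6 by rewrite exprn_even_ge0.
rewrite ht_real /hmax maxr_pMr //; congr Num.max.
  have -> : A%:~R = a%:~R ^+ 2 * param a D.
    by rewrite AE /param; field.
  by rewrite normrM exprMn ger0_norm ?sqr_ge0 //; ring.
have -> : B%:~R = - (a%:~R ^+ 3 * quad (param a D)) / 4.
  apply: (mulfI aR); rewrite -intrM BE /quad /param; field.
  by [].
by field.
Qed.

Lemma ht_le_hfun T (A B a D : int) : 0 < T -> a != 0 -> A = 3 * a ^+ 2 + 6 * D -> a * B = 3 * D ^+ 2 - a ^+ 4 ->
  ((ht (A, B))%:~R <= T ^+ 6) = (`|a|%:~R <= T * hfun (param a D)).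
Proof.
move=> T0 a0 AE BE; rewrite (ht_param a0 AE BE).
have aR : 0 < (`|a|%:~R : R) by rewrite ltr0z normr_gt0.
have -> : (a%:~R : R) ^+ 6 = `|a|%:~R ^+ 6.
  by rewrite intr_norm -normrX ger0_norm // exprn_even_ge0.
rewrite -[RHS](@ler_pM2l _ T^-1) ?invr_gt0 // mulKf ?gt_eqF //.
rewrite le_hfun ?mulr_gt0 ?invr_gt0 // exprMn exprVn.
rewrite -[RHS](@ler_pM2l _ (T ^+ 6)) ?exprn_gt0 // mulr1.
by rewrite -[(T ^+ 6)^-1 * _ * _]mulrA mulVKf // expf_eq0 gt_eqF.
Qed.

Definition cubic_bound T (a : nat) : set R := [set beta | a%:R <= T * hfun beta].

(** The bound on [A] limits [|beta|], the bound on [B] says [|quad beta| <= kap]. Removing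
    [quad > kap] from [quad >= - kap] presents the set as a difference of two regions, each of which
    is an interval by concavity. *)
Lemma cubic_boundE T a : 0 < T -> (0 < a)%N -> exists y kap : R, [/\ 0 < y, 0 <= kap,
  a%:R = T * y & cubic_bound T a =
  [set b | y ^+ 6 * (4 * `|b| ^+ 3) <= 1 /\ - kap <= quad b] `\`
  [set b | y ^+ 6 * (4 * `|b| ^+ 3) <= 1 /\ kap < quad b]].
Proof.
move=> T0 a0; have aR : (0 : R) < a%:R by rewrite ltr0n.
pose y : R := a%:R / T; have y0 : 0 < y by rewrite divr_gt0.
have yE : a%:R = T * y by rewrite mulrC mulfVK ?gt_eqF.
pose kap := Num.sqrt (16 / 27 / y ^+ 6).
have k2 : kap ^+ 2 = 16 / 27 / y ^+ 6 by rewrite sqr_sqrtr // !divr_ge0 // exprn_ge0 // ltW.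
have k0 : 0 <= kap by apply: sqrtr_ge0.
exists y, kap; split=> //.
have E b : cubic_bound T a b <-> y ^+ 6 * (4 * `|b| ^+ 3) <= 1 /\ `|quad b| <= kap.
  rewrite /cubic_bound /= yE ler_pM2l // le_hfun // /hmax maxr_pMr ?exprn_ge0 ?(ltW y0) // ge_max.
  have -> : (y ^+ 6 * (27 / 16 * quad b ^+ 2) <= 1) = (`|quad b| <= kap).
    rewrite -[RHS](@ler_pXn2r _ 2) ?nnegrE // real_normK ?num_real // k2 ler_pdivlMr ?exprn_gt0 //.
    by apply/idP/idP => h; lra.
  by split=> [/andP//|[-> ->]].
apply/seteqP; split=> b /=.
  move/E => [h1]; rewrite ler_norml => /andP[h2 h3]; split=> // -[_].
  by rewrite ltNge h3.
move=> [[h1 h2] h3]; apply/E; split=> //; rewrite ler_norml h2 /= leNgt; apply/negP => h.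
by apply: h3.
Qed.

(** [quad] is concave with maximum at 3, so at a point between [u] and [v] it is at least one of the
    two end values; the constant 6 is twice the axis. *)
Lemma quad_region_interval y kap (P : R -> Prop) : 0 < y -> (P = fun q => - kap <= q) \/ (P = fun q => kap < q) ->
  is_interval [set b : R | y ^+ 6 * (4 * `|b| ^+ 3) <= 1 /\ P (quad b)].
Proof.
move=> y0 HP u v [u1 u2] [v1 v2] z /andP[uz zv]; split.
  have : `|z| <= Num.max `|u| `|v|.
    rewrite le_max; have [z0|z0] := lerP 0 z.
      by rewrite (ger0_norm z0) (ger0_norm (le_trans z0 zv)) zv orbT.
    have u0 : u < 0 by apply: le_lt_trans z0.
    by rewrite (ltr0_norm z0) (ltr0_norm u0) lerN2 uz.
  have mono t : `|z| <= `|t| -> y ^+ 6 * (4 * `|t| ^+ 3) <= 1 -> y ^+ 6 * (4 * `|z| ^+ 3) <= 1.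
    move=> zt; apply: le_trans; rewrite ler_pM2l ?exprn_gt0 // ler_pM2l //.
    by rewrite ler_pXn2r ?nnegrE.
  by rewrite le_max => /orP[] /mono; apply.
have cav : quad u <= quad z \/ quad v <= quad z.
  have [h|h] := lerP (u + z) 6; [left | right].
    rewrite -subr_ge0 (_ : _ - _ = (z - u) * (6 - (u + z)) / 3); last by rewrite /quad; field.
    by rewrite divr_ge0 // mulr_ge0 // subr_ge0.
  rewrite -subr_ge0 (_ : _ - _ = (v - z) * ((z + v) - 6) / 3); last by rewrite /quad; field.
  by rewrite divr_ge0 // mulr_ge0 // subr_ge0 //; lra.
by case: HP u2 v2 => -> u2 v2; case: cav => h; lra.
Qed.

Definition root_pairs T : set (nat * int) :=
  [set aD | [/\ (0 < aD.1)%N, (aD.1 %| 3 * `|aD.2| ^ 2)%N & aD.1%:R <= T * hfun (param aD.1%:Z aD.2)]].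

(** The admissible [D] are the multiples of [w = a / s(3 a)], so [beta = 3 + 6 D / a ^ 2] runs
    through a progression of step [6 / (a s(3 a))]. Each of the two intervals contributes an error
    of at most 1. *)
Lemma fiber_count T (a : nat) : 0 < T -> (0 < a)%N ->
  [/\ measurable (cubic_bound T a), lam (cubic_bound T a) \is a fin_num &
  `|(cnt [set D | root_pairs T (a, D)])%:R - (a * sqrt_part (3 * a))%:R / 6 * fine (lam (cubic_bound T a))| <= 2].
Proof.
move=> T0 a0; have [y [kap [y0 k0 aE SE]]] := cubic_boundE T0 a0.
set I := [set b | _ /\ - kap <= quad b] in SE; set J := [set b | _ /\ kap < quad b] in SE.
have iI : is_interval I by apply: (@quad_region_interval y kap (fun q => - kap <= q)) => //; left.
have iJ : is_interval J by apply: (@quad_region_interval y kap (fun q => kap < q)) => //; right.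
have JI : J `<=` I by move=> b [h1 h2]; split=> //; lra.
have mI := is_interval_measurable iI; have mJ := is_interval_measurable iJ.
have [dE ua] := dvdn_3sqr 0 a0.
set u := sqrt_part (3 * a) in dE ua *; pose w := (a %/ u)%N.
have u0 : (0 < u)%N by apply: sqrt_part_gt0; rewrite muln_gt0.
have aw : a = (w * u)%N by rewrite divnK.
have w0 : (0 < w)%N by move: a0; rewrite aw muln_gt0 => /andP[].
have wR : (0 : R) < w%:R by rewrite ltr0n.
have uR : (0 : R) < u%:R by rewrite ltr0n.
have aR : (0 : R) < a%:R by rewrite ltr0n.
pose d : R := 6 * w%:R / a%:R ^+ 2.
have d0 : 0 < d by rewrite divr_gt0 ?mulr_gt0 ?exprn_gt0.
have dV : d^-1 = (a * u)%:R / 6.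
  rewrite /d aw !natrM; move: wR uR; move: w%:R u%:R => p q p0 q0; field.
  by rewrite !gt_eqF.
pose L := 1 + (4 * y ^+ 6)^-1.
have y6 : 0 < y ^+ 6 by rewrite exprn_gt0.
have Lb b : I b -> `|b| <= L.
  move=> [h _]; rewrite leNgt; apply/negP => lt.
  have i0 : 0 < (4 * y ^+ 6)^-1 by rewrite invr_gt0 mulr_gt0.
  have b1 : 1 <= `|b| by rewrite /L in lt; lra.
  have b3 : `|b| <= `|b| ^+ 3 by rewrite -[leLHS]expr1 ler_weXn2l.
  have : (4 * y ^+ 6)^-1 < `|b| ^+ 3 by rewrite /L in lt; lra.
  by rewrite -[_^-1]mul1r ltr_pdivrMr ?mulr_gt0 // => h'; lra.
have L0 : 0 <= L by rewrite addr_ge0 // invr_ge0 mulr_ge0 // ltW.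
(* [L] bounds [|beta|]; the progression is started [M] steps below its point 3 (where [D = 0]), so
   that it covers the whole region. *)
have [M dM] : exists M : nat, L + 3 <= d * M%:R.
  by exists (truncn ((L + 3) / d)).+1; rewrite mulrC -ler_pdivrMr // ltW // truncnS_gt.
pose s : R := 3 - d * M%:R; pose K := (2 * M).+1.
have bI b : I b -> s <= b < s + d * K%:R.
  move=> /Lb; rewrite ler_norml => /andP[h1 h2]; rewrite /s /K -[(2 * M).+1%:R]natr1 [(2 * M)%:R]natrM; apply/andP; split; first by lra.
  rewrite (_ : 3 - d * M%:R + d * (2%:R * M%:R + 1) = 3 + d * M%:R + d); last by ring.
  by lra.
have cI := lattice_interval d0 iI bI.
have cJ := lattice_interval d0 iJ (fun b Jb => bI b (JI b Jb)).
have sK : s <= s + d * K%:R by rewrite lerDl mulr_ge0 // ltW.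
have bI' b : I b -> s <= b <= s + d * K%:R by move=> /bI /andP[-> /ltW].
have [fI _] := lebesgue_le mI sK bI'.
have [fJ _] := lebesgue_le mJ sK (fun b Jb => bI' b (JI b Jb)).
have lS : lam (cubic_bound T a) = (lam I - lam J)%E.
  rewrite SE measureD // ?(setIidr JI) //.
  by rewrite -ge0_fin_numE.
split.
- by rewrite SE; apply: measurableD.
- by rewrite lS fin_numB fI fJ.
rewrite lS fineB // -dV.
have pE j : param a%:Z (w%:Z * (j%:Z - M%:Z)) = s + d * j%:R.
  rewrite /param /s /d !(intrM, intrB) /= -!pmulrn.
  by field; rewrite gt_eqF.
pose ds := [seq w%:Z * (j%:Z - M%:Z) | j <- iota 0 K].
have uds : uniq ds.
  rewrite map_inj_uniq ?iota_uniq // => i j /eqP.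
  rewrite (inj_eq (mulfI _)); last by rewrite -lt0n in w0 *; case: (w) w0.
  by rewrite (inj_eq (addIr _)) => /eqP [].
rewrite (@cnt_count _ _ ds) //; last first.
  move=> D [_ /= dv h]; move: dv; have [-> _] := dvdn_3sqr `|D| a0.
  rewrite -/u -/w => wD; have /dvdzP [k kE] : (w%:Z %| D)%Z by rewrite dvdzE.
  have : cubic_bound T a (param a%:Z D) by [].
  rewrite SE => -[/bI /andP[h1 h2] _].
  have pE2 : param a%:Z D = s + d * (k + M%:Z)%:~R.
    by rewrite /param /s /d kE intrM intrD -!pmulrn; field; rewrite gt_eqF.
  rewrite pE2 lerDl pmulr_rge0 // in h1; rewrite pE2 ltrD2l ltr_pM2l // in h2.
  apply/mapP; exists (absz (k + M%:Z)); last first.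
    by rewrite kE gez0_abs ?addrK 1?mulrC // -(ler0z R).
  have kM : 0 <= k + M%:Z by rewrite -(ler0z R).
  by rewrite mem_iota add0n leq0n /= -ltz_nat gez0_abs // -(ltr_int R) -pmulrn.
rewrite /ds count_map.
have -> : count (preim (fun j : nat => w%:Z * (j%:Z - M%:Z)) (fun D => `[< [set D | root_pairs T (a, D)] D >])) (iota 0 K)
   = count (fun j : nat => `[< cubic_bound T a (s + d * j%:R) >]) (iota 0 K).
  apply: eq_count => j /=; apply: asbool_equiv_eq; rewrite -pE; split=> [[_ _]//|h]; split=> //=.
  by have [-> _] := dvdn_3sqr `|w%:Z * (j%:Z - M%:Z)| a0; rewrite abszM dvdn_mulr.
have -> : count (fun j : nat => `[< cubic_bound T a (s + d * j%:R) >]) (iota 0 K)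
  = (count (fun j : nat => `[< I (s + d * j%:R)%R >]) (iota 0 K) - count (fun j : nat => `[< J (s + d * j%:R)%R >]) (iota 0 K))%N.
  apply/eqP; rewrite -(eqn_add2r (count (fun j : nat => `[< J (s + d * j%:R)%R >]) (iota 0 K))) subnK; last first.
    by apply: sub_count => j /asboolP /JI h; apply/asboolP.
  rewrite -count_predUI (@eq_count _ (predI _ _) pred0) ?count_pred0 ?addn0; last first.
    move=> j /=; apply/negP => /andP[/asboolP]; rewrite SE => -[_ h] /asboolP; exact: h.
  apply/eqP; apply: eq_count => j /=; apply/orP/asboolP => [[]/asboolP|h].
  - by rewrite SE => -[].
  - exact: JI.
  - have [Jj|nJ] := pselect (J (s + d * j%:R)); [right|left]; apply/asboolP => //.
    by rewrite SE.
rewrite natrB; last by apply: sub_count => j /asboolP /JI h; apply/asboolP.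
move: cI cJ; rewrite !ler_norml mulrBr ![d^-1 * _]mulrC => /andP[a1 a2] /andP[a3 a4].
by apply/andP; split; lra.
Qed.

Lemma integrable_cubic_bound T (a : nat) (k : R) : 0 < T -> (0 < a)%N ->
  lam.-integrable [set: R] (EFin \o (fun b => k * \1_(cubic_bound T a) b)) /\
  \int[lam]_b (k * \1_(cubic_bound T a) b) = k * fine (lam (cubic_bound T a)).
Proof.
move=> T0 a0; have [mS fS _] := fiber_count T0 a0.
have i1 : lam.-integrable [set: R] (EFin \o \1_(cubic_bound T a)).
  apply/integrableP; split; first by apply/measurable_EFinP; exact: measurable_indic.
  under eq_integral => x _ do rewrite /= ger0_norm //.
  by rewrite integral_indic // setIT -ge0_fin_numE.
split; first by have := integrableZl measurableT k i1; apply: eq_integrable.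
by rewrite RintegralZl // /Rintegral integral_indic // setIT.
Qed.

(** As [hfun <= 2], only [a <= 2 T] occur, and the integrand is a finite sum of indicators of the
    sets [cubic_bound T a]. *)
Lemma integral_sqrt_sum3 T : 0 < T ->
  lam.-integrable [set: R] (EFin \o (fun b => sqrt_sum3 (T * hfun b))) /\
  \int[lam]_b (sqrt_sum3 (T * hfun b)) =
  \sum_(1 <= a < (truncn (2 * T)).+1) (a * sqrt_part (3 * a))%:R * fine (lam (cubic_bound T a)).
Proof.
move=> T0; set N := truncn (2 * T).
have E b : sqrt_sum3 (T * hfun b) = \sum_(1 <= a < N.+1) (a * sqrt_part (3 * a))%:R * \1_(cubic_bound T a) b.
  have x0 : 0 <= T * hfun b by rewrite mulr_ge0 ?(ltW T0) ?(ltW (hfun_gt0 b)).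
  have le : (truncn (T * hfun b) <= N)%N.
    by apply: le_truncn; rewrite mulrC ler_pM2r //; apply: hfun_le2.
  rewrite /sqrt_sum3 -[LHS](psum_if (fun a => (a * sqrt_part (3 * a))%:R) le); apply: eq_bigr => a _.
  rewrite truncn_ge_nat // indicE /cubic_bound.
  by rewrite (_ : (b \in _) = (a%:R <= T * hfun b)) ?inE //; [case: ifP; rewrite ?mulr1 ?mulr0 | apply/idP/idP; rewrite inE].
have -> : (fun b => sqrt_sum3 (T * hfun b)) = (fun b => \sum_(1 <= a < N.+1) (a * sqrt_part (3 * a))%:R * \1_(cubic_bound T a) b).
  by apply/funext => b.
elim: N {E} => [|N [IH1 IH2]].
  split; last by rewrite !big_nil; under eq_Rintegral do rewrite big_nil; rewrite Rintegral_cst // mul0r.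
  by apply: (eq_integrable measurableT (cst 0%E)) => [x _|]; rewrite ?big_nil //=; [rewrite big_nil | exact: integrable0].
have [j1 j2] := integrable_cubic_bound (N.+1 * sqrt_part (3 * N.+1))%:R T0 (ltn0Sn N).
have Ef : (fun b => \sum_(1 <= a < N.+2) (a * sqrt_part (3 * a))%:R * \1_(cubic_bound T a) b) =
  (fun b => \sum_(1 <= a < N.+1) (a * sqrt_part (3 * a))%:R * \1_(cubic_bound T a) b +
   (N.+1 * sqrt_part (3 * N.+1))%:R * \1_(cubic_bound T N.+1) b :> R).
  by apply/funext => b; rewrite big_nat_recr.
rewrite Ef big_nat_recr //=; split; last by rewrite RintegralD // IH2 j2.
by have := integrableD measurableT IH1 j1; apply: eq_integrable.
Qed.

Lemma good_integral_sqrt_sum3 (Z : R) : psum (@dirichlet R xpredT 2) @ \oo --> Z ->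
  good (fun T => \int[lam]_b (sqrt_sum3 (T * hfun b))) (3 / (8 * Z) * \int[lam]_b (hfun b ^+ 2)).
Proof.
move=> cZ; apply: good_integral; last exact: good_sqrt_sum3.
by move=> T T0; have [] := integral_sqrt_sum3 T0.
Qed.

Definition int_box (M : nat) : seq int := [seq j%:Z - M%:Z | j <- iota 0 (2 * M).+1].

Lemma int_box_uniq M : uniq (int_box M).
Proof. by rewrite map_inj_uniq ?iota_uniq // => i j /addIr []. Qed.

Lemma mem_int_box M (D : int) : (`|D| <= M)%N -> D \in int_box M.
Proof.
move=> le; apply/mapP; exists (absz (D + M%:Z)); last by lia.
by rewrite mem_iota; lia.
Qed.

Lemma root_pairs_bound T a D : 0 < T -> root_pairs T (a, D) ->
  (a <= truncn (2 * T))%N /\ (`|D| <= truncn (T ^+ 6 + 12 * T ^+ 2))%N.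
Proof.
move=> T0 [/= a0 _ h]; have aR : (0 : R) < a%:R by rewrite ltr0n.
have a2 : a%:R <= 2 * T by have := hfun_le2 (param a%:Z D); nra.
split; first by rewrite truncn_ge_nat // mulr_ge0 // ltW.
have bd : 0 <= T ^+ 6 + 12 * T ^+ 2 by rewrite addr_ge0 ?mulr_ge0 ?exprn_ge0 // ltW.
rewrite truncn_ge_nat // natr_absz intr_norm.
pose A : int := 3 * a%:Z ^+ 2 + 6 * D.
have A3 : `|(A%:~R : R)| ^+ 3 <= T ^+ 6.
  have aE : (A%:~R : R) = a%:R ^+ 2 * param a%:Z D.
    by rewrite /A /param; field; rewrite gt_eqF.
  have := h; rewrite -ler_pdivrMl // le_hfun ?mulr_gt0 ?invr_gt0 // /hmax maxr_pMr ?exprn_ge0 ?mulr_ge0 ?invr_ge0 ?(ltW T0) //.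
  rewrite ge_max => /andP[h1 _].
  rewrite aE normrM exprMn ger0_norm ?sqr_ge0 //.
  move: h1; rewrite exprMn exprVn -(@ler_pM2l _ (T ^+ 6)) ?exprn_gt0 // mulr1 -[(T ^+ 6)^-1 * _ * _]mulrA mulVKf; last by rewrite expf_eq0 gt_eqF.
  have : 0 <= a%:R ^+ 6 * `|param a%:Z D| ^+ 3 by rewrite mulr_ge0 ?exprn_ge0.
  by rewrite (_ : (a%:R ^+ 2) ^+ 3 = a%:R ^+ 6 :> R); [lra | ring].
have A1 : `|(A%:~R : R)| <= T ^+ 6.
  apply: le_trans A3; rewrite -intr_norm -rmorphXn ler_int.
  have [->|A0] := eqVneq A 0; first by rewrite normr0 expr0n.
  by rewrite -[leLHS]expr1 ler_weXn2l // -gtz0_ge1 normr_gt0.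
have -> : (D%:~R : R) = (A%:~R - 3 * a%:R ^+ 2) / 6 by rewrite /A; field.
rewrite normrM [X in _ * X]ger0_norm // ler_pdivrMr //.
apply: le_trans (ler_normB _ _) _; rewrite [X in _ + X]ger0_norm ?mulr_ge0 ?sqr_ge0 //.
have : a%:R ^+ 2 <= (2 * T) ^+ 2 by rewrite ler_pXn2r ?nnegrE // ltW // mulr_gt0.
by have : 0 <= T ^+ 6 by [rewrite exprn_ge0 // ltW]; nra.
Qed.

Lemma finite_root_pairs T : 0 < T -> finite_set (root_pairs T).
Proof.
move=> T0; apply: (@finite_mem_seq _ _ [seq (a, D) | a <- iota 1 (truncn (2 * T)), D <- int_box (truncn (T ^+ 6 + 12 * T ^+ 2))]).
move=> [a D] aD; have [h1 h2] := root_pairs_bound T0 aD; have [a0 _ _] := aD.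
apply: allpairs_f; last exact: mem_int_box.
by rewrite mem_iota a0 add1n ltnS.
Qed.

Lemma cnt_root_pairs T : 0 < T ->
  `|(cnt (root_pairs T))%:R - 6^-1 * \int[lam]_b (sqrt_sum3 (T * hfun b))| <= 4 * T.
Proof.
move=> T0; have [_ ->] := integral_sqrt_sum3 T0; set N := truncn (2 * T).
rewrite (@cnt_fibers _ _ _ (iota 1 N) (iota_uniq _ _) (finite_root_pairs T0)); last first.
  move=> a D aD; have [h1 _] := root_pairs_bound T0 aD; have [/= a0 _ _] := aD.
  by rewrite mem_iota a0 add1n ltnS.
have -> : iota 1 N = index_iota 1 N.+1 by rewrite /index_iota subn1.
rewrite natr_sum mulr_sumr -sumrB; apply: le_trans (ler_norm_sum _ _ _) _.
apply: le_trans (_ : \sum_(1 <= a < N.+1) 2 <= _).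
  rewrite big_nat_cond [leRHS]big_nat_cond; apply: ler_sum => a; rewrite andbT => /andP[a0 _].
  have [_ _] := fiber_count T0 a0; rewrite (_ : _ / 6 * _ = 6^-1 * ((a * sqrt_part (3 * a))%:R * fine (lam (cubic_bound T a)))) //.
  by ring.
rewrite sumr_const_nat subn1 /= -mulr_natr.
have : N%:R <= 2 * T by rewrite truncn_le mulr_ge0 // ltW.
by lra.
Qed.

End RootCount.

(** * Counting curves *)

Definition curve_of (aD : int * int) : int * int :=
  (3 * aD.1 ^+ 2 + 6 * aD.2, ((3 * aD.2 ^+ 2 - aD.1 ^+ 4) %/ aD.1)%Z).

Definition has_root (AB : int * int) := exists a, psi3 AB.1 AB.2 a = 0.

(** Some root, chosen once for each curve, with default 0; it makes [pair_of] a section of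
    [curve_of] even when there are two roots. *)
Definition a_root (AB : int * int) : int :=
  if pselect (has_root AB) is left H then sval (cid H) else 0.

Definition pair_of (AB : int * int) : int * int :=
  (a_root AB, ((AB.1 - 3 * a_root AB ^+ 2) %/ 6)%Z).

Lemma a_rootP AB : has_root AB -> psi3 AB.1 AB.2 (a_root AB) = 0.
Proof. by rewrite /a_root; case: pselect => // H _; case: (cid H). Qed.

Lemma curve_ofP a D : a != 0 -> (`|a| %| 3 * `|D| ^ 2)%N ->
  a * (curve_of (a, D)).2 = 3 * D ^+ 2 - a ^+ 4.
Proof.
move=> a0 dv; rewrite /curve_of /= mulrC divzK //.
apply: rpredB; last by rewrite exprS dvdz_mulr.
by rewrite dvdzE abszM abszX.
Qed.

Lemma psi3_curve_of a D : a != 0 -> (`|a| %| 3 * `|D| ^ 2)%N ->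
  psi3 (curve_of (a, D)).1 (curve_of (a, D)).2 a = 0.
Proof. by move=> a0 dv; apply/psi3_param => //; exists D; split=> //; apply: curve_ofP. Qed.

Lemma psi3_pair A B a : a != 0 -> psi3 A B a = 0 ->
  let D := ((A - 3 * a ^+ 2) %/ 6)%Z in
  [/\ A = 3 * a ^+ 2 + 6 * D, a * B = 3 * D ^+ 2 - a ^+ 4 & (`|a| %| 3 * `|D| ^ 2)%N].
Proof.
move=> a0 /psi3_param => /(_ a0) [D [AE BE]] /=.
have -> : ((A - 3 * a ^+ 2) %/ 6)%Z = D by rewrite AE addrC addKr mulrC mulzK.
split=> //; have : (a %| 3 * D ^+ 2)%Z.
  apply/dvdzP; exists (B + a ^+ 3); move: BE => /eqP; rewrite eq_sym subr_eq => /eqP ->; ring.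
by rewrite dvdzE abszM abszX.
Qed.

Lemma curve_of_pair A B a : a != 0 -> psi3 A B a = 0 -> curve_of (a, ((A - 3 * a ^+ 2) %/ 6)%Z) = (A, B).
Proof.
move=> a0 /(psi3_pair a0) [AE BE dv]; have := curve_ofP a0 dv; rewrite -BE => /(mulfI a0) E.
by rewrite [LHS]surjective_pairing E /= -AE.
Qed.

(** * Curves with a nonzero root, minimal or not *)

Section CurveCount.
Variable R : realType.
Implicit Types T : R.

Definition signed_pairs T : set (int * int) :=
  [set aD | [/\ aD.1 != 0, (`|aD.1| %| 3 * `|aD.2| ^ 2)%N & `|aD.1|%:~R <= T * hfun (param R aD.1 aD.2)]].

Definition curves T : set (int * int) :=
  [set AB | [/\ AB.1 != 0, 4 * AB.1 ^+ 3 + 27 * AB.2 ^+ 2 != 0, has_root AB & (ht AB)%:~R <= T ^+ 6]].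

Lemma param_abs a D : param R (absz a)%:Z D = param R a D.
Proof.
have E : (absz a)%:Z ^+ 2 = a ^+ 2 by rewrite abszE -normrX ger0_norm ?sqr_ge0.
by rewrite /param -[in LHS]rmorphXn /= E rmorphXn.
Qed.

Lemma signed_pairs_abs T a D : a != 0 -> signed_pairs T (a, D) <-> root_pairs T (absz a, D).
Proof.
move=> a0; rewrite /signed_pairs /root_pairs /= param_abs absz_gt0 a0 natr_absz.
by split=> -[].
Qed.

Lemma signed_pairs_bound T a D : 0 < T -> signed_pairs T (a, D) ->
  (absz a <= truncn (2 * T))%N /\ (absz D <= truncn (T ^+ 6 + 12 * T ^+ 2))%N.
Proof.
move=> T0 H; have [/= a0 _ _] := H; move/(signed_pairs_abs _ _ a0): H.
exact: root_pairs_bound.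
Qed.

Lemma finite_signed_pairs T : 0 < T -> finite_set (signed_pairs T).
Proof.
move=> T0; apply: (@finite_mem_seq _ _ [seq (a, D) | a <- int_box (truncn (2 * T)), D <- int_box (truncn (T ^+ 6 + 12 * T ^+ 2))]).
move=> [a D] aD; have [h1 h2] := signed_pairs_bound T0 aD.
by apply: allpairs_f; apply: mem_int_box.
Qed.

(** [param] depends on [a] only through [a ^ 2], so [(a, D)] and [(-a, D)] occur together. *)
Lemma cnt_signed_pairs T : 0 < T -> cnt (signed_pairs T) = (2 * cnt (root_pairs T))%N.
Proof.
move=> T0; pose S := [set x : bool * (nat * int) | root_pairs T x.2].
have fS : finite_set S.
  have /finite_seqP [s sE] := finite_root_pairs T0.
  apply: (@finite_mem_seq _ _ [seq (b, x) | b <- [:: true; false], x <- s]) => -[b x] Sx.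
  apply: allpairs_f; first by case: b {Sx}; rewrite !inE.
  by have : [set` s] x by rewrite -sE.
have -> : cnt (signed_pairs T) = cnt S.
  apply: (cnt_bij (finite_signed_pairs T0) fS (f := fun x => (x.1 < 0, (absz x.1, x.2))) (g := fun y => (if y.1 then - (y.2.1)%:Z else (y.2.1)%:Z, y.2.2))).
  - by move=> [a D] aD; have [/= a0 _ _] := aD; apply/signed_pairs_abs.
  - move=> [b [a D]] aD; have [/= a0 _ _] := aD.
    have an : (if b then - a%:Z else a%:Z) != 0 by case: b {aD}; rewrite ?oppr_eq0 -lt0n.
    by apply/(signed_pairs_abs _ _ an); case: b {aD an} (aD : root_pairs T (a, D)); rewrite ?abszN.
  - move=> [a D] _ /=; congr (_, _); case: ifP => h; last by rewrite gez0_abs // leNgt h.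
    by rewrite ltz0_abs // opprK.
  - move=> [b [a D]] [/= a0 _ _]; case: b => /=; rewrite ?abszN /=; congr (_, _).
    by rewrite oppr_lt0 ltz_nat.
have -> : cnt S = (\sum_(b <- [:: true; false]) cnt [set x | S (b, x)])%N.
  by apply: cnt_fibers => // -[] x _; rewrite !inE.
by rewrite !big_cons big_nil addn0 mul2n addnn.
Qed.

Lemma ht_abs_le T (A B : int) : (ht (A, B))%:~R <= T ^+ 6 -> 0 <= T -> (absz A <= truncn (T ^+ 6))%N /\ (absz B <= truncn (T ^+ 6))%N.
Proof.
rewrite ht_real ge_max => /andP[h1 h2] T0; have T6 : 0 <= T ^+ 6 by rewrite exprn_ge0.
split; rewrite truncn_ge_nat // natr_absz intr_norm.
  have [->|A0] := eqVneq A 0; first by rewrite normr0.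
  have A1 : 1 <= `|A%:~R : R| by rewrite -intr_norm -[1]/(1%:~R) ler_int -gtz0_ge1 normr_gt0.
  by have : `|A%:~R : R| <= `|A%:~R| ^+ 3; [rewrite -[leLHS]expr1 ler_weXn2l | lra].
have [->|B0] := eqVneq B 0; first by rewrite normr0.
have B1 : 1 <= `|B%:~R : R| by rewrite -intr_norm -[1]/(1%:~R) ler_int -gtz0_ge1 normr_gt0.
have : `|B%:~R : R| <= `|B%:~R| ^+ 2 by rewrite -[leLHS]expr1 ler_weXn2l.
by rewrite real_normK ?num_real //; lra.
Qed.

Lemma finite_ht_le T (P : set (int * int)) : 0 <= T -> (forall AB, P AB -> (ht AB)%:~R <= T ^+ 6) -> finite_set P.
Proof.
move=> T0 H; apply: (@finite_mem_seq _ _ [seq (a, D) | a <- int_box (truncn (T ^+ 6)), D <- int_box (truncn (T ^+ 6))]).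
move=> [A B] /H /ht_abs_le => /(_ T0) [h1 h2].
by apply: allpairs_f; apply: mem_int_box.
Qed.

Lemma finite_curves T : 0 <= T -> finite_set (curves T).
Proof. by move=> T0; apply: (finite_ht_le T0) => AB []. Qed.

Lemma curves_root T AB : curves T AB -> a_root AB != 0 /\ psi3 AB.1 AB.2 (a_root AB) = 0.
Proof.
move=> [A0 _ /a_rootP r0 _]; split=> //; apply/eqP => E; move: r0; rewrite E /psi3.
move/eqP; rewrite !expr0n /= !mulr0 !add0r oppr_eq0 expf_eq0 /=.
exact/negP.
Qed.

Lemma pair_of_curves T AB : 0 < T -> curves T AB -> signed_pairs T (pair_of AB) /\ curve_of (pair_of AB) = AB.
Proof.
case: AB => A B T0 cAB; have [r0 rE] := curves_root cAB; have [_ _ _ hAB] := cAB.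
split; last exact: curve_of_pair.
have [AE BE dv] := psi3_pair r0 rE; split=> //.
by rewrite -(ht_le_hfun T0 r0 AE BE).
Qed.

(** The first alternative is [A = 0], the other two are the singular curves found in
    [disc_param]. *)
Definition degenerate T : set (int * int) :=
  [set x | signed_pairs T x /\ [\/ 2 * x.2 = - x.1 ^+ 2, x.2 = - x.1 ^+ 2 | 9 * x.2 = - (5 * x.1 ^+ 2)]].

Definition two_roots T : set (int * int) :=
  [set x | signed_pairs T x /\ exists b, [/\ b != x.1, b != 0 & psi3 (curve_of x).1 (curve_of x).2 b = 0]].

(** [pair_of] is injective on curves. A pair outside its image either gives no member of [curves T],
    hence is degenerate, or carries a root different from the chosen one. *)
Lemma cnt_curves_le T : 0 < T -> (cnt (curves T) <= cnt (signed_pairs T))%N /\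
  (cnt (signed_pairs T) <= cnt (curves T) + cnt (degenerate T) + cnt (two_roots T))%N.
Proof.
move=> T0; have fC := finite_curves (ltW T0); have fS := finite_signed_pairs T0.
have fd : finite_set (degenerate T) by apply: sub_finite_set fS => x [].
have ft : finite_set (two_roots T) by apply: sub_finite_set fS => x [].
split.
  apply: (@cnt_inj _ _ _ _ pair_of fC fS) => [x /(pair_of_curves T0) []//|x y].
  by move=> /(pair_of_curves T0) [_ {2}<-] /(pair_of_curves T0) [_ {2}<-] ->.
have fi : finite_set (pair_of @` curves T) by apply: finite_image.
apply: leq_trans (_ : cnt ((pair_of @` curves T) `|` degenerate T `|` two_roots T) <= _)%N.
  apply: cnt_sub => [|[a D] sx]; first by rewrite !finite_setU.
  have [/= a0 dv hT] := sx; have BE := curve_ofP a0 dv.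
  have aR := psi3_curve_of a0 dv.
  have [A0|A0] := eqVneq (curve_of (a, D)).1 0.
    left; right; split=> //; constructor 1; move: A0; rewrite /curve_of /= => A0.
    by apply: (mulfI (_ : 3 != 0)) => //; apply/eqP; rewrite -subr_eq0 -A0; apply/eqP; ring.
  have [d0|d0] := eqVneq (4 * (curve_of (a, D)).1 ^+ 3 + 27 * (curve_of (a, D)).2 ^+ 2) 0.
    left; right; split=> //; have [E|E] := disc_param a0 BE d0; [by constructor 2|by constructor 3].
  have cx : curves T (curve_of (a, D)).
    split=> //; first by exists a.
    by rewrite [curve_of _]surjective_pairing (ht_le_hfun T0 a0 erefl BE).
  have [rE|rE] := eqVneq (a_root (curve_of (a, D))) a.
    left; left; exists (curve_of (a, D)) => //; rewrite /pair_of rE; congr (_, _).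
    by rewrite /curve_of /= addrC addKr mulrC mulzK.
  right; split=> //; exists (a_root (curve_of (a, D))); split=> //.
    by have [] := curves_root cx.
  by have [] := curves_root cx.
apply: leq_trans (cnt_setU _ ft) _; first by rewrite finite_setU.
rewrite leq_add2r; apply: leq_trans (cnt_setU fi fd) _; rewrite leq_add2r.
apply: (@cnt_inj _ _ _ _ curve_of fi fC) => [_ [x cx <-]|_ _ [x cx <-] [y cy <-]].
  by have [_ ->] := pair_of_curves T0 cx.
by have [_ ->] := pair_of_curves T0 cx; have [_ ->] := pair_of_curves T0 cy => ->.
Qed.

Lemma natr_double_succ (m : nat) : (2 * m).+1%:R = 2 * m%:R + 1 :> R.
Proof. by rewrite -[_.+1%:R]natr1 [(2 * m)%:R]natrM. Qed.

Lemma cnt_le_size (U : choiceType) (S : set U) (s : seq U) : (forall x, S x -> x \in s) -> (cnt S <= size s)%N.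
Proof.
move=> H; have fS := finite_mem_seq H; apply: uniq_leq_size; first exact: fset_uniq.
by move=> x; rewrite (_ : x \in enum_fset _ = (x \in fset_set S)) // in_fset_set // inE => /H.
Qed.

Lemma cnt_degenerate T : 0 < T -> (cnt (degenerate T) <= 3 * (2 * truncn (2 * T)).+1)%N.
Proof.
move=> T0; pose d (a : int) (i : nat) : int :=
  if i == 0%N then (- a ^+ 2 %/ 2)%Z else if i == 1%N then - a ^+ 2 else (- (5 * a ^+ 2) %/ 9)%Z.
pose L := [seq (a, d a i) | a <- int_box (truncn (2 * T)), i <- [:: 0%N; 1%N; 2%N]].
have -> : (3 * (2 * truncn (2 * T)).+1)%N = size L by rewrite size_allpairs size_map size_iota mulnC.
apply: cnt_le_size => -[a D] [sx H]; have [h1 _] := signed_pairs_bound T0 sx.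
have aL := mem_int_box h1; apply/allpairsP.
move: H => /= [h|h|h]; [exists (a, 0%N) | exists (a, 1%N) | exists (a, 2%N)]; split=> //; congr (_, _); rewrite /d /=.
- by rewrite -h mulKz.
- by [].
- by rewrite -h mulKz.
Qed.

(** For [a = d u ^ 2] with [d] squarefree, [e = d u] works, and [e ^ 2 = d a]. *)
Lemma dvdn_sqr_multiple (a : nat) : (0 < a)%N -> exists e : nat, [/\ (0 < e)%N, (a <= e ^ 2)%N &
  forall s : int, (a %| absz s ^ 2)%N -> (e%:Z %| s)%Z].
Proof.
move=> a0; have [d [d0 sf aE]] := sqrt_part_factor a0; set u := sqrt_part a in aE.
have u0 : (0 < u)%N by apply: sqrt_part_gt0.
exists (d * u)%N; split; first by rewrite muln_gt0 d0.
  by rewrite [in leqLHS]aE expnMn leq_mul2r; apply/orP; right; rewrite -{1}[d]expn1 leq_pexp2l.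
move=> s; rewrite dvdzE /= => h.
have /dvdnP [t tE] : (u %| absz s)%N.
  by rewrite -(@dvdn_pexp2r _ _ 2) //; apply: dvdn_trans h; rewrite [X in (_ %| X)%N]aE dvdn_mull.
rewrite tE dvdn_pmul2r //; apply: squarefree_dvdn_sqr => //.
by move: h; rewrite tE {1}aE expnMn dvdn_pmul2r // expn_gt0 u0.
Qed.

(** By [psi3_two_roots], [(a - b) ^ 2] divides [(A + 3 a b) ^ 2], and [s] is the quotient of the
    bases. Both roots are at most [2 T] in absolute value, so [s ^ 2 = - 3 a b] is at most
    [12 T ^ 2]. *)
Lemma two_roots_witness T a D : 0 < T -> two_roots T (a, D) -> exists b s : int,
  [/\ s != 0, s ^+ 2 = - 3 * a * b, 3 * a ^+ 2 + 6 * D + 3 * a * b = (a - b) * s & (absz s <= truncn (4 * T))%N].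
Proof.
move=> T0 [sx [b [/= ba b0 bR]]]; have [/= a0 dv hT] := sx.
have BE := curve_ofP a0 dv; have aR := psi3_curve_of a0 dv.
have two := psi3_two_roots (_ : a != b) a0 b0 aR bR; rewrite eq_sym in two; have {}two := two ba.
set A := (curve_of (a, D)).1 in two aR bR; set B := (curve_of (a, D)).2 in BE aR bR.
have ab : a - b != 0 by rewrite subr_eq0 eq_sym.
have : (a - b %| A + 3 * a * b)%Z.
  by rewrite dvdzE -(@dvdn_pexp2r _ _ 2) // -!abszX -dvdzE two dvdz_mull.
move=> /dvdzP [s]; rewrite [s * _]mulrC => sE.
have s2 : s ^+ 2 = - 3 * a * b.
  apply: (mulfI (_ : (a - b) ^+ 2 != 0)); first by rewrite expf_eq0.
  by rewrite -exprMn -sE two mulrC.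
have s0 : s != 0.
  by rewrite -sqrf_eq0 s2 !mulf_eq0 !negb_or a0 b0.
exists b, s; split=> //.
have hb : `|b|%:~R <= 2 * T.
  have [AE BE' dv'] := psi3_pair b0 bR.
  have : (ht (A, B))%:~R <= T ^+ 6 by rewrite (ht_le_hfun T0 a0 erefl BE).
  rewrite (ht_le_hfun T0 b0 AE BE') => h; apply: le_trans h _.
  by have := hfun_le2 (param R b ((A - 3 * b ^+ 2) %/ 6)%Z); nra.
have ha : `|a|%:~R <= 2 * T.
  by apply: le_trans hT _; have := hfun_le2 (param R a D); nra.
rewrite truncn_ge_nat ?mulr_ge0 ?(ltW T0) // natr_absz.
rewrite -(@ler_pXn2r _ 2) ?nnegrE ?mulr_ge0 ?(ltW T0) ?ler0z //.
rewrite -rmorphXn /= -normrX s2 !normrM !intrM.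
have : (`|a|%:~R : R) * `|b|%:~R <= (2 * T) * (2 * T) by apply: ler_pM; rewrite ?ler0z.
have : (`|- 3 : int|%:~R : R) = 3 by [].
move=> ->; nra.
Qed.

(** The pair [(a, s)] determines [b] from [s ^ 2 = - 3 a b] and then [D]. For fixed [a], the
    condition [3 a | s ^ 2] makes [s] a multiple of some [e >= sqrt a], leaving [O(T / sqrt a + 1)]
    values; summing over [a <= 2 T] gives [T ^ (3/2)]. *)
Lemma cnt_two_roots T : 1 <= T -> (cnt (two_roots T))%:R <= 70 * (T * Num.sqrt T).
Proof.
move=> T1; have T0 : 0 < T by apply: lt_le_trans T1.
set N := truncn (2 * T); set S := truncn (4 * T).
have wit (x : int * int) : {bs : int * int | two_roots T x ->
   [/\ bs.2 != 0, bs.2 ^+ 2 = - 3 * x.1 * bs.1, 3 * x.1 ^+ 2 + 6 * x.2 + 3 * x.1 * bs.1 = (x.1 - bs.1) * bs.2 & (absz bs.2 <= S)%N]}.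
  apply: cid; have [tx|nx] := pselect (two_roots T x); last by exists (0, 0).
  by case: x tx => a D tx; have [b [s H]] := two_roots_witness T0 tx; exists (b, s).
pose Q : set (nat * (bool * int)) := [set y | [/\ (0 < y.1 <= N)%N, (3 * y.1 %| absz y.2.2 ^ 2)%N & (absz y.2.2 <= S)%N]].
have fQ : finite_set Q.
  apply: (@finite_mem_seq _ _ [seq (a, y) | a <- iota 1 N, y <- [seq (b, s) | b <- [:: true; false], s <- int_box S]]).
  move=> [a [b s]] [h1 _ h2]; apply: allpairs_f; first by rewrite mem_iota add1n ltnS.
  by apply: allpairs_f; [case: (b); rewrite !inE | apply: mem_int_box].
have ft : finite_set (two_roots T) by apply: sub_finite_set (finite_signed_pairs T0) => x [].
have le1 : (cnt (two_roots T) <= cnt Q)%N.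
  apply: (@cnt_inj _ _ _ _ (fun x => (absz x.1, (x.1 < 0, (sval (wit x)).2))) ft fQ).
    move=> x tx; have [s0 s2 _ sS] := svalP (wit x) tx; have [sx _] := tx.
    split=> //=; last first.
    - by rewrite -abszX s2 !abszM dvdn_mulr.
    - case: x {s0 s2 sS tx} sx => a D sx; have [/= a0 _ _] := sx.
      by have [-> _] := signed_pairs_bound T0 sx; rewrite absz_gt0 a0.
  move=> x y tx ty; have [_ s2 sE _] := svalP (wit x) tx; have [_ t2 tE _] := svalP (wit y) ty.
  move: (sval (wit x)) (sval (wit y)) s2 sE t2 tE => [b s] [c t] /= s2 sE t2 tE [ea ec es].
  have exy : x.1 = y.1.
    move: ea ec; case: (x.1) => m; case: (y.1) => n //=; first by move=> ->.
    by move=> [->].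
  have y0 : y.1 != 0 by case: ty => -[].
  rewrite exy es in s2 sE.
  have bc : b = c.
    by apply: (mulfI (_ : - 3 * y.1 != 0)); rewrite ?mulf_neq0 // -s2 -t2.
  have : x.2 = y.2.
    apply: (mulfI (_ : 6 != 0)) => //; rewrite bc in sE.
    by apply: (addrI (3 * y.1 ^+ 2)); apply: (addIr (3 * y.1 * c)); rewrite sE tE.
  by move=> e2; rewrite [x]surjective_pairing exy e2 -surjective_pairing.
apply: le_trans (_ : (cnt Q)%:R <= _); first by rewrite ler_nat.
rewrite (@cnt_fibers _ _ _ (iota 1 N) (iota_uniq _ _) fQ); last first.
  by move=> a y [h _ _]; rewrite mem_iota add1n ltnS.
have -> : iota 1 N = index_iota 1 N.+1 by rewrite /index_iota subn1.
have n2 : 0 <= 2 * T by rewrite mulr_ge0 // ltW.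
have n4 : 0 <= 4 * T by rewrite mulr_ge0 // ltW.
have NT : N%:R <= 2 * T by rewrite truncn_le.
have ST : S%:R <= 4 * T by rewrite truncn_le.
rewrite natr_sum.
apply: le_trans (_ : \sum_(1 <= a < N.+1) (4 * S%:R * (Num.sqrt a%:R)^-1 + 2) <= _).
  rewrite big_nat_cond [leRHS]big_nat_cond; apply: ler_sum => a; rewrite andbT => /andP[a0 _].
  have a30 : (0 < 3 * a)%N by rewrite muln_gt0.
  have [e [e0 ae eP]] := dvdn_sqr_multiple a30.
  pose L := [seq (b, e%:Z * k) | b <- [:: true; false], k <- int_box (S %/ e)].
  apply: le_trans (_ : (size L)%:R <= _).
    rewrite ler_nat; apply: cnt_le_size => -[b s] [/= _ dv sS].
    have /dvdzP [k kE] := eP s dv; rewrite mulrC in kE; rewrite kE.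
    apply: (allpairs_f (fun b k => (b, e%:Z * k))); first by case: (b); rewrite !inE.
    by apply: mem_int_box; rewrite leq_divRL // -[e]/(absz e%:Z) -abszM mulrC -kE.
  rewrite size_allpairs size_map size_iota /=.
  have aR : (0 : R) < a%:R by rewrite ltr0n.
  have eR : (0 : R) < e%:R by rewrite ltr0n.
  have sa : 0 < Num.sqrt (a%:R : R) by rewrite sqrtr_gt0.
  have sae : Num.sqrt (a%:R : R) <= e%:R.
    rewrite -(@ler_pXn2r _ 2) ?nnegrE ?sqrtr_ge0 // sqr_sqrtr // -natrX ler_nat.
    by apply: leq_trans ae; rewrite leq_pmull.
  have k1 : ((S %/ e)%:R : R) <= S%:R / Num.sqrt a%:R.
    apply: le_trans (_ : S%:R / e%:R <= _).
      by rewrite ler_pdivlMr // -natrM ler_nat leq_trunc_div.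
    by rewrite ler_wpM2l // lef_pV2 ?posrE.
  rewrite -[(2 * _ )%N]/(2 * (2 * (S %/ e)).+1)%N.
  by rewrite natrM natr_double_succ; lra.
rewrite big_split /= -mulr_sumr sumr_const_nat subn1 /= -[2 *+ N]mulr_natr.
have := psum_invsqrt R N; rewrite /psum => h.
have sT : 1 <= Num.sqrt T by rewrite -[leLHS]sqrtr1; apply: ler_wsqrtr.
have sN : Num.sqrt (N%:R : R) <= 2 * Num.sqrt T.
  rewrite -(@ler_pXn2r _ 2) ?nnegrE ?mulr_ge0 ?sqrtr_ge0 // exprMn !sqr_sqrtr ?(ltW T0) //.
  by lra.
have h2 : 4 * S%:R * \sum_(1 <= i < N.+1) (Num.sqrt (i%:R : R))^-1 <= 4 * (4 * T) * (2 * (2 * Num.sqrt T)).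
  apply: ler_pM; rewrite ?mulr_ge0 //; first by apply: sumr_ge0 => i _; rewrite invr_ge0 sqrtr_ge0.
    by lra.
  by apply: le_trans h _; lra.
apply: le_trans (lerD h2 (lexx _)) _.
have : T <= T * Num.sqrt T by rewrite ler_peMr // ltW.
lra.
Qed.

Lemma curves_lt1 T : 0 < T < 1 -> cnt (curves T) = 0%N.
Proof.
move=> /andP[T0 T1]; rewrite /cnt (_ : curves T = set0) ?fset_set0 ?cardfs0 //.
apply/seteqP; split=> // -[A B] [/= A0 _ _]; rewrite ht_real ge_max => /andP[h _].
have A1 : 1 <= `|A%:~R : R| by rewrite -intr_norm -[1]/(1%:~R) ler_int -gtz0_ge1 normr_gt0.
have : 1 <= `|A%:~R : R| ^+ 3 by apply: exprn_ege1.
have : T ^+ 6 <= 1 by rewrite exprn_ile1 // ltW.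
lra.
Qed.

(** Two signs and the density 1/6 turn [3 / (8 Z)] into [1 / (8 Z)]; both exceptional sets are
    absorbed in the error. *)
Lemma good_curves (Z : R) : psum (@dirichlet R xpredT 2) @ \oo --> Z ->
  good (fun T => (cnt (curves T))%:R) ((\int[@lebesgue_measure R]_b (hfun b ^+ 2)) / (8 * Z)).
Proof.
move=> cZ; have [c' [C H]] := good_integral_sqrt_sum3 cZ.
have Z0 : Z != 0.
  by rewrite gt_eqF //; apply: lt_le_trans (dirichlet_ge1 (isT : xpredT 1%N) cZ).
set I := \int[_]_b _ in H *; pose J T := \int[@lebesgue_measure R]_b (sqrt_sum3 (T * hfun b)).
apply: good_zero => [T T1|]; first by rewrite curves_lt1.
exists (c' / 3), (C / 3 + 100) => T T1; have T0 : 0 < T by apply: lt_le_trans T1.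
have := H T T0; have [le1 le2] := cnt_curves_le T0; have := cnt_root_pairs T0; rewrite -/(J T).
rewrite (cnt_signed_pairs T0) in le1 le2.
have := cnt_degenerate T0; have := cnt_two_roots T1.
set d := cnt (degenerate T) in le2 *; set t := cnt (two_roots T) in le2 *.
set c := cnt (curves T) in le1 le2 *; set r := cnt (root_pairs T) in le1 le2 *.
have NT : (truncn (2 * T))%:R <= 2 * T by rewrite truncn_le mulr_ge0 // ltW.
move=> ht hd hr hJ; have {}hd : d%:R <= 3 * (2 * (2 * T) + 1) :> R.
  apply: le_trans (_ : (3 * (2 * truncn (2 * T)).+1)%:R <= _); first by rewrite ler_nat.
  by rewrite natrM natr_double_succ; lra.
have {}le1 : c%:R <= 2 * r%:R :> R by rewrite -natrM ler_nat.
have {}le2 : 2 * r%:R <= c%:R + d%:R + t%:R :> R by rewrite -natrM -!natrD ler_nat.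
have e1 : T <= err T by rewrite -{1}(powRr1 (ltW T0)); apply: err_ge1 => //; lra.
have e2 : T * Num.sqrt T <= err T.
  have -> : T * Num.sqrt T = T `^ (3/2).
    rewrite -powR12_sqrt ?(ltW T0) // -{1}(powRr1 (ltW T0)) -powRD; last by rewrite (gt_eqF T0) implybT.
    by congr (_ `^ _); lra.
  by apply: err_ge1 => //; lra.
have -> : T ^+ 2 * (I / (8 * Z) * ln T + c' / 3) = (T ^+ 2 * (3 / (8 * Z) * I * ln T + c')) / 3 by field.
move: hJ hr; rewrite !ler_norml => /andP[a1 a2] /andP[a3 a4].
apply/andP; split; lra.
Qed.

End CurveCount.

Lemma cnt_split (T : choiceType) (S P : set T) : finite_set S ->
  cnt S = (cnt [set x | S x /\ P x] + cnt [set x | S x /\ ~ P x])%N.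
Proof.
move=> fS; pose s := enum_fset (fset_set S).
have sP x : S x -> x \in s by move=> Sx; rewrite (_ : x \in s = (x \in fset_set S)) // in_fset_set // inE.
rewrite !(@cnt_count _ _ s) ?fset_uniq //; try by move=> x [/sP].
rewrite -count_predUI (@eq_count _ (predI _ _) pred0) ?count_pred0 ?addn0 => [|x]; last first.
  by apply/negP => /= /andP[/asboolP[_ Px] /asboolP[_]]; apply.
apply: eq_count => x /=; apply/asboolP/orP => [Sx|[]/asboolP[]//].
by have [Px|nP] := pselect (P x); [left|right]; apply/asboolP.
Qed.

Lemma has_rootP (A B : int) : has_root (A, B) <->
  exists e : rat, 3 * e ^+ 4 + 6 * A%:~R * e ^+ 2 + 12 * B%:~R * e - A%:~R ^+ 2 = 0.
Proof. by split=> h; [apply/psi3_integral_root | apply/psi3_integral_root]. Qed.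

Lemma has_root_twist (e : nat) (A B : int) : (0 < e)%N ->
  has_root (e%:Z ^+ 4 * A, e%:Z ^+ 6 * B) <-> has_root (A, B).
Proof.
move=> e0; have eR : (e%:R : rat) != 0 by rewrite pnatr_eq0 -lt0n.
rewrite !has_rootP; split=> [[x E]|[x E]].
  exists (x / e%:R ^+ 2); apply: (mulfI (_ : (e%:R : rat) ^+ 8 != 0)); first by rewrite expf_eq0.
  by rewrite mulr0 -E !(rmorphM, rmorphXn) /= -!pmulrn; field.
exists (e%:R ^+ 2 * x); rewrite -[RHS](mulr0 (e%:R ^+ 8)) -E !(rmorphM, rmorphXn) /= -!pmulrn; ring.
Qed.

(** * The sieve for minimal models *)

Section Sieve.
Variable R : realType.
Implicit Types T : R.

Definition minimal (AB : int * int) := minimal_model AB.1 AB.2.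

Definition twist (e : nat) (AB : int * int) : int * int := (e%:Z ^+ 4 * AB.1, e%:Z ^+ 6 * AB.2).

Lemma ht_twist e AB : (ht (twist e AB))%:~R = (e%:R ^+ 12) * (ht AB)%:~R :> R.
Proof.
case: AB => A B; have E k (m : int) : (e%:Z ^+ k * m)%:~R = e%:R ^+ k * m%:~R :> R.
  by rewrite intrM rmorphXn /= -pmulrn.
rewrite /twist !ht_real maxr_pMr ?exprn_ge0 // !E.
rewrite normrM exprMn ger0_norm ?exprn_ge0 //; congr Num.max; ring.
Qed.

(** [twist e] maps [C (T / e ^ 2)] bijectively onto the members of [C T] divisible by the twist,
    because it multiplies the height by [e ^ 12]. [N] bounds [|A| + |B|] on [C T], hence every
    relevant [e]. *)
Lemma sieve (C : R -> set (int * int)) T N : 0 < T ->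
  (forall T AB, C T AB -> [/\ (AB.1 != 0) || (AB.2 != 0) & (ht AB)%:~R <= T ^+ 6]) ->
  (forall e T AB, (0 < e)%N -> 0 < T -> C T (twist e AB) <-> C (T / e%:R ^+ 2) AB) ->
  (2 * truncn (T ^+ 6) <= N)%N ->
  (cnt [set AB | C T AB /\ minimal AB])%:R = psum (fun e => mu R e * (cnt (C (T / e%:R ^+ 2)))%:R) N.
Proof.
move=> T0 HC Htw TN.
have fC T' : 0 <= T' -> finite_set (C T') by move=> T'0; apply: (finite_ht_le T'0) => AB /HC [].
have fCT := fC T (ltW T0).
pose s := enum_fset (fset_set (C T)).
have us : uniq s := fset_uniq _.
have sP x : C T x <-> x \in s.
  rewrite (_ : x \in s = (x \in fset_set (C T))) // in_fset_set // inE; split=> // h; exact: asboolW.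
have cntE (P : set (int * int)) : (forall x, P x -> C T x) -> (cnt P)%:R = \sum_(x <- s) (`[< P x >])%:R :> R.
  move=> PC; rewrite (@cnt_count _ _ s) //; last by move=> x /PC /sP.
  by rewrite -sum1_count natr_sum big_mkcond; apply: eq_bigr => x _; case: `[< _ >].
rewrite cntE; last by move=> x [].
transitivity (\sum_(x <- s) \sum_(1 <= e < N.+1) (if twist_dvd x.1 x.2 e then mu R e else 0)).
  apply: eq_big_seq => x /sP Cx; have [x0 hx] := HC _ _ Cx.
  have xN : (absz x.1 + absz x.2 <= N)%N.
    apply: leq_trans TN; case: x hx {Cx x0} => A B hx; have [h1 h2] := ht_abs_le hx (ltW T0).
    by rewrite mul2n -addnn leq_add.
  have /(congr1 (fun z : int => z%:~R : R)) := sum_mobius_twist x0 xN.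
  rewrite rmorph_sum big_mkcond /= => ->.
  rewrite /minimal (_ : `[< _ >] = minimal_model x.1 x.2); last by apply/asboolP/idP => [[]|].
  by case: minimal_model.
rewrite exchange_big /psum big_nat_cond [RHS]big_nat_cond; apply: eq_bigr => e; rewrite andbT => /andP[e0 _].
have eR : (0 : R) < e%:R by rewrite ltr0n.
have eZ : e%:Z != 0 by rewrite -lt0n in e0 *; case: (e) e0.
have PX k : (e ^ k)%N%:Z = e%:Z ^+ k by rewrite -!natz natrX.
have -> : cnt (C (T / e%:R ^+ 2)) = cnt [set AB | C T AB /\ twist_dvd AB.1 AB.2 e].
  apply: (cnt_bij (fC _ _) _ (f := twist e) (g := fun AB => ((AB.1 %/ e%:Z ^+ 4)%Z, (AB.2 %/ e%:Z ^+ 6)%Z))).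
  - by rewrite divr_ge0 ?exprn_ge0 ?(ltW T0).
  - by apply: sub_finite_set fCT => x [].
  - move=> AB /(Htw e T AB e0 T0) h; split=> //.
    have dA k (m : int) : (e ^ k %| absz (e%:Z ^+ k * m)%R)%N.
      by rewrite -[(e ^ k)%N]/(absz (e ^ k)%N%:Z) -dvdzE PX dvdz_mulr.
    by rewrite /twist_dvd !dA.
  - move=> [A B] [h /= dv]; apply/(Htw e T _ e0 T0).
    by move: dv; rewrite /twist_dvd /twist /= -[(e ^ 4)%N]/(absz (e ^ 4)%N%:Z) -[(e ^ 6)%N]/(absz (e ^ 6)%N%:Z) -!dvdzE !PX => /andP[d1 d2]; rewrite ![_ * (_ %/ _)%Z]mulrC !divzK.
  - by move=> [A B] _; rewrite /twist /= ![_ * A]mulrC ![_ * B]mulrC !mulzK ?expf_eq0 // expf_neq0.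
  - move=> [A B] [h /= dv].
    by move: dv; rewrite /twist_dvd /twist /= -[(e ^ 4)%N]/(absz (e ^ 4)%N%:Z) -[(e ^ 6)%N]/(absz (e ^ 6)%N%:Z) -!dvdzE !PX => /andP[d1 d2]; rewrite ![_ * (_ %/ _)%Z]mulrC !divzK.
rewrite cntE; last by move=> x [].
rewrite mulr_sumr; apply: eq_big_seq => x /sP Cx.
have -> : `[< [set AB | C T AB /\ twist_dvd AB.1 AB.2 e] x >] = twist_dvd x.1 x.2 e.
  by apply/asboolP/idP => [[]|].
by case: ifP; rewrite ?mulr1 ?mulr0.
Qed.

Lemma curves_twist e T AB : (0 < e)%N -> 0 < T -> curves T (twist e AB) <-> curves (T / e%:R ^+ 2) AB.
Proof.
move=> e0 T0; have eZ : e%:Z != 0 by rewrite -lt0n in e0 *; case: (e) e0.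
have eR : (0 : R) < e%:R by rewrite ltr0n.
case: AB => A B; rewrite /curves /= ht_twist.
have -> : (e%:Z ^+ 4 * A != 0) = (A != 0) by rewrite mulf_eq0 expf_eq0 (negPf eZ).
have -> : 4 * (e%:Z ^+ 4 * A) ^+ 3 + 27 * (e%:Z ^+ 6 * B) ^+ 2 = e%:Z ^+ 12 * (4 * A ^+ 3 + 27 * B ^+ 2) by ring.
have -> : (e%:Z ^+ 12 * (4 * A ^+ 3 + 27 * B ^+ 2) != 0) = (4 * A ^+ 3 + 27 * B ^+ 2 != 0).
  by rewrite mulf_eq0 expf_eq0 (negPf eZ).
have -> : (e%:R ^+ 12 * (ht (A, B))%:~R <= T ^+ 6) = ((ht (A, B))%:~R <= (T / e%:R ^+ 2) ^+ 6).
  by rewrite expr_div_n -exprM ler_pdivlMr ?exprn_gt0 // mulrC.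
by have := has_root_twist A B e0; split=> -[h1 h2 /H h3 h4]; split.
Qed.

Definition curves0 T : set (int * int) :=
  [set AB | [/\ AB.1 = 0, AB.2 != 0 & (ht AB)%:~R <= T ^+ 6]].

Lemma curves0_twist e T AB : (0 < e)%N -> 0 < T -> curves0 T (twist e AB) <-> curves0 (T / e%:R ^+ 2) AB.
Proof.
move=> e0 T0; have eZ : e%:Z != 0 by rewrite -lt0n in e0 *; case: (e) e0.
have eR : (0 : R) < e%:R by rewrite ltr0n.
case: AB => A B; rewrite /curves0 /= ht_twist.
have -> : (e%:Z ^+ 6 * B != 0) = (B != 0) by rewrite mulf_eq0 expf_eq0 (negPf eZ).
have -> : (e%:R ^+ 12 * (ht (A, B))%:~R <= T ^+ 6) = ((ht (A, B))%:~R <= (T / e%:R ^+ 2) ^+ 6).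
  by rewrite expr_div_n -exprM ler_pdivlMr ?exprn_gt0 // mulrC.
split=> -[h1 h2 h3]; split=> //; last by rewrite h1 mulr0.
by apply/eqP; move/eqP: h1; rewrite mulf_eq0 expf_eq0 (negPf eZ).
Qed.

(** The condition is [27 B ^ 2 <= T ^ 6], and [(3 sqrt 3) ^ 2 = 27]. *)
Lemma cnt_curves0 T : 0 < T -> cnt (curves0 T) = (2 * truncn (T ^+ 3 / (3 * Num.sqrt 3)))%N.
Proof.
move=> T0; set y := T ^+ 3 / _.
have s3 : 0 < 3 * Num.sqrt (3 : R) by rewrite mulr_gt0 // sqrtr_gt0.
have y0 : 0 <= y by rewrite divr_ge0 ?exprn_ge0 ?(ltW T0) // ltW.
have s32 : (3 * Num.sqrt (3 : R)) ^+ 2 = 27 by rewrite exprMn sqr_sqrtr //; ring.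
have hE (B : int) : ((ht (0, B))%:~R <= T ^+ 6) = (absz B <= truncn y)%N.
  rewrite ht_real mulr0z normr0 expr0n mulr0 max_r; last by apply: mulr_ge0 => //; apply: sqr_ge0.
  rewrite truncn_ge_nat // natr_absz intr_norm ler_pdivlMr //.
  rewrite -[RHS](@ler_pXn2r _ 2) ?nnegrE ?mulr_ge0 ?exprn_ge0 ?(ltW T0) ?sqrtr_ge0 //.
  by rewrite exprMn s32 real_normK ?num_real // mulrC -exprM.
pose L := [seq ((0 : int), k%:Z) | k <- iota 1 (truncn y)] ++ [seq ((0 : int), - k%:Z) | k <- iota 1 (truncn y)].
rewrite (@cnt_count _ _ L); last 2 first.
- rewrite cat_uniq !map_inj_uniq ?iota_uniq //=; last 2 first.
    by move=> i j /(congr1 snd) /= /oppr_inj [].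
    by move=> i j /(congr1 snd) /= [].
  rewrite andbT; apply/hasPn => _ /mapP [k kL ->]; apply/mapP => -[j jL [E]].
  by move: kL jL E; rewrite !mem_iota; case: k => // k _; case: j => // j _; rewrite -opprK -NegzE => /eqP.
- move=> [A B] [/= -> B0]; rewrite hE => BY; rewrite mem_cat.
  case: B B0 BY => n B0 BY; apply/orP; [left|right]; apply/mapP.
    by exists n => //; rewrite mem_iota add1n ltnS BY andbT lt0n; move: B0; case: (n).
  by exists n.+1; rewrite // mem_iota add1n ltnS /=.
transitivity (size L); last by rewrite size_cat !size_map size_iota mul2n addnn.
apply/eqP; rewrite -all_count; apply/allP => x; rewrite mem_cat => /orP[] /mapP [k]; rewrite mem_iota add1n ltnS => /andP[k0 ky] ->;
  apply/asboolP; split; rewrite ?hE ?abszN //=; by rewrite ?oppr_eq0 -?lt0n //; case: (k) k0.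
Qed.

(** The error is at most both 1 and [y], hence at most [sqrt y]. This weaker form is summable over
    all twists, where [y] is proportional to [T ^ 3 / e ^ 6]. *)
Lemma truncn_approx (y : R) : 0 <= y -> `|(truncn y)%:R - y| <= Num.sqrt y.
Proof.
move=> y0; have /andP[h1 h2] := truncn_itv y0; rewrite -natr1 in h2.
rewrite ler0_norm ?subr_le0 // opprB.
have s0 : 0 <= Num.sqrt y by apply: sqrtr_ge0.
have sE : Num.sqrt y ^+ 2 = y by rewrite sqr_sqrtr.
have [y1|y1] := lerP 1 y; first by nra.
have : (truncn y)%:R >= 0 :> R by [].
by nra.
Qed.

Lemma minimal_curves0 (Z : R) : psum (@dirichlet R xpredT 6) @ \oo --> Z -> forall T, 0 < T ->
  `|(cnt [set AB | curves0 T AB /\ minimal AB])%:R - 2 / (3 * Num.sqrt 3 * Z) * T ^+ 3| <= 4 * (T * Num.sqrt T).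
Proof.
move=> cZ T T0; have cM := mobius_series (isT : xpredT 1%N) (fun _ _ => erefl) (isT : (1 < 6)%N) cZ.
have Z0 : Z != 0 by rewrite gt_eqF //; apply: lt_le_trans (dirichlet_ge1 (isT : xpredT 1%N) cZ).
have s3 : 0 < Num.sqrt (3 : R) by rewrite sqrtr_gt0.
have -> : 2 / (3 * Num.sqrt 3 * Z) * T ^+ 3 = 2 / (3 * Num.sqrt 3) * T ^+ 3 * Z^-1.
  by field; rewrite Z0 gt_eqF.
have c2 : (fun N => 2 / (3 * Num.sqrt 3) * T ^+ 3 * psum (fun e => mu R e * dirichlet R xpredT 6 e) N) @ \oo --> 2 / (3 * Num.sqrt 3) * T ^+ 3 * Z^-1.
  by apply: cvgMr.
apply: (cvgn_dist_le c2); near=> N.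
rewrite (@sieve curves0 T N) //; last 3 first.
- by move=> T' [A B] [/= _ B0 h]; split=> //; rewrite B0 orbT.
- by move=> e T' AB; apply: curves0_twist.
- by near: N; apply: nbhs_infty_ge.
rewrite /psum mulr_sumr -sumrB; apply: le_trans (ler_norm_sum _ _ _) _.
apply: le_trans (_ : 2 * (T * Num.sqrt T) * psum (fun g => (g%:R ^+ 2)^-1) N <= _); last first.
  have := psum_inv2 R N; have : 0 <= T * Num.sqrt T by rewrite mulr_ge0 ?sqrtr_ge0 // ltW.
  by nra.
rewrite /psum mulr_sumr big_nat_cond [leRHS]big_nat_cond; apply: ler_sum => e; rewrite andbT => /andP[e0 _].
have eR : (0 : R) < e%:R by rewrite ltr0n.
have e1 : (1 : R) <= e%:R by rewrite ler1n.
have d0 : 0 < T / e%:R ^+ 2 by rewrite divr_gt0 ?exprn_gt0.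
rewrite cnt_curves0 // natrM; set y := (_ / e%:R ^+ 2) ^+ 3 / _.
have y0 : 0 <= y by rewrite divr_ge0 ?exprn_ge0 ?(ltW d0) // mulr_ge0 // ltW.
have -> : mu R e * (2 * (truncn y)%:R) - 2 / (3 * Num.sqrt 3) * T ^+ 3 * (mu R e * dirichlet R xpredT 6 e)
   = mu R e * (2 * ((truncn y)%:R - y)).
  by rewrite /dirichlet /= mulr1n /y; field; rewrite !gt_eqF.
rewrite normrM -[leRHS]mul1r; apply: ler_pM; rewrite ?mu_norm //.
rewrite normrM ger0_norm // -mulrA ler_pM2l //; apply: le_trans (truncn_approx y0) _.
have sT : 0 < Num.sqrt T by rewrite sqrtr_gt0.
rewrite -(@ler_pXn2r _ 2) ?nnegrE ?sqrtr_ge0 ?mulr_ge0 ?invr_ge0 ?exprn_ge0 ?(ltW T0) // sqr_sqrtr //.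
rewrite !exprMn sqr_sqrtr ?(ltW T0) // /y ler_pdivrMr ?mulr_gt0 //.
have s31 : 1 <= Num.sqrt (3 : R) by rewrite -[leLHS]sqrtr1 ler_wsqrtr //; lra.
have -> : (T * e%:R ^- 2) ^+ 3 = T ^+ 3 * (e%:R ^- 2) ^+ 3 by rewrite exprMn.
have i0 : 0 < (e%:R ^+ 2)^-1 :> R by rewrite invr_gt0 exprn_gt0.
have i1 : (e%:R ^+ 2)^-1 <= 1 :> R by rewrite invf_le1 ?exprn_gt0 // exprn_ege1.
have -> : T ^+ 2 * T * (e%:R ^- 2) ^+ 2 * (3 * Num.sqrt 3) = T ^+ 3 * ((e%:R ^- 2) ^+ 2 * (3 * Num.sqrt 3)) by ring.
rewrite ler_pM2l ?exprn_gt0 // exprSr ler_pM2l ?exprn_gt0 //.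
by lra.
Unshelve. all: by end_near. Qed.

Lemma N3_split (X T : R) : 0 < T -> X = T ^+ 6 -> N3 X =
  (cnt [set AB | curves0 T AB /\ minimal AB] + cnt [set AB | curves T AB /\ minimal AB])%N.
Proof.
move=> T0 XE; rewrite /N3 -/(cnt _).
set S := [set AB | _]; have fS : finite_set S.
  by apply: (finite_ht_le (ltW T0)) => AB [_ + _]; rewrite XE.
have cal A B : 4 * A ^+ 3 + 27 * B ^+ 2 != 0 :> int -> calE (A, B) <-> minimal (A, B).
  move=> d0; have AB0 : (A != 0) || (B != 0).
    by move: d0; case: (eqVneq A 0) => [->|//]; case: (eqVneq B 0) => [->|//]; rewrite !expr0n !mulr0 addr0 eqxx.
  rewrite /minimal (minimal_modelP AB0) /calE /=; split=> [[_ h]|h]; [exact: h | by split].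
have iso A B : 4 * A ^+ 3 + 27 * B ^+ 2 != 0 :> int -> has_isogeny_of_degree A%:~R B%:~R 3 <-> has_root (A, B).
  move=> d0; rewrite has_rootP; apply: isogeny3_psi3.
  by rewrite -!rmorphXn /= -[4]/(4%:~R) -[27]/(27%:~R) -!rmorphM -rmorphD intr_eq0.
rewrite (cnt_split (fun AB => AB.1 = 0) fS); congr (_ + _)%N; congr cnt; apply/seteqP; split=> -[A B] /=.
- move=> [[[d0 h1] h2 h3] A0]; split; last by apply/cal.
  split=> //; last by rewrite -XE.
  by apply/eqP => /= B0; move: d0; rewrite /= A0 B0 !expr0n !mulr0 addr0 eqxx.
- move=> [[/= A0 B0 hX] m]; have d0 : 4 * A ^+ 3 + 27 * B ^+ 2 != 0.
    by rewrite A0 expr0n mulr0 add0r mulf_neq0 // expf_neq0.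
  split=> //; split; [by apply/cal | by rewrite XE | ].
  by apply/iso => //; exists 0; rewrite /psi3 /= A0; ring.
- move=> [[[d0 h1] h2 h3] A0]; split; last by apply/cal.
  by split=> //; [exact/eqP | apply/iso | rewrite -XE].
- move=> [[/= A0 d0 r hX] m]; split; last exact/eqP.
  by split; [apply/cal | rewrite XE | apply/iso].
Qed.

Lemma good_minimal_curves (Z2 Z4 : R) : psum (@dirichlet R xpredT 2) @ \oo --> Z2 ->
  psum (@dirichlet R xpredT 4) @ \oo --> Z4 ->
  good (fun T => (cnt [set AB | curves T AB /\ minimal AB])%:R)
    ((\int[@lebesgue_measure R]_b (hfun b ^+ 2)) / (8 * Z2) * Z4^-1).
Proof.
move=> c2 c4; apply: (good_sum (w := mu R) (good_curves c2)).
- move=> g g0; apply: le_trans (mu_norm _ _) _.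
  by rewrite exprn_ege1 // ler1n.
- have := mobius_series (isT : xpredT 1%N) (fun _ _ => erefl) (isT : (1 < 4)%N) c4.
  apply: cvg_trans; apply: near_eq_cvg; near=> N.
  by rewrite /psum; apply: eq_bigr => g _; rewrite /dirichlet /= mulr1n mul1r.
move=> x x0; near=> N; apply: sieve => //.
- by move=> T' [A B] [/= A0 _ _ h]; split=> //; rewrite A0.
- by move=> e T' AB; apply: curves_twist.
- by near: N; apply: nbhs_infty_ge.
Unshelve. all: by end_near. Qed.

Lemma N3_asymptotic (Z2 Z4 Z6 : R) : psum (@dirichlet R xpredT 2) @ \oo --> Z2 ->
  psum (@dirichlet R xpredT 4) @ \oo --> Z4 -> psum (@dirichlet R xpredT 6) @ \oo --> Z6 ->
  exists c2 C : R, forall X, 1 <= X ->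
  `|(N3 X)%:R - (2 / (3 * Num.sqrt 3 * Z6) * X `^ (1 / 2)
     + (\int[@lebesgue_measure R]_b (hfun b ^+ 2)) / (48 * Z2 * Z4) * X `^ (1 / 3) * ln X
     + c2 * X `^ (1 / 3))| <= C * X `^ (7 / 24).
Proof.
move=> cZ2 cZ4 cZ6; have [c' [C H]] := good_minimal_curves cZ2 cZ4.
have z0 s (Z : R) : psum (@dirichlet R xpredT s) @ \oo --> Z -> (1 < s)%N -> Z != 0.
  by move=> cZ s1; rewrite gt_eqF //; apply: lt_le_trans (dirichlet_ge1 (isT : xpredT 1%N) cZ).
have Z20 := z0 _ _ cZ2 isT; have Z40 := z0 _ _ cZ4 isT.
exists c', (C + 4) => X X1; have X0 : 0 < X by apply: lt_le_trans X1.
pose T := X `^ (1/6); have T0 : 0 < T by apply: powR_gt0.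
have T1 : 1 <= T by rewrite -(powRr0 X); apply: ler_powR => //; lra.
have TX k : T `^ k = X `^ (1/6 * k) by rewrite -powRrM.
have XE : X = T ^+ 6.
  by rewrite -powR_mulrn ?(ltW T0) // TX (_ : 1/6 * 6%:R = 1) ?powRr1 ?(ltW X0) //; field.
have E3 : X `^ (1/2) = T ^+ 3 by rewrite -powR_mulrn ?(ltW T0) // TX; congr (_ `^ _); field.
have E2 : X `^ (1/3) = T ^+ 2 by rewrite -powR_mulrn ?(ltW T0) // TX; congr (_ `^ _); field.
have E7 : X `^ (7/24) = err T by rewrite /err TX; congr (_ `^ _); field.
(* This 6 turns the 8 in the coefficient of [T ^ 2 ln T] into 48. *)
have EL : ln X = 6 * ln T by rewrite XE lnXn // mulr_natl.
have h1 := minimal_curves0 cZ6 T0; have h2 := H T T0.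
rewrite (N3_split T0 XE) natrD E3 E2 E7 EL.
set I := \int[_]_b _ in h2 *; set a := (cnt _)%:R in h1 *; set b := (cnt _)%:R in h2 *.
set d := 2 / _ in h1 *.
rewrite (_ : _ - _ = (a - d * T ^+ 3) + (b - T ^+ 2 * (I / (8 * Z2) / Z4 * ln T + c'))); last first.
  by field; rewrite Z20 Z40.
apply: le_trans (ler_normD _ _) _; rewrite [leRHS]mulrDl [leRHS]addrC; apply: lerD => //.
apply: le_trans h1 _; rewrite ler_pM2l //.
have -> : T * Num.sqrt T = T `^ (3/2).
  rewrite -powR12_sqrt ?(ltW T0) // -{1}(powRr1 (ltW T0)) -powRD; last by rewrite (gt_eqF T0) implybT.
  by congr (_ `^ _); lra.
by apply: err_ge1 => //; lra.
Qed.

End Sieve.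

(** * The value of zeta(2) *)

Section Basel.
Variable R : realType.
Implicit Types x : R.

Lemma nondecreasing_derive (f f' : R -> R) (b : R) : (forall x, is_derive x 1 f (f' x)) ->
  (forall x, 0 < x < b -> 0 <= f' x) -> forall x, 0 <= x <= b -> f 0 <= f x.
Proof.
move=> df f0 x /andP[x0 xb].
have h := @ger0_derive1_le_cc R f 0 b; apply: h => //.
- by move=> y; rewrite in_itv /= => y0; rewrite derive1E; case: (df y) => _ ->; apply: f0.
- by apply: derivable_within_continuous => y _; case: (df y).
- by rewrite in_itv /= lexx (le_trans x0 xb).
- by rewrite in_itv /= x0 xb.
Qed.

Lemma sin_le_id x : 0 <= x -> sin x <= x.
Proof.
move=> x0; suff : 0 - sin 0 <= x - sin x by rewrite sin0 subrr subr_ge0.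
apply: (@nondecreasing_derive (fun t => t - sin t) (fun t => 1 - cos t) x); rewrite ?x0 ?lexx //.
Qed.

Lemma cos_le_sinc x : 0 <= x <= pi / 2 -> x * cos x <= sin x.
Proof.
move=> x0; have := @nondecreasing_derive (fun t => sin t - t * cos t) (fun t => t * sin t) (pi / 2).
rewrite sin0 mul0r subrr => h; rewrite -subr_ge0; apply: h => //.
- move=> t; apply: is_derive_eq.
  by rewrite /GRing.scale /=; ring.
- move=> t /andP[t0 tp]; apply: mulr_ge0; first exact: ltW.
  by apply: sin_ge0_pi; rewrite ltW //=; have := pi_gt0 R; lra.
Qed.

(** The left side is [cot ^ 2], so the claim is [sin x <= x <= tan x] inverted and squared. *)
Lemma inv_sin_sqr x : 0 < x < pi / 2 -> (sin x ^+ 2)^-1 - 1 <= (x ^+ 2)^-1 <= (sin x ^+ 2)^-1.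
Proof.
move=> /[dup] xp /andP[x0 x2]; have s0 := sin_gt0_pihalf xp.
have c0 : 0 < cos x by apply: cos_gt0_pihalf; rewrite x2 andbT; have := pi_gt0 R; lra.
have h1 := sin_le_id (ltW x0).
have h2 : x * cos x <= sin x by apply: cos_le_sinc; rewrite !ltW.
apply/andP; split; last first.
  by rewrite lef_pV2 ?posrE ?exprn_gt0 // ler_pXn2r ?nnegrE // ltW.
have -> : (sin x ^+ 2)^-1 - 1 = cos x ^+ 2 / sin x ^+ 2.
  by rewrite cos2sin2; field; rewrite gt_eqF.
rewrite ler_pdivrMr ?exprn_gt0 // mulrC ler_pdivlMr ?exprn_gt0 // mulrC -exprMn.
by rewrite ler_pXn2r ?nnegrE ?mulr_ge0 // ltW.
Qed.

Definition angle (n k : nat) : R := (2 * k + 1)%:R * pi / 2 ^+ n.+1.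

(* Each term is split by [1 / sin^2 x = (1 / sin^2 (x/2) + 1 / sin^2 (pi/2 - x/2)) / 4]. *)
Lemma sum_inv_sin_sqr n : \sum_(0 <= k < 2 ^ n) (sin (angle n.+1 k) ^+ 2)^-1 = 4 ^+ n.+1 / 2.
Proof.
have angle_bnd m k : (k < 2 ^ m)%N -> 0 < angle m.+1 k < pi / 2.
  move=> km; have p0 := pi_gt0 R; have e0 : (0 : R) < 2 ^+ m by rewrite exprn_gt0.
  rewrite /angle !exprS; apply/andP; split; first by rewrite divr_gt0 ?mulr_gt0 // ltr0n addn1.
  rewrite ltr_pdivrMr ?mulr_gt0 // (_ : pi / 2 * _ = (2 * 2 ^+ m) * pi); last by field.
  by rewrite ltr_pM2r // -natrX -natrM ltr_nat; lia.
elim: n => [|n IH].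
  rewrite big_nat1 (_ : angle 1 0 = pi / 4); last by rewrite /angle; field.
  have -> : sin (pi / 4 : R) ^+ 2 = 2^-1.
    have := cos_mulr2n (pi / 4 : R); rewrite (_ : pi / 4 *+ 2 = pi / 2 :> R); last by rewrite -mulr_natl; field.
    rewrite cos_pihalf cos2sin2 => /eqP; rewrite -mulr_natl; move: (sin _ ^+ 2) => s /eqP; lra.
  by field.
have split_term k : (k < 2 ^ n)%N -> (sin (angle n.+1 k) ^+ 2)^-1 =
   ((sin (angle n.+2 k) ^+ 2)^-1 + (sin (angle n.+2 (2 ^ n.+1 - 1 - k)) ^+ 2)^-1) / 4.
  move=> kn; have := angle_bnd n k kn; set x := angle n.+1 k => xb; have p0 := pi_gt0 R.
  have -> : angle n.+2 k = x / 2 by rewrite /x /angle (exprS _ n.+2); field; rewrite expf_neq0.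
  have -> : angle n.+2 (2 ^ n.+1 - 1 - k) = pi / 2 - x / 2.
    rewrite /x /angle (_ : 2 * (2 ^ n.+1 - 1 - k) + 1 = 2 * 2 ^ n.+1 - (2 * k + 1))%N; last by rewrite expnS; lia.
    rewrite natrB; last by rewrite expnS; lia.
    by rewrite natrM natrX !exprS; field; rewrite expf_neq0.
  have -> : sin (pi / 2 - x / 2) = cos (x / 2).
    by rewrite -[pi / 2 - x / 2]opprB sinN sinBpihalf opprK.
  have h : 0 < x / 2 < pi / 2 by move: xb => /andP[]; lra.
  have s0 := sin_gt0_pihalf h.
  have c0 : 0 < cos (x / 2) by apply: cos_gt0_pihalf; move: h => /andP[]; lra.
  have -> : sin x = 2 * (cos (x / 2) * sin (x / 2)).
    by rewrite mulr_natl -sin_mulr2n; congr sin; rewrite -mulr_natl; field.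
  have cs : cos (x / 2) ^+ 2 + sin (x / 2) ^+ 2 = 1 := cos2Dsin2 (x / 2).
  rewrite -[in RHS](mulr1 (_ + _)) -[in RHS](mul1r (_ * 1)) .
  rewrite [LHS](_ : _ = (cos (x / 2) ^+ 2 + sin (x / 2) ^+ 2) / (2 * (cos (x / 2) * sin (x / 2))) ^+ 2); last by rewrite cs mul1r.
  by field; rewrite !gt_eqF.
rewrite (@big_cat_nat _ _ _ (2 ^ n)) //=; last by rewrite leq_pexp2l.
have -> : \sum_(2 ^ n <= k < 2 ^ n.+1) (sin (angle n.+2 k) ^+ 2)^-1
    = \sum_(0 <= k < 2 ^ n) (sin (angle n.+2 (2 ^ n.+1 - 1 - k)) ^+ 2)^-1.
  rewrite big_nat_rev /= -{1}[(2 ^ n)%N]add0n big_addn.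
  have -> : (2 ^ n.+1 - 2 ^ n = 2 ^ n)%N by rewrite expnS mul2n -addnn addnK.
  rewrite big_nat_cond [RHS]big_nat_cond; apply: eq_bigr => k; rewrite andbT => /andP[_ kn].
  congr ((sin (angle _ _) ^+ 2)^-1); move: kn; rewrite expnS; set m := (2 ^ n)%N; lia.
rewrite -big_split /= (exprS 4 n.+1) -mulrA -IH mulr_sumr.
rewrite big_nat_cond [RHS]big_nat_cond; apply: eq_bigr => k; rewrite andbT => /andP[_ kn].
by rewrite split_term // mulrCA mulfV // mulr1.
Qed.

Definition odd_sum n : R := \sum_(0 <= k < 2 ^ n) ((2 * k + 1)%:R ^+ 2)^-1.

(** [inv_sin_sqr] summed over the angles. The loss of 1 per term amounts to [2 ^ n], against a total
    of order [4 ^ n]. *)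
Lemma odd_sum_bound n : pi ^+ 2 / 8 - pi ^+ 2 / 16 / 2 ^+ n <= odd_sum n <= pi ^+ 2 / 8.
Proof.
set S := odd_sum n; have p0 := pi_gt0 R; have e0 : (0 : R) < 2 ^+ n by rewrite exprn_gt0.
have angle_bnd k : (k < 2 ^ n)%N -> 0 < angle n.+1 k < pi / 2.
  move=> km; rewrite /angle !exprS; apply/andP; split; first by rewrite divr_gt0 ?mulr_gt0 // ltr0n addn1.
  rewrite ltr_pdivrMr ?mulr_gt0 // (_ : pi / 2 * _ = (2 * 2 ^+ n) * pi); last by field.
  by rewrite ltr_pM2r // -natrX -natrM ltr_nat; lia.
have SE : 16 * (2 ^+ n) ^+ 2 / pi ^+ 2 * S = \sum_(0 <= k < 2 ^ n) (angle n.+1 k ^+ 2)^-1.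
  rewrite /S /odd_sum mulr_sumr; apply: eq_bigr => k _; rewrite /angle [2 ^+ n.+2]exprS [2 ^+ n.+1]exprS.
  have k0 : (2 * k + 1)%:R != 0 :> R by rewrite pnatr_eq0 addn1.
  move: (2 * k + 1)%:R k0 (2 ^+ n) e0 (pi : R) p0 => q q0 r r0 p p0; field.
  by rewrite ?q0 ?(gt_eqF r0) ?(gt_eqF p0).
have := sum_inv_sin_sqr n.
have -> : 4 ^+ n.+1 = 4 * (2 ^+ n) ^+ 2 :> R by rewrite exprS -exprM mulnC exprM -[4 in LHS]/(4%:R); congr (_ * _ ^+ _); ring.
move=> H; have up : 16 * (2 ^+ n) ^+ 2 / pi ^+ 2 * S <= 4 * (2 ^+ n) ^+ 2 / 2.
  rewrite SE -H big_nat_cond [leRHS]big_nat_cond; apply: ler_sum => k; rewrite andbT => /andP[_ kn].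
  by have /andP[] := inv_sin_sqr (angle_bnd k kn).
have lo : 4 * (2 ^+ n) ^+ 2 / 2 - 2 ^+ n <= 16 * (2 ^+ n) ^+ 2 / pi ^+ 2 * S.
  have -> : (2 ^+ n : R) = \sum_(0 <= k < 2 ^ n) 1 by rewrite big_const_nat iter_addr subn0 addr0 -natrX.
  rewrite -(_ : 2 ^+ n = \sum_(0 <= k < 2 ^ n) 1 :> R); last by rewrite big_const_nat iter_addr subn0 addr0 -natrX.
  rewrite -H [X in _ - X](_ : _ = \sum_(0 <= k < 2 ^ n) 1); last by rewrite big_const_nat iter_addr subn0 addr0 -natrX.
  rewrite SE -sumrB big_nat_cond [leRHS]big_nat_cond; apply: ler_sum => k; rewrite andbT => /andP[_ kn].
  by have /andP[] := inv_sin_sqr (angle_bnd k kn).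
have c0 : 0 < 16 * (2 ^+ n) ^+ 2 / pi ^+ 2 :> R by rewrite divr_gt0 ?mulr_gt0 ?exprn_gt0.
apply/andP; split; rewrite -(ler_pM2l c0).
  apply: le_trans lo; rewrite le_eqVlt; apply/orP; left; apply/eqP.
  by move: (pi : R) p0 (2 ^+ n) e0 => p p0 r r0; field; rewrite ?(gt_eqF r0) ?(gt_eqF p0).
apply: le_trans up _; rewrite le_eqVlt; apply/orP; left; apply/eqP.
by move: (pi : R) p0 (2 ^+ n) e0 => p p0 r r0; field; rewrite ?(gt_eqF r0) ?(gt_eqF p0).
Qed.

(** Dropping the even terms leaves [3/4 Z], and the odd terms sum to [pi ^ 2 / 8]. *)
Lemma basel (Z : R) : psum (@dirichlet R xpredT 2) @ \oo --> Z -> Z = pi ^+ 2 / 6.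
Proof.
move=> cZ; have p0 := pi_gt0 R.
have oddE n : odd_sum n
    = psum (@dirichlet R xpredT 2) (2 ^ n.+1) - 4^-1 * psum (@dirichlet R xpredT 2) (2 ^ n).
  have H m : psum (@dirichlet R xpredT 2) (2 * m) = \sum_(0 <= k < m) ((2 * k + 1)%:R ^+ 2)^-1 + 4^-1 * psum (@dirichlet R xpredT 2) m.
    elim: m => [|m IH]; first by rewrite muln0 !psum0 big_geq // mulr0 addr0.
    have dE k : dirichlet R xpredT 2 k = (k%:R ^+ 2)^-1 by rewrite /dirichlet /= mulr1n mul1r.
    rewrite mulnS addSn add1n !psumS IH big_nat_recr //= !dE addn1.
    have -> : (2 * m).+2%:R = 2 * m.+1%:R :> R by rewrite -natrM; congr (_%:R); lia.
    have m0 : m.+1%:R != 0 :> R by rewrite pnatr_eq0.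
    have n0 : (2 * m).+1%:R != 0 :> R by rewrite pnatr_eq0.
    by move: (m.+1%:R) ((2 * m).+1%:R) m0 n0 => a b a0 b0; field; rewrite a0 b0.
  by rewrite expnS H addrK /odd_sum.
have c2 : (fun n => psum (@dirichlet R xpredT 2) (2 ^ n.+1) - 4^-1 * psum (@dirichlet R xpredT 2) (2 ^ n)) @ \oo --> Z - 4^-1 * Z.
  have e2 : (fun n : nat => (2 ^ n)%N) @ \oo --> \oo.
    apply/cvgnyPge => k; near=> n; apply: leq_trans (ltnW (ltn_expl n (ltnSn 1))).
    by near: n; apply: nbhs_infty_ge.
  apply: cvgB; last by apply: cvgMr; apply: cvg_comp cZ.
  have e3 : (fun n : nat => (2 ^ n.+1)%N) @ \oo --> \oo.
    apply/cvgnyPge => k; near=> n; apply: leq_trans (ltnW (ltn_expl n.+1 (ltnSn 1))).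
    by apply: leqW; near: n; apply: nbhs_infty_ge.
  by apply: cvg_comp cZ.
suff : `|pi ^+ 2 / 8 - (Z - 4^-1 * Z)| <= 0 by rewrite normr_le0 => /eqP; lra.
apply/ler_addgt0Pl => e e0; rewrite addr0; apply: (cvgn_dist_le c2); near=> n.
rewrite -oddE; have /andP[h1 h2] := odd_sum_bound n.
rewrite ger0_norm ?subr_ge0 // lerBlDr -lerBlDl; apply: le_trans h1.
rewrite lerB // ler_pdivrMr ?exprn_gt0 //.
apply: le_trans (_ : e * n%:R <= _); last first.
  by rewrite ler_pM2l // -natrX ler_nat ltnW // ltn_expl.
rewrite -ler_pdivrMl //.
by near: n; apply: nbhs_infty_ger.
Unshelve. all: by end_near. Qed.

End Basel.

(** * Computability of the secondary constant *)

Section RecursiveFunctions.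
Local Open Scope nat_scope.

(** * Closure properties of the recursive functions *)

Section RecursiveClosure.

(* Functions of an environment, given as a list of the values of the variables. *)
Definition rec (k : nat) (f : seq nat -> nat) := recursive (fun x : k.-tuple nat => f x).

Lemma rec_ext k f g : (forall x, size x = k -> f x = g x) -> rec k g -> rec k f.
Proof.
move=> fg; rewrite /rec (_ : (fun x : k.-tuple nat => f x) = (fun x => g x)) //.
by apply/funext => x; apply: fg; rewrite size_tuple.
Qed.

Lemma rec_var k i : i < k -> rec k (fun x => nth 0 x i).
Proof.
move=> ik; have := rec_proj (Ordinal ik); rewrite /rec.
by rewrite (_ : (fun x => tnth x (Ordinal ik)) = (fun x : k.-tuple nat => nth 0 x i)) //; apply/funext => x; rewrite (tnth_nth 0).
Qed.

Lemma rec_subst k m f (s : seq nat -> seq nat) : (forall x, size x = k -> size (s x) = m) ->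
  rec m f -> (forall i, i < m -> rec k (fun x => nth 0 (s x) i)) -> rec k (fun x => f (s x)).
Proof.
move=> sz rf rs; have := @rec_comp k m _ (fun i x => nth 0 (s x) i) rf (fun i => rs i (ltn_ord i)).
rewrite /rec; set F := fun x => _; set G := fun x => _; rewrite (_ : F = G) //.
apply/funext => x; rewrite /F /G; congr f; apply: (@eq_from_nth _ 0).
  by rewrite size_tuple sz // size_tuple.
move=> i; rewrite size_tuple => im.
by rewrite -[LHS](tnth_nth 0 _ (Ordinal im)) tnth_mktuple.
Qed.

Lemma rec_subst1 k f g : rec 1 f -> rec k g -> rec k (fun x => f [:: g x]).
Proof. by move=> rf rg; apply: (rec_subst (s := fun x => [:: g x]) _ rf) => // -[]. Qed.

Lemma rec_subst2 k f g h : rec 2 f -> rec k g -> rec k h -> rec k (fun x => f [:: g x; h x]).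
Proof. by move=> rf rg rh; apply: (rec_subst (s := fun x => [:: g x; h x]) _ rf) => // -[|[]]. Qed.

Lemma rec_weak k f : rec k f -> rec k.+1 (fun x => f (behead x)).
Proof.
move=> rf; apply: (rec_subst (s := behead) _ rf) => [x|i ik]; first by rewrite size_behead => ->.
by apply: (rec_ext _ (@rec_var k.+1 i.+1 _)) => // x _; rewrite nth_behead.
Qed.

Lemma rec_push k f b : rec k.+1 f -> rec k b -> rec k (fun x => f (b x :: x)).
Proof.
move=> rf rb; apply: (rec_subst (s := fun x => b x :: x) _ rf) => [x /= ->//|[|i] //= ik].
exact: rec_var.
Qed.

Lemma recS k f : rec k f -> rec k (fun x => (f x).+1).
Proof.
move=> rf; apply: (@rec_subst1 k (fun x => (head 0 x).+1) f _ rf).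
have := rec_succ; rewrite /rec; set F := fun x => _; set G := fun x => _; rewrite (_ : F = G) //.
by apply/funext => x; rewrite /F /G /thead (tnth_nth 0) nth0.
Qed.

Lemma rec_const k c : rec k (fun=> c).
Proof.
elim: c => [|c IH]; last exact: recS.
apply: (@rec_subst k 0 (fun=> 0) (fun=> [::])) => //.
exact: rec_zero.
Qed.

Lemma rec_primrec k f g : rec k f -> rec k.+2 g ->
  rec k.+1 (fun y => nat_rec (fun _ => nat) (f (behead y)) (fun n r => g [:: n, r & behead y]) (head 0 y)).
Proof.
move=> rf rg; have := rec_prim rf rg; rewrite /rec; set F := fun x => _; set G := fun x => _.
rewrite (_ : F = G) //; apply/funext => x; rewrite /F /G /thead (tnth_nth 0) nth0 /=.
by elim: (head 0 x) => //= n ->.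
Qed.

Lemma rec_add k f g : rec k f -> rec k g -> rec k (fun x => f x + g x).
Proof.
move=> rf rg; apply: (@rec_subst2 k (fun y => nth 0 y 0 + nth 0 y 1) _ _ _ rf rg).
apply: (rec_ext _ (rec_primrec (@rec_var 1 0 isT) (recS (@rec_var 3 1 isT)))) => -[|n [|m [|]]] //= _.
by elim: n => //= n <-.
Qed.

Lemma rec_mul k f g : rec k f -> rec k g -> rec k (fun x => f x * g x).
Proof.
move=> rf rg; apply: (@rec_subst2 k (fun y => nth 0 y 0 * nth 0 y 1) _ _ _ rf rg).
apply: (rec_ext _ (rec_primrec (rec_const 1 0) (rec_add (@rec_var 3 2 isT) (@rec_var 3 1 isT)))) => -[|n [|m [|]]] //= _.
by elim: n => //= n IH; rewrite mulSn IH.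
Qed.

Lemma rec_pred k f : rec k f -> rec k (fun x => (f x).-1).
Proof.
move=> rf; apply: (@rec_subst1 k (fun y => (head 0 y).-1) _ _ rf).
apply: (rec_ext _ (rec_primrec (rec_const 0 0) (@rec_var 2 0 isT))) => -[|n [|]] //= _.
by case: n.
Qed.

Lemma rec_sub k f g : rec k f -> rec k g -> rec k (fun x => f x - g x).
Proof.
move=> rf rg; apply: (@rec_subst2 k (fun y => nth 0 y 1 - nth 0 y 0) _ _ _ rg rf).
apply: (rec_ext _ (rec_primrec (@rec_var 1 0 isT) (rec_pred (@rec_var 3 1 isT)))) => -[|n [|m [|]]] //= _.
by elim: n => [|n IH] /=; rewrite ?subn0 // subnS IH.
Qed.

Lemma rec_exp k f g : rec k f -> rec k g -> rec k (fun x => f x ^ g x).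
Proof.
move=> rf rg; apply: (@rec_subst2 k (fun y => nth 0 y 1 ^ nth 0 y 0) _ _ _ rg rf).
apply: (rec_ext _ (rec_primrec (rec_const 1 1) (rec_mul (@rec_var 3 2 isT) (@rec_var 3 1 isT)))) => -[|n [|m [|]]] //= _.
by elim: n => [|n IH] //=; rewrite expnS IH.
Qed.

Lemma rec_sum k f b : rec k.+1 f -> rec k b -> rec k (fun x => \sum_(0 <= i < b x) f (i :: x)).
Proof.
move=> rf rb.
have rg : rec k.+2 (fun y => nth 0 y 1 + f (nth 0 y 0 :: behead (behead y))).
  apply: rec_add; first exact: rec_var.
  apply: (rec_subst (s := fun y => nth 0 y 0 :: behead (behead y)) _ rf) => [[|n [|r x]] //= [->]//|[|i] ik].
    exact: rec_var.
  by apply: (rec_ext _ (@rec_var k.+2 i.+2 _)) => // -[|? [|]].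
apply: (rec_ext _ (rec_push (rec_primrec (rec_const k 0) rg) rb)) => x _ /=.
elim: (b x) => [|n IH]; first by rewrite big_geq.
by rewrite big_nat_recr //= IH.
Qed.

Definition recb k (P : seq nat -> bool) := rec k (fun x => P x).

Lemma recb_leq k f g : rec k f -> rec k g -> recb k (fun x => f x <= g x).
Proof.
move=> rf rg; apply: (rec_ext _ (rec_sub (rec_const k 1) (rec_sub rf rg))) => x _.
by rewrite -subn_eq0; case: (_ - _) => [|[]].
Qed.

Lemma recb_and k P Q : recb k P -> recb k Q -> recb k (fun x => P x && Q x).
Proof. by move=> rP rQ; apply: (rec_ext _ (rec_mul rP rQ)) => x _; rewrite -mulnb. Qed.

Lemma recb_not k P : recb k P -> recb k (fun x => ~~ P x).
Proof. by move=> rP; apply: (rec_ext _ (rec_sub (rec_const k 1) rP)) => x _; case: (P x). Qed.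

Lemma recb_eq k f g : rec k f -> rec k g -> recb k (fun x => f x == g x).
Proof.
move=> rf rg; apply: (rec_ext _ (recb_and (recb_leq rf rg) (recb_leq rg rf))) => x _.
by rewrite eqn_leq.
Qed.

Lemma recb_has k (P : nat -> seq nat -> bool) b : recb k.+1 (fun y => P (head 0 y) (behead y)) -> rec k b ->
  recb k (fun x => has (fun i => P i x) (iota 0 (b x))).
Proof.
move=> rP rb; apply: (rec_ext _ (recb_leq (rec_const k 1) (rec_sum rP rb))) => x _ /=.
have -> : \sum_(0 <= i < b x) P i x = count (fun i => P i x) (iota 0 (b x)).
  by rewrite -sum1_count [RHS]big_mkcond /index_iota subn0; apply: eq_bigr => i _; case: (P i x).
by rewrite has_count.
Qed.

(** Integer-valued functions are differences of two recursive ones, since [recursive] speaks of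
    natural numbers only. *)
Definition reci k (z : seq nat -> int) := exists p q, [/\ rec k p, rec k q & forall x, z x = (Posz (p x) - Posz (q x))%R].

Lemma reci_nat k f : rec k f -> reci k (fun x => Posz (f x)).
Proof. by move=> rf; exists f, (fun=> 0); split=> //; [exact: rec_const | move=> x; rewrite subr0]. Qed.

Lemma reci_const k (c : nat) : reci k (fun=> Posz c).
Proof. exact/reci_nat/rec_const. Qed.

Lemma reci_add k y z : reci k y -> reci k z -> reci k (fun x => y x + z x)%R.
Proof.
move=> [p [q [rp rq E]]] [p' [q' [rp' rq' E']]]; exists (fun x => p x + p' x), (fun x => q x + q' x).
by split=> [||x]; [exact: rec_add | exact: rec_add | rewrite E E' !PoszD; ring].
Qed.

Lemma reci_opp k z : reci k z -> reci k (fun x => - z x)%R.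
Proof. by move=> [p [q [rp rq E]]]; exists q, p; split=> // x; rewrite E opprB. Qed.

Lemma reci_mul k y z : reci k y -> reci k z -> reci k (fun x => y x * z x)%R.
Proof.
move=> [p [q [rp rq E]]] [p' [q' [rp' rq' E']]].
exists (fun x => p x * p' x + q x * q' x), (fun x => p x * q' x + q x * p' x).
by split=> [||x]; [apply: rec_add; exact: rec_mul | apply: rec_add; exact: rec_mul | rewrite E E' !PoszD !PoszM; ring].
Qed.

Lemma reci_exp k z n : reci k z -> reci k (fun x => z x ^+ n)%R.
Proof.
move=> rz; elim: n => [|n IH]; first exact: (reci_const k 1).
have [p [q [rp rq E]]] := reci_mul rz IH; exists p, q; split=> // x.
by rewrite -E exprS.
Qed.

Lemma rec_abs k z : reci k z -> rec k (fun x => absz (z x)).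
Proof.
move=> [p [q [rp rq E]]]; apply: (rec_ext _ (rec_add (rec_sub rp rq) (rec_sub rq rp))) => x _.
rewrite E; case: (leqP (p x) (q x)) => h; last by rewrite subzn ?(ltnW h) // absz_nat (eqP (ltnW h : q x - p x == 0)) addn0.
by rewrite -opprB subzn // abszN absz_nat (eqP (h : p x - q x == 0)) add0n.
Qed.

Lemma recb_eq0 k z : reci k z -> recb k (fun x => z x == 0%R).
Proof.
move=> rz; apply: (rec_ext _ (recb_eq (rec_abs rz) (rec_const k 0))) => x _.
by rewrite absz_eq0.
Qed.

Lemma reci_weak k z : reci k z -> reci k.+1 (fun x => z (behead x)).
Proof.
move=> [p [q [rp rq E]]]; exists (fun x => p (behead x)), (fun x => q (behead x)).
by split; [exact: rec_weak | exact: rec_weak | move=> x; rewrite E].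
Qed.

Lemma recb_dvd k f g : rec k f -> rec k g -> recb k (fun x => f x %| g x).
Proof.
move=> rf rg.
apply: (rec_ext _ (recb_has (P := fun q x => q * f x == g x) (b := fun x => (g x).+1) _ (recS rg))) => [x _|].
  congr nat_of_bool; apply/idP/hasP => [/dvdnP [q qE]|[q _ /eqP <-]]; last by rewrite dvdn_mull.
  have [g0|g0] := posnP (g x).
    by exists 0; rewrite ?mem_iota // g0 mul0n.
  exists q; last by rewrite qE.
  rewrite mem_iota add0n ltnS qE leq_pmulr //.
  by move: g0; rewrite qE muln_gt0 => /andP[].
apply: recb_eq; last exact: rec_weak.
apply: rec_mul; last exact: rec_weak.
by apply: (rec_ext _ (@rec_var k.+1 0 isT)) => x _; rewrite nth0.
Qed.

End RecursiveClosure.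

(** * A bounded decision procedure for the curves counted by N_3 *)

Definition minimal_test (A B : int) :=
  ~~ has (fun l => [&& 1 < l, l ^ 4 %| absz A & l ^ 6 %| absz B]) (iota 0 (absz A + absz B).+1).

(** A root divides [A ^ 2], so when [A] is nonzero it lies between [- A ^ 2] and [A ^ 2]; the shift
    makes the search variable a natural number. For [A = 0] the root 0 is found. *)
Definition root_test (A B : int) :=
  has (fun t => psi3 A B (Posz t - Posz (absz A ^ 2))%R == 0%R) (iota 0 (2 * absz A ^ 2).+1).

Definition curve_test (A B : int) (X : nat) :=
  [&& (4 * A ^+ 3 + 27 * B ^+ 2 != 0)%R, minimal_test A B, root_test A B,
      absz (4 * A ^+ 3)%R <= X & absz (27 * B ^+ 2)%R <= X].

(** The test tries every [l > 1] instead of the primes, which avoids deciding primality; any such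
    [l] divides the maximal twist. *)
Lemma minimal_testP A B : (A != 0%R) || (B != 0%R) -> minimal_test A B = minimal_model A B.
Proof.
move=> AB0; rewrite /minimal_test (minimal_twist_max AB0); apply/hasPn/eqP => [H|H l].
  have f0 := twist_max_gt0 AB0; apply/eqP; rewrite eqn_leq f0 andbT leqNgt; apply/negP => lt.
  have tm : twist_max A B \in iota 0 (absz A + absz B).+1.
    by rewrite mem_iota add0n ltnS twist_dvd_leq // twist_max_dvd.
  by have := H _ tm; rewrite lt => /negP; apply; apply: twist_max_dvd.
move=> _; apply/negP => /and3P[l1 h1 h2].
have : l %| twist_max A B by rewrite -twist_dvdE ?(ltnW l1) // /twist_dvd h1.
by rewrite H dvdn1 => /eqP E; rewrite E in l1.
Qed.

Lemma root_testP A B : root_test A B <-> exists a, psi3 A B a = 0%R.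
Proof.
split=> [/hasP [t _ /eqP E]|[a E]]; first by eexists; exact: E.
have : exists2 b, absz b <= absz A ^ 2 & psi3 A B b = 0%R.
  have [A0|A0] := eqVneq A 0%R; first by exists 0%R; rewrite // /psi3 A0; ring.
  exists a => //; rewrite -abszX; apply: dvdn_leq; first by rewrite absz_gt0 expf_neq0.
  rewrite -dvdzE; apply/dvdzP; exists (3 * a ^+ 3 + 6 * A * a + 12 * B)%R.
  by apply/eqP; rewrite -subr_eq0 -oppr_eq0 -E /psi3; apply/eqP; ring.
move=> [b le Eb]; apply/hasP; exists (absz (b + Posz (absz A ^ 2))%R).
  by rewrite mem_iota; lia.
have -> : (Posz (absz (b + Posz (absz A ^ 2))%R) - Posz (absz A ^ 2) = b)%R by lia.
by rewrite Eb.
Qed.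

Lemma recb_curve_test k A B X : reci k A -> reci k B -> rec k X -> recb k (fun x => curve_test (A x) (B x) (X x)).
Proof.
move=> rA rB rX.
have r3 : reci k (fun x => 4 * A x ^+ 3)%R by apply: reci_mul; [exact: (reci_const k 4) | exact: reci_exp].
have r2 : reci k (fun x => 27 * B x ^+ 2)%R by apply: reci_mul; [exact: (reci_const k 27) | exact: reci_exp].
have rh : rec k.+1 (fun y => head 0 y) by apply: (rec_ext _ (@rec_var k.+1 0 isT)) => x _; rewrite nth0.
apply: recb_and; first by apply: recb_not; apply: recb_eq0; apply: reci_add.
apply: recb_and.
  apply: recb_not; apply: (recb_has (P := fun l x => [&& 1 < l, l ^ 4 %| absz (A x) & l ^ 6 %| absz (B x)])).
    apply: recb_and; first by apply: recb_leq => //; exact: rec_const.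
    by apply: recb_and; apply: recb_dvd; [apply: rec_exp => //; exact: rec_const | apply: rec_abs; exact: reci_weak
       | apply: rec_exp => //; exact: rec_const | apply: rec_abs; exact: reci_weak].
  by apply: recS; apply: rec_add; exact: rec_abs.
have rA2 : rec k (fun x => absz (A x) ^ 2) by apply: rec_exp; [exact: rec_abs | exact: rec_const].
apply: recb_and.
  apply: (recb_has (P := fun t x => psi3 (A x) (B x) (Posz t - Posz (absz (A x) ^ 2))%R == 0%R)); last first.
    by apply: recS; apply: rec_mul => //; exact: rec_const.
  apply: recb_eq0.
  have ra : reci k.+1 (fun y => Posz (head 0%N y) - Posz (absz (A (behead y)) ^ 2)%N)%R.
    by apply: reci_add; [exact: reci_nat | apply: reci_opp; apply: reci_nat; exact: (rec_weak rA2)].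
  have wA := reci_weak rA; have wB := reci_weak rB.
  rewrite /psi3; apply: reci_add; last by apply: reci_opp; apply: reci_exp.
  apply: reci_add; first apply: reci_add.
  - by apply: reci_mul; [exact: (reci_const _ 3) | exact: reci_exp].
  - by apply: reci_mul; [apply: reci_mul; [exact: (reci_const _ 6) | ] | exact: reci_exp].
  - by apply: reci_mul => //; apply: reci_mul => //; exact: (reci_const _ 12).
by apply: recb_and; apply: recb_leq => //; exact: rec_abs.
Qed.

(** The count at height [X = 2 ^ (24 k)]. The exponent 24 makes [X ^ (1/2)], [X ^ (1/3)] and
    [X ^ (7/24)] the integers [16 ^ (3 k)], [16 ^ (2 k)] and [128 ^ k]. A height at most [X] forces
    [|A|] and [|B|] to be at most [X]. *)
Definition curve_count (k : nat) : nat :=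
  \sum_(0 <= i < (2 * 2 ^ (24 * k)).+1) \sum_(0 <= j < (2 * 2 ^ (24 * k)).+1)
    curve_test (Posz i - Posz (2 ^ (24 * k)))%R (Posz j - Posz (2 ^ (24 * k)))%R (2 ^ (24 * k)).

Lemma rec_curve_count k f : rec k f -> rec k (fun x => curve_count (f x)).
Proof.
move=> rf; apply: (@rec_subst1 k (fun x => curve_count (head 0 x)) f _ rf).
have rX : rec 1 (fun x => 2 ^ (24 * head 0 x)).
  apply: rec_exp; first exact: rec_const; apply: rec_mul; first exact: rec_const.
  by apply: (rec_ext _ (@rec_var 1 0 isT)) => x _; rewrite nth0.
have rb : rec 1 (fun x => (2 * 2 ^ (24 * head 0 x)).+1) by apply: recS; apply: rec_mul => //; exact: rec_const.
pose X2 (y : seq nat) := 2 ^ (24 * nth 0 y 2).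
have rX2 : rec 3 X2.
  by apply: rec_exp; [exact: rec_const | apply: rec_mul; [exact: rec_const | exact: rec_var]].
have r3 : rec 3 (fun y => curve_test (Posz (nth 0%N y 1) - Posz (X2 y))%R (Posz (nth 0%N y 0) - Posz (X2 y))%R (X2 y)).
  have v1 : reci 3 (fun y => Posz (nth 0 y 1)) := reci_nat (@rec_var 3 1 isT).
  have v0 : reci 3 (fun y => Posz (nth 0 y 0)) := reci_nat (@rec_var 3 0 isT).
  have vX : reci 3 (fun y => - Posz (X2 y))%R := reci_opp (reci_nat rX2).
  exact: (@recb_curve_test 3 (fun y => (Posz (nth 0%N y 1) - Posz (X2 y))%R) (fun y => (Posz (nth 0%N y 0) - Posz (X2 y))%R) X2 (reci_add v1 vX) (reci_add v0 vX) rX2).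
have rb2 : rec 2 (fun x => (2 * 2 ^ (24 * nth 0 x 1)).+1).
  by apply: recS; apply: rec_mul; [exact: rec_const | apply: rec_exp; [exact: rec_const | apply: rec_mul; [exact: rec_const | exact: rec_var]]].
apply: (rec_ext _ (rec_sum (rec_sum r3 rb2) rb)) => -[|n [|]] //= _.
Qed.

End RecursiveFunctions.

Section Computability.
Variable R : realType.

Lemma calE_isogenyP (A B : int) : (calE (A, B) /\ has_isogeny_of_degree A%:~R B%:~R 3) <->
  [/\ 4 * A ^+ 3 + 27 * B ^+ 2 != 0, minimal (A, B) & has_root (A, B)].
Proof.
have d0 : 4 * A ^+ 3 + 27 * B ^+ 2 != 0 -> (A != 0) || (B != 0).
  by case: (eqVneq A 0) => [->|//]; case: (eqVneq B 0) => [->|//]; rewrite !expr0n !mulr0 addr0 eqxx.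
have iso : 4 * A ^+ 3 + 27 * B ^+ 2 != 0 -> has_isogeny_of_degree A%:~R B%:~R 3 <-> has_root (A, B).
  move=> nz; rewrite has_rootP; apply: isogeny3_psi3.
  by rewrite -!rmorphXn /= -[4]/(4%:~R) -[27]/(27%:~R) -!rmorphM -rmorphD intr_eq0.
split=> [[[nz h] /(iso nz) r]|[nz m /(iso nz) r]].
  by split=> //; apply/(minimal_modelP (d0 nz)).
by split=> //; split=> //; apply/(minimal_modelP (d0 nz)).
Qed.

Lemma ht_leE (A B : int) (X : nat) : ((ht (A, B))%:~R <= X%:R :> R) = (absz (4 * A ^+ 3)%R <= X)%N && (absz (27 * B ^+ 2)%R <= X)%N.
Proof.
by rewrite pmulrn ler_int /ht ge_max -!abszE !lez_nat.
Qed.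

Lemma N3_curve_count k : N3 (2 ^+ (24 * k) : R) = curve_count k.
Proof.
have XE : 2 ^+ (24 * k) = (2 ^ (24 * k))%:R :> R by rewrite natrX.
rewrite XE /N3 -/(cnt _); move EX : (2 ^ (24 * k))%N XE => X XE.
have tE (A B : int) : [set AB : int * int | [/\ calE AB, (ht AB)%:~R <= (X%:R : R) & has_isogeny_of_degree AB.1%:~R AB.2%:~R 3]] (A, B) <-> curve_test A B X.
  rewrite /curve_test /=; split=> [[c h i]|].
    have [nz m r] : [/\ 4 * A ^+ 3 + 27 * B ^+ 2 != 0, minimal (A, B) & has_root (A, B)] by apply/calE_isogenyP.
    have AB0 : (A != 0) || (B != 0).
      by move: nz; case: (eqVneq A 0) => [->|//]; case: (eqVneq B 0) => [->|//]; rewrite !expr0n !mulr0 addr0 eqxx.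
    rewrite nz minimal_testP // [minimal_model _ _]m -ht_leE h !andbT /=.
    exact/root_testP.
  move=> /and3P[nz m /and3P[r h1 h2]].
  have AB0 : (A != 0) || (B != 0).
    by move: nz; case: (eqVneq A 0) => [->|//]; case: (eqVneq B 0) => [->|//]; rewrite !expr0n !mulr0 addr0 eqxx.
  have [c i] : calE (A, B) /\ has_isogeny_of_degree A%:~R B%:~R 3.
    apply/calE_isogenyP; split=> //; last exact/root_testP.
    by rewrite /minimal /= -minimal_testP.
  by split=> //; rewrite ht_leE h1 h2.
rewrite (@cnt_count _ _ [seq (A, B) | A <- int_box X, B <- int_box X]); last 2 first.
- by apply: allpairs_uniq; rewrite ?int_box_uniq // => -[a b] [c d].
- move=> [A B] [_ h _].
  have h' : (ht (A, B))%:~R <= (X%:R : R) := h.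
  have cube (a : int) : (absz a <= absz (4 * a ^+ 3)%R)%N /\ (absz a <= absz (27 * a ^+ 2)%R)%N.
    by rewrite (abszM 4) (abszM 27) !abszX /= !expnS expn0 muln1; case: (absz a) => // n; split; nia.
  move: h'; rewrite ht_leE => /andP[h1 h2].
  by apply: allpairs_f; apply: mem_int_box; [apply: leq_trans h1; case: (cube A) | apply: leq_trans h2; case: (cube B)].
rewrite count_flatten sumnE !big_map /curve_count EX.
rewrite /index_iota !subn0; apply: eq_bigr => i _.
rewrite -sum1_count !big_map big_mkcond; apply: eq_bigr => j _ /=.
have -> : `[< [set AB : int * int | [/\ calE AB, (ht AB)%:~R <= (X%:R : R) & has_isogeny_of_degree AB.1%:~R AB.2%:~R 3]] (i%:Z - X%:Z, j%:Z - X%:Z) >] = curve_test (i%:Z - X%:Z) (j%:Z - X%:Z) X.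
  by apply/asboolP/idP => /tE.
by case: curve_test.
Qed.

End Computability.

(* Two eliminations, at the heights 2^(24k), 2^(24(k+1)) and 2^(24(k+2)), remove
   the terms in X^(1/2) and in X^(1/3) log X from the asymptotic. *)
Definition c2_num_pos (k : nat) : nat :=
  ((15 * k + 14) * 16 ^ 5 * curve_count k + (15 * k - 1) * curve_count k.+2)%N.
Definition c2_num_neg (k : nat) : nat :=
  (((15 * k + 14) * 16 ^ 2 + (15 * k - 1) * 16 ^ 3) * curve_count k.+1)%N.
(** The predecessor compensates the successor in the denominator of [computable_real]. *)
Definition c2_den (k : nat) : nat := ((15 * 16 ^ 2) ^ 2 * 16 ^ (2 * k)).-1%N.

Lemma recursive_unary (f : nat -> nat) : rec 1 (fun x => f (nth 0%N x 0)) ->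
  recursive (fun t : 1.-tuple nat => f (thead t)).
Proof.
rewrite /rec; set F := fun x => _; set G := fun x => _; rewrite (_ : F = G) //.
by apply/funext => x; rewrite /F /G /thead (tnth_nth 0%N).
Qed.

Lemma rec_c2 k f : rec k f ->
  [/\ rec k (fun x => c2_num_pos (f x)), rec k (fun x => c2_num_neg (f x)) & rec k (fun x => c2_den (f x))].
Proof.
move=> rf; have cst c : rec k (fun=> c) := rec_const k c.
have r14 : rec k (fun x => 15 * f x + 14)%N by apply: rec_add => //; exact: rec_mul.
have r1 : rec k (fun x => 15 * f x - 1)%N by apply: rec_sub => //; exact: rec_mul.
have p a b : rec k (fun=> a ^ b)%N by exact: rec_exp.
split.
- apply: rec_add; apply: rec_mul => //; first exact: rec_mul.
  + exact: rec_curve_count.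
  + by apply: rec_curve_count; do 2! apply: recS.
- apply: rec_mul; last by apply: rec_curve_count; apply: recS.
  by apply: rec_add; apply: rec_mul.
- apply: rec_pred; apply: rec_mul; first exact: cst.
  by apply: rec_exp => //; exact: rec_mul.
Qed.

(** * Extraction of the constant from three values of the count *)

Section Elimination.
Variable R : realType.

(** Up to errors, [16 ^ 3 F0 - F1] is free of [a] and equals [16 ^ 2 T ((15 k - 1) L + 15 c)]; the
    next such difference has [15 k + 14] in place of [15 k - 1]. Cross multiplication cancels [L]
    and leaves [15 ^ 2 16 ^ 4 T c]. *)
Lemma elimination_error (a T L k c C e E0 E1 E2 : R) : 1 <= k -> 0 <= C -> 0 <= e ->
  `|E0| <= C * e -> `|E1| <= 128 * (C * e) -> `|E2| <= 128 * 128 * (C * e) ->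
  forall F0 F1 F2, F0 = a + (L * k + c) * T + E0 ->
  F1 = 16 ^+ 3 * a + (L * (k + 1) + c) * (16 ^+ 2 * T) + E1 ->
  F2 = 16 ^+ 6 * a + (L * (k + 2) + c) * (16 ^+ 4 * T) + E2 ->
  `|(15 * k + 14) * 16 ^+ 5 * F0 + (15 * k - 1) * F2 - ((15 * k + 14) * 16 ^+ 2 + (15 * k - 1) * 16 ^+ 3) * F1
    - (15 * 16 ^+ 2) ^+ 2 * T * c| <= (15 * 16 ^+ 2) ^+ 2 * (2 * (C * e) * (k + 1)).
Proof.
move=> k1 C0 e0 h0 h1 h2 F0 F1 F2 F0E F1E F2E.
have -> : (15 * k + 14) * 16 ^+ 5 * F0 + (15 * k - 1) * F2 - ((15 * k + 14) * 16 ^+ 2 + (15 * k - 1) * 16 ^+ 3) * F1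
    - (15 * 16 ^+ 2) ^+ 2 * T * c =
   (15 * k + 14) * 16 ^+ 2 * (16 ^+ 3 * E0 - E1) - (15 * k - 1) * (16 ^+ 3 * E1 - E2) by rewrite F0E F1E F2E; ring.
have d0 : 0 <= C * e by exact: mulr_ge0.
move: (C * e) d0 h0 h1 h2 => d d0 h0 h1 h2.
have b x y (z w : R) : `|x| <= z -> `|y| <= w -> `|16 ^+ 3 * x - y| <= 16 ^+ 3 * z + w.
  move=> hx hy; apply: le_trans (ler_normB _ _) _; apply: lerD => //.
  by rewrite normrM (ger0_norm (exprn_ge0 _ _)) ?ler0n // ler_pM2l // exprn_gt0 // ltr0n.
have b0 := b _ _ _ _ h0 h1; have b1 := b _ _ _ _ h1 h2.
have u0 : 0 <= (15 * k + 14) * 16 ^+ 2 by apply: mulr_ge0; [lra | apply: exprn_ge0; lra].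
have v0 : 0 <= 15 * k - 1 by lra.
apply: le_trans (ler_normB _ _) _.
rewrite (normrM ((15 * k + 14) * 16 ^+ 2)) (normrM (15 * k - 1)) (ger0_norm u0) (ger0_norm v0).
apply: le_trans (lerD (ler_wpM2l u0 b0) (ler_wpM2l v0 b1)) _.
have kd : d <= k * d by rewrite ler_peMl.
rewrite -subr_ge0; have -> : (15 * 16 ^+ 2) ^+ 2 * (2 * d * (k + 1)) -
  ((15 * k + 14) * 16 ^+ 2 * (16 ^+ 3 * d + 128 * d) + (15 * k - 1) * (16 ^+ 3 * (128 * d) + 128 * 128 * d)) =
  16 ^+ 3 * 4 * (k * d * 315 + d * 909) by ring.
by apply: mulr_ge0; [apply: mulr_ge0; [apply: exprn_ge0 |] | ]; lra.
Qed.

Lemma powR_2X (m n : nat) (q : R) : n%:R * q = m%:R -> forall k, (2 ^+ (n * k) : R) `^ q = 2 ^+ (m * k).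
Proof.
move=> nq k; rewrite -powR_mulrn // -powRrM natrM mulrAC nq -natrM powR_mulrn //.
Qed.

Lemma computable_of_asymptotic (alpha c1 c2 C : R) :
  (forall X : R, 1 <= X -> `|(N3 X)%:R - (alpha * X `^ (1 / 2) + c1 * X `^ (1 / 3) * ln X + c2 * X `^ (1 / 3))| <= C * X `^ (7 / 24)) ->
  computable_real c2.
Proof.
move=> H.
pose L := 24 * c1 * ln 2 : R.
have {H} H k : `|(curve_count k)%:R - (alpha * 16 ^+ (3 * k) + (L * k%:R + c2) * 16 ^+ (2 * k))| <= C * 128 ^+ k.
  have := H (2 ^+ (24 * k)) _; rewrite exprn_ege1 ?ler1n // N3_curve_count => /(_ isT).
  rewrite (@powR_2X 12 24 (1/2)); last by field.
  rewrite (@powR_2X 8 24 (1/3)); last by field.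
  rewrite (@powR_2X 7 24 (7/24)); last by field.
  rewrite lnXn // -[_ *+ (24 * k)]mulr_natr natrM.
  have -> : (16 : R) = 2 ^+ 4 by ring.
  have -> : (128 : R) = 2 ^+ 7 by ring.
  rewrite -!exprM !mulnA (_ : (4 * 3 = 12)%N) // (_ : (4 * 2 = 8)%N) //.
  apply: le_trans; rewrite le_eqVlt; apply/orP; left; apply/eqP; congr (`|_ - _|); rewrite /L; ring.
have [j Cj] : exists j : nat, C <= 2 ^+ j.
  exists (Num.truncn C).+1; apply: le_trans (ltW (truncnS_gt _)) _.
  by rewrite -natrX ler_nat ltnW // ltn_expl.
have {Cj} H k : `|(curve_count k)%:R - (alpha * 16 ^+ (3 * k) + (L * k%:R + c2) * 16 ^+ (2 * k))| <= 2 ^+ j * 128 ^+ k.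
  by apply: le_trans (H k) _; apply: ler_wpM2r => //; apply: exprn_ge0; rewrite ler0n.
(* With [C <= 2 ^ j], the approximation at level [k] is off by at most [2 * 2 ^ j (k + 1) / 2 ^ k];
   at [k = K n] this is below [2 ^ (-n)]. *)
pose K (n : nat) := (2 * n + (2 * j + 8))%N.
have [rp rq rd] : [/\ rec 1 (fun x => c2_num_pos (K (nth 0%N x 0))), rec 1 (fun x => c2_num_neg (K (nth 0%N x 0))) & rec 1 (fun x => c2_den (K (nth 0%N x 0)))].
  apply: rec_c2; apply: rec_add; last exact: rec_const.
  by apply: rec_mul; [exact: rec_const | exact: rec_var].
exists (fun t => c2_num_pos (K (thead t))), (fun t => c2_num_neg (K (thead t))), (fun t => c2_den (K (thead t))).
split; [exact: (recursive_unary (f := fun n => c2_num_pos (K n))) | exact: (recursive_unary (f := fun n => c2_num_neg (K n))) | exact: (recursive_unary (f := fun n => c2_den (K n))) |].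
move=> n; cbv zeta; rewrite theadE.
have Kbound : 2 * 2 ^+ j * ((K n)%:R + 1) * 2^-1 ^+ K n <= 2^-1 ^+ n :> R.
  have le : (2 * 2 ^ j * (K n).+1 * 2 ^ n <= 2 ^ K n)%N.
    have -> : (2 ^ K n = 2 * 2 ^ j * 2 ^ n * 2 ^ (n + j + 7))%N.
      by rewrite /K -expnS -!expnD; congr expn; lia.
    rewrite mulnAC leq_mul2l; apply/orP; right.
    rewrite expnD; have := ltn_expl (n + j) (isT : (1 < 2)%N); rewrite /K.
    by move: (2 ^ (n + j))%N => z; rewrite (_ : (2 ^ 7 = 128)%N) //; lia.
  rewrite exprVn exprVn ler_pdivrMr ?exprn_gt0 // [X in _ <= X]mulrC ler_pdivlMr ?exprn_gt0 //.
  by rewrite natr1 -!natrX -!natrM ler_nat.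
apply: le_trans Kbound.
have : (1 <= K n)%N by rewrite /K; lia.
move: (K n) => k k1.
have Tk : 16 ^+ (2 * k) = 128 ^+ k * 2 ^+ k :> R.
  by rewrite exprM -exprMn; congr (_ ^+ k); ring.
have e0 : 0 <= 128 ^+ k :> R by apply: exprn_ge0; rewrite ler0n.
have C0 : 0 <= 2 ^+ j :> R by apply: exprn_ge0.
have k1' : 1 <= k%:R :> R by rewrite ler1n.
have h0 := H k; have h1 := H k.+1; have h2 := H k.+2.
have e1 : 2 ^+ j * 128 ^+ k.+1 = 128 * (2 ^+ j * 128 ^+ k) :> R by rewrite exprS mulrCA.
have e2 : 2 ^+ j * 128 ^+ k.+2 = 128 * 128 * (2 ^+ j * 128 ^+ k) :> R by rewrite 2!exprS; ring.
rewrite e1 in h1; rewrite e2 in h2.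
have D0 : 0 < (15 * 16 ^+ 2) ^+ 2 :> R by apply: exprn_gt0; apply: mulr_gt0; [|apply: exprn_gt0]; rewrite ltr0n.
have T0 : 0 < 16 ^+ (2 * k) :> R by apply: exprn_gt0; rewrite ltr0n.
have E (x y : R) : y + (x - y) = x by rewrite addrC subrK.
have S1 : 16 ^+ 3 * (alpha * 16 ^+ (3 * k)) + (L * (k%:R + 1) + c2) * (16 ^+ 2 * 16 ^+ (2 * k)) =
   alpha * 16 ^+ (3 * k.+1) + (L * k.+1%:R + c2) * 16 ^+ (2 * k.+1) :> R.
  by rewrite natr1 -exprD [16 ^+ 3 * _]mulrCA -exprD !mulnS.
have S2 : 16 ^+ 6 * (alpha * 16 ^+ (3 * k)) + (L * (k%:R + 2) + c2) * (16 ^+ 4 * 16 ^+ (2 * k)) =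
   alpha * 16 ^+ (3 * k.+2) + (L * k.+2%:R + c2) * 16 ^+ (2 * k.+2) :> R.
  by rewrite -natrD addn2 -exprD [16 ^+ 6 * _]mulrCA -exprD !mulnS !addnA.
have := elimination_error k1' C0 e0 h0 h1 h2 (esym (E _ _)) (esym (etrans (congr1 (+%R^~ _) S1) (E _ _)))
  (esym (etrans (congr1 (+%R^~ _) S2) (E _ _))).
set N := (X in `|X - _| <= _ -> _).
have -> : (c2_num_pos k)%:R - (c2_num_neg k)%:R = N :> R.
  have xE : (15 * k + 14)%:R = 15 * k%:R + 14 :> R by rewrite natrD natrM.
  have yE : (15 * k - 1)%:R = 15 * k%:R - 1 :> R by rewrite natrB ?muln_gt0 ?k1 // natrM.
  rewrite /N /c2_num_pos /c2_num_neg -xE -yE -(natrX R 16 5) -(natrX R 16 2) -(natrX R 16 3).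
  by move: (15 * k + 14)%N (15 * k - 1)%N (16 ^ 5)%N (16 ^ 2)%N (16 ^ 3)%N => x y u v w; rewrite !(natrM, natrD).
have -> : (c2_den k).+1%:R = (15 * 16 ^+ 2) ^+ 2 * 16 ^+ (2 * k) :> R.
  rewrite /c2_den prednK ?muln_gt0 ?expn_gt0 // -(natrX R 16 (2 * k)) -(natrX R 16 2) -(natrM R 15) -natrX.
  by move: ((15 * 16 ^ 2) ^ 2)%N => d; rewrite natrM.
move=> le; have DT := mulr_gt0 D0 T0.
have G (D c x : R) : D != 0 -> c - x / D = - ((x - D * c) / D) by move=> D1; field.
rewrite G ?gt_eqF // normrN normrM normfV (gtr0_norm DT) ler_pdivrMr //.
apply: le_trans le _; rewrite Tk exprVn le_eqVlt; apply/orP; left; apply/eqP.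
have : 2 ^+ k != 0 :> R by rewrite expf_neq0.
by move: ((15 * 16 ^+ 2) ^+ 2) (2 ^+ k) (2 ^+ j) (128 ^+ k) => D z y x z0; field.
Qed.

End Elimination.

(** * Numerical value of the leading secondary constant *)

Section IntegralBounds.
Variable R : realType.
Local Notation mu := (@lebesgue_measure R).

Lemma integrable_itvZ (i : interval R) (g : R -> R) (C : R) : mu.-integrable [set` i] (EFin \o g) ->
  mu.-integrable [set` i] (EFin \o (fun x => C * g x)).
Proof.
by move=> ig; exact: (@integrableZl _ _ _ mu _ (measurable_itv i) C _ ig).
Qed.

(** [G] will be a truncated series and [g] its exact derivative; the factors [A] and [B] take up the
    truncation and the slack. *)
Lemma Rintegral_segment_bounds (h G g : R -> R) (a b A B : R) : a < b ->
  mu.-integrable `[a, b] (EFin \o h) ->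
  (forall x, a <= x <= b -> is_derive x 1 G (g x)) ->
  (forall x, a <= x <= b -> {for x, continuous g}) ->
  (forall x, a <= x <= b -> A * g x <= h x <= B * g x) ->
  A * (G b - G a) <= \int[mu]_(x in `[a, b]) h x <= B * (G b - G a).
Proof.
move=> ab ih dG cg bnd.
have cg' : {within `[a, b], continuous g}.
  by apply: continuous_in_subspaceT => x; rewrite inE /= in_itv; apply: cg.
have ig : mu.-integrable `[a, b] (EFin \o g).
  by apply: continuous_compact_integrable => //; exact: segment_compact.
have cG x : a <= x <= b -> {for x, continuous G}.
  move=> xab; have d := dG x xab; apply: differentiable_continuous; apply/derivable1_diffP; exact: ex_derive.
have E : \int[mu]_(x in `[a, b]) g x = G b - G a.
  rewrite /Rintegral (@continuous_FTC2 _ g G) //.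
  - split.
    + by move=> x; rewrite in_itv /= => /andP[ax xb]; have d : is_derive x 1 G (g x) by apply: dG; rewrite !ltW.
    + by apply: cvg_at_right_filter; apply: cG; rewrite lexx ltW.
    + by apply: cvg_at_left_filter; apply: cG; rewrite lexx ltW.
  - move=> x; rewrite in_itv /= => /andP[ax xb]; have d : is_derive x 1 G (g x) by apply: dG; rewrite !ltW.
    by rewrite derive1E; exact: derive_val.
have iZ (C : R) : mu.-integrable `[a, b] (EFin \o (fun x => C * g x)).
  exact: integrable_itvZ.
rewrite -E -!RintegralZl //; apply/andP; split; apply: le_Rintegral => // x /=; rewrite in_itv /= => /bnd /andP[] //.
Qed.

Lemma Rintegral_ray_bounds (h G g : R -> R) (a l A B : R) : 0 <= A ->
  measurable_fun [set: R] h ->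
  (forall x, a <= x -> 0 <= g x) ->
  (forall x, a <= x -> is_derive x 1 G (g x)) ->
  (forall x, a <= x -> {for x, continuous g}) -> G x @[x --> +oo] --> l ->
  (forall x, a <= x -> A * g x <= h x <= B * g x) ->
  A * (l - G a) <= \int[mu]_(x in `[a, +oo[) h x <= B * (l - G a).
Proof.
move=> A0 mh g0 dG cg Gl bnd.
have cg' : {within `[a, +oo[, continuous g}.
  by apply: continuous_in_subspaceT => x; rewrite inE /= in_itv /= andbT; apply: cg.
have mg : measurable_fun `[a, +oo[ g by apply: subspace_continuous_measurable_fun.
have E0 : (\int[mu]_(x in `[a, +oo[) (g x)%:E = (l - G a)%:E)%E.
  rewrite (@ge0_continuous_FTC2y _ g G a l) //.
  - by move=> x ax; have d := dG x (ltW ax); exact: ex_derive.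
  - have d := dG a (lexx _); apply: cvg_at_right_filter.
    by apply: differentiable_continuous; apply/derivable1_diffP; apply: ex_derive.
  - move=> x; rewrite in_itv /= andbT => ax; have d := dG x (ltW ax).
    by rewrite derive1E; exact: derive_val.
have ig : mu.-integrable `[a, +oo[ (EFin \o g).
  apply/integrableP; split; first exact/measurable_EFinP.
  rewrite (_ : (\int[mu]_(x in `[a, +oo[) `|(EFin \o g) x| = (l - G a)%:E)%E) ?ltry // -E0.
  by apply: eq_integral => x; rewrite inE /= in_itv /= andbT => ax; rewrite ger0_norm // g0.
have E : \int[mu]_(x in `[a, +oo[) g x = l - G a by rewrite /Rintegral E0.
have iZ (C : R) : mu.-integrable `[a, +oo[ (EFin \o (fun x => C * g x)).
  exact: integrable_itvZ.
have ih : mu.-integrable `[a, +oo[ (EFin \o h).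
  apply: (@le_integrable _ _ _ mu _ (measurable_itv `[a, +oo[) _ (EFin \o (fun x => B * g x))) => //; first by apply/measurable_EFinP; exact: measurable_funTS.
  move=> x /=; rewrite in_itv /= andbT => ax; have /andP[h1 h2] := bnd x ax; rewrite lee_fin.
  have h0 : 0 <= h x by apply: le_trans h1; rewrite mulr_ge0 // g0.
  by rewrite !ger0_norm // (le_trans h0).
rewrite -E -!RintegralZl //; apply/andP; split; apply: le_Rintegral => // x /=; rewrite in_itv /= andbT => /bnd /andP[] //.
Qed.

Lemma continuous_hfun : continuous (@hfun R).
Proof.
move=> x; apply: (@cvg_powR _ _ x (@hmax R)); last exact: hmax_gt0.
apply: continuous_max.
  apply: cvgMr; apply: (@continuous_comp R R R (fun z => `|z|) (fun z => z ^+ 3)); first exact: norm_continuous.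
  exact: exprn_continuous.
apply: cvgMr; apply: (@continuous_comp R R R (@quad R) (fun z => z ^+ 2)); last exact: exprn_continuous.
apply: cvgB; last by apply: cvgMr; exact: exprn_continuous.
by apply: cvgD; [exact: cvg_cst | apply: cvgMr; exact: cvg_id].
Qed.

Lemma continuous_sqr_hfun : continuous (fun b => @hfun R b ^+ 2).
Proof. by move=> x; apply: (@continuous_comp R R R (@hfun R) (fun z => z ^+ 2)); [exact: continuous_hfun | exact: exprn_continuous]. Qed.

Lemma Rintegral_left_ray (h : R -> R) (a : R) : continuous h -> (forall x, 0 <= h x) ->
  \int[mu]_(x in `]-oo, (- a)%R]) h x = \int[mu]_(x in `[a, +oo[) h (- x).
Proof.
move=> ch h0; rewrite /Rintegral ge0_integration_by_substitutionNy //.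
by apply: continuous_subspaceT.
Qed.

Lemma Rintegral_split5 (h : R -> R) (a b c d : R) : a <= b -> b <= c -> c <= d ->
  mu.-integrable [set: R] (EFin \o h) ->
  \int[mu]_x h x = \int[mu]_(x in `]-oo, a]) h x + \int[mu]_(x in `[a, b]) h x
    + \int[mu]_(x in `[b, c]) h x + \int[mu]_(x in `[c, d]) h x + \int[mu]_(x in `[d, +oo[) h x.
Proof.
move=> ab bc cd ih.
have iS (i : interval R) : mu.-integrable [set` i] (EFin \o h) by apply: integrableS ih.
have E1 := @Rintegral_itvB _ h -oo%O +oo%O a (iS _) isT isT.
have E2 := @Rintegral_itvB _ h (BRight a) +oo%O b (iS _) ab isT.
have E3 := @Rintegral_itvB _ h (BRight b) +oo%O c (iS _) bc isT.
have E4 := @Rintegral_itvB _ h (BRight c) +oo%O d (iS _) cd isT.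
rewrite -set_itvNyy; move: E1 E2 E3 E4; rewrite !Rintegral_itv_obnd_cbnd //; lra.
Qed.

End IntegralBounds.

(** * Truncated antiderivatives of h^2 *)

Section Antiderivatives.
Variable R : realType.
Local Notation mu := (@lebesgue_measure R).

Lemma is_derive1M (f g : R -> R) (x df dg : R) : is_derive x 1 f df -> is_derive x 1 g dg ->
  is_derive x 1 (fun z => f z * g z) (df * g x + f x * dg).
Proof.
move=> d1 d2; have d : is_derive x 1 (f * g) (f x *: dg + g x *: df) by apply: is_deriveM.
by apply: (is_derive_eq d); rewrite /GRing.scale /= addrC [g x * _]mulrC.
Qed.

Lemma is_derive1X (f : R -> R) n (x df : R) : is_derive x 1 f df ->
  is_derive x 1 (fun z => f z ^+ n) (n%:R * f x ^+ n.-1 * df).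
Proof. by move=> d; have := @is_deriveX _ _ f n x 1 df d; rewrite exprfctE. Qed.

Lemma is_derive1V (f : R -> R) (x df : R) : f x != 0 -> is_derive x 1 f df ->
  is_derive x 1 (fun z => (f z)^-1) (- (f x ^- 2) * df).
Proof. by move=> f0 d; exact: is_deriveV. Qed.

Lemma is_derive1_cst (c x : R) : is_derive x 1 (fun=> c) 0.
Proof. exact: is_derive_cst. Qed.

Lemma is_derive1_id (x : R) : is_derive x 1 (fun z => z) 1.
Proof. exact: is_derive_id. Qed.

Lemma is_derive1D (f g : R -> R) (x df dg : R) : is_derive x 1 f df -> is_derive x 1 g dg ->
  is_derive x 1 (fun z => f z + g z) (df + dg).
Proof. by move=> d1 d2; exact: is_deriveD. Qed.

Lemma is_derive1Z (c : R) (f : R -> R) (x df : R) : is_derive x 1 f df -> is_derive x 1 (fun z => c * f z) (c * df).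
Proof. by move=> d; exact: is_deriveZ. Qed.

Definition cbrt (x : R) : R := x `^ (1 / 3).

Lemma cbrt_gt0 x : 0 < x -> 0 < cbrt x.
Proof. exact: powR_gt0. Qed.

Lemma cbrtX3 x : 0 <= x -> cbrt x ^+ 3 = x.
Proof. by move=> x0; rewrite -powR_mulrn ?powR_ge0 // -powRrM (_ : 1 / 3 * 3%:R = 1) ?powRr1 //; field. Qed.

Lemma cbrt_le (x y : R) : 0 <= x -> 0 <= y -> x <= y ^+ 3 -> cbrt x <= y.
Proof. by move=> x0 y0 h; rewrite -(@ler_pXn2r _ 3) ?nnegrE ?powR_ge0 // cbrtX3. Qed.

Lemma cbrt_ge (x y : R) : 0 <= x -> 0 <= y -> y ^+ 3 <= x -> y <= cbrt x.
Proof. by move=> x0 y0 h; rewrite -(@ler_pXn2r _ 3) ?nnegrE ?powR_ge0 // cbrtX3. Qed.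

Lemma is_derive1_cbrt (x : R) : 0 < x -> is_derive x 1 cbrt (3 * cbrt x ^+ 2)^-1.
Proof.
move=> x0; have d := is_derive1_powR (1 / 3) x0; apply: (is_derive_eq d).
have c0 := cbrt_gt0 x0.
have -> : x `^ (1 / 3 - 1) = cbrt x / x.
  by rewrite powRD ?(gt_eqF x0) ?implybT // powRN powRr1 // ltW.
by rewrite -{2}(cbrtX3 (ltW x0)); field; rewrite gt_eqF.
Qed.

Lemma continuous_cbrt (x : R) : 0 < x -> {for x, continuous cbrt}.
Proof. exact: continuous_powR. Qed.

(* A series that telescopes after differentiation: the error of the N-th partial
   sum is the factor [1 - e N x], so that it has a known sign. *)
Lemma is_derive_telescope (t e : nat -> R -> R) (u x : R) N : e 0%N x = 1 ->
  (forall n, is_derive x 1 (t n) (u * (e n x - e n.+1 x))) ->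
  is_derive x 1 (fun z => \sum_(n < N) t n z) (u * (1 - e N x)).
Proof.
move=> e0 dt; elim: N => [|N IH].
  rewrite (_ : (fun z => _) = fun=> 0); last by apply/funext => z; rewrite big_ord0.
  by apply: (is_derive_eq (is_derive1_cst 0 x)); rewrite e0 subrr mulr0.
rewrite (_ : (fun z => _) = fun z => (\sum_(n < N) t n z) + t N z); last by apply/funext => z; rewrite big_ord_recr.
by apply: (is_derive_eq (is_derive1D IH (dt N))); ring.
Qed.

(* With [y = (16/3) |w^2 - 12|] for [w = b - 3], the function [g b ^ 2] of the
   paper is [(16/3) y^(-2/3)]. *)
Definition kernel (y : R) : R := 16 / 3 / cbrt y ^+ 2.

Lemma kernel_gt0 y : 0 < y -> 0 < kernel y.
Proof. by move=> y0; rewrite divr_gt0 ?exprn_gt0 ?cbrt_gt0 //; lra. Qed.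

Lemma kernelX3 y : 0 < y -> kernel y ^+ 3 * ((3 / 16) ^+ 3 * y ^+ 2) = 1.
Proof.
move=> y0; have c0 := cbrt_gt0 y0; rewrite /kernel -{2}(cbrtX3 (ltW y0)).
by move: (cbrt y) c0 => c c0; field; rewrite gt_eqF.
Qed.

Lemma continuous_kernel (f : R -> R) (x : R) : {for x, continuous f} -> 0 < f x -> {for x, continuous (fun z => kernel (f z))}.
Proof.
move=> cf f0; apply: cvgMr; apply: cvgV; first by rewrite expf_neq0 // gt_eqF // cbrt_gt0.
apply: (@continuous_comp R R R (fun z => cbrt (f z)) (fun z => z ^+ 2)); last exact: exprn_continuous.
by apply: (@continuous_comp R R R f cbrt) => //; exact: continuous_cbrt.
Qed.

Lemma is_derive1_cbrt_comp (f : R -> R) (x df : R) : 0 < f x -> is_derive x 1 f (16 / 3 * df) ->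
  is_derive x 1 (fun z => cbrt (f z)) (kernel (f x) * (df / 3)).
Proof.
move=> f0 d; have c0 := cbrt_gt0 f0.
apply: (is_derive_eq (is_derive1_comp (f := cbrt) (is_derive1_cbrt f0) d)).
by rewrite /kernel; field; rewrite gt_eqF.
Qed.

Lemma cbrt_kernel y : 0 < y -> cbrt y = kernel y * (3 / 16 * y).
Proof.
move=> y0; have c0 := cbrt_gt0 y0; rewrite /kernel -{3}(cbrtX3 (ltW y0)).
by move: (cbrt y) c0 => c c0; field; rewrite gt_eqF.
Qed.

(** Coefficients of hypergeometric series. Their ratios are the ones for which the derivatives of
    successive terms telescope, in [is_derive_ray_term] and [is_derive_mid_term]. *)
Fixpoint ray_coef n : R := if n is m.+1 then ray_coef m * ((6 * m + 3)%:R / (6 * m + 7)%:R) else 1.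
Fixpoint mid_coef n : R := if n is m.+1 then mid_coef m * ((3 * m + 2)%:R / (3 * m + 4)%:R) else 1.

Lemma ray_coef_ge0 n : 0 <= ray_coef n.
Proof. by elim: n => //= n IH; rewrite mulr_ge0 // divr_ge0 ?ler0n. Qed.

Lemma mid_coef_ge0 n : 0 <= mid_coef n.
Proof. by elim: n => //= n IH; rewrite mulr_ge0 // divr_ge0 ?ler0n. Qed.

Definition ray_arg (w : R) : R := 16 / 3 * (w ^+ 2 - 12).
Definition mid_arg (w : R) : R := 16 / 3 * (12 - w ^+ 2).

Definition ray_term n (w : R) : R := - (3 * ray_coef n * 12 ^+ n) * (cbrt (ray_arg w) * w^-1 ^+ (2 * n + 1)).
(** The fraction of [kernel] that the derivative of the first [n] terms still misses; it is
    expressed in [12 / w ^ 2], the variable of the expansion at infinity. *)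
Definition ray_err n (w : R) : R := ray_coef n * (6 * n + 1)%:R * (12 * w^-1 ^+ 2) ^+ n.

Lemma is_derive_ray_arg (w : R) : is_derive w 1 ray_arg (16 / 3 * (2 * w)).
Proof.
have d := is_derive1Z (16 / 3) (is_derive1D (is_derive1X 2 (is_derive1_id w)) (is_derive1_cst (- 12) w)).
by apply: (is_derive_eq d); rewrite /=; ring.
Qed.

Lemma is_derive_ray_term n (w : R) : 0 < w -> 12 < w ^+ 2 ->
  is_derive w 1 (ray_term n) (kernel (ray_arg w) * (ray_err n w - ray_err n.+1 w)).
Proof.
move=> w0 w12; have y0 : 0 < ray_arg w by rewrite /ray_arg; lra.
have w1 : w != 0 by rewrite gt_eqF.
have d1 := is_derive1_cbrt_comp y0 (is_derive_ray_arg w).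
have d2 := is_derive1X (2 * n + 1) (is_derive1V w1 (is_derive1_id w)).
apply: (is_derive_eq (is_derive1Z _ (is_derive1M d1 d2))).
rewrite (cbrt_kernel y0) /ray_err /ray_arg /= (_ : (2 * n + 1).-1 = (2 * n)%N); last by rewrite addn1.
have q0 : (6 * n + 7)%:R != 0 :> R by rewrite pnatr_eq0 addnS.
rewrite (_ : (6 * n.+1 + 1 = 6 * n + 7)%N); last by lia.
rewrite -[ray_coef n * _ * (6 * n + 7)%:R]mulrA divfK //.
have nE a b : (a * n + b)%:R = a%:R * n%:R + b%:R :> R by rewrite natrD natrM.
rewrite (nE 6 1)%N (nE 6 3)%N (nE 2 1)%N [w^-1 ^+ (2 * n + 1)]exprD expr1 [w^-1 ^+ (2 * n)]exprM [_ ^+ n.+1]exprSr [(12 * w^-1 ^+ 2) ^+ n]exprMn.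
move: (kernel _) (12 ^+ n) (ray_coef n) (n%:R : R) ((w^-1 ^+ 2) ^+ n) => u p r m z.
by field.
Qed.

(** Expansion about the zero [w = 2 sqrt 3] of [12 - w ^ 2], where the variable
    [1/2 - w / (4 sqrt 3)] vanishes; on the middle piece this variable stays below 1/3. *)
Definition mid_term n (w : R) : R := Num.sqrt 3 / 4 * mid_coef n * (cbrt (mid_arg w) * (1 / 2 - w / (4 * Num.sqrt 3)) ^+ n).
Definition mid_err n (w : R) : R := mid_coef n * (3 * n + 1)%:R * (1 / 2 - w / (4 * Num.sqrt 3)) ^+ n.

Lemma is_derive_mid_arg (w : R) : is_derive w 1 mid_arg (16 / 3 * (- (2 * w))).
Proof.
have d := is_derive1Z (16 / 3) (is_derive1D (is_derive1_cst 12 w) (is_derive1Z (- 1) (is_derive1X 2 (is_derive1_id w)))).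
rewrite (_ : mid_arg = fun z => 16 / 3 * (12 + -1 * z ^+ 2)); last by apply/funext => z; rewrite mulN1r.
by apply: (is_derive_eq d); rewrite /=; ring.
Qed.

Lemma is_derive_mid_term n (w : R) : w ^+ 2 < 12 ->
  is_derive w 1 (mid_term n) (- kernel (mid_arg w) * (mid_err n w - mid_err n.+1 w)).
Proof.
move=> w12; have y0 : 0 < mid_arg w by rewrite /mid_arg; lra.
pose x (z : R) : R := 1 / 2 + (- (4 * Num.sqrt 3)^-1) * z.
have dx : is_derive w 1 x (- (4 * Num.sqrt 3)^-1).
  by apply: (is_derive_eq (is_derive1D (is_derive1_cst (1 / 2) w) (is_derive1Z (- (4 * Num.sqrt 3)^-1) (is_derive1_id w)))); ring.
have xE z : 1 / 2 - z / (4 * Num.sqrt 3) = x z by rewrite /x mulNr [_^-1 * z]mulrC.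
have d1 := is_derive1_cbrt_comp y0 (is_derive_mid_arg w).
rewrite (_ : mid_term n = fun z => Num.sqrt 3 / 4 * mid_coef n * (cbrt (mid_arg z) * x z ^+ n)); last first.
  by apply/funext => z; rewrite /mid_term xE.
apply: (is_derive_eq (is_derive1Z _ (is_derive1M d1 (is_derive1X n dx)))).
rewrite (cbrt_kernel y0) /mid_err xE /=.
have q0 : (3 * n + 4)%:R != 0 :> R by rewrite pnatr_eq0 addnS.
rewrite (_ : (3 * n.+1 + 1 = 3 * n + 4)%N); last by lia.
rewrite -[mid_coef n * _ * (3 * n + 4)%:R]mulrA divfK //.
have nE a b : (a * n + b)%:R = a%:R * n%:R + b%:R :> R by rewrite natrD natrM.
rewrite (nE 3 1)%N (nE 3 2)%N.
have s0 : 0 < Num.sqrt 3 :> R by rewrite sqrtr_gt0.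
have s3 : Num.sqrt 3 ^+ 2 = 3 :> R by rewrite sqr_sqrtr.
have wE : w = 2 * Num.sqrt 3 * (1 - 2 * x w).
  by rewrite /x; move: (Num.sqrt 3) s0 => s s0; field; rewrite gt_eqF.
have yE : mid_arg w = 16 / 3 * (48 * x w * (1 - x w)).
  by rewrite /mid_arg {1}wE; move: (Num.sqrt 3) s3 (x w) => s s3 y; ring: s3.
rewrite [2 * w](_ : _ = 2 * (2 * Num.sqrt 3 * (1 - 2 * x w))); last by rewrite -wE.
rewrite yE.
move: (x w) => z {wE yE xE dx}; have i3 : (Num.sqrt 3)^-1 = Num.sqrt 3 / 3 :> R.
  by rewrite -{3}s3; field; rewrite gt_eqF.
rewrite [(4 * _)^-1]invfM i3.
case: n q0 nE => [|n] _ _; rewrite /=; last rewrite [z ^+ n.+2]exprS [z ^+ n.+1]exprS.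
  move: (kernel _) (Num.sqrt 3) s3 => u s s3.
  by field: s3.
move: (kernel _) (Num.sqrt 3) s3 (z ^+ n) (mid_coef n) (n.+1%:R : R) (_ / _) => u s s3 p r m d.
by field: s3.
Qed.

End Antiderivatives.

(** * The integral over one piece of the line *)

Section Pieces.
Variable R : realType.
Local Notation mu := (@lebesgue_measure R).
Local Notation cbrt := (@cbrt R).

(** [u] is the value that [hfun ^ 2] would have if [hmax] were [Q]. A relative excess [d] of [hmax]
    costs at most the factor [1 - d], as [(1 - d) ^ 3 (1 + d) <= 1]. *)
Lemma sqr_hfun_between (b u Q d : R) : 0 < u -> u ^+ 3 * Q = 1 -> 0 <= d <= 1 ->
  Q <= hmax b <= (1 + d) * Q -> (1 - d) * u <= hfun b ^+ 2 <= u.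
Proof.
move=> u0 uQ /andP[d0 d1] /andP[h1 h2]; have u3 : 0 < u ^+ 3 by rewrite exprn_gt0.
have m0 := hmax_gt0 b; have hX : hfun b ^+ 2 ^+ 3 * hmax b = 1.
  by rewrite -exprM hfunX6 mulVf // gt_eqF.
have s0 : 0 <= hfun b ^+ 2 by rewrite sqr_ge0.
have le3 (x y : R) : 0 <= x -> 0 <= y -> x ^+ 3 * hmax b <= y ^+ 3 * hmax b -> x <= y.
  by move=> x0 y0; rewrite (ler_pM2r m0) ler_pXn2r.
apply/andP; split; apply: le3 => //; rewrite ?(ltW u0) //; last by rewrite hX -uQ ler_pM2l.
  by rewrite mulr_ge0 ?subr_ge0 // ltW.
rewrite hX exprMn; apply: le_trans (_ : (1 - d) ^+ 3 * (1 + d) <= _).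
    have m1 : u ^+ 3 * hmax b <= 1 + d by have := ler_wpM2l (ltW u3) h2; rewrite mulrCA uQ mulr1.
  by rewrite -mulrA; apply: ler_wpM2l => //; rewrite exprn_ge0 // subr_ge0.
by rewrite -subr_ge0 (_ : _ - _ = d * (2 - 2 * d ^+ 2 + d ^+ 3)); [nra | ring].
Qed.

Lemma continuous_ray_err N (x : R) : x != 0 -> {for x, continuous (@ray_err R N)}.
Proof.
move=> x0; apply: cvgMr; apply: (@continuous_comp R R R (fun w => 12 * w^-1 ^+ 2) (fun z => z ^+ N)); last exact: exprn_continuous.
apply: cvgMr; apply: (@continuous_comp R R R (fun w => w^-1) (fun z => z ^+ 2)); last exact: exprn_continuous.
by apply: cvgV => //; exact: cvg_id.
Qed.

Lemma continuous_ray_arg : continuous (@ray_arg R).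
Proof. by move=> x; apply: cvgMr; apply: cvgB; [exact: exprn_continuous | exact: cvg_cst]. Qed.

Lemma continuous_mid_arg : continuous (@mid_arg R).
Proof. by move=> x; apply: cvgMr; apply: cvgB; [exact: cvg_cst | exact: exprn_continuous]. Qed.

Lemma continuous_mid_err N : continuous (@mid_err R N).
Proof.
move=> x; apply: cvgMr; apply: (@continuous_comp R R R (fun w => 1 / 2 - w / (4 * Num.sqrt 3)) (fun z => z ^+ N)); last exact: exprn_continuous.
by apply: cvgB; [exact: cvg_cst | apply: cvgMl; exact: cvg_id].
Qed.

Lemma ray_err_ge0 N (w : R) : 0 <= ray_err N w.
Proof. apply: mulr_ge0; first by apply: mulr_ge0; rewrite ?ler0n //; exact: ray_coef_ge0.
by apply: exprn_ge0; apply: mulr_ge0; rewrite ?ler0n ?sqr_ge0. Qed.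

Lemma ray_err_le N (v w : R) : 0 < v -> v <= w -> ray_err N w <= ray_err N v.
Proof.
move=> v0 vw; apply: ler_wpM2l; first by rewrite mulr_ge0 ?ray_coef_ge0.
have w0 := lt_le_trans v0 vw.
have q (x : R) : 0 <= 12 * x^-1 ^+ 2 by rewrite mulr_ge0 ?ler0n ?sqr_ge0.
apply: lerXn2r; rewrite ?nnegrE ?q // ler_pM2l ?ltr0n //.
apply: lerXn2r; rewrite ?nnegrE ?invr_ge0 ?(ltW v0) ?(ltW w0) //.
by rewrite lef_pV2.
Qed.

Lemma ray_term_cvg n : ray_term n x @[x --> +oo] --> (0 : R).
Proof.
rewrite -[X in _ --> X](mulr0 (- (3 * @ray_coef R n * 12 ^+ n))); apply: cvgMr.
apply/cvgrPdist_le => e e0; near=> x.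
have x1 : 4 <= x by near: x; apply: nbhs_pinfty_ge; rewrite num_real.
have xe : 6 / e ^+ 3 <= x by near: x; apply: nbhs_pinfty_ge; rewrite num_real.
have x0 : 0 < x by lra.
have y0 : 0 < ray_arg x by rewrite /ray_arg; nra.
have v0 : 0 <= x^-1 by rewrite invr_ge0 ltW.
have v1 : x^-1 <= 1 by rewrite invf_le1 //; lra.
have c0 := cbrt_gt0 y0.
rewrite sub0r normrN ger0_norm; last by rewrite mulr_ge0 ?(ltW c0) ?exprn_ge0.
apply: le_trans (_ : cbrt (ray_arg x) * x^-1 <= _).
  by rewrite ler_pM2l // exprD expr1 ler_piMl // exprn_ile1.
rewrite -(@ler_pXn2r _ 3) ?nnegrE ?mulr_ge0 ?(ltW e0) ?(ltW c0) // exprMn cbrtX3 ?(ltW y0) //.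
have e3 : 0 < e ^+ 3 by rewrite exprn_gt0.
move: xe; rewrite ler_pdivrMr // => xe.
rewrite exprVn ler_pdivrMr ?exprn_gt0 // /ray_arg.
have : 0 <= x ^+ 2 by rewrite sqr_ge0.
rewrite (_ : e ^+ 3 * x ^+ 3 = (x * e ^+ 3) * x ^+ 2); last by ring.
by move: (x * e ^+ 3) (x ^+ 2) xe => p q; nra.
Unshelve. all: by end_near. Qed.

Lemma ray_sum_cvg N : \sum_(n < N) ray_term n x @[x --> +oo] --> (0 : R).
Proof.
elim: N => [|N IH].
  by rewrite (_ : (fun x => _) = fun=> 0); [exact: cvg_cst | apply/funext => x; rewrite big_ord0].
rewrite (_ : (fun x => _) = fun x => (\sum_(n < N) ray_term n x) + ray_term N x); last by apply/funext => x; rewrite big_ord_recr.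
by rewrite -[X in _ --> X]addr0; apply: cvgD => //; exact: ray_term_cvg.
Qed.

(** The variable is [w = x + c]: [c = - 3] on the right ray, and [c = 3] on the left ray after the
    reflection [b = - x]. [ray_err] decreases along the ray, so its value at the end point bounds
    the truncation. *)
Lemma ray_integral (h : R -> R) (a c d : R) N : measurable_fun [set: R] h ->
  0 < a + c -> 12 < (a + c) ^+ 2 -> 0 <= d <= 1 -> ray_err N (a + c) < 1 ->
  (forall x, a <= x -> (1 - d) * kernel (ray_arg (x + c)) <= h x <= kernel (ray_arg (x + c))) ->
  (1 - d) * (- \sum_(n < N) ray_term n (a + c)) <= \int[mu]_(x in `[a, +oo[) h x
    <= (1 - ray_err N (a + c))^-1 * (- \sum_(n < N) ray_term n (a + c)).
Proof.
move=> mh w0 w12 /andP[d0 d1] e1 bnd.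
have wP x : a <= x -> [/\ 0 < x + c, 12 < (x + c) ^+ 2, 0 < ray_arg (x + c) & 0 <= ray_err N (x + c) <= ray_err N (a + c)].
  move=> ax; have h1 : 0 < x + c by lra.
  have h2 : 12 < (x + c) ^+ 2 by apply: lt_le_trans w12 _; rewrite lerXn2r ?nnegrE ?(ltW w0) ?(ltW h1) //; lra.
  by split=> //; [rewrite /ray_arg; lra | rewrite ray_err_ge0 ray_err_le // lerD2r].
have dsh (x : R) : is_derive x 1 (fun z : R => z + c) 1.
  by apply: (is_derive_eq (is_derive1D (is_derive1_id x) (is_derive1_cst c x))); rewrite addr0.
have csh (x : R) : {for x, continuous (fun z : R => z + c)} by apply: cvgD; [exact: cvg_id | exact: cvg_cst].
pose S (w : R) := \sum_(n < N) ray_term n w.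
pose g (x : R) := kernel (ray_arg (x + c)) * (1 - ray_err N (x + c)).
rewrite -/(S (a + c)) -[- S (a + c)]sub0r.
apply: (@Rintegral_ray_bounds R h (fun x => S (x + c)) g) => //.
- by rewrite subr_ge0.
- by move=> x /wP [h1 h2 h3 /andP[h4 h5]]; rewrite /g mulr_ge0 ?(ltW (kernel_gt0 h3)) // subr_ge0 ltW // (le_lt_trans h5).
- move=> x ax; have [h1 h2 h3 _] := wP x ax.
  have dS : is_derive (x + c) 1 S (kernel (ray_arg (x + c)) * (1 - ray_err N (x + c))).
    apply: is_derive_telescope; last by move=> n; exact: is_derive_ray_term.
    by rewrite /ray_err /= expr0 !mulr1.
  have dc : is_derive x 1 (S \o (fun z => z + c)) (kernel (ray_arg (x + c)) * (1 - ray_err N (x + c)) * 1).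
    exact: (is_derive1_comp (f := S) (g := fun z : R => z + c) dS (dsh x)).
  by apply: (is_derive_eq dc); rewrite mulr1.
- move=> x ax; have [h1 h2 h3 _] := wP x ax; apply: cvgM.
    apply: (@continuous_kernel R (fun z => ray_arg (z + c))) => //.
    by apply: (@continuous_comp R R R (fun z => z + c) (@ray_arg R)) => //; exact: continuous_ray_arg.
  apply: cvgB; first exact: cvg_cst.
  by apply: (@continuous_comp R R R (fun z => z + c) (@ray_err R N)) => //; apply: continuous_ray_err; rewrite gt_eqF.
- have c0 : S x @[x --> +oo] --> (0 : R).
    exact: ray_sum_cvg.
  by have := cvg_comp (fun x : R => x + c) S (cvg_addrr c) c0; apply.
- move=> x ax; have [h1 h2 h3 /andP[h4 h5]] := wP x ax; have /andP[b1 b2] := bnd x ax.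
  have k0 := ltW (kernel_gt0 h3); apply/andP; split.
    apply: le_trans b1; rewrite ler_wpM2l ?subr_ge0 // /g ler_piMr //; lra.
  apply: le_trans b2 _; rewrite /g mulrCA ler_peMr //.
  by rewrite ler_pdivlMl ?subr_gt0 // mulr1 lerD2l lerN2.
Qed.

Lemma mid_integral (h : R -> R) (a b d : R) N : mu.-integrable `[a, b] (EFin \o h) -> a < b ->
  b < 3 -> (3 - a) ^+ 2 < 12 -> 0 <= d <= 1 -> mid_err N (3 - b) < 1 ->
  (forall x, a <= x <= b -> (1 - d) * kernel (mid_arg (3 - x)) <= h x <= kernel (mid_arg (3 - x))) ->
  (1 - d) * (\sum_(n < N) mid_term n (3 - b) - \sum_(n < N) mid_term n (3 - a)) <= \int[mu]_(x in `[a, b]) h x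
    <= (1 - mid_err N (3 - b))^-1 * (\sum_(n < N) mid_term n (3 - b) - \sum_(n < N) mid_term n (3 - a)).
Proof.
move=> ih ab b3 w12 /andP[d0 d1] e1 bnd.
have s0 : 0 < Num.sqrt 3 :> R by rewrite sqrtr_gt0.
have s3 : Num.sqrt 3 ^+ 2 = 3 :> R by rewrite sqr_sqrtr.
have xE (x : R) : 1 / 2 - (3 - x) / (4 * Num.sqrt 3) = (x - 3 + 2 * Num.sqrt 3) / (4 * Num.sqrt 3).
  by move: (Num.sqrt 3) s0 => s s0; field; rewrite gt_eqF.
have aw : 3 - a <= 2 * Num.sqrt 3 by move: (Num.sqrt 3) s0 s3 w12 => s s0 s3; nra.
have wP x : a <= x <= b -> [/\ (3 - x) ^+ 2 < 12, 0 < mid_arg (3 - x) & 0 <= mid_err N (3 - x) <= mid_err N (3 - b)].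
  move=> /andP[ax xb].
  have h2 : (3 - x) ^+ 2 < 12 by apply: le_lt_trans w12; rewrite lerXn2r ?nnegrE //; lra.
  split=> //; first by rewrite /mid_arg; lra.
  rewrite /mid_err !xE; have q0 : 0 <= mid_coef R N * (3 * N + 1)%:R by rewrite mulr_ge0 ?mid_coef_ge0.
  have m0 : 0 <= (x - 3 + 2 * Num.sqrt 3) / (4 * Num.sqrt 3) by rewrite divr_ge0 ?mulr_ge0 ?(ltW s0) //; lra.
  have m1 : (x - 3 + 2 * Num.sqrt 3) / (4 * Num.sqrt 3) <= (b - 3 + 2 * Num.sqrt 3) / (4 * Num.sqrt 3).
    by rewrite ler_pM2r ?invr_gt0 ?mulr_gt0 //; lra.
  apply/andP; split; first by rewrite mulr_ge0 // exprn_ge0.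
  by rewrite ler_wpM2l // lerXn2r ?nnegrE // (le_trans m0).
have dsh (x : R) : is_derive x 1 (fun z : R => 3 - z) (-1).
  rewrite (_ : (fun z => 3 - z) = fun z => 3 + -1 * z); last by apply/funext => z; rewrite mulN1r.
  by apply: (is_derive_eq (is_derive1D (is_derive1_cst 3 x) (is_derive1Z (-1) (is_derive1_id x)))); ring.
have csh (x : R) : {for x, continuous (fun z : R => 3 - z)} by apply: cvgB; [exact: cvg_cst | exact: cvg_id].
pose S (w : R) := \sum_(n < N) mid_term n w.
pose g (x : R) := kernel (mid_arg (3 - x)) * (1 - mid_err N (3 - x)).
rewrite -/(S (3 - a)) -/(S (3 - b)).
apply: (@Rintegral_segment_bounds R h (fun x => S (3 - x)) g) => //.
- move=> x ax; have [h2 h3 _] := wP x ax.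
  have dS : is_derive (3 - x) 1 S (- kernel (mid_arg (3 - x)) * (1 - mid_err N (3 - x))).
    apply: is_derive_telescope; last by move=> n; exact: is_derive_mid_term.
    by rewrite /mid_err /= expr0 !mulr1.
  have dc : is_derive x 1 (S \o (fun z => 3 - z)) (- kernel (mid_arg (3 - x)) * (1 - mid_err N (3 - x)) * -1).
    exact: (is_derive1_comp (f := S) (g := fun z : R => 3 - z) dS (dsh x)).
  by apply: (is_derive_eq dc); rewrite mulNr mulrN1 opprK.
- move=> x ax; have [h2 h3 _] := wP x ax; apply: cvgM.
    apply: (@continuous_kernel R (fun z => mid_arg (3 - z))) => //.
    by apply: (@continuous_comp R R R (fun z => 3 - z) (@mid_arg R)) => //; exact: continuous_mid_arg.
  apply: cvgB; first exact: cvg_cst.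
  by apply: (@continuous_comp R R R (fun z => 3 - z) (@mid_err R N)) => //; exact: continuous_mid_err.
- move=> x ax; have [h2 h3 /andP[h4 h5]] := wP x ax; have /andP[b1 b2] := bnd x ax.
  have k0 := ltW (kernel_gt0 h3); apply/andP; split.
    apply: le_trans b1; rewrite ler_wpM2l ?subr_ge0 // /g ler_piMr //; lra.
  apply: le_trans b2 _; rewrite /g mulrCA ler_peMr //.
  by rewrite ler_pdivlMl ?subr_gt0 // mulr1 lerD2l lerN2.
Qed.

Lemma log_integral (h : R -> R) (a b c d : R) : mu.-integrable `[a, b] (EFin \o h) -> 0 < a -> a < b -> 0 <= c -> 0 <= d <= 1 ->
  (forall x, a <= x <= b -> (1 - d) * (c / x) <= h x <= c / x) ->
  (1 - d) * (c * ln (b / a)) <= \int[mu]_(x in `[a, b]) h x <= c * ln (b / a).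
Proof.
move=> ih a0 ab c0 d01 bnd.
rewrite ln_div ?posrE // ?(lt_trans a0 ab) // mulrBr -[X in _ <= _ <= X]mul1r.
apply: (@Rintegral_segment_bounds R h (fun x => c * ln x) (fun x => c / x)) => //.
- by move=> x /andP[ax _]; apply: is_derive1Z; apply: is_derive1_ln; apply: lt_le_trans ax.
- move=> x /andP[ax _]; apply: cvgMr; apply: cvgV; last exact: cvg_id.
  by rewrite gt_eqF // (lt_le_trans a0).
- by move=> x /bnd; rewrite mul1r.
Qed.

Lemma log_integralN (h : R -> R) (a b c d : R) : mu.-integrable `[(- b), (- a)] (EFin \o h) -> 0 < a -> a < b -> 0 <= c -> 0 <= d <= 1 ->
  (forall x, - b <= x <= - a -> (1 - d) * (c / - x) <= h x <= c / - x) ->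
  (1 - d) * (c * ln (b / a)) <= \int[mu]_(x in `[(- b), (- a)]) h x <= c * ln (b / a).
Proof.
move=> ih a0 ab c0 d01 bnd.
have -> : c * ln (b / a) = - c * ln (- - a) - - c * ln (- - b).
  by rewrite ln_div ?posrE // ?(lt_trans a0 ab) // !opprK !mulNr opprK mulrBr addrC.
rewrite -[X in _ <= _ <= X]mul1r.
apply: (@Rintegral_segment_bounds R h (fun x => - c * ln (- x)) (fun x => c / - x)) => //.
- by rewrite ltrN2.
- move=> x /andP[_ xb]; have x0 : 0 < - x by lra.
  have dN : is_derive x 1 (fun z : R => - z) (-1).
    rewrite (_ : (fun z : R => - z) = fun z => -1 * z); last by apply/funext => z; rewrite mulN1r.
    by apply: (is_derive_eq (is_derive1Z (-1) (is_derive1_id x))); rewrite mulr1.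
  apply: (is_derive_eq (is_derive1Z (- c) (is_derive1_comp (f := @ln R) (is_derive1_ln x0) dN))).
  by rewrite mulrN1 mulrNN.
- move=> x /andP[_ xb]; apply: cvgMr; apply: cvgV; first by rewrite oppr_eq0 lt_eqF //; lra.
  by apply: cvgN; exact: cvg_id.
- by move=> x /bnd; rewrite mul1r.
Qed.

End Pieces.

(** * Bounds for logarithms, zeta(2) and zeta(4) *)

Section Constants.
Variable R : realType.
Local Notation mu := (@lebesgue_measure R).

(** Partial sum of [ln ((1 + z) / (1 - z))], twice the series of the inverse hyperbolic tangent. *)
Definition atanh_sum N (z : R) : R := \sum_(n < N) 2 / (2 * n + 1)%:R * z ^+ (2 * n + 1).

Lemma ln_atanh_sum N (z : R) : 0 < z < 1 -> (0 < N)%N ->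
  atanh_sum N z <= ln ((1 + z) / (1 - z)) <= (1 - z ^+ (2 * N))^-1 * atanh_sum N z.
Proof.
move=> /andP[z0 z1] N0.
pose h (x : R) := 2 / (1 - x ^+ 2).
have hP x : 0 <= x <= z -> 0 < 1 - x ^+ 2.
  by move=> /andP[x0 xz]; rewrite subr_gt0 expr_lt1 //; lra.
have ch x : 0 <= x <= z -> {for x, continuous h}.
  move=> /hP x1; apply: cvgMr; apply: cvgV; first by rewrite gt_eqF.
  by apply: cvgB; [exact: cvg_cst | exact: exprn_continuous].
have ih : mu.-integrable `[0, z] (EFin \o h).
  apply: continuous_compact_integrable; first exact: segment_compact.
  by apply: continuous_in_subspaceT => x; rewrite inE /= in_itv; apply: ch.
pose L (x : R) := ln (1 + x) - ln (1 - x).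
have dL x : 0 <= x <= z -> is_derive x 1 L (h x).
  move=> xz; have /andP[x0 x1] := xz; have h0 := hP x xz.
  have a0 : 0 < 1 + x by lra.
  have b0 : 0 < 1 - x by lra.
  have da : is_derive x 1 (fun z : R => 1 + z) 1.
    by apply: (is_derive_eq (is_derive1D (is_derive1_cst 1 x) (is_derive1_id x))); rewrite add0r.
  have db : is_derive x 1 (fun z : R => 1 - z) (-1).
    rewrite (_ : (fun z => 1 - z) = fun z => 1 + -1 * z); last by apply/funext => y; rewrite mulN1r.
    by apply: (is_derive_eq (is_derive1D (is_derive1_cst 1 x) (is_derive1Z (-1) (is_derive1_id x)))); ring.
  have d1 := is_derive1_comp (f := @ln R) (g := fun z : R => 1 + z) (is_derive1_ln a0) da.
  have d2 := is_derive1_comp (f := @ln R) (g := fun z : R => 1 - z) (is_derive1_ln b0) db.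
  rewrite (_ : L = fun y => ln (1 + y) + -1 * ln (1 - y)); last by apply/funext => y; rewrite mulN1r.
  apply: (is_derive_eq (is_derive1D d1 (is_derive1Z (-1) d2))).
  by rewrite /h /=; field; rewrite ?gt_eqF.
have E : ln ((1 + z) / (1 - z)) = \int[mu]_(x in `[0, z]) h x.
  have := @Rintegral_segment_bounds R h L h 0 z 1 1 z0 ih dL ch.
  have -> : L z - L 0 = ln ((1 + z) / (1 - z)).
    by rewrite /L addr0 !subr0 subrr subr0 ln_div // posrE; lra.
  rewrite mul1r => H; apply/esym/eqP; rewrite eq_le.
  have b1 x : 0 <= x <= z -> 1 * h x <= h x <= 1 * h x by move=> _; rewrite mul1r lexx.
  by have /andP[-> ->] := H b1.
pose e n (x : R) := x ^+ (2 * n).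
have z2 : 0 <= e N z < 1 by rewrite exprn_ge0 ?(ltW z0) // expr_lt1 ?muln_gt0 ?(ltW z0).
pose t n (x : R) := 2 / (2 * n + 1)%:R * x ^+ (2 * n + 1).
have S0 : atanh_sum N 0 = 0.
  by rewrite /atanh_sum big1 // => n _; rewrite addn1 expr0n mulr0.
have -> : atanh_sum N z = atanh_sum N z - atanh_sum N 0 by rewrite S0 subr0.
rewrite E -[X in X <= _ <= _]mul1r.
apply: (@Rintegral_segment_bounds R h (atanh_sum N) (fun x => h x * (1 - e N x))) => //.
- move=> x xz; have h0 := hP x xz.
  apply: (@is_derive_telescope R t e (h x) x N); first by rewrite /e expr0.
  move=> n; apply: (is_derive_eq (is_derive1Z _ (is_derive1X (2 * n + 1) (is_derive1_id x)))).
  rewrite addn1 /= /e /h (_ : (2 * n.+1 = 2 * n + 2)%N); last by lia.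
  rewrite exprD; have q0 : (2 * n).+1%:R != 0 :> R by rewrite pnatr_eq0.
  by move: (x ^+ (2 * n)) (2 * n).+1%:R q0 => y q q0; field; rewrite ?q0 ?gt_eqF.
- move=> x xz; apply: cvgM; first exact: ch.
  by apply: cvgB; [exact: cvg_cst | exact: exprn_continuous].
- move=> x xz; have h0 := hP x xz; have /andP[x0 x1] := xz.
  have u0 : 0 < h x by rewrite divr_gt0.
  have ex : 0 <= e N x by rewrite exprn_ge0.
  have ez : e N x <= e N z by rewrite lerXn2r ?nnegrE // (ltW z0).
  have /andP[e0 e1] := z2.
  apply/andP; split; first by rewrite mul1r ler_piMr ?(ltW u0) //; lra.
  have -> : z ^+ (2 * N) = e N z by [].
  rewrite mulrCA ler_peMr ?(ltW u0) // ler_pdivlMl ?subr_gt0 //; lra.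
Qed.

Lemma psum_le (u f : nat -> R) N0 (Z : R) : psum u @ \oo --> Z -> (forall n, 0 <= u n) -> (forall n, 0 <= f n) ->
  (forall n, (N0 <= n)%N -> u n.+1 <= f n - f n.+1) -> Z <= psum u N0 + f N0.
Proof.
move=> cZ u0 f0 uf.
have H m : psum u (N0 + m) <= psum u N0 + f N0 - f (N0 + m)%N.
  elim: m => [|m IH]; first by rewrite addn0 addrK.
  by rewrite addnS psumS; have := uf (N0 + m)%N (leq_addr _ _); lra.
rewrite -(cvg_lim _ cZ) //; apply: limr_le; first by apply/cvg_ex; exists Z.
near=> N; have NN : (N0 <= N)%N by near: N; exact: nbhs_infty_ge.
by have := H (N - N0)%N; rewrite subnKC // => h; have := f0 N; lra.
Unshelve. all: by end_near. Qed.

Lemma psum_ge (u f : nat -> R) N0 (Z : R) : psum u @ \oo --> Z ->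
  f @ \oo --> (0 : R) ->
  (forall n, (N0 <= n)%N -> f n - f n.+1 <= u n.+1) -> psum u N0 + f N0 <= Z.
Proof.
move=> cZ cf uf.
have H m : psum u N0 + f N0 <= psum u (N0 + m) + f (N0 + m)%N.
  elim: m => [|m IH]; first by rewrite addn0.
  by rewrite addnS psumS; have := uf (N0 + m)%N (leq_addr _ _); lra.
have c : (fun n => psum u n + f n) @ \oo --> Z by rewrite -[X in _ --> X]addr0; exact: cvgD.
rewrite -(cvg_lim _ c) //; apply: limr_ge; first by apply/cvg_ex; exists Z.
near=> N; have NN : (N0 <= N)%N by near: N; exact: nbhs_infty_ge.
by have := H (N - N0)%N; rewrite subnKC.
Unshelve. all: by end_near. Qed.

Lemma cvg_inv_half k : (fun n => ((n%:R + 1 / 2) ^+ k.+1)^-1 : R) @ \oo --> (0 : R).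
Proof.
apply/cvgrPdist_le => e e0; near=> n.
have n0 : (0 < n)%N by near: n; exact: nbhs_infty_gt.
have ne : e^-1 <= n%:R by near: n; apply: nbhs_infty_ger.
have n1 : 1 <= n%:R :> R by rewrite ler1n.
have x0 : 0 < n%:R + 1 / 2 :> R by lra.
rewrite sub0r normrN ger0_norm; last by rewrite invr_ge0 exprn_ge0 // ltW.
rewrite -[e]invrK lef_pV2 ?posrE ?invr_gt0 ?exprn_gt0 //.
by apply: le_trans ne _; apply: le_trans (_ : n%:R + 1 / 2 <= _); [lra | rewrite exprS ler_peMr ?exprn_ege1 //; lra].
Unshelve. all: by end_near. Qed.

(** Differences of odd inverse powers at [m - 1/2] and [m + 1/2] depend only on the product [a] of
    the two numbers, so they compare with [m ^ 2 = a + 1/4]. *)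
Lemma inv_half_telescope (m : R) : 1 <= m -> let a := m ^+ 2 - 1 / 4 in
  [/\ 0 < a, (m - 1 / 2)^-1 - (m + 1 / 2)^-1 = a^-1,
   ((m - 1 / 2) ^+ 3)^-1 - ((m + 1 / 2) ^+ 3)^-1 = (3 * a + 1) / a ^+ 3 &
   ((m - 1 / 2) ^+ 5)^-1 - ((m + 1 / 2) ^+ 5)^-1 = (5 * a ^+ 2 + 5 * a + 1) / a ^+ 5].
Proof.
move=> m1 a; have x0 : 0 < m - 1 / 2 by lra.
have y0 : 0 < m + 1 / 2 by lra.
have aE : a = (m - 1 / 2) * (m + 1 / 2) by rewrite /a; field.
have a0 : 0 < a by rewrite aE mulr_gt0.
have mE : m + 1 / 2 = (m - 1 / 2) + 1 by field.
rewrite {}aE in a0 *; rewrite {}mE in y0 a0 *.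
move: (m - 1 / 2) x0 y0 a0 => x x0 y0 a0; split=> //.
all: by field; rewrite ?(gt_eqF x0) ?(gt_eqF y0).
Qed.

Lemma half_step (n : nat) : exists a : R, [/\ 0 < a, n.+1%:R ^+ 2 = a + 1 / 4, (n%:R + 1 / 2)^-1 - (n.+1%:R + 1 / 2)^-1 = a^-1,
   ((n%:R + 1 / 2) ^+ 3)^-1 - ((n.+1%:R + 1 / 2) ^+ 3)^-1 = (3 * a + 1) / a ^+ 3 &
   ((n%:R + 1 / 2) ^+ 5)^-1 - ((n.+1%:R + 1 / 2) ^+ 5)^-1 = (5 * a ^+ 2 + 5 * a + 1) / a ^+ 5].
Proof.
have m1 : 1 <= n.+1%:R :> R by rewrite ler1n.
have [a0 h1 h3 h5] := inv_half_telescope m1.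
have nE : n.+1%:R - 1 / 2 = n%:R + 1 / 2 :> R by rewrite -natr1; field.
rewrite nE in h1 h3 h5; exists (n.+1%:R ^+ 2 - 1 / 4); split=> //; by rewrite subrK.
Qed.

(** Fifteen terms and the midpoint Euler-Maclaurin tail [1 / y - 1 / (12 y ^ 3) + 7 / (240 y ^ 5)]
    at [y = 15 + 1/2]. Truncation after the second term errs below, after the third above; both
    signs are checked term by term on telescoping differences. *)
Lemma zeta2_bounds (Z : R) : psum (@dirichlet R xpredT 2) @ \oo --> Z ->
  1644 / 1000 + 9340 / (1000 * 10000) <= Z <= 1644 / 1000 + 9341 / (1000 * 10000).
Proof.
move=> cZ.
have dE n : dirichlet R xpredT 2 n.+1 = (n.+1%:R ^+ 2)^-1 by rewrite /dirichlet mul1r.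
pose i1 (n : nat) : R := (n%:R + 1 / 2)^-1.
pose i3 (n : nat) : R := ((n%:R + 1 / 2) ^+ 3)^-1.
pose i5 (n : nat) : R := ((n%:R + 1 / 2) ^+ 5)^-1.
have lo : psum (@dirichlet R xpredT 2) 15%N + (i1 15%N - 1 / 12 * i3 15%N) <= Z.
  apply: (@psum_ge _ (fun n => i1 n - 1 / 12 * i3 n) 15%N Z cZ).
    rewrite -[X in _ --> X](subr0 0) -[X in _ - X](mulr0 (1 / 12)).
    by apply: cvgB; [exact: (cvg_inv_half 0) | apply: cvgMr; exact: (cvg_inv_half 2)].
  move=> n _; have [a [a0 sE h1 h3 _]] := half_step n; rewrite dE sE.
  have b0 : 0 < a + 1 / 4 by lra.
  suff : 0 <= (a + 1 / 4)^-1 - (a^-1 - 1 / 12 * ((3 * a + 1) / a ^+ 3)).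
    rewrite -h1 -h3 /i1 /i3 => ?; lra.
  have -> : (a + 1 / 4)^-1 - (a^-1 - 1 / 12 * ((3 * a + 1) / a ^+ 3)) = (7 / 4 * a + 1 / 4) / (12 * a ^+ 3 * (a + 1 / 4)).
    by field; rewrite (gt_eqF a0) /= ?andbT; apply: lt0r_neq0; lra.
  by apply: divr_ge0; [lra | rewrite !mulr_ge0 ?exprn_ge0 ?ltW].
have hi : Z <= psum (@dirichlet R xpredT 2) 15%N + (i1 15%N - 1 / 12 * i3 15%N + 7 / 240 * i5 15%N).
  apply: (@psum_le _ (fun n => i1 n - 1 / 12 * i3 n + 7 / 240 * i5 n) 15%N Z cZ).
  - by move=> n; exact: dirichlet_ge0.
  - move=> n; have n0 : 0 <= n%:R :> R by rewrite ler0n.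
    have x0 : 1 / 2 <= n%:R + 1 / 2 :> R by lra.
    rewrite /i1 /i3 /i5; move: (n%:R + 1 / 2) x0 => x x0; have x1 : 0 < x by lra.
    have -> : x^-1 - 1 / 12 * x ^- 3 = (x ^+ 2 - 1 / 12) / x ^+ 3 by field; rewrite gt_eqF.
    apply: addr_ge0; first by apply: divr_ge0; [nra | exact: exprn_ge0 (ltW x1)].
    by apply: mulr_ge0; [lra | rewrite invr_ge0; exact: exprn_ge0 (ltW x1)].
  move=> n _; have [a [a0 sE h1 h3 h5]] := half_step n; rewrite dE sE.
  have b0 : 0 < a + 1 / 4 by lra.
  suff : 0 <= a^-1 - 1 / 12 * ((3 * a + 1) / a ^+ 3) + 7 / 240 * ((5 * a ^+ 2 + 5 * a + 1) / a ^+ 5) - (a + 1 / 4)^-1.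
    rewrite -h1 -h3 -h5 /i1 /i3 /i5 => ?; lra.
  have -> : a^-1 - 1 / 12 * ((3 * a + 1) / a ^+ 3) + 7 / 240 * ((5 * a ^+ 2 + 5 * a + 1) / a ^+ 5) - (a + 1 / 4)^-1 =
    (155 / 4 * a ^+ 2 + 63 / 4 * a + 7 / 4) / (240 * a ^+ 5 * (a + 1 / 4)).
    by field; rewrite (gt_eqF a0) /= ?andbT; apply: lt0r_neq0; lra.
  apply: divr_ge0; last by rewrite !mulr_ge0 ?exprn_ge0 ?ltW.
  by have := sqr_ge0 a; lra.
move: lo hi; rewrite !psumS psum0 !dE /i1 /i3 /i5 => lo hi.
have hE : (15 + 1 / 2)^-1 = 2 / 31 :> R by field.
rewrite -!exprVn !hE in lo hi; apply/andP; split; lra.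
Qed.

(** The same method: the tail [1 / (3 y ^ 3)] is too large, and [1 / (3 y ^ 3) - 1 / (6 y ^ 5)] too
    small. *)
Lemma zeta4_bounds (Z : R) : psum (@dirichlet R xpredT 4) @ \oo --> Z ->
  1082 / 1000 + 3232 / (1000 * 10000) <= Z <= 1082 / 1000 + 3235 / (1000 * 10000).
Proof.
move=> cZ.
have dE n : dirichlet R xpredT 4 n.+1 = (n.+1%:R ^+ 2 ^+ 2)^-1 by rewrite /dirichlet mul1r -exprM.
pose i3 (n : nat) : R := ((n%:R + 1 / 2) ^+ 3)^-1.
pose i5 (n : nat) : R := ((n%:R + 1 / 2) ^+ 5)^-1.
have lo : psum (@dirichlet R xpredT 4) 15%N + (1 / 3 * i3 15%N - 1 / 6 * i5 15%N) <= Z.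
  apply: (@psum_ge _ (fun n => 1 / 3 * i3 n - 1 / 6 * i5 n) 15%N Z cZ).
    rewrite -[X in _ --> X](subr0 0) -[X in X - _](mulr0 (1 / 3)) -[X in _ - X](mulr0 (1 / 6)).
    by apply: cvgB; apply: cvgMr; [exact: (cvg_inv_half 2) | exact: (cvg_inv_half 4)].
  move=> n _; have [a [a0 sE _ h3 h5]] := half_step n; rewrite dE sE.
  have b0 : 0 < a + 1 / 4 by lra.
  suff : 0 <= ((a + 1 / 4) ^+ 2)^-1 - (1 / 3 * ((3 * a + 1) / a ^+ 3) - 1 / 6 * ((5 * a ^+ 2 + 5 * a + 1) / a ^+ 5)).
    rewrite -h3 -h5 /i3 /i5 => ?; lra.
  have -> : ((a + 1 / 4) ^+ 2)^-1 - (1 / 3 * ((3 * a + 1) / a ^+ 3) - 1 / 6 * ((5 * a ^+ 2 + 5 * a + 1) / a ^+ 5)) =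
    (6 * a ^+ 5 - (a + 1 / 4) ^+ 2 * (6 * a ^+ 3 - 3 * a ^+ 2 - 5 * a - 1)) / (6 * a ^+ 5 * (a + 1 / 4) ^+ 2).
    by move: (a + 1 / 4) b0 => b b0; field; rewrite (gt_eqF a0) (gt_eqF b0).
  apply: divr_ge0; last by rewrite !mulr_ge0 ?exprn_ge0 ?ltW.
  have a2 : 0 <= a ^+ 2 by rewrite sqr_ge0.
  have a3 : 0 <= a ^+ 3 by rewrite exprn_ge0 // ltW.
  by rewrite (_ : _ - _ = 49 / 8 * a ^+ 3 + 59 / 16 * a ^+ 2 + 13 / 16 * a + 1 / 16); [lra | field].
have hi : Z <= psum (@dirichlet R xpredT 4) 15%N + 1 / 3 * i3 15%N.
  apply: (@psum_le _ (fun n => 1 / 3 * i3 n) 15%N Z cZ).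
  - by move=> n; exact: dirichlet_ge0.
  - move=> n; have n0 : 0 <= n%:R :> R by rewrite ler0n.
    by apply: mulr_ge0; [lra | rewrite invr_ge0; apply: exprn_ge0; lra].
  move=> n _; have [a [a0 sE _ h3 _]] := half_step n; rewrite dE sE -mulrBr h3.
  have b0 : 0 < a + 1 / 4 by lra.
  rewrite -subr_ge0.
  have -> : 1 / 3 * ((3 * a + 1) / a ^+ 3) - ((a + 1 / 4) ^+ 2)^-1 =
    ((3 * a + 1) * (a + 1 / 4) ^+ 2 - 3 * a ^+ 3) / (3 * a ^+ 3 * (a + 1 / 4) ^+ 2).
    by move: (a + 1 / 4) b0 => b b0; field; rewrite (gt_eqF a0) (gt_eqF b0).
  apply: divr_ge0; last by rewrite !mulr_ge0 ?exprn_ge0 ?ltW.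
  have a2 : 0 <= a ^+ 2 by rewrite sqr_ge0.
  by rewrite (_ : _ - _ = 5 / 2 * a ^+ 2 + 11 / 16 * a + 1 / 16); [lra | field].
move: lo hi; rewrite !psumS psum0 !dE /i3 /i5 => lo hi.
have hE : (15 + 1 / 2)^-1 = 2 / 31 :> R by field.
rewrite -!exprVn !hE in lo hi; apply/andP; split; lra.
Qed.

End Constants.

(** * Which of f and g is smaller, up to a small slack *)

Section Numerics.
Variable R : realType.
Local Notation mu := (@lebesgue_measure R).
Local Notation cbrt := (@cbrt R).
Local Notation dec6 a b c := (a + (b + c / 1000) / 1000).
Local Notation dec9 a b c d := (a + (b + (c + d / 1000) / 1000) / 1000).

(* Rational approximations from above of the two positive roots of f = g. *)
Definition beta1 : R := dec6 1 711 192.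
Definition beta2 : R := dec6 32 371 990.
(** Relative slack for the short stretches between the true crossing points and [beta1], [beta2], on
    which the wrong one of f and g is integrated. *)
Definition delta : R := 1 / (2 * 1000 * 1000).

Lemma delta01 : 0 <= delta <= 1.
Proof. by rewrite /delta; apply/andP; split; lra. Qed.

Lemma g_between (b Y : R) : 0 < Y -> Y ^+ 2 = (16 / 3 * ((b - 3) ^+ 2 - 12)) ^+ 2 ->
  4 * `|b| ^+ 3 <= (1 + delta) * (3 / 16 * ((b - 3) ^+ 2 - 12) ^+ 2) ->
  (1 - delta) * kernel Y <= hfun b ^+ 2 <= kernel Y.
Proof.
move=> Y0 Y2 le; have QE : (3 / 16) ^+ 3 * Y ^+ 2 = 27 / 16 * quad b ^+ 2 by rewrite Y2 /quad; field.
have QE' : 27 / 16 * quad b ^+ 2 = 3 / 16 * ((b - 3) ^+ 2 - 12) ^+ 2 by rewrite /quad; field.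
apply: (sqr_hfun_between (kernel_gt0 Y0) (kernelX3 Y0) delta01).
rewrite QE /hmax le_max lexx orbT ge_max /= QE' le /=.
have := sqr_ge0 ((b - 3) ^+ 2 - 12); move: (_ ^+ 2) => q q0.
by have /andP[d0 _] := delta01; nra.
Qed.

(** [fcst / |b|] is the square of f at [b]. *)
Definition fcst : R := cbrt (1 / 4).

Lemma fcst_gt0 : 0 < fcst.
Proof. by apply: cbrt_gt0; lra. Qed.

Lemma f_between (b : R) : b != 0 -> 3 / 16 * ((b - 3) ^+ 2 - 12) ^+ 2 <= (1 + delta) * (4 * `|b| ^+ 3) ->
  (1 - delta) * (fcst / `|b|) <= hfun b ^+ 2 <= fcst / `|b|.
Proof.
move=> b0 le; have n0 : 0 < `|b| by rewrite normr_gt0.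
have QE' : 27 / 16 * quad b ^+ 2 = 3 / 16 * ((b - 3) ^+ 2 - 12) ^+ 2 by rewrite /quad; field.
apply: (@sqr_hfun_between _ b (fcst / `|b|) (4 * `|b| ^+ 3) delta).
- by rewrite divr_gt0 // fcst_gt0.
- rewrite exprMn /fcst cbrtX3; last by lra.
  by rewrite exprVn; move: (`|b|) n0 => x x0; field; rewrite gt_eqF.
- exact: delta01.
rewrite /hmax le_max lexx ge_max QE' le andbT /=.
have : 0 <= 4 * `|b| ^+ 3 by rewrite mulr_ge0 // exprn_ge0.
by move: (4 * _) => q q0; have /andP[d0 _] := delta01; nra.
Qed.

(* The sign of 3 b^4 - 100 b^3 + 90 b^2 + 108 b + 27 decides which of f and g is
   the smaller on the positive axis; on the negative axis the quartic is
   (b + 3)^3 (3 b + 1). *)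
Lemma negative_quartic (b : R) : 3 / 16 * ((b - 3) ^+ 2 - 12) ^+ 2 + 4 * b ^+ 3 = (b + 3) ^+ 3 * (3 * b + 1) / 16.
Proof. by field. Qed.

Lemma positive_quartic (b : R) : 3 / 16 * ((b - 3) ^+ 2 - 12) ^+ 2 - 4 * b ^+ 3 =
  (3 * b ^+ 4 - 100 * b ^+ 3 + 90 * b ^+ 2 + 108 * b + 27) / 16.
Proof. by field. Qed.

(** [beta1] lies just above the root, so the quartic is slightly negative at the right end; there
    [q >= 64], and [delta * q] outweighs it. *)
Lemma quartic_left (b : R) : 0 <= b <= beta1 -> 4 * b ^+ 3 <= (1 + delta) * (3 / 16 * ((b - 3) ^+ 2 - 12) ^+ 2).
Proof.
move=> /andP[b0]; rewrite /beta1 => b1; have := positive_quartic b; set q := (_ - 12) ^+ 2 => E.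
have q0 : 0 <= q by rewrite sqr_ge0.
suff h : 0 <= 3 * b ^+ 4 - 100 * b ^+ 3 + 90 * b ^+ 2 + 108 * b + 27 + 3 * (delta * q).
  by move: (delta) h E => d h E; lra.
have dq : 0 <= delta * q by have /andP[d0 _] := delta01; exact: mulr_ge0.
have [b11|b11] := lerP b 1.
  have : 0 <= b ^+ 4 by rewrite exprn_ge0.
  have : 0 <= b ^+ 2 * (1 - b) by rewrite mulr_ge0 ?exprn_ge0 ?subr_ge0.
  have : 0 <= b * (1 - b) by rewrite mulr_ge0 ?subr_ge0.
  by move: (delta * q) dq => z z0; lra.
have q64 : 64 <= q.
  have h : 8 <= 12 - (b - 3) ^+ 2 by nra.
  rewrite /q (_ : (_ - 12) ^+ 2 = (12 - (b - 3) ^+ 2) ^+ 2); last by ring.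
  by move: (12 - _) h => z z8; nra.
have {}dq : 64 / (2 * 1000 * 1000) <= delta * q by rewrite /delta; lra.
have [t0 t1] : 0 <= dec6 1 711 192 - b /\ dec6 1 711 192 - b <= 712 / 1000 by split; lra.
move: (delta * q) dq => z dq.
have {t0 t1 b1 b0 b11 E q0 q64 q} : exists2 t : R, 0 <= t <= 712 / 1000 & b = dec6 1 711 192 - t.
  by exists (dec6 1 711 192 - b); [rewrite t0 t1 | ring].
move=> [t /andP[t0 t1] ->].
have : 0 <= t ^+ 4 by rewrite exprn_ge0.
have : 0 <= t ^+ 3 by rewrite exprn_ge0.
have : 0 <= t * (712 / 1000 - t) by rewrite mulr_ge0 ?subr_ge0.
lra.
Qed.

Lemma quartic_mid (b : R) : beta1 <= b <= beta2 -> 3 / 16 * ((b - 3) ^+ 2 - 12) ^+ 2 <= (1 + delta) * (4 * b ^+ 3).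
Proof.
rewrite /beta1 /beta2 => /andP[b1 b2]; have := positive_quartic b; set q := (_ - 12) ^+ 2 => E.
suff : 3 * b ^+ 4 - 100 * b ^+ 3 + 90 * b ^+ 2 + 108 * b + 27 <= 64 * delta * b ^+ 3.
  by move: E; move: delta => d E h; lra.
(* Up to 32 the quartic is at most 0 without slack. The slack serves only next to [beta2], which
   lies just above the root. *)
have [b3|b3] := lerP b 32.
  have /andP[d0 _] := delta01; have bb : 0 <= b by lra.
  apply: le_trans (_ : 0 <= _); last exact: (mulr_ge0 (mulr_ge0 (ler0n _ 64) d0) (exprn_ge0 3 bb)).
  have t0 : 0 <= b - dec6 1 711 192 by lra.
  have u0 : 0 <= 32 - b by lra.
  have h1 : 0 <= (b - dec6 1 711 192) * ((32 - b) * b ^+ 2) by rewrite !mulr_ge0 ?exprn_ge0 //; lra.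
  have h2 : 0 <= (b - dec6 1 711 192) * ((32 - b) * b) by rewrite !mulr_ge0 //; lra.
  have h3 : 0 <= (b - dec6 1 711 192) * (32 - b) by rewrite mulr_ge0.
  have h4 : 0 <= (b - dec6 1 711 192) * b ^+ 2 by rewrite mulr_ge0 ?exprn_ge0 //; lra.
  have h5 : 0 <= (b - dec6 1 711 192) * b by rewrite mulr_ge0 //; lra.
  lra.
have b3' : 32 * 32 * 32 <= b ^+ 3.
  have u : 32 <= b by lra.
  have m2 : 32 * 32 <= b * b by apply: ler_pM.
  rewrite (_ : b ^+ 3 = b * b * b); last by ring.
  by apply: ler_pM => //; apply: mulr_ge0.
apply: le_trans (_ : 1 / 2 <= _); last by move: (b ^+ 3) b3' => z z0; rewrite /delta; lra.
have {E q} : exists2 t : R, 0 <= t <= 372 / 1000 & b = dec6 32 371 990 - t.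
  by exists (dec6 32 371 990 - b); [lra | ring].
move=> [t /andP[t0 t1] ->].
have : 0 <= t * (372 / 1000 - t) by rewrite mulr_ge0 ?subr_ge0.
have : 0 <= t ^+ 3 by rewrite exprn_ge0.
have : 0 <= t ^+ 3 * (372 / 1000 - t) by rewrite mulr_ge0 ?exprn_ge0 ?subr_ge0.
have : 0 <= t ^+ 2 by rewrite exprn_ge0.
lra.
Qed.

Lemma quartic_right (b : R) : beta2 <= b -> 4 * b ^+ 3 <= 3 / 16 * ((b - 3) ^+ 2 - 12) ^+ 2.
Proof.
rewrite /beta2 => b2; have := positive_quartic b; set q := (_ - 12) ^+ 2 => E.
suff : 0 <= 3 * b ^+ 4 - 100 * b ^+ 3 + 90 * b ^+ 2 + 108 * b + 27 by lra.
have : exists2 t : R, 0 <= t & b = dec6 32 371 990 + t.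
  by exists (b - dec6 32 371 990); [lra | ring].
move=> [t t0 ->].
have : 0 <= t ^+ 4 by rewrite exprn_ge0.
have : 0 <= t ^+ 3 by rewrite exprn_ge0.
have : 0 <= t ^+ 2 by rewrite exprn_ge0.
lra.
Qed.

End Numerics.

(** * Values of the outer pieces *)

Section RayValues.
Variable R : realType.
Local Notation mu := (@lebesgue_measure R).
Local Notation cbrt := (@cbrt R).
Local Notation dec6 a b c := (a + (b + c / 1000) / 1000).
Local Notation dec9 a b c d := (a + (b + (c + d / 1000) / 1000) / 1000).

Lemma cbrt_between (x l u : R) : 0 <= l -> 0 <= u -> 0 <= x -> l ^+ 3 <= x -> x <= u ^+ 3 -> l <= cbrt x <= u.
Proof. by move=> l0 u0 x0 h1 h2; rewrite cbrt_ge // cbrt_le. Qed.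

Lemma mul3_between (a b c la lb lc ua ub uc : R) : 0 <= la -> 0 <= lb -> 0 <= lc ->
  la <= a <= ua -> lb <= b <= ub -> lc <= c <= uc -> la * lb * lc <= a * b * c <= ua * ub * uc.
Proof.
move=> la0 lb0 lc0 /andP[a1 a2] /andP[b1 b2] /andP[c1 c2].
have a0 := le_trans la0 a1; have b0 := le_trans lb0 b1; have c0 := le_trans lc0 c1.
have q0 : 0 <= la * lb by exact: mulr_ge0.
have q1 : 0 <= a * b by exact: mulr_ge0.
have h1 : la * lb <= a * b by exact: ler_pM.
have h2 : a * b <= ua * ub by exact: ler_pM.
by rewrite !ler_pM.
Qed.

Lemma ray_sumE N (w : R) : - \sum_(n < N) ray_term n w =
  cbrt (ray_arg w) * (3 * w^-1) * \sum_(n < N) ray_coef R n * (12 * w^-1 ^+ 2) ^+ n.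
Proof.
rewrite -sumrN mulr_sumr; apply: eq_bigr => n _.
rewrite /ray_term exprD expr1 [w^-1 ^+ (2 * n)]exprM [(12 * w^-1 ^+ 2) ^+ n]exprMn.
by move: (cbrt _) (12 ^+ n) ((w^-1 ^+ 2) ^+ n) (ray_coef _ _) (w^-1) => a b c d e; ring.
Qed.

Lemma mid_sumE N (w : R) : \sum_(n < N) mid_term n w =
  Num.sqrt 3 / 4 * cbrt (mid_arg w) * \sum_(n < N) mid_coef R n * (1 / 2 - w / (4 * Num.sqrt 3)) ^+ n.
Proof.
rewrite mulr_sumr; apply: eq_bigr => n _; rewrite /mid_term.
by rewrite !mulrA; congr (_ * _); rewrite -!mulrA [mid_coef _ _ * _]mulrC.
Qed.

Lemma mid_sum_le N (x y : R) : 0 <= x -> x <= y ->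
  \sum_(n < N) mid_coef R n * x ^+ n <= \sum_(n < N) mid_coef R n * y ^+ n.
Proof.
move=> x0 xy; apply: ler_sum => n _; apply: ler_wpM2l; first exact: mid_coef_ge0.
by apply: lerXn2r; rewrite ?nnegrE // (le_trans x0).
Qed.

Lemma ray_err_13 : @ray_err R 13 6 <= 5 / (1000 * 1000).
Proof.
rewrite /ray_err (_ : 12 * 6^-1 ^+ 2 = 1 / 3); last by field.
by rewrite /= /addn /muln /=; clear; lra.
Qed.

Lemma ray_sum_13 : dec6 1 187 935 <= \sum_(n < 13) ray_coef R n * (1 / 3) ^+ n <= dec6 1 187 936.
Proof. by rewrite !big_ord_recr big_ord0 /= /addn /muln /=; apply/andP; split; clear; lra. Qed.

(** Collects slack, truncation and rounding; the bound 1/11 is where [(1 - k) (1 + 11/10 k) >= 1]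
    stops. *)
Lemma relative_bounds (I s l u d e k : R) : 0 <= d <= 1 -> 0 <= l -> 0 <= e -> e <= k -> k <= 1 / 11 -> l <= s <= u ->
  (1 - d) * s <= I <= (1 - e)^-1 * s -> (1 - d) * l <= I <= (1 + 11 / 10 * k) * u.
Proof.
move=> /andP[d0 d1] l0 e0 ek k1 /andP[ls su] /andP[h1 h2]; have s0 := le_trans l0 ls.
have e1 : e <= 1 / 11 by exact: le_trans ek k1.
have p0 : 0 < 1 - e by clear -e1; lra.
have q0 : 0 <= (1 - e)^-1 by rewrite invr_ge0 ltW.
apply/andP; split; first by apply: le_trans h1; rewrite ler_wpM2l ?subr_ge0.
apply: le_trans h2 _; apply: ler_pM => //.
rewrite -[(1 - e)^-1]mul1r ler_pdivrMr //; clear -e0 ek k1 e1; nra.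
Qed.

(** For [b <= - 3] the product [(b + 3) ^ 3 (3 b + 1)] is nonnegative, so g is the smaller function.
    At the end point [w = 6] the series variable is 1/3, the argument of [cbrt] is 128, and thirteen
    terms are enough. *)
Lemma left_ray_value : dec6 2 993 406 <= \int[mu]_(x in `]-oo, (- 3)%R]) (hfun x ^+ 2) <= dec6 2 993 430.
Proof.
rewrite (@Rintegral_left_ray R (fun x => hfun x ^+ 2) 3); [|exact: continuous_sqr_hfun|by move=> x; rewrite sqr_ge0].
have w6 : 3 + 3 = 6 :> R by ring.
have a128 : ray_arg 6 = 128 :> R by rewrite /ray_arg; field.
have S : dec6 5 39 684 * (1 / 2) * dec6 1 187 935 <= - \sum_(n < 13) ray_term n (6 : R) <= dec6 5 39 685 * (1 / 2) * dec6 1 187 936.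
  have c128 : dec6 5 39 684 <= cbrt 128 <= dec6 5 39 685 by apply: cbrt_between; clear; lra.
  rewrite ray_sumE a128 (_ : 12 * 6^-1 ^+ 2 = 1 / 3); last by field.
  apply: mul3_between c128 _ ray_sum_13; try (apply/andP; split); clear; lra.
have := @ray_integral R (fun x => hfun (- x) ^+ 2) 3 3 (delta R) 13 _ _ _ (delta01 R) _ _.
rewrite !w6 => H.
suff /andP[h1 h2] : (1 - delta R) * (dec6 5 39 684 * (1 / 2) * dec6 1 187 935) <= \int[mu]_(x in `[3, +oo[) (hfun (- x) ^+ 2) <= (1 + 11 / 10 * (5 / (1000 * 1000))) * (dec6 5 39 685 * (1 / 2) * dec6 1 187 936).
  apply/andP; split; [apply: le_trans h1|apply: le_trans h2 _]; clear; rewrite /delta; lra.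
apply: (relative_bounds (delta01 R) _ (ray_err_ge0 13 6) ray_err_13 _ S); [by clear; lra | by clear; lra | apply: H].
- apply: continuous_measurable_fun => x; apply: (@continuous_comp R R R -%R (fun x => hfun x ^+ 2)); first exact: oppr_continuous.
  exact: continuous_sqr_hfun.
- by clear; lra.
- by clear; rewrite expr2; lra.
- by apply: le_lt_trans ray_err_13 _; clear; lra.
- move=> x x3; have y0 : 0 < ray_arg (x + 3) by rewrite /ray_arg; clear -x3; nra.
  apply: g_between => //; first by rewrite /ray_arg; congr (_ ^+ 2); ring.
  have := negative_quartic (- x); rewrite normrN ger0_norm; last by clear -x3; lra.
  have : 0 <= (x - 3) ^+ 3 * (3 * x - 1) by apply: mulr_ge0; [apply: exprn_ge0|]; clear -x3; lra.
  have -> : (- x + 3) ^+ 3 * (3 * - x + 1) = (x - 3) ^+ 3 * (3 * x - 1) by ring.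
  have q0 : 0 <= delta R * (3 / 16 * ((- x - 3) ^+ 2 - 12) ^+ 2).
    by have /andP[d0 _] := delta01 R; apply: mulr_ge0 => //; apply: mulr_ge0; [lra | exact: sqr_ge0].
  rewrite [(- x) ^+ 3](_ : _ = - x ^+ 3); last by ring.
  move: ((x - 3) ^+ 3 * _) (3 / 16 * _) (delta R) q0 (x ^+ 3) => p q d q0 c p0 E.
  by rewrite mulrDl mul1r; clear -p0 E q0; lra.
Qed.

Lemma right_ray_value : dec6 1 701 66 <= \int[mu]_(x in `[beta2 R, +oo[) (hfun x ^+ 2) <= dec6 1 701 71.
Proof.
pose w : R := dec6 29 371 990.
have wE : beta2 R + - 3 = w by rewrite /beta2 /w; ring.
have w0 : 0 < w by rewrite /w; clear; lra.
have iw : dec9 0 34 46 41 <= w^-1 <= dec9 0 34 46 42.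
  by rewrite -[w^-1]mul1r ler_pdivlMr // ler_pdivrMr // /w; apply/andP; split; clear; lra.
have zP : dec9 0 13 909 594 <= 12 * w^-1 ^+ 2 <= dec9 0 13 909 596.
  by move: (w^-1) iw => v iw; have [v1 v2] := andP iw; apply/andP; split; clear -v1 v2; nra.
have e4 : ray_err 4 w <= 2 / (1000 * 1000 * 10).
  rewrite /ray_err; apply: le_trans (_ : ray_coef R 4 * (6 * 4 + 1)%:R * (dec9 0 13 909 596) ^+ 4 <= _).
    apply: ler_wpM2l; first by apply: mulr_ge0; [exact: ray_coef_ge0 | exact: ler0n].
    by move: (12 * _) zP => z /andP[z1 z2]; apply: lerXn2r; rewrite ?nnegrE; clear -z1 z2; lra.
  by rewrite /= /addn /muln /=; clear; lra.
have P : dec6 1 6 19 <= \sum_(n < 4) ray_coef R n * (12 * w^-1 ^+ 2) ^+ n <= dec6 1 6 20.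
  move: (12 * _) zP => z /andP[z1 z2]; apply/andP; split.
    apply: le_trans (_ : \sum_(n < 4) ray_coef R n * (dec9 0 13 909 594) ^+ n <= _).
      by rewrite !big_ord_recr big_ord0 /= /addn /muln /=; clear; lra.
    apply: ler_sum => n _; apply: ler_wpM2l; first exact: ray_coef_ge0.
    by apply: lerXn2r; rewrite ?nnegrE; clear -z1 z2; lra.
  apply: le_trans (_ : \sum_(n < 4) ray_coef R n * (dec9 0 13 909 596) ^+ n <= _); last first.
    by rewrite !big_ord_recr big_ord0 /= /addn /muln /=; clear; lra.
  apply: ler_sum => n _; apply: ler_wpM2l; first exact: ray_coef_ge0.
  by apply: lerXn2r; rewrite ?nnegrE; clear -z1 z2; lra.
have S : dec6 16 554 930 * (3 * dec9 0 34 46 41) * dec6 1 6 19 <= - \sum_(n < 4) ray_term n w <= dec6 16 554 940 * (3 * dec9 0 34 46 42) * dec6 1 6 20.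
  have c5 : dec6 16 554 930 <= cbrt (ray_arg w) <= dec6 16 554 940 by apply: cbrt_between; rewrite /ray_arg /w; clear; lra.
  rewrite ray_sumE; apply: mul3_between c5 _ P; try by clear; lra.
  by move: (w^-1) iw => v /andP[v1 v2]; apply/andP; split; clear -v1 v2; lra.
have := @ray_integral R (fun x => hfun x ^+ 2) (beta2 R) (- 3) (delta R) 4 _ _ _ (delta01 R) _ _.
rewrite !wE => H.
suff /andP[h1 h2] : (1 - delta R) * (dec6 16 554 930 * (3 * dec9 0 34 46 41) * dec6 1 6 19) <= \int[mu]_(x in `[beta2 R, +oo[) (hfun x ^+ 2) <= (1 + 11 / 10 * (2 / (1000 * 1000 * 10))) * (dec6 16 554 940 * (3 * dec9 0 34 46 42) * dec6 1 6 20).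
  apply/andP; split; [apply: le_trans h1|apply: le_trans h2 _]; clear; rewrite /delta; lra.
apply: (relative_bounds (delta01 R) _ (ray_err_ge0 4 w) e4 _ S); [by clear; lra | by clear; lra | apply: H].
- exact: measurable_sqr_hfun.
- exact: w0.
- by rewrite /w; clear; lra.
- by apply: le_lt_trans e4 _; clear; lra.
- move=> x x3; have x32 : 32 <= x by apply: le_trans x3; rewrite /beta2; clear; lra.
  have y0 : 0 < ray_arg (x - 3) by rewrite /ray_arg; clear -x32; nra.
  apply: g_between => //.
  rewrite ger0_norm; last by clear -x32; lra.
  have := quartic_right x3; have q0 : 0 <= delta R * (3 / 16 * ((x - 3) ^+ 2 - 12) ^+ 2).
    by have /andP[d0 _] := delta01 R; apply: mulr_ge0 => //; apply: mulr_ge0; [clear; lra | exact: sqr_ge0].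
  by move: (3 / 16 * _) (delta R) q0 (4 * _) => q d q0 c h; rewrite mulrDl mul1r; clear -h q0; lra.
Qed.

End RayValues.

(** * Value of the middle piece, and the logarithm of 2 *)

Section MidValue.
Variable R : realType.
Local Notation mu := (@lebesgue_measure R).
Local Notation cbrt := (@cbrt R).
Local Notation dec6 a b c := (a + (b + c / 1000) / 1000).
Local Notation dec9 a b c d := (a + (b + (c + d / 1000) / 1000) / 1000).

Lemma sqrt3_between : dec9 1 732 50 800 <= (Num.sqrt 3 : R) <= dec9 1 732 50 900.
Proof.
have s3 : Num.sqrt 3 ^+ 2 = 3 :> R by rewrite sqr_sqrtr // ler0n.
have s0 : 0 <= Num.sqrt 3 :> R by exact: sqrtr_ge0.
by move: (Num.sqrt 3) s0 s3 => s s0 s3; apply/andP; split; clear -s0 s3; nra.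
Qed.

Lemma mid_sum_between N (w xl xu cl cu pl pu : R) : 0 <= xl -> 0 <= cl -> 0 <= pl ->
  xl <= 1 / 2 - w / (4 * Num.sqrt 3) <= xu -> cl <= cbrt (mid_arg w) <= cu ->
  pl <= \sum_(n < N) mid_coef R n * xl ^+ n -> \sum_(n < N) mid_coef R n * xu ^+ n <= pu ->
  dec9 1 732 50 800 / 4 * cl * pl <= \sum_(n < N) mid_term n w <= dec9 1 732 50 900 / 4 * cu * pu.
Proof.
move=> xl0 cl0 pl0 /andP[x1 x2] cb h1 h2; rewrite mid_sumE; apply: (mul3_between _ cl0 pl0 _ cb).
- by clear; lra.
- by have /andP[s1 s2] := sqrt3_between; move: (Num.sqrt 3) s1 s2 => s s1 s2; apply/andP; split; clear -s1 s2; lra.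
apply/andP; split; first by apply: le_trans h1 _; exact: mid_sum_le xl0 x1.
by apply: le_trans h2; apply: mid_sum_le x2; apply: le_trans x1.
Qed.

Lemma mid_x_linear (w : R) : 1 / 2 - w / (4 * Num.sqrt 3) = 1 / 2 - w * Num.sqrt 3 / 12.
Proof.
have s3 : Num.sqrt 3 ^+ 2 = 3 :> R by rewrite sqr_sqrtr // ler0n.
have s0 : 0 < Num.sqrt 3 :> R by rewrite sqrtr_gt0 ltr0n.
move: (Num.sqrt 3) s3 s0 => s s3 s0; have -> : (12 : R) = 4 * s ^+ 2 by rewrite s3; ring.
by field; rewrite gt_eqF.
Qed.

Lemma mid_x1 : dec9 0 313 976 500 <= 1 / 2 - (3 - beta1 R) / (4 * Num.sqrt 3) <= dec9 0 313 976 600.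
Proof.
rewrite mid_x_linear /beta1; have /andP[s1 s2] := sqrt3_between.
by move: (Num.sqrt 3) s1 s2 => s s1 s2; apply/andP; split; clear -s1 s2; lra.
Qed.

Lemma mid_x0 : dec9 0 18 874 700 <= 1 / 2 - (3 - - (1 / 3)) / (4 * Num.sqrt 3 : R) <= dec9 0 18 874 800.
Proof.
rewrite mid_x_linear; have /andP[s1 s2] := sqrt3_between.
by move: (Num.sqrt 3) s1 s2 => s s1 s2; apply/andP; split; clear -s1 s2; lra.
Qed.

Lemma mid_err_ge0 N (w : R) : 0 <= 1 / 2 - w / (4 * Num.sqrt 3) -> 0 <= mid_err N w.
Proof.
move=> x0; apply: mulr_ge0; last exact: exprn_ge0.
by apply: mulr_ge0; [exact: mid_coef_ge0 | exact: ler0n].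
Qed.

Lemma mid_err_11 : 0 <= mid_err 11 (3 - beta1 R) <= 13 / (1000 * 1000).
Proof.
have /andP[x1 x2] := mid_x1; have x0 : 0 <= 1 / 2 - (3 - beta1 R) / (4 * Num.sqrt 3).
  by apply: le_trans x1; clear; lra.
have xu0 := le_trans x0 x2; apply/andP; split; first exact: mid_err_ge0.
rewrite /mid_err.
apply: le_trans (_ : mid_coef R 11 * (3 * 11 + 1)%:R * (dec9 0 313 976 600) ^+ 11 <= _).
  apply: ler_wpM2l; first by apply: mulr_ge0; [exact: mid_coef_ge0 | exact: ler0n].
  exact: (lerXn2r 11 x0 xu0 x2).
by rewrite /= /addn /muln /=; clear; lra.
Qed.

Lemma mid_sum_1 : dec9 1 732 50 800 / 4 * dec6 3 806 203 * dec6 1 204 287 <=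
  \sum_(n < 11) mid_term n (3 - beta1 R) <= dec9 1 732 50 900 / 4 * dec6 3 806 204 * dec6 1 204 289.
Proof.
apply: (mid_sum_between _ _ _ mid_x1).
- by clear; lra.
- by clear; lra.
- by clear; lra.
- by apply: cbrt_between; rewrite /mid_arg /beta1; clear; lra.
- by rewrite !big_ord_recr big_ord0 /= /addn /muln /=; clear; lra.
- by rewrite !big_ord_recr big_ord0 /= /addn /muln /=; clear; lra.
Qed.

Lemma mid_sum_0 : dec9 1 732 50 800 / 4 * dec6 1 679 894 * dec6 1 9 566 <=
  \sum_(n < 11) mid_term n (3 - - (1 / 3) : R) <= dec9 1 732 50 900 / 4 * dec6 1 679 895 * dec6 1 9 567.
Proof.
apply: (mid_sum_between _ _ _ mid_x0).
- by clear; lra.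
- by clear; lra.
- by clear; lra.
- by apply: cbrt_between; rewrite /mid_arg; clear; lra.
- by rewrite !big_ord_recr big_ord0 /= /addn /muln /=; clear; lra.
- by rewrite !big_ord_recr big_ord0 /= /addn /muln /=; clear; lra.
Qed.

Lemma integrable_sqr_hfun_itv (i : interval R) : mu.-integrable [set` i] (EFin \o (fun b => hfun b ^+ 2)).
Proof. by apply: integrableS (integrable_sqr_hfun R). Qed.

Lemma mid_value : dec6 1 250 450 <= \int[mu]_(x in `[(- (1 / 3))%R, beta1 R]) (hfun x ^+ 2) <= dec6 1 250 475.
Proof.
have /andP[e0 e11] := mid_err_11.
have S : dec9 1 732 50 800 / 4 * dec6 3 806 203 * dec6 1 204 287 - dec9 1 732 50 900 / 4 * dec6 1 679 895 * dec6 1 9 567 <=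
   \sum_(n < 11) mid_term n (3 - beta1 R) - \sum_(n < 11) mid_term n (3 - - (1 / 3) : R) <=
   dec9 1 732 50 900 / 4 * dec6 3 806 204 * dec6 1 204 289 - dec9 1 732 50 800 / 4 * dec6 1 679 894 * dec6 1 9 566.
  by have /andP[s1 s2] := mid_sum_1; have /andP[t1 t2] := mid_sum_0; rewrite !lerB.
set l := (X in X <= _ <= _) in S; set u := (X in _ <= _ <= X) in S.
suff /andP[h1 h2] : (1 - delta R) * l <= \int[mu]_(x in `[(- (1 / 3))%R, beta1 R]) (hfun x ^+ 2) <= (1 + 11 / 10 * (13 / (1000 * 1000))) * u.
  apply/andP; split; [apply: le_trans h1|apply: le_trans h2 _]; rewrite /l /u /delta; clear; lra.
apply: (relative_bounds (delta01 R) _ e0 e11 _ S).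
- by rewrite /l; clear; lra.
- by clear; lra.
apply: (@mid_integral R (fun x => hfun x ^+ 2)).
- exact: integrable_sqr_hfun_itv.
- by rewrite /beta1; clear; lra.
- by rewrite /beta1; clear; lra.
- by clear; lra.
- exact: delta01.
- by apply: le_lt_trans e11 _; clear; lra.
move=> x /andP[x1 x2].
have x3 : x <= 2 by apply: le_trans x2 _; rewrite /beta1; clear; lra.
have y0 : 0 < mid_arg (3 - x) by rewrite /mid_arg; clear -x1 x3; nra.
apply: g_between => //; first by rewrite /mid_arg -sqrrN; congr (_ ^+ 2); ring.
have [x0|x0] := lerP 0 x.
  by rewrite ger0_norm //; apply: quartic_left; rewrite x0.
rewrite ltr0_norm // (_ : (- x) ^+ 3 = - x ^+ 3); last by ring.
have q0 : 0 <= delta R * (3 / 16 * ((x - 3) ^+ 2 - 12) ^+ 2).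
  by have /andP[d0 _] := delta01 R; apply: mulr_ge0 => //; apply: mulr_ge0; [clear; lra | exact: sqr_ge0].
have := negative_quartic x.
have : 0 <= (x + 3) ^+ 3 * (3 * x + 1) by apply: mulr_ge0; [apply: exprn_ge0|]; clear -x1; lra.
move: ((x + 3) ^+ 3 * _) (3 / 16 * _) (delta R) q0 (x ^+ 3) => p q d q0 c p0 E.
by rewrite mulrDl mul1r; clear -p0 E q0; lra.
Qed.

Lemma ln_ge_atanh N (z x : R) : 0 < z < 1 -> (0 < N)%N -> 0 < x -> 1 + z <= x * (1 - z) -> atanh_sum N z <= ln x.
Proof.
move=> z01 N0 x0 h; have /andP[h1 _] := ln_atanh_sum z01 N0; have /andP[z0 z1] := z01.
apply: le_trans h1 _; rewrite ler_ln ?posrE // ?ler_pdivrMr ?subr_gt0 //.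
by apply: divr_gt0; rewrite ?subr_gt0 // addr_gt0.
Qed.

Lemma ln_le_atanh N (z x : R) : 0 < z < 1 -> (0 < N)%N -> 0 < x -> x * (1 - z) <= 1 + z ->
  ln x <= (1 - z ^+ (2 * N))^-1 * atanh_sum N z.
Proof.
move=> z01 N0 x0 h; have /andP[_ h1] := ln_atanh_sum z01 N0; have /andP[z0 z1] := z01.
apply: le_trans h1; rewrite ler_ln ?posrE // ?ler_pdivlMr ?subr_gt0 //.
by apply: divr_gt0; rewrite ?subr_gt0 // addr_gt0.
Qed.

Lemma ln2_between : dec9 0 693 147 100 <= ln (2 : R) <= dec9 0 693 147 200.
Proof.
have z01 : 0 < (1 / 3 : R) < 1 by apply/andP; split; clear; lra.
apply/andP; split.
  apply: le_trans (ln_ge_atanh (N := 8) z01 isT (ltr0Sn R 1) _); last by clear; lra.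
  by rewrite /atanh_sum !big_ord_recr big_ord0 /= /addn /muln /=; clear; lra.
apply: le_trans (ln_le_atanh (N := 8) z01 isT (ltr0Sn R 1) _) _; first by clear; lra.
rewrite ler_pdivrMl; last by rewrite subr_gt0 /muln /=; clear; lra.
by rewrite /atanh_sum !big_ord_recr big_ord0 /= /addn /muln /=; clear; lra.
Qed.

End MidValue.

(** * Logarithmic pieces, the total, and the decimals of c_1 *)

Section LogarithmsAndTotal.
Variable R : realType.
Local Notation mu := (@lebesgue_measure R).
Local Notation cbrt := (@cbrt R).
Local Notation dec6 a b c := (a + (b + c / 1000) / 1000).
Local Notation dec9 a b c d := (a + (b + (c + d / 1000) / 1000) / 1000).

(** The two logarithmic pieces need the logarithm of [9 beta2 / beta1]. Splitting off [2 ^ 7] leaves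
    a number near 4/3, for which the series converges fast. *)
Definition logy : R := 9 * beta2 R / (128 * beta1 R).

Lemma logy_between : dec9 0 285 297 500 <= ln logy <= dec9 0 285 297 800.
Proof.
have b0 : 0 < 128 * beta1 R by rewrite /beta1; clear; lra.
have y0 : 0 < logy by apply: divr_gt0 => //; rewrite /beta2; clear; lra.
(* Roundings down and up of [(logy - 1) / (logy + 1)]. *)
have [l u] : 0 < (dec9 0 141 689 0 : R) < 1 /\ 0 < (dec9 0 141 689 100 : R) < 1 by split; apply/andP; split; clear; lra.
apply/andP; split.
  apply: le_trans (ln_ge_atanh (N := 5) l isT y0 _).
    by rewrite /atanh_sum !big_ord_recr big_ord0 /= /addn /muln /=; clear; lra.
  by rewrite /logy mulrAC ler_pdivlMr // /beta1 /beta2; clear; lra.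
apply: le_trans (ln_le_atanh (N := 5) u isT y0 _) _.
  by rewrite /logy mulrAC ler_pdivrMr // /beta1 /beta2; clear; lra.
rewrite ler_pdivrMl; last by rewrite subr_gt0 /muln /=; clear; lra.
by rewrite /atanh_sum !big_ord_recr big_ord0 /= /addn /muln /=; clear; lra.
Qed.

Lemma log_sum : ln (3 / (1 / 3)) + ln (beta2 R / beta1 R) = 7 * ln 2 + ln logy.
Proof.
have b1 : 0 < beta1 R by rewrite /beta1; clear; lra.
have b2 : 0 < beta2 R by rewrite /beta2; clear; lra.
have y0 : 0 < logy by apply: divr_gt0; apply: mulr_gt0; rewrite ?ltr0n.
have n0 : 0 < 3 / (1 / 3) :> R by clear; lra.
have c0 : 0 < beta2 R / beta1 R by exact: divr_gt0.
have -> : 7 * ln 2 = ln (2 ^+ 7) :> R by rewrite lnXn // mulr_natl.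
rewrite -!lnM ?posrE ?exprn_gt0 //; congr ln; rewrite /logy.
by move: (beta1 R) (beta2 R) b1 => x y x0; field; rewrite gt_eqF.
Qed.

Lemma fcst_between : dec9 0 629 960 500 <= fcst R <= dec9 0 629 960 600.
Proof. by apply: cbrt_between; clear; lra. Qed.

Lemma log_pieces : dec6 3 236 310 <= \int[mu]_(x in `[(- 3)%R, (- (1 / 3))%R]) (hfun x ^+ 2)
    + \int[mu]_(x in `[beta1 R, beta2 R]) (hfun x ^+ 2) <= dec6 3 236 316.
Proof.
have c0 : 0 <= fcst R by apply: ltW; exact: fcst_gt0.
have b10 : 0 < beta1 R by rewrite /beta1; clear; lra.
have H1 : (1 - delta R) * (fcst R * ln (3 / (1 / 3))) <= \int[mu]_(x in `[(- 3)%R, (- (1 / 3))%R]) (hfun x ^+ 2) <= fcst R * ln (3 / (1 / 3)).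
  apply: (@log_integralN R (fun x => hfun x ^+ 2)) => //.
  - exact: integrable_sqr_hfun_itv.
  - by clear; lra.
  - exact: delta01.
  move=> x /andP[x1 x2]; have x0 : x < 0 by clear -x2; lra.
  rewrite -(ltr0_norm x0); apply: f_between; first by rewrite lt_eqF.
  rewrite ltr0_norm // (_ : (- x) ^+ 3 = - x ^+ 3); last by ring.
  have := negative_quartic x.
  have : (x + 3) ^+ 3 * (3 * x + 1) <= 0.
    by apply: mulr_ge0_le0; [apply: exprn_ge0|]; clear -x1 x2; lra.
  have q0 : 0 <= delta R * (4 * - x ^+ 3).
    have /andP[d0 _] := delta01 R; apply: mulr_ge0 => //; apply: mulr_ge0; first by clear; lra.
    by rewrite (_ : - x ^+ 3 = (- x) ^+ 3); [apply: exprn_ge0; clear -x0; lra | ring].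
  move: ((x + 3) ^+ 3 * _) (3 / 16 * _) (delta R) (x ^+ 3) q0 => p q d c q0 p0 E.
  by rewrite mulrDl mul1r; clear -p0 E q0; lra.
have H2 : (1 - delta R) * (fcst R * ln (beta2 R / beta1 R)) <= \int[mu]_(x in `[beta1 R, beta2 R]) (hfun x ^+ 2) <= fcst R * ln (beta2 R / beta1 R).
  apply: (@log_integral R (fun x => hfun x ^+ 2)) => //.
  - exact: integrable_sqr_hfun_itv.
  - by rewrite /beta1 /beta2; clear; lra.
  - exact: delta01.
  move=> x xb; have /andP[x1 x2] := xb; have x0 : 0 < x by apply: lt_le_trans x1.
  have := @f_between R x; rewrite gtr0_norm // gt_eqF // => H; apply: H => //; exact: quartic_mid.
have T : dec9 0 629 960 500 * (7 * dec9 0 693 147 100 + dec9 0 285 297 500) <= fcst R * (7 * ln 2 + ln logy) <= dec9 0 629 960 600 * (7 * dec9 0 693 147 200 + dec9 0 285 297 800).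
  have /andP[c1 c2] := fcst_between; have /andP[l1 l2] := ln2_between R; have /andP[y1 y2] := logy_between.
  have p0 : 0 <= 7 * dec9 0 693 147 100 + dec9 0 285 297 500 :> R by clear; lra.
  have p1 : 7 * dec9 0 693 147 100 + dec9 0 285 297 500 <= 7 * ln 2 + ln logy by move: (ln 2) (ln logy) l1 y1 => a b a1 b1; clear -a1 b1; lra.
  have p2 : 7 * ln 2 + ln logy <= 7 * dec9 0 693 147 200 + dec9 0 285 297 800 by move: (ln 2) (ln logy) l2 y2 => a b a1 b1; clear -a1 b1; lra.
  have r0 : 0 <= dec9 0 629 960 500 :> R by clear; lra.
  by apply/andP; split; [exact: (ler_pM r0 p0 c1 p1) | exact: (ler_pM c0 (le_trans p0 p1) c2 p2)].
move: T; rewrite -log_sum [fcst R * (_ + _)]mulrDr; move: H1 H2.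
move: (\int[mu]_(x in _) _) (\int[mu]_(x in _) _) (_ * ln _) (_ * ln _) => i j a b /andP[i1 i2] /andP[j1 j2] /andP[t1 t2].
apply/andP; split; last by apply: le_trans (lerD i2 j2) _; apply: le_trans t2 _; clear; lra.
apply: le_trans (lerD i1 j1); rewrite -mulrDr.
have /andP[_ d1] := delta01 R; have d2 : 0 <= 1 - delta R by rewrite subr_ge0.
by apply: le_trans (ler_wpM2l d2 t1); rewrite /delta; clear; lra.
Qed.

Lemma sqr_hfun_value : dec6 9 181 230 <= \int[mu]_x (hfun x ^+ 2) <= dec6 9 181 300.
Proof.
have -> := @Rintegral_split5 R (fun x => hfun x ^+ 2) (- 3) (- (1 / 3)) (beta1 R) (beta2 R) _ _ _ (integrable_sqr_hfun R).
- have /andP[a1 a2] := left_ray_value R; have /andP[b1 b2] := log_pieces; have /andP[c1 c2] := mid_value R.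
  have /andP[e1 e2] := right_ray_value R; move: a1 a2 b1 b2 c1 c2 e1 e2.
  move: (\int[mu]_(x in _) _) (\int[mu]_(x in _) _) (\int[mu]_(x in _) _) (\int[mu]_(x in _) _) (\int[mu]_(x in _) _).
  by move=> i1 i2 i3 i4 i5 a1 a2 b1 b2 c1 c2 e1 e2; apply/andP; split; [clear -a1 b1 c1 e1 | clear -a2 b2 c2 e2]; lra.
- by clear; lra.
- by rewrite /beta1; clear; lra.
- by rewrite /beta1 /beta2; clear; lra.
Qed.

(** With [48 zeta(2) zeta(4)] as denominator, the rational bounds for the two series suffice and no
    decimals of [pi] are required. *)
Lemma c1_value (Z2 Z4 : R) : psum (@dirichlet R xpredT 2) @ \oo --> Z2 -> psum (@dirichlet R xpredT 4) @ \oo --> Z4 ->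
  (107 * 10 ^+ 3 + 437) / 10 ^+ 6 <= (\int[mu]_x (hfun x ^+ 2)) / (48 * Z2 * Z4) < (107 * 10 ^+ 3 + 438) / 10 ^+ 6.
Proof.
move=> /zeta2_bounds /andP[x1 x2] /zeta4_bounds /andP[y1 y2]; have /andP[i1 i2] := sqr_hfun_value.
move: (\int[mu]_x _) i1 i2 => i i1 i2.
have x0 : 0 < Z2 by apply: lt_le_trans x1; clear; lra.
have y0 : 0 < Z4 by apply: lt_le_trans y1; clear; lra.
have p1 := ler_pM _ _ x1 y1; have p2 := ler_pM (ltW x0) (ltW y0) x2 y2.
rewrite -mulrA; have {}p1 : (1644 / 1000 + 9340 / (1000 * 10000)) * (1082 / 1000 + 3232 / (1000 * 10000)) <= Z2 * Z4 by apply: p1; clear; lra.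
have q0 : 0 < Z2 * Z4 by exact: mulr_gt0.
have q1 : 0 < 48 * (Z2 * Z4) by apply: mulr_gt0; rewrite ?ltr0n.
have t3 : 10 ^+ 3 = 1000 :> R by rewrite !exprS expr0 mulr1; clear; lra.
have -> : 10 ^+ 6 = 1000 * 1000 :> R by rewrite -t3 -exprD.
rewrite t3 ler_pdivlMr // ltr_pdivrMr //; move: (Z2 * Z4) p1 p2 => z p1 p2.
have {}p1 : dec9 1 780 350 230 <= z by apply: le_trans p1; clear; lra.
have {}p2 : z <= dec9 1 780 350 833 by apply: le_trans p2 _; clear; lra.
by apply/andP; split; [clear -p2 i1 | clear -p1 i2]; lra.
Qed.

End LogarithmsAndTotal.

Theorem theorem1p3 (R : realType) :
  exists c1 c2 : R,
    [/\ exists C : R, \forall X \near +oo,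
        `|(N3 X)%:R
          - (2 / (3 * Num.sqrt 3 * zeta 6) * X `^ (1 / 2)
             + c1 * X `^ (1 / 3) * ln X
             + c2 * X `^ (1 / 3))| <= C * X `^ (7 / 24),
      exists c0 : R,
        (\int[lebesgue_measure]_(beta in [set: R]) (h_beta beta * h_beta beta))%E
          = c0%:E
        /\ c1 = c0 / (8 * pi ^+ 2 * zeta 4),
      (107 * 10 ^+ 3 + 437) / 10 ^+ 6 <= c1 < (107 * 10 ^+ 3 + 438) / 10 ^+ 6
    & computable_real c2].
Proof.
have z2 := @zeta_cvg R 2 isT; have z4 := @zeta_cvg R 4 isT; have z6 := @zeta_cvg R 6 isT.
have [c2 [C H]] := N3_asymptotic z2 z4 z6.
have p2 := basel z2; have c1E := c1_value z2 z4.
exists ((\int[@lebesgue_measure R]_b (hfun b ^+ 2)) / (48 * zeta 2 * zeta 4)), c2; split.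
- exists C; near=> X; apply: H.
  by near: X; apply: nbhs_pinfty_ge; rewrite num_real.
- exists (\int[@lebesgue_measure R]_b (hfun b ^+ 2)); split.
    rewrite /Rintegral fineK; last exact: integrable_fin_num (integrable_sqr_hfun R).
    by apply: eq_integral => b _; rewrite h_betaE -EFinM -expr2.
  (* [48 zeta(2) = 8 pi ^ 2] by [basel]. *)
  congr (_ / _); congr (_ * _); rewrite [zeta 2]p2.
  by move: (pi : R) => p; field.
- exact: c1E.
- exact: computable_of_asymptotic H.
Unshelve. all: by end_near. Qed.
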